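(* Let $\kappa\in(0,\kappa_{max})$ and $\rho=\frac{j(\kappa)}{c(\kappa)}$. Denote by $\mathcal F_\kappa$ the value of $\mathcal F(\rho M_{\kappa\Omega})$ (independent of $\Omega\in\mathbb S$). (i) Suppose $\left(\frac jc\right)'(\kappa)<0$. Then any equilibrium of the form $\rho M_{\kappa\Omega}$ is unstable, in the following sense: in any neighborhood of $\rho M_{\kappa\Omega}$ (in $H^\sigma(\mathbb S)$, for any $\sigma\in\mathbb R$), there exists an initial condition $f_0$ with mass $\rho$ such that $\mathcal F(f_0)<\mathcal F_\kappa$. Consequently, for the solution $f$ starting from such an $f_0$, it is not the case that $|J_f(t)|\to\rho\,c(\kappa)$ and $\|f(t)-\rho M_{\kappa\Omega_{f(t)}}\|_{H^s}\to0$ for all $s\in\mathbb R$ as $t\to\infty$. (ii) Suppose $\left(\frac jc\right)'(\kappa)>0$. Then the family of equilibria $\{\rho M_{\kappa\Omega},\ \Omega\in\mathbb S\}$ is stable, in the following sense: for all $K>0$ and $s>\frac{n-1}2$, there exist $\delta>0$ and $C$ such that for all initial conditions $f_0$ with mass $\rho$ and with $\|f_0\|_{H^s}\le K$, if $\|f_0-\rho M_{\kappa\Omega}\|_{L^2}\le\delta$ for some $\Omega\in\mathbb S$, then for all $t\ge0$ the solution $f$ with $f(0)=f_0$ satisfies $$\mathcal F(f)\ge\mathcal F_\kappa,\qquad \|f-\rho M_{\kappa\Omega_f}\|_{L^2}\le C\,\|f_0-\rho M_{\kappa\Omega_{f_0}}\|_{L^2}.$$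
   Context: Let $n\ge 2$ and let $\mathbb S$ be the unit sphere of $\mathbb R^n$ with the uniform probability measure $d\omega$. $\nabla_\omega$, $\nabla_\omega\cdot$, $\Delta_\omega$ are the gradient, divergence and Laplace–Beltrami operator on $\mathbb S$; $P_{\omega^\perp}=\mathrm{Id}-\omega\otimes\omega$; $H^s=H^s(\mathbb S)$ is the usual Sobolev space. The functions $\nu:[0,\infty)\to[0,\infty)$ and $\tau:[0,\infty)\to(0,\infty)$ are such that $r\mapsto\nu(r)/r$ and $r\mapsto\tau(r)$ are Lipschitz and bounded; $\tau_0=\tau(0)>0$. The function $k(r)=\nu(r)/\tau(r)$ is increasing; $\kappa_{max}=\lim_{r\to\infty}k(r)$ and $j:[0,\kappa_{max})\to[0,\infty)$ is the inverse function of $k$. Moreover $k$ is differentiable with Lipschitz derivative $k'$. For $f$ on $\mathbb S$, $J_f=\int_{\mathbb S}\omega f\,d\omega$, $\Omega_f=J_f/|J_f|$, $$Q(f)=-\nu(|J_f|)\nabla_\omega\cdot(P_{\omega^\perp}\Omega_f\,f)+\tau(|J_f|)\Delta_\omega f$$ (with $Q(f)=\tau_0\Delta_\omega f$ if $J_f=0$). The free energy is $\mathcal F(f)=\int_{\mathbb S}f\ln f\,d\omega-\Phi(|J_f|)$ with $\Phi(r)=\int_0^r k(u)\,du$. An initial condition is a finite nonnegative measure $f_0\in H^s(\mathbb S)$, with mass $\int_{\mathbb S}f_0\,d\omega$. For such $f_0$ there is a unique global weak solution $f$ of $\partial_t f=Q(f)$, $f(0)=f_0$, with $f\in C([0,\infty),H^s)\cap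 C^1((0,\infty),C^\infty(\mathbb S))$ and $f>0$ for $t>0$; mass is conserved. $M_{\kappa\Omega}(\omega)=e^{\kappa\,\omega\cdot\Omega}/\int_{\mathbb S}e^{\kappa\,\upsilon\cdot\Omega}d\upsilon$ for $\kappa\ge0$, $\Omega\in\mathbb S$, and $c(\kappa)=\frac{\int_0^\pi\cos\theta\,e^{\kappa\cos\theta}\sin^{n-2}\theta\,d\theta}{\int_0^\pi e^{\kappa\cos\theta}\sin^{n-2}\theta\,d\theta}$, so that $J_{M_{\kappa\Omega}}=c(\kappa)\Omega$. Primes denote derivatives with respect to $\kappa$. *)

(* Defs.v *)
From mathcomp Require Import all_boot all_order all_algebra.
From mathcomp Require Import all_classical all_reals all_analysis.
(* The notations of mpoly clash with those of mathcomp-analysis. *)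
From mathcomp Require Import -(notations) mpoly.

Set Implicit Arguments.
Unset Strict Implicit.
Unset Printing Implicit Defensive.

Import Order.TTheory GRing.Theory Num.Theory.
Import numFieldNormedType.Exports.

Local Open Scope classical_set_scope.
Local Open Scope ring_scope.

(* The norm `|x| of 'rV[R]_n in the library is the sup norm, hence enorm. *)
Definition dot (R : realType) (n : nat) (x y : 'rV[R]_n) : R :=
  \sum_(i < n) x 0 i * y 0 i.

Definition enorm (R : realType) (n : nat) (x : 'rV[R]_n) : R :=
  Num.sqrt (dot x x).

Definition sphere (R : realType) (n : nat) : set 'rV[R]_n :=
  [set x | enorm x = 1].
Arguments sphere : clear implicits.

Definition proj (R : realType) (n : nat) (x : 'rV[R]_n) : 'rV[R]_n :=
  (enorm x)^-1 *: x.

Definition borel (R : realType) (n : nat) :=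
  g_sigma_algebraType (@open 'rV[R]_n).
Arguments borel : clear implicits.

(* Measures on the sphere are Borel measures on R^n carried by the sphere.
   The uniform probability is the unique one invariant under the orthogonal
   group. *)
Definition is_uniform (R : realType) (n : nat)
    (sigma : probability (borel R n) R) : Prop :=
  sigma (sphere R n) = 1%E /\
  forall O : 'M[R]_n, O *m O^T = 1%:M ->
  forall A : set (borel R n), measurable A ->
    sigma [set x : 'rV[R]_n | A (x *m O)] = sigma A.

(* A function on the sphere is the restriction of f : 'rV[R]_n -> R; only its
   values on the sphere matter.  At a point of the sphere, the tangential
   gradient, the divergence of a tangent field and the Laplace-Beltrami operator
   are the Euclidean ones applied to the 0-homogeneous extension. *)
Definition ext (R : realType) (n : nat) (V : Type) (f : 'rV[R]_n -> V) :
  'rV[R]_n -> V := fun x => f (proj x).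

Definition partial (R : realType) (n : nat) (i : 'I_n) (F : 'rV[R]_n -> R) :
  'rV[R]_n -> R := fun x => 'D_(delta_mx 0 i) F x.

Definition partials (R : realType) (n : nat) (s : seq 'I_n)
  (F : 'rV[R]_n -> R) : 'rV[R]_n -> R := foldr (@partial R n) F s.

Definition div_sphere (R : realType) (n : nat) (A : 'rV[R]_n -> 'rV[R]_n) :
  'rV[R]_n -> R :=
  fun x => \sum_(i < n) partial i (fun y => ext A y 0 i) x.

Definition laplace_beltrami (R : realType) (n : nat) (f : 'rV[R]_n -> R) :
  'rV[R]_n -> R := fun x => \sum_(i < n) partials [:: i; i] (ext f) x.

Definition smooth_sphere (R : realType) (n : nat) (f : 'rV[R]_n -> R) : Prop :=
  forall (s : seq 'I_n) (x : 'rV[R]_n), x != 0 ->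
    differentiable (partials s (ext f)) x.

(* Convergence in the Frechet space of smooth functions on the sphere. *)
Definition cvg_smooth (R : realType) (n : nat) (T : Type) (F : set_system T)
    (g : T -> 'rV[R]_n -> R) (l : 'rV[R]_n -> R) : Prop :=
  forall s : seq 'I_n,
    {uniform sphere R n,
      (fun a => partials s (ext (g a))) @ F --> partials s (ext l)}.

Definition spherical_harmonic (R : realType) (n l : nat)
    (Y : 'rV[R]_n -> R) : Prop :=
  exists p : mpoly n R,
    [/\ p \is ishomog1 l mdeg,
        \sum_(i < n) mderiv i (mderiv i p) = 0
      & forall x, Y x = meval (fun i => x 0 i) p].

(* Distributions are given through their action on test functions. *)
Definition distribution (R : realType) (n : nat) := ('rV[R]_n -> R) -> R.
Arguments distribution : clear implicits.

Definition dist_of_fun (R : realType) (n : nat)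
    (sigma : probability (borel R n) R) (f : 'rV[R]_n -> R) :
  distribution R n := fun Y => \int[sigma]_(x in sphere R n) (f x * Y x).

Definition dist_of_meas (R : realType) (n : nat)
    (mu : {measure set (borel R n) -> \bar R}) : distribution R n :=
  fun Y => \int[mu]_(x in sphere R n) Y x.

Definition dist_sub (R : realType) (n : nat) (T1 T2 : distribution R n) :
  distribution R n := fun Y => T1 Y - T2 Y.

(* Squared L^2 norm of the component of T among the spherical harmonics of
   degree l, that is, of the l-th term of its spherical harmonic expansion. *)
Definition harmonic_energy (R : realType) (n : nat)
    (sigma : probability (borel R n) R) (l : nat) (T : distribution R n) :
  \bar R :=
  ereal_sup [set (T Y ^+ 2)%:E | Y in
    [set Y : 'rV[R]_n -> R | spherical_harmonic l Y /\
       \int[sigma]_(x in sphere R n) (Y x ^+ 2) <= 1]].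

(* The L^2 norm of (1 - Delta)^(s/2) T, where - Delta acts on the spherical
   harmonics of degree l as the multiplication by l (l + n - 2). *)
Definition Hnorm (R : realType) (n : nat)
    (sigma : probability (borel R n) R) (s : R) (T : distribution R n) :
  \bar R :=
  ((\sum_(0 <= l <oo) ((1 + (l * (l + n - 2))%:R) `^ s)%:E
                      * harmonic_energy sigma l T) `^ 2^-1)%E.

Definition L2norm (R : realType) (n : nat)
    (sigma : probability (borel R n) R) (f : 'rV[R]_n -> R) : \bar R :=
  Lnorm sigma 2%:E (EFin \o (f \_ (sphere R n))).

Definition L2dist (R : realType) (n : nat)
    (sigma : probability (borel R n) R) (f g : 'rV[R]_n -> R) : \bar R :=
  L2norm sigma (fun x => f x - g x).

Definition rate (R : realType) (nu tau : R -> R) (r : R) : R := nu r / tau r.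

Definition kappa_max (R : realType) (nu tau : R -> R) : \bar R :=
  lim ((rate nu tau r)%:E @[r --> +oo]).

(* nu(r)/r is a Lipschitz function on [0, +oo[, its value at 0 being understood
   as the limit; as 0^-1 = 0 in the library this is spelled out on ]0, +oo[. *)
Definition coefficients (R : realType) (nu tau : R -> R) : Prop :=
  [/\ (forall r, 0 <= r -> 0 <= nu r /\ 0 < tau r),
      [/\ nu 0 = 0,
          [lipschitz (nu r / r) | r in `]0, +oo[%classic]
        & exists M, forall r, 0 < r -> nu r / r <= M],
      ([lipschitz (tau r) | r in `[0, +oo[%classic] /\
       exists M, forall r, 0 <= r -> tau r <= M),
      (forall r1 r2, 0 <= r1 -> r1 < r2 -> rate nu tau r1 < rate nu tau r2)
    & exists dk : R -> R,
        [lipschitz (dk r) | r in `[0, +oo[%classic] /\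
        forall r, 0 <= r ->
          (rate nu tau u - rate nu tau r) / (u - r)
            @[u --> within `[0, +oo[%classic (r^')] --> dk r].

Definition is_inverse_rate (R : realType) (nu tau j : R -> R) : Prop :=
  forall x, 0 <= x -> (x%:E < kappa_max nu tau)%E ->
    0 <= j x /\ rate nu tau (j x) = x.

Definition flux (R : realType) (n : nat)
    (sigma : probability (borel R n) R) (f : 'rV[R]_n -> R) : 'rV[R]_n :=
  \row_(i < n) \int[sigma]_(x in sphere R n) (x 0 i * f x).

(* Meaningful only when the flux is nonzero. *)
Definition direction (R : realType) (n : nat)
    (sigma : probability (borel R n) R) (f : 'rV[R]_n -> R) : 'rV[R]_n :=
  proj (flux sigma f).

(* If the flux of f vanishes, then direction sigma f = 0 and only the
   diffusion term remains. *)
Definition Qop (R : realType) (n : nat)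
    (sigma : probability (borel R n) R) (nu tau : R -> R)
    (f : 'rV[R]_n -> R) : 'rV[R]_n -> R :=
  let J := enorm (flux sigma f) in
  let Om := direction sigma f in
  fun x => - nu J * div_sphere (fun y => f y *: (Om - dot y Om *: y)) x
           + tau J * laplace_beltrami f x.

Definition potential (R : realType) (nu tau : R -> R) (r : R) : R :=
  \int[lebesgue_measure]_(u in `[0, r]) rate nu tau u.

Definition free_energy (R : realType) (n : nat)
    (sigma : probability (borel R n) R) (nu tau : R -> R)
    (f : 'rV[R]_n -> R) : \bar R :=
  (\int[sigma]_(x in sphere R n) (f x * ln (f x))%:E
   - (potential nu tau (enorm (flux sigma f)))%:E)%E.

Definition von_mises (R : realType) (n : nat)
    (sigma : probability (borel R n) R) (kappa : R) (Om : 'rV[R]_n) :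
  'rV[R]_n -> R :=
  fun x => expR (kappa * dot x Om)
           / \int[sigma]_(y in sphere R n) expR (kappa * dot y Om).

Definition order_parameter (R : realType) (n : nat) (kappa : R) : R :=
  (\int[lebesgue_measure]_(t in `[0, pi])
      (cos t * expR (kappa * cos t) * sin t ^+ (n - 2)))
  / (\int[lebesgue_measure]_(t in `[0, pi])
      (expR (kappa * cos t) * sin t ^+ (n - 2))).

Definition equilibrium (R : realType) (n : nat)
    (sigma : probability (borel R n) R) (rho kappa : R) (Om : 'rV[R]_n) :
  'rV[R]_n -> R := fun x => rho * von_mises sigma kappa Om x.

Definition initial_condition (R : realType) (n : nat)
    (sigma : probability (borel R n) R) (s : R)
    (mu0 : {measure set (borel R n) -> \bar R}) : Prop :=
  [/\ mu0 (~` sphere R n) = 0%E, (mu0 (sphere R n) < +oo)%E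
    & (Hnorm sigma s (dist_of_meas mu0) < +oo)%E].

Definition has_density (R : realType) (n : nat)
    (sigma : probability (borel R n) R)
    (mu : {measure set (borel R n) -> \bar R}) (g : 'rV[R]_n -> R) : Prop :=
  [/\ measurable_fun (sphere R n : set (borel R n)) (g : borel R n -> R),
      (forall x, sphere R n x -> 0 <= g x)
    & forall A : set (borel R n), measurable A ->
        mu A = (\int[sigma]_(x in A `&` sphere R n) (g x)%:E)%E].

(* The weak solution with initial condition mu0 is the element of
   C([0, +oo[, H^s) and C^1(]0, +oo[, C^oo), positive for t > 0, that satisfies
   d_t f = Q(f) for t > 0, in the classical sense by smoothness. The value f 0
   is not constrained, mu0 being in general not a function. *)
Definition is_solution (R : realType) (n : nat)
    (sigma : probability (borel R n) R) (nu tau : R -> R) (s : R)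
    (mu0 : {measure set (borel R n) -> \bar R})
    (f : R -> 'rV[R]_n -> R) : Prop :=
  (forall t, 0 < t ->
     [/\ smooth_sphere (f t),
         (forall x, sphere R n x -> 0 < f t x),
         cvg_smooth (0 : R)^' (fun (h : R) x => h^-1 * (f (t + h) x - f t x))
           (Qop sigma nu tau (f t)),
         cvg_smooth (nbhs t) (fun u => Qop sigma nu tau (f u))
           (Qop sigma nu tau (f t))
       & Hnorm sigma s
           (dist_sub (dist_of_fun sigma (f u)) (dist_of_fun sigma (f t)))
           @[u --> t] --> 0%E]) /\
  Hnorm sigma s (dist_sub (dist_of_fun sigma (f u)) (dist_of_meas mu0))
    @[u --> 0^'+] --> 0%E.

(* Main.v *)
(* The fields x_i d_j - x_j d_i generate the rotations, hence are skew for sigma;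
   they turn Q into a weak form and its diffusion into a Dirichlet form.

   With J = |J_f| and j = j(kappa), the excess F(f) - F_kappa is
   H(f | rho M_(kappa Omega_f)) - [Phi(J) - Phi(j) - kappa (J - j)], where H is the
   relative entropy. By convex duality H is bounded below by a function of J alone,
   attained on the equilibria M_(x Omega); at x = kappa the second derivative of
   the resulting bound on the excess has the sign of (j/c)'(kappa).

   If (j/c)' < 0, the functions rho M_(x Omega) with x close to kappa have a smaller
   free energy than rho M_(kappa Omega), and are close to it in every H^s, the
   harmonics of degree l of e^(x u) being O(x^l / l!). As F decreases along the
   solutions while F(f) - F_kappa is bounded below by a quantity that vanishes
   when J -> rho c(kappa), such a solution cannot converge.

   If (j/c)' > 0, the excess controls H and (J - j)^2 near J = j, so that J never
   leaves a neighbourhood of j and, by Pinsker's argument, the L^1 distance to the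
   family is at most a multiple of the initial L^2 distance d. The direction then
   moves at speed O(d). Freezing Omega at a time T, the square of the L^2 distance
   to this equilibrium satisfies y' <= - y + C d^2 (1 + (T - t)^2): the lower order
   terms are absorbed by the Dirichlet form through a Nash inequality, obtained
   from the kernels (1 + x . y)^m. Gronwall's lemma gives y(T) <= C d^2. *)

From HB Require Import structures.
Require Import Defs.
From mathcomp Require Import all_boot all_order all_algebra.
From mathcomp Require Import all_classical all_reals all_analysis.
From mathcomp Require Import -(notations) mpoly.
From mathcomp Require Import measurable_realfun ring lra.

Set Implicit Arguments.
Unset Strict Implicit.
Unset Printing Implicit Defensive.

Import Order.TTheory GRing.Theory Num.Theory.
Import numFieldNormedType.Exports.

Local Open Scope classical_set_scope.
Local Open Scope ring_scope.

(** The initial time is the obstacle. A solution is tied to its datum only by convergence in H^s,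
    with s of any sign, so neither the L^2 norm nor the entropy is known to be continuous at time 0.
    What does converge is the pairing with each spherical harmonic, hence, by zonal harmonics, each
    moment of x . y. Convex functionals are therefore estimated on densities smoothed by a kernel
    polynomial in x . y; the growth factor e^(C t) does not depend on the kernel and tends to 1 at
    time 0. The kernels of the Nash inequality, mixed with a constant, serve here: finite rank makes
    them symmetric by mere algebra, and rotation invariance makes them commute with the fields of
    rotation.

    The moments of zonal functions, on the sphere, come from a single fact: the Laplacian of a zonal
    function has mean zero. Angular integrals satisfy the same recurrence, so polar coordinates are
    avoided.

    The final bound must be a multiple of the initial distance itself. Hence d is a free parameter
    above this distance, positive because Pinsker's argument divides by d a relative entropy of
    order d^2. *)

Lemma cvg_sumr (R : realType) (T : Type) (F : set_system T) {FF : Filter F}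
    (J : Type) (s : seq J) (P : pred J) (f : J -> T -> R) (l : J -> R) :
  (forall j, P j -> f j t @[t --> F] --> l j) ->
  \sum_(j <- s | P j) f j t @[t --> F] --> \sum_(j <- s | P j) l j.
Proof.
move=> fl; elim: s => [|j s ih].
  by under eq_fun do rewrite big_nil; rewrite big_nil; exact: cvg_cst.
under eq_fun do rewrite big_cons; rewrite big_cons.
by case: ifP => // Pj; apply: cvgD => //; exact: fl.
Qed.

(** * Integration over the sphere and invariance under rotations *)

Section SphereIntegral.
Variables (R : realType) (n : nat) (sigma : probability (borel R n) R).
Implicit Types (f g h w : 'rV[R]_n -> R) (x y : 'rV[R]_n) (O : 'M[R]_n).

Lemma sphereP x : sphere R n x <-> dot x x = 1.
Proof.
have dxx : 0 <= dot x x by apply: sumr_ge0 => i _; rewrite -expr2 sqr_ge0.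
rewrite /sphere /enorm /=; split=> [h|->]; last exact: sqrtr1.
by rewrite -[dot x x]sqr_sqrtr// h expr1n.
Qed.

Lemma dotC x y : dot x y = dot y x.
Proof. by apply: eq_bigr => i _; rewrite mulrC. Qed.

Lemma dotE x y : dot x y = (x *m y^T) 0 0.
Proof. by rewrite mxE; apply: eq_bigr => i _; rewrite mxE. Qed.

Lemma dotDl x y z : dot (x + y) z = dot x z + dot y z.
Proof. by rewrite !dotE mulmxDl mxE. Qed.

Lemma dotZl a x y : dot (a *: x) y = a * dot x y.
Proof. by rewrite !dotE -scalemxAl mxE. Qed.

Lemma dotDr x y z : dot z (x + y) = dot z x + dot z y.
Proof. by rewrite dotC dotDl !(dotC z). Qed.

Lemma dotZr a x y : dot x (a *: y) = a * dot x y.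
Proof. by rewrite dotC dotZl dotC. Qed.

Lemma dotxx_ge0 x : 0 <= dot x x.
Proof. by apply: sumr_ge0 => i _; rewrite -expr2 sqr_ge0. Qed.

Lemma enorm_ge0 x : 0 <= enorm x. Proof. exact: sqrtr_ge0. Qed.

Lemma sqr_enorm x : enorm x ^+ 2 = dot x x.
Proof. by rewrite sqr_sqrtr// dotxx_ge0. Qed.

Lemma CauchySchwarz_dot x y : `|dot x y| <= enorm x * enorm y.
Proof.
rewrite -(@ler_pXn2r _ 2)// ?nnegrE ?mulr_ge0 ?enorm_ge0//.
rewrite real_normK ?num_real// exprMn !sqr_enorm.
have h a : 0 <= dot x x + 2 * a * dot x y + a ^+ 2 * dot y y.
  have := dotxx_ge0 (x + a *: y).
  by rewrite !(dotDl, dotDr, dotZl, dotZr) (dotC y x); nra.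
have [y0|y0] := eqVneq (dot y y) 0.
  (* If y . y = 0 the polynomial is affine in a, and this value makes it equal to -1 unless x . y =
     0. *)
  have := h (- (dot x x + 1) / 2 / dot x y); rewrite y0 !mulr0 addr0.
  have [->|d0] := eqVneq (dot x y) 0; first by rewrite expr0n.
  have -> : 2 * (- (dot x x + 1) / 2 / dot x y) * dot x y = - (dot x x + 1).
    by field.
  lra.
have yp : 0 < dot y y by rewrite lt_neqAle eq_sym y0 dotxx_ge0.
have := h (- dot x y / dot y y).
have -> : dot x x + 2 * (- dot x y / dot y y) * dot x y +
    (- dot x y / dot y y) ^+ 2 * dot y y =
  (dot x x * dot y y - dot x y ^+ 2) / dot y y by field.
by rewrite pmulr_lge0 ?invr_gt0// subr_ge0.
Qed.

Lemma dot_sphere x y : sphere R n x -> sphere R n y -> `|dot x y| <= 1.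
Proof.
move=> hx hy; apply: le_trans (CauchySchwarz_dot x y) _.
by rewrite /sphere /= in hx hy; rewrite hx hy mulr1.
Qed.

Lemma coord_sphere x i : sphere R n x -> `|x 0 i| <= 1.
Proof.
move=> /sphereP hx; rewrite -(@ler_pXn2r _ 2)// ?nnegrE//.
rewrite real_normK ?num_real// expr1n -hx /dot (bigD1 i)//= expr2 lerDl.
by apply: sumr_ge0 => j _; rewrite -expr2 sqr_ge0.
Qed.

Lemma continuous_coord i : continuous (fun x : 'rV[R]_n => x 0 i).
Proof. exact: coord_continuous. Qed.

Lemma continuous_dot : continuous (fun x : 'rV[R]_n => dot x x).
Proof.
move=> x; rewrite /dot; apply: (@cvg_sumr _ _ (nbhs x)) => i _.
by apply: cvgM; exact: continuous_coord.
Qed.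

Lemma sphereE : sphere R n = (fun x : 'rV[R]_n => dot x x) @^-1` [set 1].
Proof. by apply/seteqP; split=> x /= /sphereP. Qed.

Lemma closed_sphere : closed (sphere R n).
Proof.
by rewrite sphereE; apply: closed_comp => [x _|]; [exact: continuous_dot | exact: closed_eq].
Qed.

Lemma compact_sphere : compact (sphere R n).
Proof.
apply: bounded_closed_compact; last exact: closed_sphere.
exists 1; split=> // M M1 x hx.
rewrite /= /Num.norm/= mx_normrE; apply/bigmax_leP; split; first by rewrite (le_trans _ (ltW M1)).
by move=> [i j] _ /=; rewrite ord1 (le_trans _ (ltW M1))//; exact: coord_sphere.
Qed.

Lemma sphere_neq0 x : sphere R n x -> x != 0.
Proof.
move=> /sphereP hx; apply/eqP => x0; move: hx; rewrite x0 /dot big1 => [/esym/eqP|i _].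
  by rewrite oner_eq0.
by rewrite mxE mul0r.
Qed.

Lemma measurable_open (A : set (borel R n)) :
  open (A : set 'rV[R]_n) -> measurable A.
Proof. by move=> oA; apply: sub_sigma_algebra. Qed.

Lemma measurable_sphere : measurable (sphere R n : set (borel R n)).
Proof.
rewrite -(setCK (sphere R n)); apply: measurableC.
apply: measurable_open; exact: closed_openC closed_sphere.
Qed.
Local Notation mS := measurable_sphere.

(** Continuity is known only at the points of the sphere, so the preimage of an open ray need not be
    open in the ambient space; its interior has the same trace on the sphere. *)
Lemma measurable_fun_sphere f :
  (forall x, sphere R n x -> {for x, continuous f}) ->
  measurable_fun (sphere R n : set (borel R n)) (f : borel R n -> R).
Proof.
move=> cf.
apply: (measurability _ (RGenOInfty.measurableE R)) => //.
move=> _ [_ [a ->] <-].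
have -> : sphere R n `&` f @^-1` `]a, +oo[%classic =
  sphere R n `&` interior (f @^-1` `]a, +oo[%classic).
  apply/seteqP; split=> x [Sx fx]; split=> //; last exact: interior_subset fx.
  apply: cf => //; apply: open_nbhs_nbhs; split=> //.
by apply: measurableI; [exact: mS | apply: measurable_open; exact: open_interior].
Qed.

Definition sint f : R := \int[sigma]_(x in sphere R n) f x.

Definition intg f :=
  sigma.-integrable (sphere R n : set (borel R n)) (EFin \o f).

(** A class closed under all the algebraic operations and under rotations, and made of integrable
    functions: it settles the integrability of nearly all integrands by syntactic closure. *)
Definition bdm f :=
  measurable_fun (sphere R n : set (borel R n)) (f : borel R n -> R) /\
  exists M, forall x, sphere R n x -> `|f x| <= M.

Lemma bdm_continuous f :
  (forall x, sphere R n x -> {for x, continuous f}) -> bdm f.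
Proof.
move=> cf; split; first exact: measurable_fun_sphere.
have : compact (f @` sphere R n).
  apply: continuous_compact compact_sphere.
  by apply: continuous_in_subspaceT => x /set_mem; exact: cf.
move=> /compact_bounded [M [_ hM]]; exists (M + 1) => x Sx.
by apply: (hM (M + 1)); [rewrite ltrDl | exists x].
Qed.

Lemma eq_bdm f g : (forall x, sphere R n x -> f x = g x) -> bdm f -> bdm g.
Proof.
move=> fg [mf [M hM]]; split; last by exists M => x Sx; rewrite -fg// hM.
by apply: eq_measurable_fun mf => x /set_mem Sx; exact: fg.
Qed.

Lemma bdm_cst (a : R) : bdm (fun=> a).
Proof. by split; [exact: measurable_cst | exists `|a|]. Qed.

Lemma bdmD f g : bdm f -> bdm g -> bdm (fun x => f x + g x).
Proof.
move=> [mf [M hM]] [mg [N hN]]; split; first exact: measurable_funD.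
by exists (M + N) => x Sx; rewrite (le_trans (ler_normD _ _))// lerD ?hM ?hN.
Qed.

Lemma bdmM f g : bdm f -> bdm g -> bdm (fun x => f x * g x).
Proof.
move=> [mf [M hM]] [mg [N hN]]; split; first exact: measurable_funM.
by exists (M * N) => x Sx; rewrite normrM ler_pM ?hM ?hN.
Qed.

Lemma bdmZ a f : bdm f -> bdm (fun x => a * f x).
Proof. by move=> bf; apply: bdmM => //; exact: bdm_cst. Qed.

Lemma bdmN f : bdm f -> bdm (fun x => - f x).
Proof.
by move=> /(bdmZ (-1)); congr bdm; apply/funext => x; rewrite mulN1r.
Qed.

Lemma bdmB f g : bdm f -> bdm g -> bdm (fun x => f x - g x).
Proof. by move=> bf bg; apply: bdmD => //; exact: bdmN. Qed.

Lemma bdm_norm f : bdm f -> bdm (fun x => `|f x|).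
Proof.
move=> [mf [M hM]]; split; first exact: measurableT_comp.
by exists M => x Sx; rewrite normr_id hM.
Qed.

Lemma bdm_sum (J : Type) (s : seq J) (P : pred J) (F : J -> 'rV[R]_n -> R) :
  (forall j, P j -> bdm (F j)) -> bdm (fun x => \sum_(j <- s | P j) F j x).
Proof.
move=> bF; elim: s => [|j s ih].
  by apply: eq_bdm (bdm_cst 0) => x _; rewrite big_nil.
apply: (@eq_bdm (fun x => (if P j then F j x else 0) + \sum_(j <- s | P j) F j x)).
  by move=> x _; rewrite big_cons; case: ifP; rewrite ?add0r.
by apply: bdmD => //; case Pj: (P j); [exact: bF | exact: bdm_cst].
Qed.

Lemma bdm_prod (J : Type) (s : seq J) (P : pred J) (F : J -> 'rV[R]_n -> R) :
  (forall j, P j -> bdm (F j)) -> bdm (fun x => \prod_(j <- s | P j) F j x).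
Proof.
move=> bF; elim: s => [|j s ih].
  by apply: eq_bdm (bdm_cst 1) => x _; rewrite big_nil.
apply: (@eq_bdm (fun x => (if P j then F j x else 1) * \prod_(j <- s | P j) F j x)).
  by move=> x _; rewrite big_cons; case: ifP; rewrite ?mul1r.
by apply: bdmM => //; case Pj: (P j); [exact: bF | exact: bdm_cst].
Qed.

Lemma bdmX f m : bdm f -> bdm (fun x => f x ^+ m).
Proof.
move=> bf; elim: m => [|m ih]; first exact: bdm_cst.
by apply: eq_bdm (bdmM bf ih) => x _; rewrite exprS.
Qed.

Lemma bdm_coord i : bdm (fun x => x 0 i).
Proof. by apply: bdm_continuous => x _; exact: continuous_coord. Qed.

Lemma bdm_dot y : bdm (fun x => dot x y).
Proof.
by apply: bdm_sum => i _; apply: bdmM; [exact: bdm_coord | exact: bdm_cst].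
Qed.

Lemma bdm_comp (phi : R -> R) f :
  (forall x, sphere R n x -> {for f x, continuous phi}) -> measurable_fun setT phi ->
  (exists M, forall x, sphere R n x -> `|phi (f x)| <= M) ->
  bdm f -> bdm (fun x => phi (f x)).
Proof.
by move=> cphi mphi hM [mf _]; split=> //; exact: measurableT_comp.
Qed.

End SphereIntegral.
Arguments bdm_cst {R n} a.
Arguments measurable_sphere : clear implicits.

Lemma cvg_rV (R : realType) (n : nat) (T : Type) (F : set_system T) {FF : Filter F}
    (f : T -> 'rV[R]_n) (l : 'rV[R]_n) :
  (forall i, f t 0 i @[t --> F] --> l 0 i) -> f t @[t --> F] --> l.
Proof.
move=> fl A [P hP sub].
have : \forall t \near F, forall i, P 0 i (f t 0 i).
  by apply: filter_forall => i; apply: fl; exact: hP.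
by apply: filterS => t Pt; apply: sub => i j; rewrite ord1.
Qed.

Section SphereIntegralTheory.
Variables (R : realType) (n : nat) (sigma : probability (borel R n) R).
Hypothesis hsigma : is_uniform sigma.
Implicit Types (f g h w : 'rV[R]_n -> R) (x y : 'rV[R]_n) (O : 'M[R]_n).

Local Notation S := (sphere R n).
Local Notation I := (sint sigma).
Local Notation mS := (measurable_sphere R n).
Local Notation intg := (intg sigma).

Lemma intg_bdm f : bdm f -> intg f.
Proof.
move=> [mf [M hM]]; apply: measurable_bounded_integrable => //.
- exact: mS.
- by have := ltry (1 : R); rewrite -(proj1 hsigma).
- exists M; split; first exact: num_real.
  by move=> N MN x Sx; rewrite /= (le_trans (hM _ Sx))// ltW.
Qed.

Lemma eq_intg f g : (forall x, S x -> f x = g x) -> intg f -> intg g.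
Proof.
move=> fg; apply: eq_integrable; first exact: mS.
by move=> x /set_mem Sx /=; rewrite fg.
Qed.

Lemma intgD f g : intg f -> intg g -> intg (fun x => f x + g x).
Proof.
move=> hf hg; by have := integrableD mS hf hg; apply: eq_integrable => //; exact: mS.
Qed.

Lemma intgM f g : intg f -> bdm g -> intg (fun x => f x * g x).
Proof.
move=> hf [mg [M hM]].
have := @integrableMl _ _ _ sigma _ mS (EFin \o f) g hf mg; apply.
exists M; split; first exact: num_real.
by move=> N MN x Sx; rewrite /= (le_trans (hM _ Sx))// ltW.
Qed.

Lemma intgZ a f : intg f -> intg (fun x => a * f x).
Proof.
move=> /intgM/(_ (bdm_cst a)); apply: eq_intg => x _; exact: mulrC.
Qed.

Lemma intgN f : intg f -> intg (fun x => - f x).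
Proof. by move=> /(intgZ (-1)); apply: eq_intg => x _; rewrite mulN1r. Qed.

Lemma intgB f g : intg f -> intg g -> intg (fun x => f x - g x).
Proof. by move=> hf hg; apply: intgD => //; exact: intgN. Qed.

Lemma intg_norm f : intg f -> intg (fun x => `|f x|).
Proof. exact: integrable_norm. Qed.

Lemma intg_measurable f : intg f -> measurable_fun (S : set (borel R n)) f.
Proof. by move=> /integrableP[/measurable_EFinP]. Qed.

Lemma intg_le f g : measurable_fun (S : set (borel R n)) f ->
  (forall x, S x -> `|f x| <= g x) -> intg g -> intg f.
Proof.
move=> mf fg; apply: le_integrable; first exact: mS.
  exact/measurable_EFinP.
by move=> x Sx; rewrite /= lee_fin (le_trans (fg _ Sx))// ler_norm.
Qed.

Lemma intg_sum (J : Type) (s : seq J) (P : pred J) (F : J -> 'rV[R]_n -> R) :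
  (forall j, P j -> intg (F j)) -> intg (fun x => \sum_(j <- s | P j) F j x).
Proof.
move=> bF; elim: s => [|j s ih].
  by apply: eq_intg (intg_bdm (bdm_cst 0)) => x _; rewrite big_nil.
apply: (@eq_intg (fun x => (if P j then F j x else 0) + \sum_(j <- s | P j) F j x)).
  by move=> x _; rewrite big_cons; case: ifP; rewrite ?add0r.
apply: intgD => //; case Pj: (P j); [exact: bF | exact/intg_bdm/bdm_cst].
Qed.

Lemma eq_sint f g : (forall x, S x -> f x = g x) -> I f = I g.
Proof. by move=> fg; apply: eq_Rintegral => x /set_mem; exact: fg. Qed.

Lemma sint_cst a : I (fun=> a) = a.
Proof.
rewrite /sint (Rintegral_cst sigma mS).
by rewrite -[RHS]mulr1; congr (_ * _); exact: (congr1 fine (proj1 hsigma)).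
Qed.

Lemma sintD f g : intg f -> intg g -> I (fun x => f x + g x) = I f + I g.
Proof. by move=> hf hg; apply: RintegralD => //; exact: mS. Qed.

Lemma sintB f g : intg f -> intg g -> I (fun x => f x - g x) = I f - I g.
Proof. by move=> hf hg; apply: RintegralB => //; exact: mS. Qed.

Lemma sintZ a f : intg f -> I (fun x => a * f x) = a * I f.
Proof. by move=> hf; apply: RintegralZl => //; exact: mS. Qed.

Lemma sintZr a f : intg f -> I (fun x => f x * a) = I f * a.
Proof. by move=> hf; apply: RintegralZr => //; exact: mS. Qed.

Lemma sint_sum (J : Type) (s : seq J) (P : pred J) (F : J -> 'rV[R]_n -> R) :
  (forall j, P j -> intg (F j)) ->
  I (fun x => \sum_(j <- s | P j) F j x) = \sum_(j <- s | P j) I (F j).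
Proof.
move=> bF; elim: s => [|j s ih].
  by rewrite big_nil -[RHS](sint_cst 0); apply: eq_sint => x _; rewrite big_nil.
rewrite big_cons -ih.
case Pj: (P j); last by apply: eq_sint => x _; rewrite big_cons Pj.
rewrite -sintD; [|exact: bF|exact: intg_sum].
by apply: eq_sint => x _; rewrite big_cons Pj.
Qed.

Lemma sint_ge0 f : (forall x, S x -> 0 <= f x) -> 0 <= I f.
Proof. by move=> f0; exact: Rintegral_ge0. Qed.

Lemma le_sint f g : intg f -> intg g -> (forall x, S x -> f x <= g x) -> I f <= I g.
Proof. by move=> hf hg fg; exact: (le_Rintegral mS hf hg fg). Qed.

Lemma norm_sint f : intg f -> `|I f| <= I (fun x => `|f x|).
Proof. by move=> hf; exact: (le_normr_Rintegral mS hf). Qed.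

Lemma norm_sint_le f M : intg f -> (forall x, S x -> `|f x| <= M) -> `|I f| <= M.
Proof.
move=> hf hM; apply: le_trans (norm_sint hf) _.
rewrite -[leRHS](sint_cst M); apply: le_sint => //; first exact: intg_norm.
exact/intg_bdm/bdm_cst.
Qed.

Lemma cvg_sint (F : nat -> 'rV[R]_n -> R) f (M : R) :
  (forall k, bdm (F k)) -> (forall k x, S x -> `|F k x| <= M) ->
  (forall x, S x -> F k x @[k --> \oo] --> f x) ->
  I (F k) @[k --> \oo] --> I f.
Proof.
move=> bF FM Ff.
have mF k : measurable_fun (S : set (borel R n)) (fun x => (F k x)%:E).
  by apply/measurable_EFinP; case: (bF k).
have Ff' x : S x -> (F k x)%:E @[k --> \oo] --> (f x)%:E.
  by move=> Sx; apply: cvg_EFin; [exact: nearW | exact: Ff].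
have mf : measurable_fun (S : set (borel R n)) (fun x => (f x)%:E).
  apply/measurable_EFinP; apply: (@measurable_fun_cvg _ (borel R n) R S F f) => // k.
  by case: (bF k).
have intM : sigma.-integrable (S : set (borel R n)) (EFin \o (fun=> M)).
  exact/intg_bdm/bdm_cst.
have h1 : {ae sigma, forall x, S x -> (F k x)%:E @[k --> \oo] --> (f x)%:E}.
  exact: aeW.
have h2 : {ae sigma, forall x k, S x -> (`|(F k x)%:E| <= M%:E)%E}.
  by apply: aeW => x k Sx; rewrite lee_fin FM.
have [intf _ h] := dominated_convergence mS mF mf h1 intM h2.
rewrite /sint /Rintegral; apply: fine_cvg.
rewrite fineK; first exact: h.
apply: integrable_fin_num intf; exact: mS.
Qed.

Lemma dot_mulmx O x y : O *m O^T = 1%:M -> dot (x *m O) (y *m O) = dot x y.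
Proof. by move=> hO; rewrite !dotE trmx_mul mulmxA -(mulmxA x) hO mulmx1. Qed.

Lemma sphere_mulmx O x : O *m O^T = 1%:M -> S (x *m O) <-> S x.
Proof. by move=> hO; rewrite !sphereP dot_mulmx. Qed.

Lemma continuous_mulmxr O : continuous (fun x : 'rV[R]_n => x *m O).
Proof.
move=> x; apply: (@cvg_rV _ _ _ (nbhs x)) => i.
rewrite mxE; under eq_fun do rewrite mxE.
apply: (@cvg_sumr _ _ (nbhs x)) => j _; apply: cvgM; [exact: continuous_coord | exact: cvg_cst].
Qed.

Lemma measurable_mulmxr O :
  measurable_fun [set: borel R n] (fun x : borel R n => (x *m O) : borel R n).
Proof.
apply: (@measurability _ _ _ (borel R n) setT _ open) => // _ [A oA <-]; rewrite setTI.
apply: measurable_open; apply: open_comp => // x _; exact: continuous_mulmxr.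
Qed.

Lemma bdm_mulmx O f : O *m O^T = 1%:M -> bdm f -> bdm (fun x => f (x *m O)).
Proof.
move=> hO bf; have mfS : measurable_fun [set: borel R n] ((f : borel R n -> R) \_ S).
  by apply/(measurable_restrictT _ mS); case: bf.
split; last by case: bf => _ [M hM]; exists M => x /(sphere_mulmx x hO); exact: hM.
have := @measurable_funTS _ _ (borel R n) R S _ (measurableT_comp mfS (measurable_mulmxr O)).
apply: eq_measurable_fun => x /set_mem Sx /=.
by rewrite patchE mem_set//; apply/sphere_mulmx.
Qed.

(** The measure lives on the whole space, so [f] is first extended by 0 outside the sphere; there
    the image of [sigma] under the rotation is [sigma] itself, and the sphere is preserved. *)
Lemma sint_rot O f : O *m O^T = 1%:M -> bdm f -> I (fun x => f (x *m O)) = I f.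
Proof.
move=> hO bf; rewrite /sint /Rintegral; congr fine.
have mphi := measurable_mulmxr O.
have mfS : measurable_fun [set: borel R n] ((f : borel R n -> R) \_ S).
  by apply/(measurable_restrictT _ mS); case: bf.
pose F : borel R n -> \bar R := EFin \o (f \_ S).
have mF : measurable_fun setT F by exact/measurable_EFinP.
have bfO := bdm_mulmx hO bf.
have FO x : (F \o (fun x : borel R n => x *m O)) x =
    ((EFin \o (fun x => f (x *m O))) \_ S) x.
  rewrite /F /= !patchE; case: ifPn => [/set_mem /(sphere_mulmx _ hO) Sx|nS].
    by rewrite mem_set.
  by rewrite ifN//; apply: contra nS => /set_mem Sx; apply/mem_set/sphere_mulmx.
have intF : sigma.-integrable ((fun x : borel R n => x *m O) @^-1` setT)
    (F \o (fun x : borel R n => x *m O)).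
  rewrite preimage_setT (_ : _ \o _ = (EFin \o (fun x => f (x *m O))) \_ S).
    by apply/(integrable_mkcond _ mS); exact: intg_bdm.
  exact/funext.
have := integral_pushforward mphi mF intF measurableT.
rewrite preimage_setT.
set L := (X in X = _); have -> : L = (\int[sigma]_y F y)%E.
  by apply: eq_measure_integral => A mA _; exact: (proj2 hsigma O hO A mA).
rewrite [X in _ = X](_ : _ = (\int[sigma]_x ((EFin \o (fun x => f (x *m O))) \_ S) x)%E).
  by rewrite -[RHS]integral_mkcond/= => <-; rewrite /F -restrict_EFin -integral_mkcond.
by apply: eq_integral => x _; rewrite FO.
Qed.

End SphereIntegralTheory.

(** * Rotational derivatives *)

Section RealDerivatives.
Variable R : realType.
Implicit Types (f g : R -> R) (t d e : R).

Lemma hd_cvgP f t d :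
  is_derive t 1 f d <-> h^-1 * (f (t + h) - f t) @[h --> 0^'] --> d.
Proof.
have E : (fun h : R => h^-1 *: ((f \o shift t) (h *: 1) - f t)) =
    (fun h => h^-1 * (f (t + h) - f t)).
  by apply/funext => h /=; rewrite [h *: 1]mulr1 (addrC h).
split=> [[dv <-]|h].
  by rewrite -E; move/cvg_ex: dv => [l hl]; rewrite /derive (cvg_lim _ hl).
apply: DeriveDef; first by apply/cvg_ex; exists d; rewrite E.
by rewrite /derive E; exact: (cvg_lim _ h).
Qed.

(** A form of the derivative without division. The increments and their error then pass through
    integrals and kernels by plain inequalities. *)
Lemma hd_epsP f t d : is_derive t 1 f d <->
  forall e, 0 < e -> \forall h \near 0, `|f (t + h) - f t - h * d| <= e * `|h|.
Proof.
rewrite hd_cvgP; split=> [/cvgrPdist_le hd e e0|hd].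
  have := hd e e0; rewrite near_withinE => {}hd.
  near=> h; have [->|h0] := eqVneq h 0.
    by rewrite addr0 mul0r !subrr !normr0 mulr0.
  have : `|d - h^-1 * (f (t + h) - f t)| <= e by apply: (near hd h).
  rewrite -(@ler_pM2r _ `|h|) ?normr_gt0// -normrM mulrBl mulrAC mulVf// mul1r.
  by rewrite distrC (mulrC d).
apply/cvgrPdist_le => e e0; rewrite near_withinE.
have {}hd := hd e e0; near=> h => h0.
rewrite -(@ler_pM2r _ `|h|) ?normr_gt0// -normrM mulrBl mulrAC mulVf// mul1r.
by rewrite distrC (mulrC d); apply: (near hd h).
Unshelve. all: by end_near. Qed.

Lemma hd_cst (a : R) t : is_derive t 1 (fun=> a) 0.
Proof. exact: is_derive_cst. Qed.

Lemma hd_id t : is_derive t 1 (fun x : R => x) 1.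
Proof. exact: is_derive_id. Qed.

Lemma hdD f g t a b : is_derive t 1 f a -> is_derive t 1 g b ->
  is_derive t 1 (fun x => f x + g x) (a + b).
Proof. exact: is_deriveD. Qed.

Lemma hdM f g t a b : is_derive t 1 f a -> is_derive t 1 g b ->
  is_derive t 1 (fun x => f x * g x) (a * g t + f t * b).
Proof.
move=> hf hg; apply: is_derive_eq (is_deriveM hf hg) _.
by rewrite addrC; congr (_ + _); rewrite mulrC.
Qed.

Lemma hdZ c f t a : is_derive t 1 f a -> is_derive t 1 (fun x => c * f x) (c * a).
Proof. by move=> hf; apply: is_derive_eq (hdM (hd_cst c t) hf) _; rewrite mul0r add0r. Qed.

Lemma hdN f t a : is_derive t 1 f a -> is_derive t 1 (fun x => - f x) (- a).
Proof. exact: is_deriveN. Qed.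

Lemma hdB f g t a b : is_derive t 1 f a -> is_derive t 1 g b ->
  is_derive t 1 (fun x => f x - g x) (a - b).
Proof. exact: is_deriveB. Qed.

Lemma hd_comp f g t a b : is_derive (g t) 1 f a -> is_derive t 1 g b ->
  is_derive t 1 (fun x => f (g x)) (a * b).
Proof. exact: is_derive1_comp. Qed.

Lemma hd_sum (J : Type) (s : seq J) (P : pred J) (F : J -> R -> R) t (d : J -> R) :
  (forall j, P j -> is_derive t 1 (F j) (d j)) ->
  is_derive t 1 (fun x => \sum_(j <- s | P j) F j x) (\sum_(j <- s | P j) d j).
Proof.
move=> hF; elim: s => [|j s ih].
  rewrite big_nil (_ : (fun _ => _) = fun=> 0); first exact: hd_cst.
  by apply/funext => x; rewrite big_nil.
rewrite big_cons (_ : (fun _ => _) =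
    fun x => if P j then F j x + \sum_(j <- s | P j) F j x
             else \sum_(j <- s | P j) F j x); last first.
  by apply/funext => x; rewrite big_cons.
by case Pj: (P j) => //; apply: hdD => //; exact: hF.
Qed.

Lemma hdX f m t a : is_derive t 1 f a ->
  is_derive t 1 (fun x => f x ^+ m) (m%:R * f t ^+ m.-1 * a).
Proof.
move=> hf; have := is_deriveX m hf.
by rewrite (_ : f ^+ m = fun x => f x ^+ m)//; apply/funext => x; rewrite fctE.
Qed.

Lemma hdV f t a : f t != 0 -> is_derive t 1 f a ->
  is_derive t 1 (fun x => (f x)^-1) (- a / f t ^+ 2).
Proof.
move=> f0 hf; apply: is_derive_eq (@is_deriveV R f t a 1 f0 hf) _.
by rewrite /GRing.scale/= mulNr mulNr mulrC.
Qed.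

Lemma hd_exp f t a : is_derive t 1 f a ->
  is_derive t 1 (fun x => expR (f x)) (expR (f t) * a).
Proof. by move=> hf; exact: hd_comp (is_derive_expR (f t)) hf. Qed.

Lemma hd_ln f t a : 0 < f t -> is_derive t 1 f a ->
  is_derive t 1 (fun x => ln (f x)) ((f t)^-1 * a).
Proof. by move=> f0 hf; exact: hd_comp (is_derive1_ln f0) hf. Qed.

Lemma hd_eq f g t d : (forall x, f x = g x) -> is_derive t 1 f d -> is_derive t 1 g d.
Proof. by move=> /funext ->. Qed.

Lemma hd_near f g t d : (\forall x \near t, f x = g x) ->
  is_derive t 1 f d -> is_derive t 1 g d.
Proof.
move=> fg; rewrite !hd_epsP => h e /h {}h.
have ftgt : f t = g t by exact: nbhs_singleton fg.
have fg' : \forall h \near 0, f (t + h) = g (t + h).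
  have : (fun h : R => t + h) @ 0 --> t.
    by rewrite -[X in _ --> X]addr0; apply: cvgD; [exact: cvg_cst|exact: cvg_id].
  by move=> /(_ _ fg).
by near=> y; rewrite -ftgt -(near fg' y)//; apply: (near h y).
Unshelve. all: by end_near. Qed.

Lemma hd_continuous f t d : is_derive t 1 f d -> {for t, continuous f}.
Proof. by move=> [df _]; apply/differentiable_continuous/derivable1_diffP. Qed.

Lemma hd_nincr f (df : R -> R) (a b : R) : a <= b ->
  (forall x : R, a < x < b -> is_derive x 1 f (df x)) ->
  (forall x : R, a < x < b -> df x <= 0) -> {within `[a, b], continuous f} -> f b <= f a.
Proof.
move=> ab fd df0 cf; apply: (@ler0_derive1_nincr _ f a b) => //.
- by move=> x; rewrite in_itv/= => /fd[].
- by move=> x; rewrite in_itv/= => xab; rewrite derive1E (@derive_val _ _ _ _ _ _ _ (fd _ xab)) df0.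
Qed.

Lemma hd_unique f t a b : is_derive t 1 f a -> is_derive t 1 f b -> a = b.
Proof. by move=> ha hb; rewrite -(@derive_val _ _ _ _ _ _ _ ha) -(@derive_val _ _ _ _ _ _ _ hb). Qed.

End RealDerivatives.

Section Rotations.
Variables (R : realType) (n : nat).
Implicit Types (i j : 'I_n) (a b : R).

(** For i != j, the orthogonal projection on the (i, j)-plane. *)
Definition rotP i j : 'M[R]_n := delta_mx i i + delta_mx j j.
Definition rotJ i j : 'M[R]_n := delta_mx i j - delta_mx j i.
(** The exponential of a J, since P J = J P = J and J^2 = - P. For i = j the matrix P would be twice
    a projection and the formula not orthogonal, hence the separate case, in which the rotation is
    trivial. *)
Definition rotmx i j a : 'M[R]_n :=
  if i == j then 1%:M else 1%:M + ((cos a - 1) *: rotP i j + sin a *: rotJ i j).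

Lemma rotPP i j : i != j -> rotP i j *m rotP i j = rotP i j.
Proof.
move=> /negPf ij; rewrite /rotP !(mulmxDl, mulmxDr) !mul_delta_mx_cond !eqxx.
by rewrite (eq_sym j i) ij !(mulr0n, mulr1n, addr0, add0r)//.
Qed.

Lemma rotPJ i j : i != j -> rotP i j *m rotJ i j = rotJ i j.
Proof.
move=> /negPf ij; rewrite /rotP /rotJ !(mulmxDl, mulmxDr, mulmxN) !mul_delta_mx_cond !eqxx.
by rewrite (eq_sym j i) ij !(mulr0n, mulr1n, oppr0, addr0, add0r, subr0, sub0r)//.
Qed.

Lemma rotJP i j : i != j -> rotJ i j *m rotP i j = rotJ i j.
Proof.
move=> /negPf ij; rewrite /rotP /rotJ !(mulmxDl, mulmxDr, mulNmx) !mul_delta_mx_cond !eqxx.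
by rewrite (eq_sym j i) ij !(mulr0n, mulr1n, oppr0, addr0, add0r, subr0, sub0r) addrC.
Qed.

Lemma rotJJ i j : i != j -> rotJ i j *m rotJ i j = - rotP i j.
Proof.
move=> /negPf ij; rewrite /rotP /rotJ !(mulmxDl, mulmxDr, mulNmx, mulmxN) !mul_delta_mx_cond.
by rewrite !eqxx (eq_sym j i) ij !(mulr0n, mulr1n, opprK, oppr0, addr0, add0r, subr0, sub0r) ?opprD//.
Qed.

Lemma rotmxD i j a b : rotmx i j (a + b) = rotmx i j a *m rotmx i j b.
Proof.
rewrite /rotmx; case: eqVneq => [_|ij]; first by rewrite mulmx1.
rewrite !(mulmxDl, mulmxDr) !mulmx1 !mul1mx -!scalemxAl -!scalemxAr.
rewrite rotPP// rotPJ// rotJP// rotJJ// cosD sinD.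
apply/matrixP => k l; rewrite !mxE; ring.
Qed.

Lemma rotmx0 i j : rotmx i j 0 = 1%:M.
Proof. by rewrite /rotmx cos0 sin0 subrr !scale0r !addr0; case: ifP. Qed.

Lemma trmx_rotmx i j a : (rotmx i j a)^T = rotmx i j (- a).
Proof.
rewrite /rotmx; case: eqVneq => [_|ij]; first by rewrite trmx1.
apply/matrixP => k l; rewrite !mxE cosN sinN (eq_sym l k) ![(l == _) && _]andbC.
ring.
Qed.

Lemma rotmx_orth i j a : rotmx i j a *m (rotmx i j a)^T = 1%:M.
Proof. by rewrite trmx_rotmx -rotmxD subrr rotmx0. Qed.

End Rotations.

Section RotationalDerivatives.
Variables (R : realType) (n : nat) (sigma : probability (borel R n) R).
Hypothesis hsigma : is_uniform sigma.
Implicit Types (f g h w : 'rV[R]_n -> R) (x y : 'rV[R]_n) (i j : 'I_n).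

Local Notation S := (sphere R n).
Local Notation I := (sint sigma).
Local Notation intg := (intg sigma).

(* The derivative of h along the rotations of the (i, j)-plane, that is, along
   the tangent field x_i d_j - x_j d_i (zero if i = j). *)
Definition rd i j h g := forall x, S x ->
  is_derive (0 : R) (1 : R) (fun a : R => h (x *m rotmx i j a)) (g x).

Lemma S_rot i j a x : S x -> S (x *m rotmx i j a).
Proof. by move=> Sx; apply/sphere_mulmx => //; exact: rotmx_orth. Qed.

(** The group law of the rotations carries the derivative at 0, taken at the rotated point, to the
    angle a. *)
Lemma rd_at i j h g x (a : R) : rd i j h g -> S x ->
  is_derive a (1 : R) (fun b : R => h (x *m rotmx i j b)) (g (x *m rotmx i j a)).
Proof.
move=> hg Sx.
have h1 : is_derive a (1 : R) (fun b : R => b - a) 1.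
  by apply: is_derive_eq (hdB (hd_id a) (hd_cst a a)) _; rewrite subr0.
have h0 : is_derive (a - a) (1 : R) (fun b : R => h (x *m rotmx i j a *m rotmx i j b))
    (g (x *m rotmx i j a)).
  by rewrite subrr; exact: hg _ (S_rot i j a Sx).
have h2 := @hd_comp _ _ (fun b : R => b - a) a _ _ h0 h1; rewrite mulr1 in h2.
apply: hd_eq h2 => b.
by rewrite -mulmxA -rotmxD addrC subrK.
Qed.

Lemma eq_rd i j h g h' g' : (forall x, S x -> h x = h' x) ->
  (forall x, S x -> g x = g' x) -> rd i j h g -> rd i j h' g'.
Proof.
move=> hh' gg' r x Sx; rewrite -gg'//.
by apply: hd_eq (r x Sx) => a; rewrite hh'//; exact: S_rot.
Qed.

Lemma rd_cst i j (a : R) : rd i j (fun=> a) (fun=> 0).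
Proof. by move=> x Sx; exact: hd_cst. Qed.

Lemma rdD i j h g h' g' : rd i j h g -> rd i j h' g' ->
  rd i j (fun x => h x + h' x) (fun x => g x + g' x).
Proof. by move=> r r' x Sx; exact: hdD (r _ Sx) (r' _ Sx). Qed.

Lemma rdB i j h g h' g' : rd i j h g -> rd i j h' g' ->
  rd i j (fun x => h x - h' x) (fun x => g x - g' x).
Proof. by move=> r r' x Sx; exact: hdB (r _ Sx) (r' _ Sx). Qed.

Lemma rdM i j h g h' g' : rd i j h g -> rd i j h' g' ->
  rd i j (fun x => h x * h' x) (fun x => g x * h' x + h x * g' x).
Proof.
move=> r r' x Sx; apply: is_derive_eq (hdM (r _ Sx) (r' _ Sx)) _.
by rewrite rotmx0 mulmx1.
Qed.

Lemma rdZ i j c h g : rd i j h g -> rd i j (fun x => c * h x) (fun x => c * g x).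
Proof. by move=> r x Sx; exact: hdZ (r _ Sx). Qed.

Lemma rd_sum i j (J : Type) (s : seq J) (P : pred J) (F G : J -> 'rV[R]_n -> R) :
  (forall k, P k -> rd i j (F k) (G k)) ->
  rd i j (fun x => \sum_(k <- s | P k) F k x) (fun x => \sum_(k <- s | P k) G k x).
Proof. by move=> r x Sx; apply: hd_sum => k Pk; exact: r. Qed.

Lemma rd_comp i j (phi dphi : R -> R) h g :
  (forall x, S x -> is_derive (h x) 1 phi (dphi (h x))) ->
  rd i j h g -> rd i j (fun x => phi (h x)) (fun x => dphi (h x) * g x).
Proof.
move=> hp r x Sx; apply: hd_comp (r _ Sx).
by rewrite rotmx0 mulmx1; exact: hp.
Qed.

(* D_ij x_k *)
Definition dcoord i j k x : R := x 0 i *+ (k == j) - x 0 j *+ (k == i).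

Lemma dcoordii i k x : dcoord i i k x = 0.
Proof. by rewrite /dcoord subrr. Qed.

Lemma mulmx_rotJ i j k x : (x *m rotJ R i j) 0 k = dcoord i j k x.
Proof.
rewrite /rotJ mulmxBr !mxE; congr (_ - _).
- rewrite (bigD1 i)//= big1 ?addr0 => [|l li]; rewrite mxE ?eqxx/= ?(negPf li) ?mulr0//.
  by case: (k == j); rewrite ?mulr1 ?mulr0.
- rewrite (bigD1 j)//= big1 ?addr0 => [|l li]; rewrite mxE ?eqxx/= ?(negPf li) ?mulr0//.
  by case: (k == i); rewrite ?mulr1 ?mulr0.
Qed.

Lemma rd_coord i j k : rd i j (fun x => x 0 k) (dcoord i j k).
Proof.
move=> x Sx; rewrite /rotmx; have [<-|ij] := eqVneq i j.
  by rewrite dcoordii; exact: hd_cst.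
rewrite -mulmx_rotJ.
pose F a : R := x 0 k + ((cos a - 1) * (x *m rotP R i j) 0 k + sin a * (x *m rotJ R i j) 0 k).
apply: (@hd_eq _ F).
  move=> a; rewrite /F; move: (rotP R i j) (rotJ R i j) => P J.
  by rewrite mulmxDr mulmx1 mulmxDr -!scalemxAr !mxE.
have hF := hdD (hd_cst (x 0 k) (0 : R))
  (hdD (hdM (hdB (is_derive_cos (0 : R)) (hd_cst 1 0)) (hd_cst ((x *m rotP R i j) 0 k) 0))
       (hdM (is_derive_sin (0 : R)) (hd_cst ((x *m rotJ R i j) 0 k) 0))).
apply: is_derive_eq hF _.
rewrite sin0 cos0; ring.
Qed.

Lemma rd_dot i j y : rd i j (fun x => dot x y) (fun x => x 0 i * y 0 j - x 0 j * y 0 i).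
Proof.
have := rd_sum (index_enum 'I_n) (P := xpredT) (fun k _ => rdM (rd_coord i j k) (rd_cst i j (y 0 k))).
apply: eq_rd => // x Sx; rewrite /dcoord.
under eq_bigr do rewrite mulr0 addr0 mulrBl !mulrnAl.
rewrite sumrB; congr (_ - _).
- by rewrite (bigD1 j)//= eqxx big1 ?addr0// => k /negPf ->.
- by rewrite (bigD1 i)//= eqxx big1 ?addr0// => k /negPf ->.
Qed.

(** Differentiation under the integral sign: by the group law the derivative at any angle is a value
    of [g] on the sphere, so the bounds of [g] and [w] dominate uniformly in the angle. *)
Lemma rd_sint i j h g w : rd i j h g -> bdm h -> bdm g -> bdm w ->
  is_derive (0 : R) (1 : R) (fun a : R => I (fun x => h (x *m rotmx i j a) * w x))
    (I (fun x => g x * w x)).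
Proof.
move=> hg bh bg bw.
have [_ [M hM]] := bg; have [_ [N hN]] := bw.
pose f (a : R) (x : borel R n) : R := h (x *m rotmx i j a) * w x.
have df a x : S x -> is_derive a (1 : R) (f ^~ x) (g (x *m rotmx i j a) * w x).
  move=> Sx; apply: is_derive_eq (hdM (rd_at a hg Sx) (hd_cst (w x) a)) _.
  by rewrite mulr0 addr0.
have I0 : `](-1 : R), 1[%classic 0 by rewrite /= in_itv /= ltrN10 ltr01.
have intf (a : R) : `](-1 : R), 1[%classic a -> sigma.-integrable S (EFin \o f a).
  by move=> _; apply: (intg_bdm hsigma); apply: bdmM => //; apply: bdm_mulmx => //; exact: rotmx_orth.
have derf (a : R) (x : borel R n) : `](-1 : R), 1[%classic a -> S x -> derivable (f ^~ x) a 1.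
  by move=> _ Sx; case: (df a x Sx).
pose G := fun _ : borel R n => `|M * N|.
have G0 x : 0 <= G x by exact: normr_ge0.
have intG : sigma.-integrable S (EFin \o G) by exact: intg_bdm (bdm_cst _).
have pE a x : S x -> partial1of2 f a x = g (x *m rotmx i j a) * w x.
  by move=> Sx; rewrite partial1of2E (@derive_val _ _ _ _ _ _ _ (df a x Sx)).
have Gub (a : R) (x : borel R n) : `](-1 : R), 1[%classic a -> S x -> `|partial1of2 f a x| <= G x.
  move=> _ Sx; rewrite pE// (le_trans _ (ler_norm _))// normrM.
  by apply: ler_pM => //; [exact: hM (S_rot _ _ _ Sx) | exact: hN].
have mS := measurable_sphere R n.
have h1 := derivable_under_integral mS I0 intf derf G0 intG Gub.
have h2 := differentiation_under_integral mS I0 intf derf G0 intG Gub.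
apply: DeriveDef; first exact: h1.
rewrite -derive1E [LHS]h2; apply: (eq_sint sigma) => x Sx.
by rewrite pE// rotmx0 mulmx1.
Qed.

(** By invariance of [sigma] the integral of [h] composed with the rotations is constant, and the
    integral of [g] is its derivative. Applied to products, this is integration by parts. *)
Lemma sint_rd i j h g : rd i j h g -> bdm h -> bdm g -> I g = 0.
Proof.
move=> hg bh bg.
have h1 := rd_sint hg bh bg (bdm_cst 1).
have h2 : is_derive (0 : R) (1 : R) (fun a : R => I (fun x => h (x *m rotmx i j a) * 1)) 0.
  apply: hd_eq (hd_cst (I h) 0) => a; rewrite -[LHS](sint_rot hsigma (rotmx_orth i j a) bh).
  by apply: eq_sint => x _; rewrite mulr1.
rewrite -(hd_unique h1 h2); by apply: eq_sint => x _; rewrite mulr1.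
Qed.

Lemma sint_rd_parts i j h g h' g' : rd i j h g -> rd i j h' g' ->
  bdm h -> bdm g -> bdm h' -> bdm g' ->
  I (fun x => g x * h' x) = - I (fun x => h x * g' x).
Proof.
move=> r r' bh bg bh' bg'.
have bgh := bdmM bg bh'; have bhg := bdmM bh bg'.
have := sint_rd (rdM r r') (bdmM bh bh') (bdmD bgh bhg).
by rewrite (sintD (intg_bdm hsigma bgh) (intg_bdm hsigma bhg)) => /eqP; rewrite addr_eq0 => /eqP.
Qed.

End RotationalDerivatives.

(** * Zonal kernels and the Nash inequality *)

Section Kernels.
Variables (R : realType) (n : nat) (sigma : probability (borel R n) R).
Hypothesis hsigma : is_uniform sigma.
Implicit Types (f g h w : 'rV[R]_n -> R) (x y : 'rV[R]_n) (i j : 'I_n).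

Local Notation S := (sphere R n).
Local Notation I := (sint sigma).
Local Notation intg := (intg sigma).
Local Notation bI := (intg_bdm hsigma).

(* Finite rank makes the operators below symmetric without Fubini. *)
Definition finite_rank (k : 'rV[R]_n -> 'rV[R]_n -> R) :=
  exists (J : finType) (c : J -> R) (a : J -> 'rV[R]_n -> R),
    (forall s, bdm (a s)) /\ forall x y, k x y = \sum_s c s * a s x * a s y.

(** The lower bound [m], when positive, keeps smoothed densities away from 0; the upper bound [M]
    gives the passage from L^1 to the sup norm. *)
Definition markov_kernel (k : 'rV[R]_n -> 'rV[R]_n -> R) (m M : R) :=
  [/\ finite_rank k,
      (forall (O : 'M[R]_n) x y, O *m O^T = 1%:M -> k (x *m O) (y *m O) = k x y),
      (forall x y, S x -> S y -> m <= k x y <= M) &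
      (forall x, S x -> I (k x) = 1)].

Definition kop (k : 'rV[R]_n -> 'rV[R]_n -> R) f x : R := I (fun y => k x y * f y).

Section FiniteRank.
Variables (k : 'rV[R]_n -> 'rV[R]_n -> R).
Hypothesis hk : finite_rank k.

Lemma bdm_kernel x : bdm (k x).
Proof.
have [J [c [a [ba kE]]]] := hk.
have : bdm (fun y => \sum_s c s * a s x * a s y).
  by apply: bdm_sum => s _; exact: bdmZ.
by apply: eq_bdm => y _; rewrite kE.
Qed.

Lemma intg_kernel x f : intg f -> intg (fun y => k x y * f y).
Proof.
move=> hf; apply: eq_intg (intgM hf (bdm_kernel x)) => y _; exact: mulrC.
Qed.

(** Both integrals expand into the same finite sum of products of moments against the functions
    [a s]. *)
Lemma kopC f g : intg f -> bdm g -> bdm (kop k f) /\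
  I (fun x => kop k f x * g x) = I (fun x => f x * kop k g x).
Proof.
move=> hf bg; have [J [c [a [ba kE]]]] := hk.
have cE h : intg h -> forall x,
    kop k h x = \sum_s c s * I (fun y => h y * a s y) * a s x.
  move=> hh x; rewrite /kop.
  have hs s : intg (fun y => h y * a s y) by exact: intgM.
  rewrite -(eq_sint sigma (f := fun y => \sum_s (c s * a s x) * (h y * a s y))); last first.
    by move=> y _; rewrite kE mulr_suml; apply: eq_bigr => s _; ring.
  rewrite (sint_sum hsigma) => [|s _]; last exact: intgZ.
  by apply: eq_bigr => s _; rewrite (sintZ _ (hs s)); ring.
have bc h : intg h -> bdm (kop k h).
  move=> hh; have : bdm (fun x => \sum_s c s * I (fun y => h y * a s y) * a s x).
    by apply: bdm_sum => s _; exact: bdmZ.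
  by apply: eq_bdm => x _; rewrite cE.
split; first exact: bc.
transitivity (\sum_s c s * I (fun y => f y * a s y) * I (fun x => g x * a s x)).
  rewrite -(eq_sint sigma (f := fun x => \sum_s (c s * I (fun y => f y * a s y)) * (g x * a s x))).
    rewrite (sint_sum hsigma) => [|s _]; last by apply: intgZ; apply: bI; exact: bdmM.
    by apply: eq_bigr => s _; rewrite sintZ//; apply: bI; exact: bdmM.
  by move=> x _; rewrite (cE _ hf) mulr_suml; apply: eq_bigr => s _; ring.
have hg := bI bg.
rewrite -(eq_sint sigma (f := fun x => \sum_s (c s * I (fun y => g y * a s y)) * (f x * a s x))).
  rewrite (sint_sum hsigma) => [|s _]; last by apply: intgZ; exact: intgM.
  by apply: eq_bigr => s _; rewrite sintZ; [ring | exact: intgM].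
by move=> x _; rewrite (cE _ hg) mulr_sumr; apply: eq_bigr => s _; ring.
Qed.

End FiniteRank.

Section Markov.
Variables (k : 'rV[R]_n -> 'rV[R]_n -> R) (m M : R).
Hypothesis hk : markov_kernel k m M.
Hypothesis m0 : 0 <= m.

Local Notation K := (kop k).
Let fk : finite_rank k. Proof. by case: hk. Qed.
Let k0 x y : S x -> S y -> 0 <= k x y.
Proof.
by case: hk => _ _ + _ => /[apply]/[apply] /andP[+ _]; exact: le_trans.
Qed.
Let k1 x : S x -> I (k x) = 1. Proof. by case: hk => _ _ _; exact. Qed.

Lemma bdm_kop f : intg f -> bdm (K f).
Proof. by move=> hf; case: (kopC fk hf (bdm_cst 0)). Qed.

Lemma sint_kopC f g : intg f -> bdm g ->
  I (fun x => K f x * g x) = I (fun x => f x * K g x).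
Proof. by move=> hf bg; case: (kopC fk hf bg). Qed.

Lemma kop_cst a x : S x -> K (fun=> a) x = a.
Proof.
move=> Sx; rewrite /kop sintZr ?k1 ?mul1r//.
exact/bI/bdm_kernel.
Qed.

Lemma sint_kop f : intg f -> I (K f) = I f.
Proof.
move=> hf; transitivity (I (fun x => K f x * 1)).
  by apply: eq_sint => x _; rewrite mulr1.
rewrite (sint_kopC hf (bdm_cst 1)); apply: eq_sint => x Sx.
by rewrite kop_cst// mulr1.
Qed.

Lemma kop_le f g x : intg f -> intg g -> S x ->
  (forall y, S y -> f y <= g y) -> K f x <= K g x.
Proof.
move=> hf hg Sx fg; apply: le_sint; [exact: intg_kernel..|].
by move=> y Sy; rewrite ler_wpM2l ?fg ?k0.
Qed.

Lemma kop_ge0 f x : S x -> (forall y, S y -> 0 <= f y) -> 0 <= K f x.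
Proof. by move=> Sx f0; apply: sint_ge0 => y Sy; rewrite mulr_ge0 ?k0 ?f0. Qed.

Lemma kop_ge f x : intg f -> S x -> (forall y, S y -> 0 <= f y) -> m * I f <= K f x.
Proof.
move=> hf Sx f0; rewrite -sintZ//; apply: le_sint; [exact: intgZ|exact: intg_kernel|].
move=> y Sy; rewrite ler_wpM2r ?f0//; case: hk => _ _ + _ => /(_ _ _ Sx Sy).
by case/andP.
Qed.

Lemma norm_kop f x : intg f -> S x -> `|K f x| <= K (fun y => `|f y|) x.
Proof.
move=> hf Sx; apply: le_trans (norm_sint (intg_kernel fk x hf)) _.
apply: le_sint; [exact/intg_norm/intg_kernel|exact/intg_kernel/intg_norm|].
by move=> y Sy; rewrite normrM (ger0_norm (k0 _ _)).
Qed.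

Lemma norm_kop_le f x : intg f -> S x -> `|K f x| <= M * I (fun y => `|f y|).
Proof.
move=> hf Sx; apply: le_trans (norm_kop hf Sx) _.
have hf' := intg_norm hf.
rewrite -sintZ//; apply: le_sint; [exact: intg_kernel|exact: intgZ|].
move=> y Sy; rewrite ler_wpM2r//; case: hk => _ _ + _ => /(_ _ _ Sx Sy).
by case/andP.
Qed.

Lemma kopB f g x : intg f -> intg g -> K (fun y => f y - g y) x = K f x - K g x.
Proof.
move=> hf hg; rewrite /kop -sintB; try exact: intg_kernel.
by apply: eq_sint => y _; rewrite mulrBr.
Qed.

Lemma kopD f g x : intg f -> intg g -> K (fun y => f y + g y) x = K f x + K g x.
Proof.
move=> hf hg; rewrite /kop -sintD; try exact: intg_kernel.
by apply: eq_sint => y _; rewrite mulrDr.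
Qed.

Lemma kopZ a f x : intg f -> K (fun y => a * f y) x = a * K f x.
Proof.
move=> hf; rewrite /kop -sintZ; last exact: intg_kernel.
by apply: eq_sint => y _; rewrite mulrCA.
Qed.

(** Since K 1 = 1, expanding K ((f - f x)^2) x >= 0 bounds 2 f K f by f^2 + K (f^2), and K preserves
    integrals. Thus the quadratic form of K is below that of the identity. *)
Lemma sint_mul_kop_le f : bdm f -> I (fun x => f x * K f x) <= I (fun x => f x ^+ 2).
Proof.
move=> bf; have bf2 := bdmX 2 bf; have bKf := bdm_kop (bI bf).
have bKf2 := bdm_kop (bI bf2).
have h x : S x -> 2 * (f x * K f x) <= f x ^+ 2 + K (fun y => f y ^+ 2) x.
  move=> Sx; rewrite -subr_ge0.
  have -> : f x ^+ 2 + K (fun y => f y ^+ 2) x - 2 * (f x * K f x) =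
      K (fun y => (f y - f x) ^+ 2) x.
    transitivity (K (fun y => f y ^+ 2 - (2 * f x * f y - f x ^+ 2)) x); last first.
      by apply: eq_sint => y _; ring.
    have b1 : bdm (fun y => 2 * f x * f y) by exact: bdmZ.
    have b2 : bdm (fun y => 2 * f x * f y - f x ^+ 2) by apply: bdmB => //; exact: bdm_cst.
    rewrite kopB; [|exact: bI..]; rewrite kopB; [|exact: bI|exact/bI/bdm_cst].
    by rewrite kopZ ?kop_cst//; [ring|exact: bI].
  by apply: kop_ge0 => // y _; exact: sqr_ge0.
have : I (fun x => 2 * (f x * K f x)) <= I (fun x => f x ^+ 2 + K (fun y => f y ^+ 2) x).
  by apply: le_sint => //; apply: bI; [apply: bdmZ; exact: bdmM|exact: bdmD].
rewrite sintZ ?sintD ?sint_kop; try apply: bI => //; last exact: bdmM.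
by lra.
Qed.

(** Invariance of the kernel and of the measure moves the rotation from the point x to the
    integrated function, where [rd_sint] applies. *)
Lemma rd_kop i j f g : rd i j f g -> bdm f -> bdm g -> rd i j (K f) (K g).
Proof.
move=> r bf bg x Sx.
have := rd_sint hsigma r bf bg (bdm_kernel fk x).
rewrite (_ : I _ = K g x); last by apply: eq_sint => y _; exact: mulrC.
apply: hd_eq => a; rewrite /kop.
rewrite -[RHS](sint_rot hsigma (rotmx_orth i j a)); last first.
  by apply: bdmM => //; exact: bdm_kernel.
apply: eq_sint => y _; case: hk => _ kO _ _.
by rewrite (kO _ x y (rotmx_orth i j a)) mulrC.
Qed.

End Markov.
End Kernels.

Section Zonal.
Variables (R : realType) (n : nat) (sigma : probability (borel R n) R).
Hypotheses (hn : (2 <= n)%N) (hsigma : is_uniform sigma).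
Implicit Types (f g h w : 'rV[R]_n -> R) (x y : 'rV[R]_n) (i j : 'I_n).

Local Notation S := (sphere R n).
Local Notation I := (sint sigma).
Local Notation intg := (intg sigma).
Local Notation bI := (intg_bdm hsigma).

Lemma bdm_zonal (phi : R -> R) y : continuous phi -> bdm (fun x => phi (dot x y)).
Proof.
move=> cphi; apply: bdm_continuous => x _.
apply: (@continuous_comp _ _ _ (fun x => dot x y) phi); last exact: cphi.
apply: (@cvg_sumr _ _ (nbhs x)) => i _; apply: cvgM; last exact: cvg_cst.
exact: continuous_coord.
Qed.

Definition ddot i j y x : R := x 0 i * y 0 j - x 0 j * y 0 i.

(* D_ij D_ij (x . y) *)
Definition d2dot i j y x : R := dcoord i j i x * y 0 j - dcoord i j j x * y 0 i.

Lemma bdm_ddot i j y : bdm (ddot i j y).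
Proof. by apply: bdmB; apply: bdmM; try exact: bdm_coord; exact: bdm_cst. Qed.

Lemma rd_ddot i j y : rd i j (ddot i j y) (d2dot i j y).
Proof.
apply: eq_rd (rdB (rdM (rd_coord i j i) (rd_cst i j (y 0 j)))
                  (rdM (rd_coord i j j) (rd_cst i j (y 0 i)))) => // x _.
by rewrite /d2dot; ring.
Qed.

Lemma bdm_d2dot i j y : bdm (d2dot i j y).
Proof.
have bd k : bdm (dcoord i j k : 'rV[R]_n -> R).
  by rewrite /dcoord; apply: bdmB; case: (k == _) => /=;
    rewrite ?mulr1n ?mulr0n; try exact: bdm_coord; exact: bdm_cst.
by apply: bdmB; apply: bdmM; try exact: bd; exact: bdm_cst.
Qed.

(** Lagrange's identity for |grad (x . y)|^2. Sums run over ordered pairs (i, j), hence the factor 2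
    here and the factors 1/2 in the Laplacian and in the Dirichlet form. *)
Lemma sum_ddot2 x y : S x -> S y ->
  \sum_i \sum_j ddot i j y x ^+ 2 = 2 * (1 - dot x y ^+ 2).
Proof.
move=> /sphereP Sx /sphereP Sy.
have E i j : ddot i j y x ^+ 2 =
   (x 0 i * x 0 i) * (y 0 j * y 0 j) + (y 0 i * y 0 i) * (x 0 j * x 0 j)
   - 2 * ((x 0 i * y 0 i) * (x 0 j * y 0 j)) by rewrite /ddot; ring.
under eq_bigr do under eq_bigr do rewrite E.
under eq_bigr do rewrite sumrB big_split/= -!mulr_sumr.
rewrite sumrB big_split/= -!mulr_sumr -!mulr_suml.
move: Sx Sy; rewrite /dot => -> ->; ring.
Qed.

Lemma sum_d2dot x y : \sum_i \sum_j d2dot i j y x = - (2 * n.-1%:R) * dot x y.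
Proof.
have E i j : d2dot i j y x =
    (2 * (x 0 i * y 0 i)) *+ (i == j) - x 0 j * y 0 j - x 0 i * y 0 i.
  rewrite /d2dot /dcoord !eqxx (eq_sym j i); have [->|_] := eqVneq i j.
    by rewrite !mulr1n; ring.
  by rewrite !mulr1n !mulr0n; ring.
under eq_bigr do under eq_bigr do rewrite E.
under eq_bigr => i _.
  rewrite !sumrB (bigD1 i)//= eqxx mulr1n big1 ?addr0; last first.
    by move=> j /negPf; rewrite eq_sym => ->.
  rewrite sumr_const card_ord.
  over.
rewrite !sumrB sumr_const card_ord -mulr_sumr sumrMnl -/(dot x y).
have -> : n.-1%:R = n%:R - 1 :> R by rewrite -[in RHS](prednK (ltnW hn)) -natr1 addrK.
by rewrite -![dot x y *+ n]mulr_natl; ring.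
Qed.

(* The Laplace-Beltrami operator on the function phi (x . y) of x, with
   phi' = a, phi'' = b and u = x . y. *)
Definition lapz (a b u : R) : R := (1 - u ^+ 2) * b - n.-1%:R * u * a.

Lemma rd_zonal i j y (phi dphi : R -> R) :
  (forall u : R, is_derive u 1 phi (dphi u)) ->
  rd i j (fun x => phi (dot x y)) (fun x => dphi (dot x y) * ddot i j y x).
Proof. by move=> hp; exact: (@rd_comp _ _ i j phi dphi _ _ (fun x _ => hp (dot x y)) (rd_dot i j y)). Qed.

(** Green's formula. Half the sum of the squares of the fields is the Laplacian, which is [lapz] on
    zonal functions; two integrations by parts move it from [phi] to [f]. *)
Lemma sint_zonal_parts y (phi dphi ddphi : R -> R) f (f1 f2 : 'I_n -> 'I_n -> 'rV[R]_n -> R) :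
  S y ->
  (forall u : R, is_derive u 1 phi (dphi u)) -> (forall u : R, is_derive u 1 dphi (ddphi u)) ->
  continuous ddphi ->
  (forall i j, rd i j f (f1 i j)) -> (forall i j, rd i j (f1 i j) (f2 i j)) ->
  bdm f -> (forall i j, bdm (f1 i j)) -> (forall i j, bdm (f2 i j)) ->
  I (fun x => lapz (dphi (dot x y)) (ddphi (dot x y)) (dot x y) * f x) =
  2^-1 * \sum_i \sum_j I (fun x => phi (dot x y) * f2 i j x).
Proof.
move=> Sy hp hdp cdd rf rf1 bf bf1 bf2.
have cp : continuous phi by move=> u; exact: hd_continuous (hp u).
have cdp : continuous dphi by move=> u; exact: hd_continuous (hdp u).
have bp := bdm_zonal y cp; have bdp := bdm_zonal y cdp; have bddp := bdm_zonal y cdd.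
have bd := fun i j => bdm_ddot i j y; have bd2 := fun i j => bdm_d2dot i j y.
pose A i j x := (ddphi (dot x y) * ddot i j y x ^+ 2 + dphi (dot x y) * d2dot i j y x).
have bA i j : bdm (A i j) by apply: bdmD; apply: bdmM => //; exact: bdmX.
have rA i j : rd i j (fun x => dphi (dot x y) * ddot i j y x) (A i j).
  apply: eq_rd (rdM (rd_zonal i j y hdp) (rd_ddot i j y)) => // x _.
  by rewrite /A; ring.
have bdd i j : bdm (fun x => dphi (dot x y) * ddot i j y x) by exact: bdmM.
have -> : I (fun x => lapz (dphi (dot x y)) (ddphi (dot x y)) (dot x y) * f x) =
    I (fun x => 2^-1 * \sum_i \sum_j A i j x * f x).
  apply: eq_sint => x Sx.
  have -> : \sum_i \sum_j A i j x * f x = (\sum_i \sum_j A i j x) * f x.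
    by rewrite mulr_suml; apply: eq_bigr => i _; rewrite mulr_suml.
  rewrite /A /lapz; under eq_bigr do rewrite big_split/= -!mulr_sumr.
  rewrite big_split/= -!mulr_sumr sum_ddot2// sum_d2dot.
  by field.
have bAf i j : bdm (fun x => A i j x * f x) by exact: bdmM.
rewrite sintZ; last by apply: bI; apply: bdm_sum => i _; exact: bdm_sum.
rewrite (sint_sum hsigma) => [|i _]; last by apply: bI; exact: bdm_sum.
congr (_ * _); apply: eq_bigr => i _.
rewrite (sint_sum hsigma) => [|j _]; last exact: bI.
apply: eq_bigr => j _.
rewrite (sint_rd_parts hsigma (rA i j) (rf i j))//.
by rewrite (sint_rd_parts hsigma (rd_zonal i j y hp) (rf1 i j))// opprK.
Qed.

Lemma sint_lapz y (phi dphi ddphi : R -> R) : S y ->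
  (forall u : R, is_derive u 1 phi (dphi u)) -> (forall u : R, is_derive u 1 dphi (ddphi u)) ->
  continuous ddphi ->
  I (fun x => lapz (dphi (dot x y)) (ddphi (dot x y)) (dot x y)) = 0.
Proof.
move=> Sy hp hdp cdd.
have := @sint_zonal_parts y phi dphi ddphi (fun=> 1) (fun _ _ _ => 0) (fun _ _ _ => 0) Sy hp hdp cdd.
move=> /(_ (fun i j => rd_cst i j 1) (fun i j => rd_cst i j 0) (bdm_cst 1) (fun _ _ => bdm_cst 0)).
move=> /(_ (fun _ _ => bdm_cst 0)) h.
transitivity (I (fun x => lapz (dphi (dot x y)) (ddphi (dot x y)) (dot x y) * 1)).
  by apply: eq_sint => x _; rewrite mulr1.
rewrite h big1 ?mulr0// => i _; rewrite big1// => j _.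
by rewrite -[RHS](sint_cst hsigma 0); apply: eq_sint => x _; rewrite mulr0.
Qed.

End Zonal.

Section PowerKernel.
Variables (R : realType) (n : nat) (sigma : probability (borel R n) R).
Hypotheses (hn : (2 <= n)%N) (hsigma : is_uniform sigma).
Implicit Types (f g h w : 'rV[R]_n -> R) (x y : 'rV[R]_n) (i j : 'I_n) (N : nat).

Local Notation S := (sphere R n).
Local Notation I := (sint sigma).
Local Notation intg := (intg sigma).
Local Notation bI := (intg_bdm hsigma).

(** The integral of (1 + x . y)^N over x. Each factor is the ratio of two consecutive integrals,
    forced by the vanishing mean of the Laplacian of (1 + x . y)^(m+1). *)
Definition mass N : R :=
  \prod_(m < N) ((2 * m%:R + n.-1%:R) / (m%:R + n.-1%:R)).

Lemma predn_gt0 : 0 < n.-1%:R :> R.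
Proof. by rewrite ltr0n; case: (n) hn => [|[]]. Qed.

Lemma mass_gt0 N : 0 < mass N.
Proof.
apply: prodr_gt0 => m _; have := predn_gt0; have : 0 <= (m : nat)%:R :> R by [].
by move=> m0 n0; apply: divr_gt0; lra.
Qed.

Lemma massS N : mass N.+1 = mass N * ((2 * N%:R + n.-1%:R) / (N%:R + n.-1%:R)).
Proof. by rewrite /mass big_ord_recr. Qed.

Lemma hd_pow1 N (u : R) : is_derive u (1 : R) (fun v : R => (1 + v) ^+ N) (N%:R * (1 + u) ^+ N.-1).
Proof.
apply: is_derive_eq (hdX N (hdD (hd_cst 1 u) (hd_id u))) _.
by rewrite add0r mulr1.
Qed.

(** The Laplacian of (1 + u)^(N+1) involves only the powers N and N + 1. This gives both the
    recurrence for [mass] and the telescoping of consecutive kernels. *)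
Lemma lapz_pow N (u : R) :
  lapz n (N.+1%:R * (1 + u) ^+ N) (N.+1%:R * (N%:R * (1 + u) ^+ N.-1)) u =
  N.+1%:R * ((2 * N%:R + n.-1%:R) * (1 + u) ^+ N - (N%:R + n.-1%:R) * (1 + u) ^+ N.+1).
Proof.
rewrite /lapz; case: N => [|N] /=; first by rewrite expr0 expr1; ring.
by rewrite !exprS; ring.
Qed.

Lemma continuous_pow1 N (c : R) : continuous (fun v : R => c * (1 + v) ^+ N).
Proof. by move=> u; exact: hd_continuous (hdZ c (hd_pow1 N u)). Qed.

Lemma bdm_pow1 N y : bdm (fun x => (1 + dot x y) ^+ N).
Proof. by apply: bdmX; apply: bdmD; [exact: bdm_cst|exact: bdm_dot]. Qed.

Lemma sint_pow1 N y : S y -> I (fun x => (1 + dot x y) ^+ N) = mass N.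
Proof.
move=> Sy; elim: N => [|N ih]; first by rewrite /mass big_ord0 -[RHS](sint_cst hsigma).
have cc : continuous (fun v : R => N.+1%:R * (N%:R * (1 + v) ^+ N.-1)).
  by move=> u; under eq_fun do rewrite mulrA; exact: continuous_pow1.
have := sint_lapz hn hsigma Sy (hd_pow1 N.+1) (fun u : R => hdZ N.+1%:R (hd_pow1 N u)) cc.
have -> : I (fun x => lapz n (N.+1%:R * (1 + dot x y) ^+ N)
     (N.+1%:R * (N%:R * (1 + dot x y) ^+ N.-1)) (dot x y)) =
  I (fun x => N.+1%:R * ((2 * N%:R + n.-1%:R) * (1 + dot x y) ^+ N -
    (N%:R + n.-1%:R) * (1 + dot x y) ^+ N.+1)).
  by apply: eq_sint => x _; rewrite lapz_pow.
have b m := bdm_pow1 m y.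
rewrite sintZ; last by apply: bI; apply: bdmB; exact: bdmZ.
rewrite sintB; try (apply: bI; exact: bdmZ).
rewrite !sintZ; try exact: bI.
rewrite ih => /eqP; rewrite mulf_eq0 pnatr_eq0/= subr_eq0 => /eqP h.
rewrite massS; have := predn_gt0; have : 0 <= N%:R :> R by [].
move=> N0 n0; have n1 : N%:R + n.-1%:R != 0 :> R by lra.
by apply: (mulfI n1); rewrite -h; field.
Qed.

Definition kN N x y : R := (1 + dot x y) ^+ N / mass N.

Lemma finite_rank_kN N : finite_rank (kN N).
Proof.
(* 1 + x . y is the scalar product of (1, x) and (1, y). Its N-th power expands over the maps from
   'I_N to 'I_n.+1, each term having separated variables. *)
pose X (s : 'I_n.+1) x : R := if unlift ord0 s is Some i then x 0 i else 1.
have E x y : 1 + dot x y = \sum_s X s x * X s y.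
  rewrite big_ord_recl /X unlift_none mul1r; congr (_ + _).
  by apply: eq_bigr => i _; rewrite liftK.
exists {ffun 'I_N -> 'I_n.+1}, (fun=> (mass N)^-1), (fun (s : {ffun 'I_N -> 'I_n.+1}) x => \prod_i X (s i) x).
split=> [s|x y].
  apply: bdm_prod => i _; rewrite /X; case: (unlift _ _) => [k|]; [exact: bdm_coord|exact: bdm_cst].
rewrite /kN E -[N in _ ^+ N]card_ord -prodr_const bigA_distr_bigA/= mulrC mulr_sumr.
by apply: eq_bigr => s _; rewrite big_split/= mulrA.
Qed.

Lemma dot_ge x y : S x -> S y -> 0 <= 1 + dot x y.
Proof. by move=> Sx Sy; have := dot_sphere Sx Sy; rewrite ler_norml => /andP[]; lra. Qed.

Lemma dot_le x y : S x -> S y -> dot x y <= 1.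
Proof. by move=> Sx Sy; have := dot_sphere Sx Sy; rewrite ler_norml => /andP[]; lra. Qed.

Lemma markov_kN N : markov_kernel sigma (kN N) 0 (2 ^+ N / mass N).
Proof.
split; first exact: finite_rank_kN.
- by move=> O x y hO; rewrite /kN dot_mulmx.
- move=> x y Sx Sy; have u0 := dot_ge Sx Sy; have u1 := dot_le Sx Sy.
  rewrite /kN divr_ge0 ?exprn_ge0 ?(ltW (mass_gt0 _))//=.
  by rewrite ler_pM2r ?invr_gt0 ?mass_gt0// lerXn2r ?nnegrE//; lra.
- move=> x Sx; rewrite /kN sintZr.
    rewrite -(eq_sint sigma (f := fun y => (1 + dot y x) ^+ N)).
      by rewrite sint_pow1// mulfV// gt_eqF ?mass_gt0.
    by move=> y _; rewrite dotC.
  apply: bI; apply: eq_bdm (bdm_pow1 N x) => y _; by rewrite dotC.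
Qed.

(** Concentration on the diagonal. As (1 + u)^N (1 - u) = 2 (1 + u)^N - (1 + u)^(N+1), the mean of 1
    - x . y is 2 - mass (N+1) / mass N = (n - 1) / (N + n - 1). *)
Lemma sint_kN_dist N x : (0 < N)%N -> S x ->
  I (fun y => kN N x y * (1 - dot x y)) <= n.-1%:R / N%:R.
Proof.
move=> N0 Sx.
pose C (p : R * R) u : R := (p.1 * (1 + u) ^+ N - p.2 * (1 + u) ^+ N.+1).
have b m := bdm_pow1 m x.
have key : I (fun y => (1 + dot y x) ^+ N * (1 - dot y x)) = 2 * mass N - mass N.+1.
  rewrite -(eq_sint sigma (f := fun y => 2 * (1 + dot y x) ^+ N - (1 + dot y x) ^+ N.+1)).
    by rewrite sintB ?sintZ ?sint_pow1//; apply: bI => //; exact: bdmZ.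
  by move=> y _; rewrite exprS; ring.
have bk : bdm (fun y => (1 + dot y x) ^+ N * (1 - dot y x)).
  by apply: bdmM => //; apply: bdmB; [exact: bdm_cst|exact: bdm_dot].
have -> : I (fun y => kN N x y * (1 - dot x y)) = (2 * mass N - mass N.+1) / mass N.
  rewrite -key -sintZr; last exact: bI.
  by apply: eq_sint => y _; rewrite /kN dotC; ring.
rewrite massS; have n0 := predn_gt0; have N1 : 0 < N%:R :> R by rewrite ltr0n.
have m0 := mass_gt0 N.
have -> : (2 * mass N - mass N * ((2 * N%:R + n.-1%:R) / (N%:R + n.-1%:R))) / mass N =
  n.-1%:R / (N%:R + n.-1%:R) by field; rewrite !gt_eqF//; lra.
by rewrite ler_pM2l// lef_pV2 ?posrE//; lra.
Qed.

(* |x - y|^2 = 2 (1 - x . y) on the sphere. *)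
Lemma coord_dist x y i : S x -> S y -> (x 0 i - y 0 i) ^+ 2 <= 2 * (1 - dot x y).
Proof.
move=> Sx Sy; have /sphereP hx := Sx; have /sphereP hy := Sy.
have -> : 2 * (1 - dot x y) = \sum_k (x 0 k - y 0 k) ^+ 2.
  transitivity (\sum_k (x 0 k * x 0 k + y 0 k * y 0 k - 2 * (x 0 k * y 0 k))).
    by rewrite sumrB big_split/= -mulr_sumr -/(dot x x) -/(dot y y) -/(dot x y) hx hy; ring.
  by apply: eq_bigr => k _; ring.
by rewrite (bigD1 i)//= lerDl; apply: sumr_ge0 => k _; exact: sqr_ge0.
Qed.

Lemma continuous_dist f x e : S x -> {for x, continuous f} -> 0 < e ->
  exists2 d, 0 < d & forall y, S y -> 1 - dot x y < d -> `|f y - f x| < e.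
Proof.
move=> Sx /cvgrPdist_lt/(_ _) cf e0.
have /nbhs_ballP[d /= d0 hd] := cf e e0.
exists (d ^+ 2 / 2); first by rewrite divr_gt0// exprn_gt0.
move=> y Sy hy; rewrite distrC; apply: hd.
rewrite -ball_normE /= /Num.norm/= mx_normrE.
apply/bigmax_ltP; split=> // -[a i] _ /=; rewrite ord1 !mxE.
rewrite -(@ltr_pXn2r _ 2)// ?nnegrE ?(ltW d0)// real_normK ?num_real//.
by have := coord_dist i Sx Sy; nra.
Qed.

Lemma kop_kN_cvg f x : bdm f -> S x -> {for x, continuous f} ->
  kop sigma (kN N) f x @[N --> \oo] --> f x.
Proof.
move=> bf Sx cf; have [_ [M hM]] := bf.
have M0 : 0 <= M by apply: le_trans (hM x Sx).
apply/cvgrPdist_le => e e0.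
have e2 : 0 < e / 2 by rewrite divr_gt0.
have [d d0 hd] := continuous_dist Sx cf e2.
have n0 := predn_gt0.
near=> N.
have N0 : (0 < N)%N by near: N; exact: nbhs_infty_gt.
have mk := markov_kN N; have [fk _ k0 k1] := mk.
have bk := bdm_kernel fk x.
rewrite distrC -[X in _ - X](kop_cst hsigma mk (f x) Sx) -(kopB mk _ (bI bf) (bI (bdm_cst (f x)))).
have bfx : bdm (fun y => f y - f x) by apply: bdmB => //; exact: bdm_cst.
apply: le_trans (norm_kop mk (lexx 0) (bI bfx) Sx) _.
have bu : bdm (fun y => 1 - dot x y).
  by apply: bdmB; [exact: bdm_cst|apply: eq_bdm (bdm_dot x) => y _; exact: dotC].
(* Majorant of |f y - f x|: e / 2 covers the points with 1 - x . y < d, and the linear term exceeds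
   2 M at the others. Its mean under the kernel is e / 2 + O(1/N). *)
have bg : bdm (fun y => e / 2 + 2 * M / d * (1 - dot x y)).
  by apply: bdmD; [exact: bdm_cst|exact: bdmZ].
apply: le_trans (@kop_le _ _ _ _ _ _ mk (lexx 0) _ (fun y => e / 2 + 2 * M / d * (1 - dot x y)) _ _ _ Sx _) _; try exact: bI.
- exact/bI/bdm_norm.
- move=> y Sy; have u1 : 0 <= 1 - dot x y by have := dot_le Sx Sy; lra.
  have [ud|ud] := ltP (1 - dot x y) d.
    have := hd y Sy ud; have : 0 <= 2 * M / d * (1 - dot x y) by rewrite !mulr_ge0// invr_ge0 ltW.
    lra.
  have : `|f y - f x| <= 2 * M.
    by rewrite (le_trans (ler_normB _ _))// mulr_natl mulr2n lerD ?hM.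
  have : 2 * M <= 2 * M / d * (1 - dot x y).
    rewrite -mulrA ler_peMr ?mulr_ge0//.
    by rewrite mulrC ler_pdivlMr// mul1r.
  lra.
rewrite (kopD mk _ (bI (bdm_cst (e / 2))) (bI (bdmZ _ bu))).
rewrite (kop_cst hsigma mk)// (kopZ mk _ _ (bI bu)) /kop.
have := sint_kN_dist N0 Sx.
have : 2 * M / d * (n.-1%:R / N%:R) <= e / 2.
  rewrite mulrA ler_pdivrMr ?ltr0n// -ler_pdivrMl//.
  by near: N; exact: nbhs_infty_ger.
move=> h1 h2.
have : 2 * M / d * I (fun y => kN N x y * (1 - dot x y)) <= 2 * M / d * (n.-1%:R / N%:R).
  by apply: ler_wpM2l => //; rewrite !mulr_ge0// invr_ge0 ltW.
lra.
Unshelve. all: by end_near. Qed.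

End PowerKernel.

Section Nash.
Variables (R : realType) (n : nat) (sigma : probability (borel R n) R).
Hypotheses (hn : (2 <= n)%N) (hsigma : is_uniform sigma).
Implicit Types (f g h w : 'rV[R]_n -> R) (x y : 'rV[R]_n) (i j : 'I_n) (N : nat).

Local Notation S := (sphere R n).
Local Notation I := (sint sigma).
Local Notation intg := (intg sigma).
Local Notation bI := (intg_bdm hsigma).
Local Notation K N := (kop sigma (kN N)).

Definition dirichlet (f1 : 'I_n -> 'I_n -> 'rV[R]_n -> R) : R :=
  2^-1 * \sum_i \sum_j I (fun x => f1 i j x ^+ 2).

Lemma dirichlet_ge0 (f1 : 'I_n -> 'I_n -> 'rV[R]_n -> R) : 0 <= dirichlet f1.
Proof.
rewrite mulr_ge0// sumr_ge0// => i _; rewrite sumr_ge0// => j _.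
by apply: sint_ge0 => x _; exact: sqr_ge0.
Qed.

Section Fixed.
Variables (f : 'rV[R]_n -> R) (f1 f2 : 'I_n -> 'I_n -> 'rV[R]_n -> R).
Hypotheses (rf : forall i j, rd i j f (f1 i j)) (rf1 : forall i j, rd i j (f1 i j) (f2 i j))
  (bf : bdm f) (bf1 : forall i j, bdm (f1 i j)) (bf2 : forall i j, bdm (f2 i j)).

(* Delta k_m = m (m + n - 2) (k_(m-1) - k_m) *)
Lemma kop_kN_telescope m x : S x ->
  m.+1%:R * (m%:R + n.-1%:R) * (K m f x - K m.+1 f x) =
  2^-1 * \sum_i \sum_j K m.+1 (f2 i j) x.
Proof.
move=> Sx; have cc : continuous (fun v : R => m.+1%:R * (m%:R * (1 + v) ^+ m.-1)).
  by move=> u; under eq_fun do rewrite mulrA; exact: continuous_pow1.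
have h := sint_zonal_parts hn hsigma Sx (hd_pow1 m.+1)
  (fun u : R => hdZ m.+1%:R (hd_pow1 m u)) cc rf rf1 bf bf1 bf2.
have mm := mass_gt0 R hn m; have mm1 := mass_gt0 R hn m.+1.
have E k g : bdm g -> K k g x = I (fun y => (1 + dot y x) ^+ k * g y) / mass R n k.
  move=> bg; rewrite -sintZr; last by apply: bI; apply: bdmM => //; exact: bdm_pow1.
  by apply: eq_sint => y _; rewrite /kN dotC; ring.
have -> : 2^-1 * \sum_i \sum_j K m.+1 (f2 i j) x =
   2^-1 * (\sum_i \sum_j I (fun y => (1 + dot y x) ^+ m.+1 * f2 i j y)) / mass R n m.+1.
  rewrite -mulrA; congr (_ * _); rewrite mulr_suml; apply: eq_bigr => i _.
  by rewrite mulr_suml; apply: eq_bigr => j _; rewrite E.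
rewrite -h; set L := I _.
have -> : L = m.+1%:R * ((2 * m%:R + n.-1%:R) * I (fun y => (1 + dot y x) ^+ m * f y)
    - (m%:R + n.-1%:R) * I (fun y => (1 + dot y x) ^+ m.+1 * f y)).
  have b k : bdm (fun y => (1 + dot y x) ^+ k * f y) by apply: bdmM => //; exact: bdm_pow1.
  rewrite -(sintZ _ (bI (b m))) -(sintZ _ (bI (b m.+1))) -sintB; try (apply: bI; exact: bdmZ).
  rewrite -sintZ; last by apply: bI; apply: bdmB; exact: bdmZ.
  by apply: eq_sint => y _; rewrite lapz_pow; ring.
rewrite !E// massS//; have := predn_gt0 R hn; have : 0 <= m%:R :> R by [].
move=> m0 n0; field; rewrite !gt_eqF//; lra.
Qed.

(** Pairing the telescoping relation with f and integrating by parts gives the integrals of D_ij f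
    against K (D_ij f), which are at most those of (D_ij f)^2. *)
Lemma kop_kN_step m :
  m.+1%:R * (m%:R + n.-1%:R) *
    (I (fun x => f x * K m.+1 f x) - I (fun x => f x * K m f x)) <= dirichlet f1.
Proof.
have mk k := markov_kN hn hsigma k.
have bK k g : bdm g -> bdm (K k g) by move=> bg; exact: (bdm_kop hsigma (mk k) (bI bg)).
have b k g : bdm g -> bdm (fun x => f x * K k g x) by move=> bg; apply: bdmM => //; exact: bK.
have key : m.+1%:R * (m%:R + n.-1%:R) *
    (I (fun x => f x * K m f x) - I (fun x => f x * K m.+1 f x)) =
    2^-1 * \sum_i \sum_j - I (fun x => f1 i j x * K m.+1 (f1 i j) x).
  rewrite -sintB; try (apply: bI; exact: b).
  rewrite -sintZ; last by apply: bI; apply: bdmB; exact: b.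
  rewrite (eq_sint sigma (g := fun x => 2^-1 * \sum_i \sum_j f x * K m.+1 (f2 i j) x)); last first.
    move=> x Sx; transitivity (f x * (m.+1%:R * (m%:R + n.-1%:R) * (K m f x - K m.+1 f x))).
      by ring.
    rewrite kop_kN_telescope// mulrCA; congr (_ * _); rewrite mulr_sumr.
    by apply: eq_bigr => i _; rewrite mulr_sumr.
  rewrite sintZ; last by apply: bI; apply: bdm_sum => i _; apply: bdm_sum => j _; exact: b.
  rewrite (sint_sum hsigma) => [|i _]; last by apply: bI; apply: bdm_sum => j _; exact: b.
  congr (_ * _); apply: eq_bigr => i _.
  rewrite (sint_sum hsigma) => [|j _]; last by apply: bI; exact: b.
  apply: eq_bigr => j _.
  rewrite -(sint_kopC hsigma (mk m.+1) (bI bf) (bf2 i j)).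
  have := sint_rd_parts hsigma (rf1 i j) (rd_kop hsigma (mk m.+1) (rf i j) bf (bf1 i j)).
  move=> /(_ (bf1 i j) (bf2 i j) (bK _ _ bf) (bK _ _ (bf1 i j))) h.
  transitivity (I (fun x => f2 i j x * K m.+1 f x)).
    by apply: eq_sint => x _; exact: mulrC.
  exact: h.
rewrite -opprB mulrN key /dirichlet -mulrN ler_wpM2l// -sumrN ler_sum// => i _.
rewrite -sumrN ler_sum// => j _; rewrite opprK.
exact: (sint_mul_kop_le hsigma (mk m.+1)).
Qed.

(** The increment at k is at most E / (k (k + 1)) = E / k - E / (k + 1), with E the Dirichlet form,
    so adding E / k gives a nonincreasing sequence. *)
Lemma kop_kN_mono N m : (0 < N)%N -> 
  I (fun x => f x * K (N + m) f x) + dirichlet f1 / (N + m)%:R <=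
  I (fun x => f x * K N f x) + dirichlet f1 / N%:R.
Proof.
move=> N0; set E := dirichlet f1; elim: m => [|m ih]; first by rewrite addn0.
apply: le_trans ih; rewrite addnS.
have := kop_kN_step (N + m); rewrite -/E.
set A := I _; set B := I _ => h.
have E0 : 0 <= E by exact: dirichlet_ge0.
have k0 : 0 < (N + m)%:R :> R by rewrite ltr0n addn_gt0 N0.
have n1 : 1 <= n.-1%:R :> R by rewrite ler1n; case: (n) hn => [|[]].
rewrite -natr1 in h *; set k : R := (N + m)%:R in k0 h *.
have kp : 0 < (k + 1) * (k + n.-1%:R) by apply: mulr_gt0; lra.
have h1 : A - B <= E / ((k + 1) * k).
  rewrite ler_pdivlMr; last by apply: mulr_gt0; lra.
  have [ABn|ABp] := ltP (A - B) 0.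
    apply: le_trans E0; rewrite nmulr_rle0//; nra.
  by apply: le_trans h; rewrite mulrC ler_wpM2r// ler_wpM2l//; lra.
have -> : E / k = E / (k + 1) + E / ((k + 1) * k) by field; rewrite !gt_eqF//; lra.
lra.
Qed.

(* The sum over m >= N of the differences of the kernels k_m is controlled by the
   Dirichlet form, and k_N is bounded by 2^N / mass N. *)
Lemma nash N : (0 < N)%N -> (forall x, S x -> {for x, continuous f}) ->
  I (fun x => f x ^+ 2) <= 2 ^+ N / mass R n N * I (fun x => `|f x|) ^+ 2 +
    dirichlet f1 / N%:R.
Proof.
move=> N0 cf; set E := dirichlet f1; have mk k := markov_kN hn hsigma k.
have [_ [M hM]] := bf.
have E0 : 0 <= E by exact: dirichlet_ge0.
have bK k : bdm (K k f) by exact: (bdm_kop hsigma (mk k) (bI bf)).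
have h1 : I (fun x => f x * K N f x) <= 2 ^+ N / mass R n N * I (fun x => `|f x|) ^+ 2.
  have bnf := bdm_norm bf.
  apply: (@le_trans _ _ (I (fun x => (2 ^+ N / mass R n N * I (fun x => `|f x|)) * `|f x|))).
    apply: le_sint; [by apply: bI; exact: bdmM|by apply: bI; exact: bdmZ|].
    move=> x Sx; rewrite (le_trans (ler_norm _))// normrM mulrC ler_wpM2r//.
    exact: (norm_kop_le (mk N) (lexx 0) (bI bf) Sx).
  by rewrite sintZ ?expr2 ?mulrA//; exact: bI.
apply: le_trans (lerD h1 (lexx _)).
have cvg : I (fun x => f x * K k f x) @[k --> \oo] --> I (fun x => f x ^+ 2).
  apply: (cvg_sint hsigma (M := M * M)).
  - by move=> k; exact: bdmM.
  - move=> k x Sx; rewrite normrM ler_pM ?hM//.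
    apply: le_trans (norm_kop (mk k) (lexx 0) (bI bf) Sx) _.
    rewrite -[leRHS](kop_cst hsigma (mk k) M Sx).
    apply: (kop_le (mk k) (lexx 0)) => //; [by apply: bI; exact: bdm_norm|].
    by apply: bI; exact: bdm_cst.
  - by move=> x Sx; rewrite expr2; apply: cvgM; [exact: cvg_cst|exact: (kop_kN_cvg hn hsigma bf Sx (cf _ Sx))].
apply: (cvgr_to_le cvg); near=> k.
have Nk : (N <= k)%N by near: k; exact: nbhs_infty_ge.
have := kop_kN_mono (k - N) N0; rewrite -/E subnKC//.
have : 0 <= E / k%:R by rewrite divr_ge0.
lra.
Unshelve. all: by end_near. Qed.

End Fixed.

(** Mixing with the constant kernel bounds the smoothed density below by e times its mass, away from
    the singularity at 0 of the derivatives of s ln s. *)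
Definition kmix (e : R) N x y : R := (1 - e) * kN N x y + e.

Lemma markov_kmix (e : R) N : 0 <= e <= 1 ->
  markov_kernel sigma (kmix e N) e ((1 - e) * (2 ^+ N / mass R n N) + e).
Proof.
move=> /andP[e0 e1]; have [[J [c [a [ba kE]]]] kO k0 k1] := markov_kN hn hsigma N.
have fk := finite_rank_kN R n N.
split.
- exists (J + unit)%type, (fun s => if s is inl s then (1 - e) * c s else e),
    (fun s x => if s is inl s then a s x else 1); split.
    by move=> [s|_]; [exact: ba|exact: bdm_cst].
  move=> x y; rewrite big_sumType/= big_const card_unit/= addr0 /kmix kE !mulr1.
  by congr (_ + _); rewrite mulr_sumr; apply: eq_bigr => s _; rewrite !mulrA.
- by move=> O x y hO; rewrite /kmix kO.
- move=> x y Sx Sy; rewrite /kmix lerDr lerD2r; have /andP[h1 h2] := k0 _ _ Sx Sy.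
  by rewrite mulr_ge0 ?subr_ge0//= ler_wpM2l// subr_ge0.
- move=> x Sx; have bk := bdm_kernel fk x.
  rewrite /kmix sintD ?sintZ ?k1 ?sint_cst//; try exact: bI; first by ring.
    by apply: bI; exact: bdmZ.
  by apply: bI; exact: bdm_cst.
Qed.

Lemma kop_kmix (e : R) N f x : bdm f -> kop sigma (kmix e N) f x = (1 - e) * K N f x + e * I f.
Proof.
move=> bf; have bk := bdm_kernel (finite_rank_kN R n N) x.
rewrite -sintZ; last exact: bI.
rewrite /kop -sintZ; last by apply: bI; exact: bdmM.
rewrite -sintD; [|by apply: bI; apply: bdmZ; exact: bdmM|by apply: bI; exact: bdmZ].
by apply: eq_sint => y _; rewrite /kmix; ring.
Qed.

End Nash.

(** * Weak form of the collision operator *)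

Section Partials.
Variables (R : realType) (n : nat).
Implicit Types (f F : 'rV[R]_n -> R) (x y v : 'rV[R]_n) (i j k : 'I_n).

Local Notation S := (sphere R n).

Lemma diff_partial F x v : differentiable F x ->
  'd F x v = \sum_k v 0 k * partial k F x.
Proof.
move=> dF; rewrite [in LHS](row_sum_delta v) linear_sum; apply: eq_bigr => k _.
by rewrite linearZ/= /partial deriveE.
Qed.

Lemma hd_curve F (c : R -> 'rV[R]_n) (t : R) v : differentiable F (c t) ->
  (forall k, is_derive t 1 (fun a : R => c a 0 k) (v 0 k)) ->
  is_derive t 1 (fun a : R => F (c a)) (\sum_k v 0 k * partial k F (c t)).
Proof.
move=> dF hc.
have dc : derivable c t 1.
  by apply/derivable_mxP => i k; rewrite ord1; case: (hc k).
have dcd : differentiable c t by exact/derivable1_diffP.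
have dFc : differentiable (F \o c) t by exact: differentiable_comp.
apply: DeriveDef; first exact/derivable1_diffP.
have E : 'd c t 1 = v.
  rewrite -deriveE// derive_mx//; apply/rowP => k; rewrite mxE.
  exact: (@derive_val _ _ _ _ _ _ _ (hc k)).
by rewrite -[X in 'D_1 X t]/(F \o c) deriveE// diff_comp//= E diff_partial.
Qed.

Definition D1 F i j x : R := x 0 i * partial j F x - x 0 j * partial i F x.

Lemma sum_dcoord i j x (c : 'I_n -> R) :
  \sum_k dcoord i j k x * c k = x 0 i * c j - x 0 j * c i.
Proof.
rewrite /dcoord; under eq_bigr do rewrite mulrBl !mulrnAl.
rewrite sumrB; congr (_ - _).
- by rewrite (bigD1 j)//= eqxx big1 ?addr0// => k /negPf ->.
- by rewrite (bigD1 i)//= eqxx big1 ?addr0// => k /negPf ->.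
Qed.

Lemma rd_differentiable F i j : (forall x, S x -> differentiable F x) ->
  rd i j F (D1 F i j).
Proof.
move=> dF x Sx; rewrite /D1 -(sum_dcoord i j x (fun k => partial k F x)).
have := @hd_curve F (fun a : R => x *m rotmx i j a) 0 (\row_k dcoord i j k x).
rewrite rotmx0 mulmx1 => /(_ (dF _ Sx)).
under [X in is_derive _ _ _ X]eq_bigr do rewrite mxE.
by apply=> k; rewrite mxE; exact: rd_coord.
Qed.

Lemma proj_sphere x : S x -> Defs.proj x = x.
Proof. by rewrite /sphere /Defs.proj /= => ->; rewrite invr1 scale1r. Qed.

Lemma ext_sphere f x : S x -> ext f x = f x.
Proof. by move=> /proj_sphere; rewrite /ext => ->. Qed.

Lemma enorm_gt0 x : x != 0 -> 0 < enorm x.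
Proof.
move=> x0; rewrite lt_neqAle enorm_ge0 andbT eq_sym sqrtr_eq0 -ltNge.
have [i xi] : exists i, x 0 i != 0.
  apply/existsP; apply: contraNT x0 => /existsPn h; apply/eqP/rowP => i.
  by rewrite mxE; have := h i; rewrite negbK => /eqP.
rewrite /dot (bigD1 i)//= ltr_pwDl//; first by rewrite -expr2 exprn_even_gt0.
by apply: sumr_ge0 => k _; rewrite -expr2 sqr_ge0.
Qed.

Lemma enormZ (a : R) x : 0 <= a -> enorm (a *: x) = a * enorm x.
Proof.
by move=> a0; rewrite /enorm dotZl dotZr mulrA sqrtrM ?mulr_ge0// -expr2 sqrtr_sqr ger0_norm.
Qed.

Lemma extZ f (a : R) x : 0 < a -> ext f (a *: x) = ext f x.
Proof.
move=> a0; rewrite /ext /Defs.proj enormZ ?ltW// invfM scalerA mulrAC mulVf ?gt_eqF//.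
by rewrite mul1r.
Qed.

Lemma sphere_proj x : x != 0 -> S (Defs.proj x).
Proof.
move=> x0; rewrite /sphere /= /Defs.proj enormZ ?invr_ge0 ?enorm_ge0//.
by rewrite mulVf// gt_eqF// enorm_gt0.
Qed.

(** The extension is constant along rays: its derivative in the radial direction is computed
    twice. *)
Lemma euler_ext f x : differentiable (ext f) x ->
  \sum_k x 0 k * partial k (ext f) x = 0.
Proof.
move=> dF; have := @hd_curve (ext f) (fun a : R => (1 + a) *: x) 0 x.
rewrite addr0 scale1r => /(_ dF) h.
have h1 : is_derive (0 : R) 1 (fun a : R => ext f ((1 + a) *: x)) (\sum_k x 0 k * partial k (ext f) x).
  apply: h => k.
  apply: (@hd_eq _ (fun a : R => (1 + a) * x 0 k)); first by move=> a; rewrite mxE.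
  by apply: is_derive_eq (hdM (hdD (hd_cst 1 0) (hd_id 0)) (hd_cst (x 0 k) 0)) _; ring.
have h2 : is_derive (0 : R) 1 (fun a : R => ext f ((1 + a) *: x)) 0.
  apply: hd_near (hd_cst (ext f x) 0); near=> a.
  rewrite extZ//; have : `|a| < 1.
    by near: a; exact: (@nbhs0_lt _ R).
  by rewrite ltr_norml => /andP[]; lra.
exact: hd_unique h1 h2.
Unshelve. all: by end_near. Qed.

Lemma partialE F x i (d : R) :
  is_derive (0 : R) 1 (fun a : R => F (x + a *: delta_mx 0 i)) d -> partial i F x = d.
Proof.
move=> /hd_cvgP h; rewrite /partial /derive; apply: cvg_lim => //.
have -> : (fun a : R => a^-1 *: ((F \o shift x) (a *: delta_mx 0 i) - F x)) =
    (fun a : R => a^-1 * (F (x + (0 + a) *: delta_mx 0 i) - F (x + 0 *: delta_mx 0 i))).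
  by apply/funext => a /=; rewrite scale0r addr0 add0r (addrC x).
exact: h.
Qed.

Lemma hd_partial F x i : differentiable F x ->
  is_derive (0 : R) 1 (fun a : R => F (x + a *: delta_mx 0 i)) (partial i F x).
Proof.
move=> dF; have := @hd_curve F (fun a : R => x + a *: delta_mx 0 i) 0 (delta_mx 0 i).
rewrite scale0r addr0 => /(_ dF) h.
have -> : partial i F x = \sum_k delta_mx (0 : 'I_1) i 0 k * partial k F x.
  rewrite (bigD1 i)//= mxE !eqxx mul1r big1 ?addr0// => k ki.
  by rewrite mxE (negPf ki) andbF mul0r.
apply: h => k; apply: (@hd_eq _ (fun a : R => x 0 k + a * delta_mx (0 : 'I_1) i 0 k)).
  by move=> a; rewrite !mxE.
by apply: is_derive_eq (hdD (hd_cst _ 0) (hdM (hd_id 0) (hd_cst _ 0))) _; ring.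
Qed.

Lemma hd_proj x i k : S x ->
  is_derive (0 : R) 1 (fun a : R => Defs.proj (x + a *: delta_mx 0 i) 0 k)
    ((k == i)%:R - x 0 i * x 0 k).
Proof.
move=> Sx; have /sphereP xx := Sx.
have dE (a : R) : dot (x + a *: delta_mx 0 i) (x + a *: delta_mx 0 i) =
    1 + a * (2 * x 0 i) + a * a.
  have e1 y : dot y (delta_mx 0 i) = y 0 i.
    rewrite /dot (bigD1 i)//= mxE !eqxx mulr1 big1 ?addr0// => l li.
    by rewrite mxE (negPf li) andbF mulr0.
  rewrite !(dotDl, dotDr, dotZl, dotZr) (dotC (delta_mx 0 i) x) !e1 xx mxE !eqxx.
  by rewrite mulr1n; ring.
have h0 : is_derive (0 : R) 1 (fun a : R => 1 + a * (2 * x 0 i) + a * a) (2 * x 0 i).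
  apply: is_derive_eq (hdD (hdD (hd_cst 1 0) (hdM (hd_id 0) (hd_cst (2 * x 0 i) 0))) (hdM (hd_id 0) (hd_id 0))) _.
  by ring.
have h1 : is_derive (0 : R) 1 (fun a : R => Num.sqrt (1 + a * (2 * x 0 i) + a * a)) (x 0 i).
  have := @hd_comp _ (@Num.sqrt R) _ 0 (2 * Num.sqrt 1)^-1 _ _ h0.
  rewrite !mul0r !addr0 => /(_ (is_derive1_sqrt ltr01)) h.
  apply: is_derive_eq h _.
  by rewrite sqrtr1; field.
have h2 : is_derive (0 : R) 1 (fun a : R => (Num.sqrt (1 + a * (2 * x 0 i) + a * a))^-1) (- x 0 i).
  have nz : Num.sqrt (1 + 0 * (2 * x 0 i) + 0 * 0) != 0.
    by rewrite !mul0r !addr0 sqrtr1 oner_neq0.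
  apply: is_derive_eq (@hdV R (fun a : R => Num.sqrt (1 + a * (2 * x 0 i) + a * a)) 0 _ nz h1) _.
  by rewrite !mul0r !addr0 sqrtr1 expr1n divr1.
apply: (@hd_eq _ (fun a : R => (Num.sqrt (1 + a * (2 * x 0 i) + a * a))^-1 * (x 0 k + a * (k == i)%:R))).
  by move=> a; rewrite /Defs.proj /enorm dE !mxE eqxx.
apply: is_derive_eq (hdM h2 (hdD (hd_cst (x 0 k) 0) (hdM (hd_id 0) (hd_cst (k == i)%:R 0)))) _.
by rewrite !mul0r !addr0 sqrtr1 invr1; ring.
Qed.

End Partials.

Section Smooth.
Variables (R : realType) (n : nat) (sigma : probability (borel R n) R).
Hypotheses (hn : (2 <= n)%N) (hsigma : is_uniform sigma).
Implicit Types (x y v : 'rV[R]_n) (i j k : 'I_n).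

Local Notation S := (sphere R n).
Local Notation I := (sint sigma).
Local Notation intg := (intg sigma).
Local Notation bI := (intg_bdm hsigma).

(* v . grad w, in terms of the rotational derivatives w1 i j = D_ij w *)
Definition Tgrad v (w1 : 'I_n -> 'I_n -> 'rV[R]_n -> R) x : R :=
  \sum_i \sum_j v 0 i * x 0 j * w1 j i x.

Lemma bdm_Tgrad v w1 : (forall i j, bdm (w1 i j)) -> bdm (Tgrad v w1).
Proof.
move=> b; apply: bdm_sum => i _; apply: bdm_sum => j _; apply: bdmM => //.
by apply: bdmM; [exact: bdm_cst|exact: bdm_coord].
Qed.

(* the adjoint of the drift term: div (f v^T) tested against w *)
Lemma sint_Tgrad_parts v f f1 (w : 'rV[R]_n -> R) w1 :
  (forall i j, rd i j f (f1 i j)) -> (forall i j, rd i j w (w1 i j)) ->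
  bdm f -> (forall i j, bdm (f1 i j)) -> bdm w -> (forall i j, bdm (w1 i j)) ->
  I (fun x => w x * (Tgrad v f1 x - n.-1%:R * dot x v * f x)) =
  - I (fun x => f x * Tgrad v w1 x).
Proof.
move=> rf rw bf bf1 bw bw1.
have bc k : bdm (fun x : 'rV[R]_n => x 0 k) by exact: bdm_coord.
have bd i j k : bdm (dcoord i j k : 'rV[R]_n -> R).
  by rewrite /dcoord; apply: bdmB; case: (k == _) => /=;
    rewrite ?mulr1n ?mulr0n; try exact: bdm_coord; exact: bdm_cst.
have h i j : I (fun x => w x * (v 0 i * x 0 j) * f1 j i x) =
    - I (fun x => f x * (v 0 i * x 0 j * w1 j i x + v 0 i * w x * dcoord j i j x)).
  have r : rd j i (fun x => v 0 i * (w x * x 0 j))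
      (fun x => v 0 i * (w1 j i x * x 0 j + w x * dcoord j i j x)).
    exact: rdZ (rdM (rw j i) (rd_coord j i j)).
  have := sint_rd_parts hsigma (rf j i) r bf (bf1 j i) (bdmZ _ (bdmM bw (bc j)))
    (bdmZ _ (bdmD (bdmM (bw1 j i) (bc j)) (bdmM bw (bd j i j)))).
  move=> h; transitivity (I (fun x => f1 j i x * (v 0 i * (w x * x 0 j)))).
    by apply: eq_sint => x _; ring.
  by rewrite h; congr (- _); apply: eq_sint => x _; ring.
have bT := bdm_Tgrad v bf1; have bTw := bdm_Tgrad v bw1.
have bdv : bdm (fun x => dot x v) by exact: bdm_dot.
have bL : bdm (fun x => w x * Tgrad v f1 x) by exact: bdmM.
have bM : bdm (fun x => w x * (n.-1%:R * dot x v * f x)).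
  by apply: bdmM => //; apply: bdmM => //; exact: bdmZ.
rewrite (eq_sint sigma (g := fun x => w x * Tgrad v f1 x - w x * (n.-1%:R * dot x v * f x))); last first.
  by move=> x _; rewrite mulrBr.
rewrite sintB; try exact: bI.
have b1 i j : bdm (fun x => w x * (v 0 i * x 0 j) * f1 j i x).
  by apply: bdmM => //; apply: bdmM => //; exact: bdmZ.
have b2 i j : bdm (fun x => f x * (v 0 i * x 0 j * w1 j i x + v 0 i * w x * dcoord j i j x)).
  by apply: bdmM => //; apply: bdmD; apply: bdmM => //; exact: bdmZ.
have -> : I (fun x => w x * Tgrad v f1 x) =
    I (fun x => \sum_i \sum_j w x * (v 0 i * x 0 j) * f1 j i x).
  apply: eq_sint => x _; rewrite /Tgrad mulr_sumr; apply: eq_bigr => i _.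
  by rewrite mulr_sumr; apply: eq_bigr => j _; rewrite mulrA.
rewrite (sint_sum hsigma) => [|i _]; last by apply: bI; exact: bdm_sum.
under eq_bigr => i _.
  rewrite (sint_sum hsigma) => [|j _]; last by apply: bI.
  under eq_bigr do rewrite h.
  rewrite sumrN -(sint_sum hsigma) => [|j _]; last by apply: bI.
  over.
rewrite sumrN -(sint_sum hsigma) => [|i _]; last by apply: bI; exact: bdm_sum.
rewrite -opprD; congr (- _); rewrite -sintD; try apply: bI => //; last first.
  by apply: bdm_sum => i _; exact: bdm_sum.
apply: eq_sint => x _.
have -> : \sum_i \sum_j f x * (v 0 i * x 0 j * w1 j i x + v 0 i * w x * dcoord j i j x) =
    f x * (Tgrad v w1 x + w x * \sum_i v 0 i * \sum_j dcoord j i j x).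
  rewrite /Tgrad mulrDr !mulr_sumr -big_split/=; apply: eq_bigr => i _.
  rewrite !mulr_sumr -big_split/=; apply: eq_bigr => j _; ring.
have -> : \sum_i v 0 i * \sum_j dcoord j i j x = - (n.-1%:R * dot x v).
  have E i : \sum_j dcoord j i j x = - (n.-1%:R * x 0 i).
    rewrite /dcoord; under eq_bigr do rewrite eqxx mulr1n.
    rewrite sumrB sumr_const card_ord (bigD1 i)//= eqxx big1 ?addr0; last first.
      by move=> k /negPf ->.
    have -> : n.-1%:R = n%:R - 1 :> R by rewrite -[in RHS](prednK (ltnW hn)) -natr1 addrK.
    by rewrite mulr1n -mulr_natl; ring.
  rewrite /dot mulr_sumr -sumrN; apply: eq_bigr => i _; rewrite E; ring.
ring.
Qed.

Lemma sint_lap_parts (f : 'rV[R]_n -> R) f1 f2 (w : 'rV[R]_n -> R) w1 :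
  (forall i j, rd i j (f1 i j) (f2 i j)) -> (forall i j, rd i j w (w1 i j)) ->
  bdm f -> (forall i j, bdm (f1 i j)) -> (forall i j, bdm (f2 i j)) ->
  bdm w -> (forall i j, bdm (w1 i j)) ->
  I (fun x => w x * (2^-1 * \sum_i \sum_j f2 i j x)) =
  - (2^-1 * \sum_i \sum_j I (fun x => w1 i j x * f1 i j x)).
Proof.
move=> rf1 rw bf bf1 bf2 bw bw1.
transitivity (I (fun x => 2^-1 * \sum_i \sum_j f2 i j x * w x)).
  apply: eq_sint => x _; rewrite mulrCA; congr (_ * _).
  rewrite mulr_sumr; apply: eq_bigr => i _; rewrite mulr_sumr.
  by apply: eq_bigr => j _; exact: mulrC.
have b i j : bdm (fun x => f2 i j x * w x) by exact: bdmM.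
rewrite sintZ; last by apply: bI; apply: bdm_sum => i _; exact: bdm_sum.
rewrite -mulrN -sumrN; congr (_ * _).
rewrite (sint_sum hsigma) => [|i _]; last by apply: bI; exact: bdm_sum.
apply: eq_bigr => i _; rewrite -sumrN (sint_sum hsigma) => [|j _]; last exact: bI.
apply: eq_bigr => j _; rewrite (sint_rd_parts hsigma (rf1 i j) (rw i j))//.
by congr (- _); apply: eq_sint => x _; exact: mulrC.
Qed.

(** Common to two situations, with c = x, p a gradient and h a Hessian: the 0-homogeneous extension
    of a smooth function, where E = H = 0, and a homogeneous polynomial P of degree l, where E = l P
    and H = l (l - 1) P. *)
Lemma lap_algebra (c p : 'I_n -> R) (h : 'I_n -> 'I_n -> R) (E H : R) :
  \sum_k c k * p k = E -> \sum_i \sum_j c i * c j * h i j = H ->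
  \sum_k c k * c k = 1 ->
  \sum_i \sum_j ((c i * p j) *+ (i == j) + (c j * p i) *+ (i == j)
    - c j * p j - c i * p i + c i * c i * h j j + c j * c j * h i i
    - c i * c j * h i j - c j * c i * h j i) =
  2 * (\sum_i h i i - H - n.-1%:R * E).
Proof.
move=> eu sh xx.
have sl : \sum_i \sum_j c i * c i * h j j = \sum_i h i i.
  rewrite -[RHS]mul1r -xx mulr_suml; apply: eq_bigr => i _.
  by rewrite mulr_sumr.
rewrite (eq_bigr (fun i => c i * p i + c i * p i - \sum_k c k * p k - \sum_(j < n) c i * p i
  + \sum_j c i * c i * h j j + \sum_j c j * c j * h i i
  - \sum_j c i * c j * h i j - \sum_j c j * c i * h j i)); last first.
  move=> i _; rewrite !big_split/= !sumrN.
  rewrite (bigD1 i)//= [X in _ + X + _ - _ - _ + _ + _ - _ - _ = _]big1 => [|j /negPf]; last first.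
    by rewrite eq_sym => ->.
  rewrite [X in _ + _ + X - _ - _ + _ + _ - _ - _ = _](bigD1 i)//=.
  rewrite [X in _ + _ + (_ + X) - _ - _ + _ + _ - _ - _ = _]big1 => [|j /negPf]; last first.
    by rewrite eq_sym => ->.
  by rewrite eqxx !mulr1n !addr0.
rewrite !big_split/= !sumrN eu sl.
have -> : \sum_i \sum_j c j * c j * h i i = \sum_i h i i by rewrite exchange_big.
have -> : \sum_i \sum_j c j * c i * h j i = H by rewrite exchange_big.
have -> : \sum_(i < n) \sum_(j < n) c i * p i = n%:R * E.
  by rewrite exchange_big/= eu sumr_const card_ord mulr_natl.
rewrite sumr_const card_ord -[E *+ n]mulr_natl sh.
have -> : n.-1%:R = n%:R - 1 :> R by rewrite -[in RHS](prednK (ltnW hn)) -natr1 addrK.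
ring.
Qed.

Section Fixed.
Variable f : 'rV[R]_n -> R.
Hypothesis sf : smooth_sphere f.
Local Notation F := (ext f).

Let dF x : x != 0 -> differentiable F x. Proof. exact: (sf [::]). Qed.
Let dF1 k x : x != 0 -> differentiable (partial k F) x. Proof. exact: (sf [:: k]). Qed.
Let dF2 k l x : x != 0 -> differentiable (partial l (partial k F)) x.
Proof. exact: (sf [:: l; k]). Qed.

Definition D2 i j x : R :=
  (dcoord i j i x * partial j F x + x 0 i * D1 (partial j F) i j x) -
  (dcoord i j j x * partial i F x + x 0 j * D1 (partial i F) i j x).

Lemma smooth_continuous x : S x -> {for x, continuous F}.
Proof. by move=> /sphere_neq0 /dF /differentiable_continuous. Qed.

Lemma bdm_partial k : bdm (partial k F).
Proof.
by apply: bdm_continuous => x /sphere_neq0 /(dF1 k) /differentiable_continuous.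
Qed.

Lemma bdm_D1 i j : bdm (D1 F i j).
Proof.
by apply: bdmB; apply: bdmM; try exact: bdm_coord; exact: bdm_partial.
Qed.

Lemma bdm_smooth : bdm f.
Proof.
have : bdm F by apply: bdm_continuous => x; exact: smooth_continuous.
by apply: eq_bdm => x; exact: ext_sphere.
Qed.

Lemma bdm_D2 i j : bdm (D2 i j).
Proof.
have bd a b k : bdm (dcoord a b k : 'rV[R]_n -> R).
  by rewrite /dcoord; apply: bdmB; case: (k == _) => /=;
    rewrite ?mulr1n ?mulr0n; try exact: bdm_coord; exact: bdm_cst.
have b2 k l : bdm (partial l (partial k F)).
  by apply: bdm_continuous => x /sphere_neq0 /(dF2 k l) /differentiable_continuous.
have b1 k a b : bdm (D1 (partial k F) a b).
  by apply: bdmB; apply: bdmM; try exact: bdm_coord; exact: b2.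
by apply: bdmB; apply: bdmD; apply: bdmM => //; try exact: bdm_coord; exact: bdm_partial.
Qed.

Lemma rd_smooth i j : rd i j f (D1 F i j).
Proof.
have : rd i j F (D1 F i j).
  by apply: rd_differentiable => x /sphere_neq0; exact: dF.
by apply: eq_rd => // x; exact: ext_sphere.
Qed.

Lemma rd_D1 i j : rd i j (D1 F i j) (D2 i j).
Proof.
have r k : rd i j (partial k F) (D1 (partial k F) i j).
  by apply: rd_differentiable => x /sphere_neq0; exact: dF1.
exact: rdB (rdM (rd_coord i j i) (r j)) (rdM (rd_coord i j j) (r i)).
Qed.

(** Euler's identity holds at all nonzero points, hence near x, and may be differentiated in each
    coordinate; contracting with x leaves the radial part of the Hessian. *)
Lemma sum_hess x : S x ->
  \sum_i \sum_j x 0 i * x 0 j * partial i (partial j F) x = 0.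
Proof.
move=> Sx; have x0 := sphere_neq0 Sx.
pose E y : R := \sum_k y 0 k * partial k F y.
have hE i : \sum_j (delta_mx (0 : 'I_1) i 0 j * partial j F x + x 0 j * partial i (partial j F) x) = 0.
  have h1 : is_derive (0 : R) 1 (fun a : R => E (x + a *: delta_mx 0 i))
      (\sum_j (delta_mx (0 : 'I_1) i 0 j * partial j F x + x 0 j * partial i (partial j F) x)).
    apply: hd_sum => j _.
    have hc : is_derive (0 : R) 1 (fun a : R => (x + a *: delta_mx 0 i) 0 j) (delta_mx (0 : 'I_1) i 0 j).
      apply: (@hd_eq _ (fun a : R => x 0 j + a * delta_mx (0 : 'I_1) i 0 j)).
        by move=> a; rewrite !mxE.
      by apply: is_derive_eq (hdD (hd_cst _ 0) (hdM (hd_id 0) (hd_cst _ 0))) _; ring.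
    apply: is_derive_eq (hdM hc (hd_partial i (dF1 j x0))) _.
    by rewrite scale0r addr0.
  have h2 : is_derive (0 : R) 1 (fun a : R => E (x + a *: delta_mx 0 i)) 0.
    apply: hd_near (hd_cst 0 0).
    have cl : (fun a : R => x + a *: delta_mx 0 i) @ 0 --> x.
      apply: (@cvg_rV _ _ _ (nbhs (0 : R))) => k; under eq_fun do rewrite !mxE.
      set c : R := (_ && _)%:R.
      have : (x 0 k + a * c) @[a --> (0 : R)] --> x 0 k + 0 * c.
        by apply: cvgD; [exact: cvg_cst|apply: cvgM; [exact: cvg_id|exact: cvg_cst]].
      by rewrite mul0r addr0.
    have cl0 := cvgr_neq0 x cl x0.
    near=> a; rewrite /E euler_ext//; apply: dF.
    by near: a; exact: cl0.
  exact: hd_unique h1 h2.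
have : \sum_i x 0 i * \sum_j (delta_mx (0 : 'I_1) i 0 j * partial j F x + x 0 j * partial i (partial j F) x) = 0.
  by rewrite big1// => i _; rewrite hE mulr0.
have eu := euler_ext (dF x0).
under eq_bigr do rewrite big_split/= mulrDr.
rewrite big_split/= [X in X + _](_ : _ = 0).
  rewrite add0r => h; rewrite -[RHS]h; apply: eq_bigr => i _.
  by rewrite mulr_sumr; apply: eq_bigr => j _; rewrite mulrA.
rewrite -[RHS]eu; apply: eq_bigr => i _; congr (_ * _).
rewrite (bigD1 i)//= mxE !eqxx mul1r big1 ?addr0// => k ki.
by rewrite mxE (negPf ki) andbF mul0r.
Unshelve. all: by end_near. Qed.

(** By the two Euler identities the first order and the radial terms of the sum of squares vanish,
    and the Euclidean Laplacian of the extension remains. *)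
Lemma laplace_sphere x : S x ->
  laplace_beltrami f x = 2^-1 * \sum_i \sum_j D2 i j x.
Proof.
move=> Sx; have x0 := sphere_neq0 Sx; have eu := euler_ext (dF x0).
have sh := sum_hess Sx; have /sphereP xx := Sx.
have E i j : D2 i j x =
    (x 0 i * partial j F x) *+ (i == j) + (x 0 j * partial i F x) *+ (i == j)
    - x 0 j * partial j F x - x 0 i * partial i F x
    + x 0 i * x 0 i * partial j (partial j F) x + x 0 j * x 0 j * partial i (partial i F) x
    - x 0 i * x 0 j * partial i (partial j F) x - x 0 j * x 0 i * partial j (partial i F) x.
  rewrite /D2 /D1 /dcoord !eqxx (eq_sym j i); have [->|_] := eqVneq i j.
    rewrite !mulr1n; move: (partial j F x) (partial j (partial j F) x) (x 0 j) => a b c; ring.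
  rewrite !mulr1n !mulr0n; move: (partial j (partial j F) x) (partial i (partial i F) x)
    (partial i (partial j F) x) (partial j (partial i F) x) => c d e g.
  move: (partial j F x) (partial i F x) (x 0 i) (x 0 j) => a b p q; ring.
under eq_bigr do under eq_bigr do rewrite E.
rewrite (lap_algebra eu sh xx) mulrA mulVf ?mul1r// mulr0 !subr0; exact: eq_bigr.
Qed.

End Fixed.
End Smooth.

Section WeakForm.
Variables (R : realType) (n : nat) (sigma : probability (borel R n) R).
Hypotheses (hn : (2 <= n)%N) (hsigma : is_uniform sigma).
Variables (nu tau : R -> R).
Implicit Types (x y v : 'rV[R]_n) (i j k : 'I_n).

Local Notation S := (sphere R n).
Local Notation I := (sint sigma).
Local Notation bI := (intg_bdm hsigma).

Variable f : 'rV[R]_n -> R.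
Hypothesis sf : smooth_sphere f.
Local Notation F := (ext f).

Let dF x : x != 0 -> differentiable F x. Proof. exact: (sf [::]). Qed.

Lemma Tgrad_D1 v x : S x -> Tgrad v (D1 F) x = \sum_i v 0 i * partial i F x.
Proof.
move=> Sx; have /sphereP xx := Sx; have eu := euler_ext (dF (sphere_neq0 Sx)).
rewrite /Tgrad /D1; move: eu; move: (fun i => partial i F x) => p.
move=> eu; transitivity (\sum_i (v 0 i * partial i F x * \sum_j x 0 j * x 0 j -
    v 0 i * x 0 i * \sum_j x 0 j * partial j F x)).
  apply: eq_bigr => i _; rewrite !mulr_sumr -sumrB; apply: eq_bigr => j _.
  by move: (partial i F x) (partial j F x) => a b; ring.
by apply: eq_bigr => i _; rewrite -/(dot x x) xx euler_ext ?mulr1 ?mulr0 ?subr0//; exact/dF/sphere_neq0.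
Qed.

(** The differential of the projection at x is Id - x (x) x ([hd_proj]). Differentiating v - (y . v)
    y through it contributes the trace - (n - 1) x . v, and the radial derivative of f vanishes. *)
Lemma div_sphere_drift v x : S x ->
  div_sphere (fun y => f y *: (v - dot y v *: y)) x =
  Tgrad v (D1 F) x - n.-1%:R * dot x v * f x.
Proof.
move=> Sx; have /sphereP xx := Sx; have x0 := sphere_neq0 Sx.
have eu := euler_ext (dF x0).
have E i : partial i (fun y => ext (fun y => f y *: (v - dot y v *: y)) y 0 i) x =
    partial i F x * (v 0 i - dot x v * x 0 i) -
    f x * ((v 0 i - x 0 i * dot x v) * x 0 i + dot x v * (1 - x 0 i * x 0 i)).
  apply: partialE.
  apply: (@hd_eq _ (fun a : R => F (x + a *: delta_mx 0 i) *
    (v 0 i - (\sum_k Defs.proj (x + a *: delta_mx 0 i) 0 k * v 0 k) *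
              Defs.proj (x + a *: delta_mx 0 i) 0 i))).
    by move=> a; rewrite /ext !mxE.
  have h1 := hd_partial i (dF x0).
  have h2 k := hd_proj i k Sx.
  have h3 := @hd_sum R _ (index_enum 'I_n) xpredT _ 0 _ (fun k _ => hdM (h2 k) (hd_cst (v 0 k) (0 : R))).
  apply: is_derive_eq (hdM h1 (hdB (hd_cst (v 0 i) 0) (hdM h3 (h2 i)))) _.
  rewrite scale0r addr0 proj_sphere// eqxx ext_sphere//.
  have -> : \sum_k (((k == i)%:R - x 0 i * x 0 k) * v 0 k + x 0 k * 0) = v 0 i - x 0 i * dot x v.
    under eq_bigr do rewrite mulr0 addr0 mulrBl -mulrA.
    rewrite sumrB -mulr_sumr; congr (_ - _).
    by rewrite (bigD1 i)//= eqxx mul1r big1 ?addr0// => k /negPf ->; rewrite mul0r.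
  rewrite -/(dot x v) mulr1n; move: (partial i F x) (dot x v) (f x) => a b c; ring.
rewrite /div_sphere; under eq_bigr do rewrite E.
rewrite Tgrad_D1//; move: eu; rewrite sumrB.
have -> : \sum_i partial i F x * (v 0 i - dot x v * x 0 i) =
    \sum_i v 0 i * partial i F x - dot x v * \sum_i x 0 i * partial i F x.
  rewrite mulr_sumr -sumrB; apply: eq_bigr => i _.
  by move: (partial i F x) (dot x v) => a b; ring.
move=> ->; rewrite mulr0 subr0; congr (_ - _).
rewrite -mulr_sumr mulrC; congr (_ * _).
transitivity (\sum_i x 0 i * v 0 i + \sum_(i < n) dot x v - 2 * dot x v * \sum_i x 0 i * x 0 i).
  rewrite mulr_sumr -big_split -sumrB; apply: eq_bigr => i _ /=.
  by move: (dot x v) => a; ring.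
rewrite -/(dot x x) -/(dot x v) xx sumr_const card_ord.
have -> : n.-1%:R = n%:R - 1 :> R by rewrite -[in RHS](prednK (ltnW hn)) -natr1 addrK.
by rewrite -[_ *+ n]mulr_natl; ring.
Qed.

Local Notation J := (enorm (flux sigma f)).
Local Notation Om := (direction sigma f).

Lemma QopE x : S x -> Qop sigma nu tau f x =
  - nu J * (Tgrad Om (D1 F) x - n.-1%:R * dot x Om * f x) +
  tau J * (2^-1 * \sum_i \sum_j D2 f i j x).
Proof. by move=> Sx; rewrite /Qop div_sphere_drift// laplace_sphere. Qed.

Lemma bdm_Qop : bdm (Qop sigma nu tau f).
Proof.
have bf := bdm_smooth sf.
apply: (@eq_bdm _ _ (fun x => - nu J * (Tgrad Om (D1 F) x - n.-1%:R * dot x Om * f x) +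
  tau J * (2^-1 * \sum_i \sum_j D2 f i j x))) => [x Sx|]; first by rewrite QopE.
apply: bdmD; apply: bdmZ; last first.
  by apply: bdmZ; apply: bdm_sum => i _; apply: bdm_sum => j _; exact: bdm_D2.
apply: bdmB; first by apply: bdm_Tgrad => i j; exact: bdm_D1.
by apply: bdmM => //; apply: bdmZ; exact: bdm_dot.
Qed.

(** The weak form. The estimates on solutions are this identity for a suitable [w]: a constant for
    the mass, x . v for the flux, ln f for the entropy, f minus an equilibrium for the L^2
    distance. *)
Lemma sint_Qop_parts (w : 'rV[R]_n -> R) w1 :
  (forall i j, rd i j w (w1 i j)) -> bdm w -> (forall i j, bdm (w1 i j)) ->
  I (fun x => w x * Qop sigma nu tau f x) =
  nu J * I (fun x => f x * Tgrad Om w1 x) -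
  tau J * (2^-1 * \sum_i \sum_j I (fun x => w1 i j x * D1 F i j x)).
Proof.
move=> rw bw bw1; have bf := bdm_smooth sf.
have bT := bdm_Tgrad Om (fun i j => bdm_D1 sf i j).
have bL : bdm (fun x => 2^-1 * \sum_i \sum_j D2 f i j x).
  by apply: bdmZ; apply: bdm_sum => i _; apply: bdm_sum => j _; exact: bdm_D2.
have bG : bdm (fun x => Tgrad Om (D1 F) x - n.-1%:R * dot x Om * f x).
  by apply: bdmB => //; apply: bdmM => //; apply: bdmZ; exact: bdm_dot.
rewrite (eq_sint sigma (g := fun x =>
   - nu J * (w x * (Tgrad Om (D1 F) x - n.-1%:R * dot x Om * f x)) +
   tau J * (w x * (2^-1 * \sum_i \sum_j D2 f i j x)))); last first.
  by move=> x Sx; rewrite QopE//; ring.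
rewrite sintD; try (apply: bI; apply: bdmZ; exact: bdmM).
rewrite sintZ; last by apply: bI; exact: bdmM.
rewrite sintZ; last by apply: bI; exact: bdmM.
rewrite (sint_Tgrad_parts hn hsigma Om (rd_smooth sf) rw bf (bdm_D1 sf) bw bw1).
rewrite (sint_lap_parts hsigma (rd_D1 sf) rw bf (bdm_D1 sf) (bdm_D2 sf) bw bw1).
by rewrite mulrNN mulrN.
Qed.

End WeakForm.

(** * Convex functionals along solutions *)

Section RealLemmas.
Variable R : realType.
Implicit Types (y dy : R -> R) (a b c t : R).

Lemma nonincreasing_pos y dy : (forall t, 0 < t -> is_derive t (1 : R) y (dy t)) ->
  (forall t, 0 < t -> dy t <= 0) -> forall a b, 0 < a -> a <= b -> y b <= y a.
Proof.
move=> yd dy0 a b a0 ab; apply: (hd_nincr (df := dy)) => //.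
- by move=> x /andP[ax _]; apply: yd; exact: lt_trans ax.
- by move=> x /andP[ax _]; apply: dy0; exact: lt_trans ax.
- apply: derivable_within_continuous => x; rewrite in_itv/= => /andP[ax _].
  by case: (yd x (lt_le_trans a0 ax)).
Qed.

Lemma gronwall_pos y dy c : (forall t, 0 < t -> is_derive t (1 : R) y (dy t)) ->
  (forall t, 0 < t -> dy t <= c * y t) ->
  forall a b, 0 < a -> a <= b -> y b <= expR (c * (b - a)) * y a.
Proof.
move=> yd dyc a b a0 ab.
have h : y b * expR (- (c * b)) <= y a * expR (- (c * a)).
  apply: (nonincreasing_pos (y := fun t => y t * expR (- (c * t)))
    (dy := fun t => dy t * expR (- (c * t)) + y t * (expR (- (c * t)) * - (c * 1)))) => //.
    by move=> t t0; exact: hdM (yd t t0) (hd_exp (hdN (hdZ c (hd_id t)))).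
  move=> t t0; have := dyc t t0; have := expR_gt0 (- (c * t)).
  move: (expR _) => E E0 h; nra.
rewrite mulrBr expRD mulrAC -(ler_pM2r (expR_gt0 (- (c * b)))).
apply: le_trans h _; rewrite -[leLHS]mul1r -(expRxMexpNx_1 (c * b)).
by rewrite le_eqVlt; apply/orP; left; apply/eqP; ring.
Qed.

(** The inequality started at a > 0, with a sent to 0: [y] has a limit at 0 but its value there is
    not constrained. *)
Lemma gronwall_lim y dy c (l : R) : (forall t, 0 < t -> is_derive t (1 : R) y (dy t)) ->
  (forall t, 0 < t -> dy t <= c * y t) ->
  y t @[t --> 0^'+] --> l ->
  forall t, 0 < t -> y t <= expR (c * t) * l.
Proof.
move=> yd dyc yl t t0.
have h : expR (c * (t - a)) * y a @[a --> 0^'+] --> expR (c * t) * l.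
  apply: cvgM => //; apply: cvg_at_right_filter.
  have : {for 0, continuous (fun a : R => expR (c * (t - a)))}.
    exact: hd_continuous (hd_exp (hdZ c (hdB (hd_cst t 0) (hd_id 0)))).
  by rewrite /prop_for /continuous_at subr0.
apply: (cvgr_to_ge h); near=> a.
apply: (gronwall_pos yd dyc) => //.
by apply: ltW; near: a; exact: nbhs_right_lt.
Unshelve. all: by end_near. Qed.

Lemma ln_le_subr1 t : 0 < t -> ln t <= t - 1.
Proof.
move=> t0; have := expR_ge1Dx (ln t); rewrite lnK ?posrE//; lra.
Qed.

Lemma continuous_pos_comp (n : nat) (phi : R -> R) (g : 'rV[R]_n -> R) (m : R) :
  0 < m -> (forall s, 0 < s -> {for s, continuous phi}) -> bdm g ->
  (forall x, sphere R n x -> m <= g x) -> bdm (fun x => phi (g x)).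
Proof.
move=> m0 cphi bg gm; have [_ [M hM]] := bg.
(* [phi] is continuous only on the positive half-line; truncating its argument from below at m makes
   it continuous everywhere without changing it on the values of g. *)
have cp : continuous (fun s : R => phi (Num.max m s)).
  move=> s; apply: (@continuous_comp _ _ _ (fun s : R => Num.max m s) phi).
    by apply: (@continuous_max _ R (fun=> m) id); [exact: cvg_cst|exact: cvg_id].
  by apply: cphi; rewrite lt_max m0.
have : bdm (fun x => phi (Num.max m (g x))).
  apply: (bdm_comp (phi := fun s => phi (Num.max m s))) => //.
  - by move=> x _; exact: cp.
  - exact: continuous_measurable_fun.
  - have cpt : compact ((fun s : R => phi (Num.max m s)) @` `[- M, M]).
      apply: continuous_compact; last exact: segment_compact.
      by apply: continuous_subspaceT.
    have [B [_ hB]] := compact_bounded cpt.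
    exists (B + 1) => x Sx; apply: (hB (B + 1)); first by rewrite ltrDl.
    by exists (g x) => //; rewrite /= in_itv/= -ler_norml hM.
by apply: eq_bdm => x Sx; rewrite max_r// gm.
Qed.

End RealLemmas.

Section UniformDerivatives.
Variables (R : realType) (n : nat) (sigma : probability (borel R n) R).
Hypotheses (hn : (2 <= n)%N) (hsigma : is_uniform sigma).
Implicit Types (F G : R -> 'rV[R]_n -> R) (g w : 'rV[R]_n -> R) (t : R).

Local Notation S := (sphere R n).
Local Notation I := (sint sigma).
Local Notation bI := (intg_bdm hsigma).

(** A derivative in time that is uniform on the sphere: it survives integration, multiplication by a
    bounded function, kernels and composition. *)
Definition uder F t g := forall e : R, 0 < e -> \forall h \near (0 : R),
  forall x, S x -> `|F (t + h) x - F t x - h * g x| <= e * `|h|.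

Lemma nearD0 (P : R -> Prop) t :
  (\forall s \near t, P s) -> \forall h \near (0 : R), P (t + h).
Proof.
move=> Pt; have : (fun h : R => t + h) @ 0 --> t.
  by rewrite -[X in _ --> X]addr0; apply: cvgD; [exact: cvg_cst|exact: cvg_id].
by move=> /(_ _ Pt).
Qed.

Lemma uder_sint F t g : (\forall s \near t, bdm (F s)) -> bdm g -> uder F t g ->
  is_derive t (1 : R) (fun s => I (F s)) (I g).
Proof.
move=> bF bg uF; apply/hd_epsP => e e0.
have bFt : bdm (F t) by exact: nbhs_singleton bF.
have bFh := nearD0 bF; have uFe := uF e e0.
near=> h.
have bh : bdm (F (t + h)) by near: h.
rewrite -sintB; try exact: bI.
rewrite -sintZ; last exact: bI.
rewrite -sintB; [|by apply: bI; exact: bdmB|by apply: bI; exact: bdmZ].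
apply: (norm_sint_le hsigma); first by apply: bI; apply: bdmB; [exact: bdmB|exact: bdmZ].
by near: h.
Unshelve. all: by end_near. Qed.

Lemma uder_mul F t g w : bdm w -> uder F t g -> uder (fun s x => w x * F s x) t (fun x => w x * g x).
Proof.
move=> [_ [M hM]] uF e e0.
have M1 : 0 < `|M| + 1 by rewrite ltr_wpDl.
have := uF (e / (`|M| + 1)) (divr_gt0 e0 M1); apply: filterS => h hh x Sx.
have -> : w x * F (t + h) x - w x * F t x - h * (w x * g x) =
   w x * (F (t + h) x - F t x - h * g x) by ring.
rewrite normrM; apply: le_trans (ler_pM _ _ (_ : `|w x| <= `|M| + 1) (hh x Sx)) _ => //.
  by rewrite (le_trans (hM _ Sx))// (le_trans (ler_norm _))// lerDl.
by rewrite mulrA mulrCA mulfV ?mulr1// gt_eqF.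
Qed.

Lemma uder_bound F t g : bdm g -> uder F t g ->
  exists2 M : R, 0 < M & \forall h \near (0 : R), forall x, S x -> `|F (t + h) x - F t x| <= M * `|h|.
Proof.
move=> [_ [M hM]] uF; exists (`|M| + 1); first by rewrite ltr_wpDl.
have := uF 1 ltr01; apply: filterS => h hh x Sx.
have -> : F (t + h) x - F t x = (F (t + h) x - F t x - h * g x) + h * g x by ring.
rewrite (le_trans (ler_normD _ _))// mulrDl addrC lerD ?hh// normrM mulrC ler_wpM2r//.
by rewrite (le_trans (hM _ Sx))// ler_norm.
Qed.

Lemma uder_comp F t g (th th1 D : R -> R) :
  (forall a b, 0 < a -> 0 < b -> `|th b - th a - th1 a * (b - a)| <= D a * (b - a) ^+ 2) ->
  (\forall s \near t, forall x, S x -> 0 < F s x) ->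
  bdm (fun x => th1 (F t x)) -> bdm (fun x => D (F t x)) -> bdm g ->
  uder F t g -> uder (fun s x => th (F s x)) t (fun x => th1 (F t x) * g x).
Proof.
move=> hth F0 [_ [M1 hM1]] [_ [MD hMD]] bg uF e e0.
have [M M0 hM] := uder_bound bg uF.
have F0t := nbhs_singleton F0; have F0h := nearD0 F0.
have p1 : 0 < `|M1| + 1 by rewrite ltr_wpDl.
have pD : 0 < `|MD| + 1 by rewrite ltr_wpDl.
have e2 : 0 < e / 2 by rewrite divr_gt0.
have uFe := uF _ (divr_gt0 e2 p1).
have eD : 0 < e / 2 / ((`|MD| + 1) * M ^+ 2) by rewrite divr_gt0// mulr_gt0// exprn_gt0.
have hsmall : \forall h \near (0 : R), `|h| < e / 2 / ((`|MD| + 1) * M ^+ 2).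
  exact: nbhs0_lt.
near=> h => x Sx.
have Fp : 0 < F (t + h) x by apply: (near F0h h).
have h1 : `|F (t + h) x - F t x - h * g x| <= e / 2 / (`|M1| + 1) * `|h| by apply: (near uFe h).
have h2 : `|F (t + h) x - F t x| <= M * `|h| by apply: (near hM h).
have h3 : `|h| < e / 2 / ((`|MD| + 1) * M ^+ 2) by near: h.
have h4 := hth _ _ (F0t x Sx) Fp.
have -> : th (F (t + h) x) - th (F t x) - h * (th1 (F t x) * g x) =
  (th (F (t + h) x) - th (F t x) - th1 (F t x) * (F (t + h) x - F t x)) +
  th1 (F t x) * (F (t + h) x - F t x - h * g x) by ring.
rewrite (le_trans (ler_normD _ _))// [e](splitr e) mulrDl lerD//.
- apply: le_trans h4 _.
  apply: (@le_trans _ _ ((`|MD| + 1) * (M * `|h|) ^+ 2)).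
    apply: (@le_trans _ _ ((`|MD| + 1) * (F (t + h) x - F t x) ^+ 2)).
      rewrite ler_wpM2r ?sqr_ge0// (le_trans (ler_norm _))// (le_trans (hMD _ Sx))//.
      by rewrite (le_trans (ler_norm _))// lerDl.
    rewrite ler_wpM2l ?(ltW pD)// -real_normK ?num_real// lerXn2r ?nnegrE//.
    by rewrite mulr_ge0// ltW.
  rewrite exprMn mulrA expr2 mulrA ler_wpM2r//.
  have c0 : 0 < (`|MD| + 1) * M ^+ 2 by rewrite mulr_gt0// exprn_gt0.
  by move: h3; rewrite ltr_pdivlMr// => /ltW; rewrite mulrC.
- rewrite normrM; apply: le_trans (ler_pM _ _ (_ : _ <= `|M1| + 1) h1) _ => //.
    by rewrite (le_trans (hM1 _ Sx))// (le_trans (ler_norm _))// lerDl.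
  by rewrite mulrA mulrCA mulfV ?mulr1// gt_eqF.
Unshelve. all: by end_near. Qed.

Lemma uder_kop k m M F t g : markov_kernel sigma k m M -> 0 <= m ->
  (\forall s \near t, bdm (F s)) -> bdm g -> uder F t g ->
  uder (fun s => kop sigma k (F s)) t (kop sigma k g).
Proof.
move=> mk m0 bF bg uF e e0.
have bFt : bdm (F t) by exact: nbhs_singleton bF.
have bFh := nearD0 bF; have uFe := uF e e0.
near=> h => x Sx.
have bh : bdm (F (t + h)) by near: h.
rewrite -(kopB mk _ (bI bh) (bI bFt)) -(kopZ mk _ _ (bI bg)).
rewrite -(kopB mk _ (bI (bdmB bh bFt)) (bI (bdmZ _ bg))).
apply: le_trans (norm_kop mk m0 (bI (bdmB (bdmB bh bFt) (bdmZ _ bg))) Sx) _.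
rewrite -[leRHS](kop_cst hsigma mk (e * `|h|) Sx).
apply: (kop_le mk m0 _ _ Sx); first exact/bI/bdm_norm/bdmB/bdmZ/bg/bdmB.
  exact/bI/bdm_cst.
by near: h.
Unshelve. all: by end_near. Qed.

Lemma cvg_smooth_uder (f : R -> 'rV[R]_n -> R) t g :
  cvg_smooth (0 : R)^' (fun (h : R) x => h^-1 * (f (t + h) x - f t x)) g ->
  uder f t g.
Proof.
move=> /(_ [::]) cv e e0.
have : \forall h \near (0 : R)^', forall x, S x -> `|h^-1 * (f (t + h) x - f t x) - g x| < e.
  have := cv [set u | forall x, S x -> `|u x - ext g x| < e].
  rewrite /nbhs/= => /(_ _) h.
  have : \forall h \near (0 : R)^', forall x, S x ->
      `|ext (fun x => h^-1 * (f (t + h) x - f t x)) x - ext g x| < e.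
    apply: h; apply/uniform_nbhs; exists [set xy : R * R | ball xy.1 e xy.2].
    split; first exact: entourage_ball (PosNum e0).
    by move=> u hu x Sx; have := hu x Sx; rewrite /= -ball_normE/= distrC.
  by apply: filterS => y hy x Sx; have := hy x Sx; rewrite !ext_sphere.
rewrite near_withinE => hn0; near=> h => x Sx.
have [->|h0] := eqVneq h 0; first by rewrite addr0 mul0r !subrr normr0 mulr0.
have hh : h != 0 -> forall x, S x -> `|h^-1 * (f (t + h) x - f t x) - g x| < e.
  by apply: (near hn0 h).
have := ltW (hh h0 x Sx).
rewrite -(@ler_pM2r _ `|h|) ?normr_gt0// -normrM mulrBl mulrAC mulVf// mul1r.
by rewrite (mulrC (g x)).
Unshelve. all: by end_near. Qed.

End UniformDerivatives.

Section ConvexFunctionals.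
Variables (R : realType) (n : nat) (sigma : probability (borel R n) R).
Hypotheses (hn : (2 <= n)%N) (hsigma : is_uniform sigma).
Variables (nu tau : R -> R).
Implicit Types (t s a b : R) (i j : 'I_n) (x y : 'rV[R]_n).

Local Notation S := (sphere R n).
Local Notation I := (sint sigma).
Local Notation bI := (intg_bdm hsigma).
Local Notation J g := (enorm (flux sigma g)).
Local Notation Om g := (direction sigma g).
Local Notation Q := (Qop sigma nu tau).

Variables (f : R -> 'rV[R]_n -> R) (f0 : 'rV[R]_n -> R) (rho nuM taum : R).
Hypotheses (rho0 : 0 < rho) (taum0 : 0 < taum)
  (sf : forall t, 0 < t -> smooth_sphere (f t))
  (fpos : forall t, 0 < t -> forall x, S x -> 0 < f t x)
  (fder : forall t, 0 < t -> uder f t (Q (f t)))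
  (hnu : forall t, 0 < t -> `|nu (J (f t))| <= nuM)
  (htau : forall t, 0 < t -> taum <= tau (J (f t)))
  (hmass : forall t, 0 < t -> I (f t) = rho).
Hypotheses (intf0 : intg sigma f0) (f00 : forall x, S x -> 0 <= f0 x)
  (mass0 : I f0 = rho)
  (hmom : forall x d, S x ->
    I (fun y => dot x y ^+ d * f t y) @[t --> 0^'+] --> I (fun y => dot x y ^+ d * f0 y)).

Lemma direction_le1 g i : `|Om g 0 i| <= 1.
Proof.
have [f0'|f0'] := eqVneq (flux sigma g) 0.
  by rewrite /direction f0' /Defs.proj scaler0 mxE normr0.
by apply: coord_sphere; exact: sphere_proj.
Qed.

Lemma near_pos t : 0 < t -> \forall s \near t, 0 < s.
Proof. by move=> t0; exact: lt_nbhsr. Qed.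

(** [th] is convex with derivatives [th1] and [th2]; [thAB] lets the functional control the term
    created by the drift. The cases in view are s^2, with A = 2 and B = 0, and s ln s, with A = B =
    1. *)
Variables (th th1 th2 : R -> R) (A B : R).
Hypotheses (thd : forall s, 0 < s -> is_derive s (1 : R) th (th1 s))
  (th1d : forall s, 0 < s -> is_derive s (1 : R) th1 (th2 s))
  (th2c : forall s, 0 < s -> {for s, continuous th2})
  (th20 : forall s, 0 < s -> 0 <= th2 s)
  (thAB : forall s, 0 < s -> s ^+ 2 * th2 s <= A * th s + B)
  (A0 : 0 < A)
  (th_ge : forall a b, 0 < a -> 0 <= b -> th a + th1 a * (b - a) <= th b)
  (th_le : forall a b, 0 < a -> 0 < b -> th b <= th a + th1 a * (b - a) + th2 a * (b - a) ^+ 2).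

Let thc s : 0 < s -> {for s, continuous th}.
Proof. by move=> s0; exact: hd_continuous (thd s0). Qed.
Let th1c s : 0 < s -> {for s, continuous th1}.
Proof. by move=> s0; exact: hd_continuous (th1d s0). Qed.

Section FixedKernel.
Variables (k : 'rV[R]_n -> 'rV[R]_n -> R) (m M : R).
Hypotheses (mk : markov_kernel sigma k m M) (m0 : 0 < m).
Local Notation K := (kop sigma k).

Let m0' := ltW m0.

Let bf t : 0 < t -> bdm (f t). Proof. by move=> t0; exact: bdm_smooth (sf t0). Qed.

Lemma Kf_ge t x : 0 < t -> S x -> m * rho <= K (f t) x.
Proof.
move=> t0 Sx; rewrite -(hmass t0); apply: (kop_ge mk) => //; first exact/bI/bf.
by move=> y Sy; exact/ltW/fpos.
Qed.

Let Kf_gt0 t x : 0 < t -> S x -> 0 < K (f t) x.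
Proof. by move=> t0 Sx; apply: lt_le_trans (Kf_ge t0 Sx); rewrite mulr_gt0. Qed.

Let bKf t : 0 < t -> bdm (K (f t)).
Proof. by move=> t0; exact: (bdm_kop hsigma mk (bI (bf t0))). Qed.

Let bphi t (phi : R -> R) : 0 < t -> (forall s, 0 < s -> {for s, continuous phi}) ->
  bdm (fun x => phi (K (f t) x)).
Proof.
move=> t0 cphi; apply: (continuous_pos_comp (m := m * rho)) => //.
- by rewrite mulr_gt0.
- exact: bKf.
- by move=> x; exact: Kf_ge.
Qed.

Lemma functional_derive t : 0 < t ->
  is_derive t (1 : R) (fun s => I (fun x => th (K (f s) x)))
    (I (fun x => th1 (K (f t) x) * K (Q (f t)) x)).
Proof.
move=> t0; have bQ : bdm (Q (f t)) by exact: (bdm_Qop sigma hn nu tau (sf t0)).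
have bKQ : bdm (K (Q (f t))) by exact: (bdm_kop hsigma mk (bI bQ)).
apply: (uder_sint hsigma).
- by apply: filterS (near_pos t0) => s s0; exact: (bphi s0 thc).
- by apply: bdmM => //; exact: (bphi t0 th1c).
- apply: (uder_comp (D := th2)) => //.
  + move=> a b a0 b0; have := th_ge a0 (ltW b0); have := th_le a0 b0.
    by move=> h1 h2; rewrite ger0_norm; lra.
  + by apply: filterS (near_pos t0) => s s0 x; exact: Kf_gt0.
  + exact: (bphi t0 th1c).
  + exact: (bphi t0 th2c).
  + apply: (uder_kop hsigma mk m0') => //; last exact: fder.
    by apply: filterS (near_pos t0) => s; exact: bf.
Qed.

(** Young's inequality costs nuM^2 / (2 taum) for each of the n^2 ordered pairs (i, j). *)
Definition rateC : R := (n * n)%:R * (nuM ^+ 2 / (2 * taum)).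

(** Put u = K f. By symmetry the weak form is tested with K (th1 u); since K commutes with the
    fields, diffusion yields th2 u (D_ij u)^2. The drift is at most nuM u th2 u |D_ij u|, and
    Young's inequality leaves u^2 th2 u. *)
Lemma functional_derive_le t : 0 < t ->
  I (fun x => th1 (K (f t) x) * K (Q (f t)) x) <=
  rateC * (A * I (fun x => th (K (f t) x)) + B).
Proof.
move=> t0; have bft := bf t0; have bKft := bKf t0.
have bQ : bdm (Q (f t)) by exact: (bdm_Qop sigma hn nu tau (sf t0)).
have b1 : bdm (fun x => th1 (K (f t) x)) by exact: (bphi t0 th1c).
have b2 : bdm (fun x => th2 (K (f t) x)) by exact: (bphi t0 th2c).
have bD i j : bdm (D1 (ext (f t)) i j) by exact: bdm_D1 (sf t0) i j.
pose p i j := K (D1 (ext (f t)) i j).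
have bp i j : bdm (p i j) by exact: (bdm_kop hsigma mk (bI (bD i j))).
pose q i j x := th2 (K (f t) x) * p i j x.
have bq i j : bdm (q i j) by exact: bdmM.
have rq i j : rd i j (fun x => th1 (K (f t) x)) (q i j).
  apply: (@rd_comp _ _ i j th1 th2) => [x Sx|]; first by apply: th1d; exact: Kf_gt0.
  exact: (rd_kop hsigma mk (rd_smooth (sf t0) i j) bft (bD i j)).
have bKq i j : bdm (K (q i j)) by exact: (bdm_kop hsigma mk (bI (bq i j))).
have rW i j : rd i j (K (fun x => th1 (K (f t) x))) (K (q i j)).
  exact: (rd_kop hsigma mk (rq i j) b1 (bq i j)).
have bW : bdm (K (fun x => th1 (K (f t) x))) by exact: (bdm_kop hsigma mk (bI b1)).
have -> : I (fun x => th1 (K (f t) x) * K (Q (f t)) x) =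
    I (fun x => K (fun x => th1 (K (f t) x)) x * Q (f t) x).
  rewrite (sint_kopC hsigma mk (bI b1) bQ); apply: eq_sint => x _ //.
rewrite (sint_Qop_parts hn hsigma nu tau (sf t0) rW bW bKq).
set Jt := J (f t); pose u x := K (f t) x.
have bu : bdm u by [].
have tp : taum <= tau Jt by exact: htau.
have E1 i j : I (fun x => K (q i j) x * D1 (ext (f t)) i j x) =
    I (fun x => th2 (u x) * p i j x ^+ 2).
  rewrite (sint_kopC hsigma mk (bI (bq i j)) (bD i j)); apply: eq_sint => x _.
  by rewrite /q -/(p i j) expr2 mulrA.
have b2p i j : bdm (fun x => th2 (u x) * p i j x ^+ 2) by apply: bdmM => //; exact: bdmX.
have b2u : bdm (fun x => u x ^+ 2 * th2 (u x)) by apply: bdmM => //; exact: bdmX.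
have E2 i j : nuM * I (fun x => u x * `|q i j x|) <=
    taum / 2 * I (fun x => th2 (u x) * p i j x ^+ 2) +
    nuM ^+ 2 / (2 * taum) * I (fun x => u x ^+ 2 * th2 (u x)).
  have bq' := bdm_norm (bq i j).
  rewrite -!sintZ -?sintD; try apply: bI; [|exact: bdmZ|exact: bdmZ|exact: b2u|exact: b2p|by apply: bdmM].
  apply: le_sint; [by apply: bI; apply: bdmZ; exact: bdmM|by apply: bI; apply: bdmD; exact: bdmZ|].
  move=> x Sx; have u0 : 0 < u x by exact: Kf_gt0.
  rewrite /q normrM (ger0_norm (th20 u0)).
  have P2 : p i j x ^+ 2 = `|p i j x| ^+ 2 by rewrite real_normK ?num_real.
  rewrite P2; move: (th20 u0); move: (th2 (u x)) (`|p i j x|) => c P c0.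
  (* Young's inequality as the completion of a square. *)
  have -> : taum / 2 * (c * P ^+ 2) + nuM ^+ 2 / (2 * taum) * (u x ^+ 2 * c) =
    nuM * (u x * (c * P)) + c / (2 * taum) * (taum * P - nuM * u x) ^+ 2.
    by field; rewrite gt_eqF.
  by rewrite lerDl mulr_ge0 ?sqr_ge0// divr_ge0// mulr_ge0// ltW.
have E3 : nu Jt * I (fun x => f t x * Tgrad (Om (f t)) (fun i j => K (q i j)) x) <=
    \sum_i \sum_j nuM * I (fun x => u x * `|q i j x|).
  have bT : bdm (Tgrad (Om (f t)) (fun i j => K (q i j))) by exact: bdm_Tgrad.
  apply: le_trans (ler_norm _) _; rewrite normrM.
  have nuM0 : 0 <= nuM by apply: le_trans (hnu t0).
  apply: (@le_trans _ _ (nuM * \sum_i \sum_j I (fun x => u x * `|q i j x|))).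
    apply: ler_pM => //; first exact: hnu.
    have bfT : bdm (fun x => f t x * Tgrad (Om (f t)) (fun i j => K (q i j)) x) by exact: bdmM.
    apply: le_trans (norm_sint (bI bfT)) _.
    have bn i j : bdm (fun x => `|q i j x|) by exact: bdm_norm.
    have bKn i j : bdm (K (fun x => `|q i j x|)) by exact: (bdm_kop hsigma mk (bI (bn i j))).
    have bfK i j : bdm (fun x => f t x * K (fun x => `|q i j x|) x) by exact: bdmM.
    rewrite exchange_big/=.
    have -> : \sum_j \sum_i I (fun x => u x * `|q i j x|) =
        I (fun x => \sum_i \sum_j f t x * K (fun x => `|q j i x|) x).
      rewrite (sint_sum hsigma) => [|i _]; last by apply: bI; exact: bdm_sum.
      apply: eq_bigr => i _; rewrite (sint_sum hsigma) => [|j _]; last exact: bI.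
      by apply: eq_bigr => j _; rewrite (sint_kopC hsigma mk (bI bft) (bn j i)).
    apply: le_sint; [by apply: bI; exact: bdm_norm|by apply: bI; apply: bdm_sum => i _; exact: bdm_sum|].
    move=> x Sx; rewrite normrM (ger0_norm (ltW (fpos t0 Sx))) /Tgrad.
    have f0x := ltW (fpos t0 Sx).
    apply: le_trans (ler_wpM2l f0x (ler_norm_sum _ _ _)) _.
    rewrite mulr_sumr ler_sum// => i _.
    apply: le_trans (ler_wpM2l f0x (ler_norm_sum _ _ _)) _.
    rewrite mulr_sumr ler_sum// => j _; apply: ler_wpM2l => //; rewrite !normrM.
    rewrite -[leRHS]mul1r; apply: ler_pM => //.
      by rewrite -[leRHS]mul1r; apply: ler_pM => //; [exact: direction_le1|exact: coord_sphere].
    exact: (norm_kop mk m0' (bI (bq j i)) Sx).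
  rewrite mulr_sumr ler_sum// => i _; by rewrite mulr_sumr.
have E4 : taum / 2 * \sum_i \sum_j I (fun x => th2 (u x) * p i j x ^+ 2) <=
    tau Jt * (2^-1 * \sum_i \sum_j I (fun x => K (q i j) x * D1 (ext (f t)) i j x)).
  under [in leRHS]eq_bigr do under eq_bigr do rewrite E1.
  rewrite mulrA; apply: ler_wpM2r; last by rewrite ler_pM2r.
  rewrite sumr_ge0// => i _; rewrite sumr_ge0// => j _; apply: sint_ge0 => x Sx.
  by rewrite mulr_ge0 ?sqr_ge0// th20//; exact: Kf_gt0.
apply: (@le_trans _ _ ((n * n)%:R * (nuM ^+ 2 / (2 * taum)) * I (fun x => u x ^+ 2 * th2 (u x)))); last first.
  rewrite /rateC; apply: ler_wpM2l.
    by rewrite mulr_ge0// divr_ge0 ?sqr_ge0// mulr_ge0// ltW.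
  have bthu : bdm (fun x => th (u x)) by exact: (bphi t0 thc).
  rewrite -sintZ; last exact: bI.
  rewrite -[X in _ <= _ + X](sint_cst hsigma B) -sintD; [|by apply: bI; exact: bdmZ|by apply: bI; exact: bdm_cst].
  apply: le_sint; [exact: bI|by apply: bI; apply: bdmD; [exact: bdmZ|exact: bdm_cst]|].
  by move=> x Sx; apply: thAB; exact: Kf_gt0.
rewrite lerBlDr; apply: le_trans E3 _; apply: le_trans (lerD (lexx _) E4).
have -> : (n * n)%:R * (nuM ^+ 2 / (2 * taum)) * I (fun x => u x ^+ 2 * th2 (u x)) =
    \sum_(i < n) \sum_(j < n) nuM ^+ 2 / (2 * taum) * I (fun x => u x ^+ 2 * th2 (u x)).
  by rewrite !sumr_const card_ord -mulrnA -[RHS]mulr_natl !mulrA.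
rewrite mulr_sumr -big_split ler_sum// => i _ /=.
rewrite mulr_sumr -big_split ler_sum// => j _ /=.
by rewrite addrC; exact: E2.
Qed.

(** Jensen's inequality: the tangent to [th] at K f0 x, evaluated at f0 y, is averaged in x against
    the kernel and then integrated in y. [f0] may vanish, which is why tangents are required up to
    the point 0. *)
Lemma functional_jensen : intg sigma (fun x => th (f0 x)) ->
  I (fun x => th (K f0 x)) <= I (fun x => th (f0 x)).
Proof.
move=> intth; have [fk _ k0 _] := mk.
have ba : bdm (K f0) by exact: (bdm_kop hsigma mk intf0).
have a_ge x : S x -> m * rho <= K f0 x by move=> Sx; rewrite -mass0; exact: (kop_ge mk).
have mr : 0 < m * rho by rewrite mulr_gt0.
have a_gt x : S x -> 0 < K f0 x by move=> Sx; exact: lt_le_trans (a_ge x Sx).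
have bth : bdm (fun x => th (K f0 x)) by exact: continuous_pos_comp mr thc ba a_ge.
have bth1 : bdm (fun x => th1 (K f0 x)) by exact: continuous_pos_comp mr th1c ba a_ge.
pose g x := th (K f0 x) - th1 (K f0 x) * K f0 x.
have bg : bdm g by apply: bdmB => //; exact: bdmM.
have bKg : bdm (K g) by exact: (bdm_kop hsigma mk (bI bg)).
have bKth1 : bdm (K (fun x => th1 (K f0 x))) by exact: (bdm_kop hsigma mk (bI bth1)).
have intfK : intg sigma (fun y => f0 y * K (fun x => th1 (K f0 x)) y) by exact: intgM.
have h y : S y -> K g y + f0 y * K (fun x => th1 (K f0 x)) y <= th (f0 y).
  move=> Sy; rewrite -(kopZ mk _ _ (bI bth1)) -(kopD mk _ (bI bg) (bI (bdmZ _ bth1))).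
  rewrite -[leRHS](kop_cst hsigma mk (th (f0 y)) Sy).
  apply: (kop_le mk m0') => //; [apply: bI; apply: bdmD => //; exact: bdmZ|exact/bI/bdm_cst|].
  move=> x Sx; have := th_ge (a_gt x Sx) (f00 Sy); rewrite /g; lra.
have : I (fun y => K g y + f0 y * K (fun x => th1 (K f0 x)) y) <= I (fun y => th (f0 y)).
  by apply: le_sint => //; apply: intgD => //; exact: bI.
rewrite (sintD (bI bKg) intfK) (sint_kop hsigma mk (bI bg)).
rewrite -(sint_kopC hsigma mk intf0 bth1) -sintD; [|exact: bI|by apply: bI; exact: bdmM].
by congr (_ <= _); apply: eq_sint => x _; rewrite /g; ring.
Qed.

(** The smoothed densities take values in [m rho, M rho], where [th] is bounded, so pointwise
    convergence is enough. *)
Lemma functional_cvg0 :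
  (forall x, S x -> K (f t) x @[t --> 0^'+] --> K f0 x) ->
  I (fun x => th (K (f t) x)) @[t --> 0^'+] --> I (fun x => th (K f0 x)).
Proof.
move=> hK.
have mr : 0 < m * rho by rewrite mulr_gt0.
have cpt : compact (th @` `[m * rho, M * rho]).
  apply: continuous_compact; last exact: segment_compact.
  apply: continuous_in_subspaceT => s /set_mem; rewrite /= in_itv/= => /andP[h _].
  by apply: thc; exact: lt_le_trans h.
have [Bd [_ hB]] := compact_bounded cpt.
apply/cvg_at_rightP => u [u0 ul].
apply: (cvg_sint hsigma (M := Bd + 1)).
- by move=> l; exact: (bphi (u0 l) thc).
- move=> l x Sx; apply: (hB (Bd + 1)); first by rewrite ltrDl.
  exists (K (f (u l)) x) => //; rewrite /= in_itv/= Kf_ge//=.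
  rewrite (le_trans (ler_norm _))// (le_trans (norm_kop_le mk m0' (bI (bf (u0 l))) Sx))//.
  rewrite -(hmass (u0 l)) le_eqVlt; apply/orP; left; apply/eqP; congr (_ * _).
  by apply: eq_sint => y Sy; rewrite ger0_norm// ltW// fpos.
- move=> x Sx; have p : 0 < K f0 x.
    by apply: lt_le_trans mr _; rewrite -mass0; exact: (kop_ge mk).
  apply: (@cvg_comp _ _ _ (fun l => K (f (u l)) x) th _ (nbhs (K f0 x))); last exact: thc.
  by have /cvg_at_rightP := hK x Sx; apply.
Qed.

Lemma functional_kop_le t : 0 < t ->
  (forall x, S x -> K (f t) x @[t --> 0^'+] --> K f0 x) ->
  intg sigma (fun x => th (f0 x)) ->
  A * I (fun x => th (K (f t) x)) + B <=
  expR (A * rateC * t) * (A * I (fun x => th (f0 x)) + B).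
Proof.
move=> t0 hK intth.
have hl : A * I (fun x => th (K (f t) x)) + B @[t --> 0^'+] -->
    A * I (fun x => th (K f0 x)) + B.
  apply: cvgD; last exact: cvg_cst.
  by apply: cvgM; [exact: cvg_cst|exact: functional_cvg0].
have := @gronwall_lim R (fun t => A * I (fun x => th (K (f t) x)) + B)
  (fun t => A * I (fun x => th1 (K (f t) x) * K (Q (f t)) x)) (A * rateC) _ _ _ hl _ t0.
move=> h; apply: le_trans (h _ _) _.
- move=> s s0; apply: is_derive_eq (hdD (hdZ A (functional_derive s0)) (hd_cst B s)) _.
  by rewrite addr0.
- move=> s s0; rewrite -mulrA ler_pM2l//; exact: functional_derive_le.
- rewrite ler_wpM2l ?expR_ge0// lerD2r ler_pM2l//; exact: functional_jensen.
Qed.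

End FixedKernel.

(** The binomial expansion of (1 + x . y)^N reduces the smoothed density to finitely many
    moments. *)
Lemma kop_kmix_cvg0 (e : R) N x : S x ->
  kop sigma (kmix e N) (f t) x @[t --> 0^'+] --> kop sigma (kmix e N) f0 x.
Proof.
move=> Sx; have E g : intg sigma g -> kop sigma (kmix e N) g x =
    \sum_(d < N.+1) ((1 - e) / mass R n N * 'C(N, d)%:R) * I (fun y => dot x y ^+ d * g y) +
    e * I (fun y => dot x y ^+ 0 * g y).
  move=> ig; have bd d : bdm (fun y => dot x y ^+ d).
    by apply: bdmX; apply: eq_bdm (bdm_dot x) => y _; exact: dotC.
  have id d : intg sigma (fun y => dot x y ^+ d * g y).
    by apply: eq_intg (intgM ig (bd d)) => y _; exact: mulrC.
  rewrite -(sintZ _ (id 0%N)).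
  under eq_bigr do rewrite -(sintZ _ (id _)).
  rewrite -(sint_sum hsigma) => [|d _]; last exact: intgZ.
  rewrite -sintD; [|by apply: (intg_sum hsigma) => d _; exact: intgZ|exact: intgZ].
  apply: eq_sint => y _; rewrite /kmix /kN exprDn mulrDl expr0; congr (_ + _); last by ring.
  rewrite !mulr_suml mulr_sumr mulr_suml; apply: eq_bigr => d _.
  by rewrite expr1n mul1r -mulr_natr; ring.
rewrite E//; have : (\sum_(d < N.+1) ((1 - e) / mass R n N * 'C(N, d)%:R) *
    I (fun y => dot x y ^+ d * f t y) + e * I (fun y => dot x y ^+ 0 * f t y)) @[t --> 0^'+] -->
    \sum_(d < N.+1) ((1 - e) / mass R n N * 'C(N, d)%:R) * I (fun y => dot x y ^+ d * f0 y) +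
    e * I (fun y => dot x y ^+ 0 * f0 y).
  apply: cvgD; last by apply: cvgM; [exact: cvg_cst|exact: hmom].
  by apply: cvg_sumr => d _; apply: cvgM; [exact: cvg_cst|exact: hmom].
apply: cvg_trans; apply: near_eq_cvg; near=> t; rewrite E//.
by apply: bI; apply: bdm_smooth; apply: sf; near: t; exact: nbhs_right_gt.
Unshelve. all: by end_near. Qed.

Lemma smooth_pos_bound t : 0 < t ->
  exists2 m : R, 0 < m & forall x, S x -> m <= f t x.
Proof.
move=> t0; have : bdm (fun x => (ext (f t) x)^-1).
  apply: bdm_continuous => x Sx.
  apply: (@continuous_comp _ _ _ (ext (f t)) (@GRing.inv R) x (smooth_continuous (sf t0) Sx)).
  apply: inv_continuous.
  by have := fpos t0 Sx; rewrite -(ext_sphere (f t) Sx) => /lt0r_neq0.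
move=> [_ [M hM]]; exists (`|M| + 1)^-1; first by rewrite invr_gt0 ltr_wpDl.
move=> x Sx; have fx := fpos t0 Sx.
rewrite -[f t x]invrK lef_pV2 ?posrE ?invr_gt0// ?ltr_wpDl//.
have h := hM x Sx; rewrite ext_sphere// gtr0_norm ?invr_gt0// in h.
by rewrite (le_trans h)// (le_trans (ler_norm M))// lerDl.
Qed.

(* Since only the moments of f t are known to converge as t -> 0, the initial
   value of the functional is reached by smoothing f t with a finite rank Markov
   kernel, Jensen's inequality and Gronwall's lemma. *)
Lemma functional_le t : 0 < t -> intg sigma (fun x => th (f0 x)) ->
  A * I (fun x => th (f t x)) + B <=
  expR (A * rateC * t) * (A * I (fun x => th (f0 x)) + B).
Proof.
move=> t0 intth.
(* The constant part fades as N grows: each kernel is positive and the sequence still approximates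
   the identity. *)
pose e (N : nat) : R := N.+1%:R^-1.
have e0 N : 0 < e N by rewrite invr_gt0.
have e1 N : e N <= 1 by rewrite invf_le1// ler1n.
have mk N : markov_kernel sigma (kmix (e N) N) (e N) ((1 - e N) * (2 ^+ N / mass R n N) + e N).
  by apply: markov_kmix => //; rewrite ltW/=.
have [a a0 ha] := smooth_pos_bound t0.
have bft : bdm (f t) by exact: bdm_smooth (sf t0).
have [_ [b hb]] := bft.
have Kab N x : S x -> a <= kop sigma (kmix (e N) N) (f t) x <= b.
  move=> Sx; apply/andP; split.
    rewrite -[leLHS](kop_cst hsigma (mk N) a Sx).
    by apply: (kop_le (mk N) (ltW (e0 N))) => //; apply: bI => //; exact: bdm_cst.
  rewrite -[leRHS](kop_cst hsigma (mk N) b Sx).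
  apply: (kop_le (mk N) (ltW (e0 N))) => //; [exact: bI|apply: bI; exact: bdm_cst|].
  by move=> y Sy; rewrite (le_trans (ler_norm _))// hb.
have cpt : compact (th @` `[a, b]).
  apply: continuous_compact; last exact: segment_compact.
  apply: continuous_in_subspaceT => s /set_mem; rewrite /= in_itv/= => /andP[h _].
  by apply: thc; exact: lt_le_trans h.
have [Bd [_ hB]] := compact_bounded cpt.
have cvg : I (fun x => th (kop sigma (kmix (e N) N) (f t) x)) @[N --> \oo] -->
    I (fun x => th (f t x)).
  apply: (cvg_sint hsigma (M := Bd + 1)).
  - move=> N; apply: (continuous_pos_comp a0 thc).
      exact: (bdm_kop hsigma (mk N) (bI bft)).
    by move=> x Sx; case/andP: (Kab N x Sx).
  - move=> N x Sx; apply: (hB (Bd + 1)); first by rewrite ltrDl.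
    by exists (kop sigma (kmix (e N) N) (f t) x) => //; rewrite /= in_itv/= Kab.
  - move=> x Sx; apply: (@cvg_comp _ _ _ (fun N => kop sigma (kmix (e N) N) (f t) x) th _ (nbhs (f t x))); last first.
      by apply: thc; exact: fpos.
    have ce : e N @[N --> \oo] --> (0 : R) by exact: cvg_harmonic.
    have bF : bdm (ext (f t)).
      by apply: eq_bdm bft => y Sy; rewrite ext_sphere.
    have cK := kop_kN_cvg hn hsigma bF Sx (smooth_continuous (sf t0) Sx).
    have : (1 - e N) * kop sigma (kN N) (ext (f t)) x + e N * I (f t) @[N --> \oo] -->
        (1 - 0) * ext (f t) x + 0 * I (f t).
      apply: cvgD; apply: cvgM => //; last exact: cvg_cst.
      by apply: cvgB => //; exact: cvg_cst.
    rewrite subr0 mul1r mul0r addr0 ext_sphere//; apply: cvg_trans.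
    apply: near_eq_cvg; apply: nearW => N; rewrite (kop_kmix hsigma)//.
    by congr (_ * _ + _); apply: eq_sint => y Sy; rewrite ext_sphere.
have cvg' : A * I (fun x => th (kop sigma (kmix (e N) N) (f t) x)) + B @[N --> \oo] -->
    A * I (fun x => th (f t x)) + B.
  by apply: cvgD; [apply: cvgM => //; exact: cvg_cst|exact: cvg_cst].
apply: (cvgr_to_le cvg'); apply: nearW => N.
apply: (functional_kop_le (mk N) (e0 N)) => // x Sx; exact: kop_kmix_cvg0.
Qed.

End ConvexFunctionals.

(** * Spherical harmonics and moments *)

Section Polynomials.
Variables (R : realType) (n : nat).
Implicit Types (x a : 'rV[R]_n) (p q : mpoly n R) (i j k : 'I_n).

Definition ev p x : R := meval (fun i => x 0 i) p.

Definition lapm p : mpoly n R := \sum_(i < n) mderiv i (mderiv i p).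

Lemma bdm_ev p : bdm (ev p).
Proof.
have : bdm (fun x : 'rV[R]_n => \sum_(m <- msupp p) mcoeff m p * \prod_(i < n) x 0 i ^+ m i).
  apply: bdm_sum => m _; apply: bdmZ; apply: bdm_prod => i _.
  by apply: bdmX; exact: bdm_coord.
by apply: eq_bdm => x _; rewrite /ev mevalE.
Qed.

Lemma mderivXn i p (k : nat) : mderiv i (p ^+ k) = k%:R * p ^+ k.-1 * mderiv i p.
Proof.
elim: k => [|k ih]; first by rewrite expr0 -mpolyC1 mderivC !mul0r.
rewrite exprS mderivM ih /=; case: k {ih} => [|k]; first by rewrite expr0; ring.
rewrite /= exprS -!natr1; ring.
Qed.

Lemma euler_mpoly l p : p \is ishomog1 l mdeg ->
  \sum_(i < n) mpolyX R (mnm1 i) * mderiv i p = l%:R * p.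
Proof.
move=> hp.
have dE i : mderiv i p = \sum_(m <- msupp p) mcoeff m p *: mderiv i (mpolyX R m).
  by rewrite {1}(mpolyE p) raddf_sum; apply: eq_bigr => m _; exact: mderivZ.
under eq_bigr do rewrite dE mulr_sumr.
rewrite exchange_big [in RHS](mpolyE p) mulr_sumr/=; apply: eq_big_seq => m mp.
have ml : mdeg m = l by apply: (dhomog_mf hp).
under eq_bigr do rewrite mderivX -scalerAr.
rewrite -scaler_sumr -scalerAr; congr (_ *: _).
rewrite -ml mdegE natr_sum mulr_suml; apply: eq_bigr => i _.
rewrite -scalerAr -mpolyXD; have [->|mi] := eqVneq (m i) 0%N.
  by rewrite scale0r mul0r.
rewrite addmC submK ?scaler_nat ?mulr_natl//.
by apply/mnm_lepP => j; rewrite mnm1E; case: eqP => // <-; rewrite lt0n.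
Qed.

Lemma mderiv_X i j : mderiv i (mpolyX R (mnm1 j)) = (i == j)%:R.
Proof.
rewrite mderivX mnm1E eq_sym; have [->|_] := eqVneq i j; last by rewrite scale0r.
rewrite scale1r (_ : mnm_sub _ _ = mnm0) ?mpolyX0//.
by apply/mnmP => l; rewrite mnmBE subnn mnm0E.
Qed.

Lemma hd_ev p (c : R -> 'rV[R]_n) (t : R) (v : 'I_n -> R) :
  (forall k, is_derive t (1 : R) (fun s : R => c s 0 k) (v k)) ->
  is_derive t (1 : R) (fun s : R => ev p (c s)) (\sum_k v k * ev (mderiv k p) (c t)).
Proof.
move=> hc.
have hX (m : multinom n) : is_derive t (1 : R) (fun s : R => ev (mpolyX R m) (c s))
    (\sum_k v k * ev (mderiv k (mpolyX R m)) (c t)).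
  rewrite mpolyXE_id || rewrite mpolyXE.
  apply: (@big_rec _ (fun q : mpoly n R => is_derive t (1 : R) (fun s : R => ev q (c s))
    (\sum_k v k * ev (mderiv k q) (c t)))).
    have h1 : is_derive t (1 : R) (fun s : R => ev (1 : mpoly n R) (c s)) 0.
      by apply: hd_eq (hd_cst 1 t) => s; rewrite /ev meval1.
    apply: is_derive_eq h1 _.
    by rewrite big1// => k _; rewrite -mpolyC1 mderivC /ev meval0 mulr0.
  move=> i q _ hq.
  have hi := hdX (m i) (hc i).
  have h1 : is_derive t (1 : R) (fun s : R => ev (mpolyX R (mnm1 i) ^+ m i * q) (c s))
    ((m i)%:R * c t 0 i ^+ (m i).-1 * v i * ev q (c t) + c t 0 i ^+ m i * \sum_k v k * ev (mderiv k q) (c t)).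
    by apply: hd_eq (hdM hi hq) => s; rewrite /ev mevalM rmorphXn/= mevalXU.
  apply: is_derive_eq h1 _.
    rewrite /ev; transitivity (\sum_k v k * (((m i)%:R * c t 0 i ^+ (m i).-1 * (i == k)%:R) *
      meval (fun i => c t 0 i) q + c t 0 i ^+ m i * meval (fun i => c t 0 i) (mderiv k q))).
      under [in RHS]eq_bigr do rewrite mulrDr; rewrite big_split/=; congr (_ + _).
        rewrite (bigD1 i)//= eqxx big1 ?addr0 => [|k /negPf ki].
          by rewrite mulr1; ring.
        by rewrite eq_sym ki !mulr0 mul0r mulr0.
      by rewrite mulr_sumr; apply: eq_bigr => k _; rewrite mulrCA.
    apply: eq_bigr => k _; congr (_ * _); rewrite mderivM mevalD !mevalM; congr (_ * _ + _ * _).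
      by rewrite mderivXn !mevalM rmorphXn/= mevalXU rmorph_nat mderiv_X rmorph_nat eq_sym.
    by rewrite rmorphXn/= mevalXU.
have E q x : ev q x = \sum_(m <- msupp q) mcoeff m q * ev (mpolyX R m) x.
  rewrite {1}(mpolyE q) /ev raddf_sum; apply: eq_bigr => m _; exact: mevalZ.
have dE k : ev (mderiv k p) (c t) = \sum_(m <- msupp p) mcoeff m p * ev (mderiv k (mpolyX R m)) (c t).
  rewrite {1}(mpolyE p) raddf_sum /ev /= raddf_sum; apply: eq_bigr => m _.
  by rewrite /= mderivZ mevalZ.
apply: (@hd_eq _ (fun s : R => \sum_(m <- msupp p) mcoeff m p * ev (mpolyX R m) (c s))).
  by move=> s; rewrite -E.
have h := @hd_sum R _ (msupp p) xpredT _ t _ (fun m _ => hdZ (mcoeff m p) (hX m)).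
apply: is_derive_eq h _; under [RHS]eq_bigr do rewrite dE mulr_sumr.
rewrite exchange_big/=; apply: eq_bigr => m _; rewrite mulr_sumr.
by apply: eq_bigr => k _; rewrite mulrCA.
Qed.

Section Zonal.
Variable a : 'rV[R]_n.
Hypothesis aa : dot a a = 1.

Definition linp : mpoly n R := \sum_(i < n) mpolyC n (a 0 i) * mpolyX R (mnm1 i).
Definition sqrp : mpoly n R := \sum_(i < n) mpolyX R (mnm1 i) ^+ 2.

Lemma ev_linp x : ev linp x = dot x a.
Proof.
rewrite /ev raddf_sum; apply: eq_bigr => i _.
by rewrite /= mevalM mevalC mevalXU mulrC.
Qed.

Lemma ev_sqrp x : ev sqrp x = dot x x.
Proof.
rewrite /ev raddf_sum; apply: eq_bigr => i _.
by rewrite /= rmorphXn/= mevalXU expr2.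
Qed.

Lemma mderiv_linp i : mderiv i linp = mpolyC n (a 0 i).
Proof.
rewrite /linp raddf_sum (bigD1 i)//= big1 ?addr0 => [|j ji];
  rewrite mderivM mderivC mul0r add0r mderiv_X ?eqxx ?mulr1//.
by rewrite eq_sym (negPf ji) mulr0.
Qed.

Lemma mderiv_sqrp i : mderiv i sqrp = 2 * mpolyX R (mnm1 i).
Proof.
rewrite /sqrp raddf_sum (bigD1 i)//= big1 ?addr0 => [|j ji];
  rewrite mderivXn mderiv_X ?eqxx ?mulr1 ?expr1//.
by rewrite eq_sym (negPf ji) mulr0.
Qed.

(** The Laplacian of (a . x)^p |x|^(2 q) has two terms, one losing two factors a . x, the other one
    factor |x|^2. The truncated exponents are harmless, being multiplied by 0. *)
Lemma lapm_zonal (p q : nat) : lapm (linp ^+ p * sqrp ^+ q) =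
  (p * p.-1)%:R * (linp ^+ p.-2 * sqrp ^+ q) +
  (2 * q)%:R * ((2 * q)%:R + (2 * p)%:R + n%:R - 2) * (linp ^+ p * sqrp ^+ q.-1).
Proof.
set L := linp; set Q := sqrp; pose X i := mpolyX R (mnm1 i); pose A i := mpolyC n (a 0 i).
have E i : mderiv i (mderiv i (L ^+ p * Q ^+ q)) =
   (p * p.-1)%:R * (L ^+ p.-2 * Q ^+ q) * (A i * A i) +
   ((4 * (p * q))%:R * (L ^+ p.-1 * Q ^+ q.-1)) * (A i * X i) +
   ((4 * (q * q.-1))%:R * (L ^+ p * Q ^+ q.-2)) * (X i ^+ 2) +
   (2 * q)%:R * (L ^+ p * Q ^+ q.-1).
  rewrite mderivM !mderivXn mderiv_linp mderiv_sqrp.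
  rewrite mderivD !mderivM !mderivXn mderiv_linp mderiv_sqrp mderivC mderiv_X eqxx.
  rewrite -!mpolyC_nat !mderivC !mpolyC_nat !natrM !mulr1n -/(X i) -/(A i); ring.
rewrite /lapm; under eq_bigr do rewrite E.
rewrite !big_split/= -!mulr_sumr sumr_const card_ord.
have -> : \sum_(i < n) A i * A i = 1.
  by rewrite -[RHS]mpolyC1 -aa /dot raddf_sum; apply: eq_bigr => i _; rewrite /= mpolyCM.
rewrite -/L -/sqrp -/Q -mulr_natr mulr1.
have hL : p%:R * (L ^+ p.-1 * L) = p%:R * L ^+ p :> mpoly n R.
  by case: (p) => [|p']; rewrite ?mul0r//= -exprSr.
have hQ : q.-1%:R * (Q ^+ q.-2 * Q) = q.-1%:R * Q ^+ q.-1 :> mpoly n R.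
  by case: (q) => [|[|q']]; rewrite ?mul0r//= -exprSr.
have -> : (4 * (p * q))%:R * (L ^+ p.-1 * Q ^+ q.-1) * L =
    (4 * q)%:R * Q ^+ q.-1 * (p%:R * (L ^+ p.-1 * L)) by rewrite !natrM; ring.
have -> : (4 * (q * q.-1))%:R * (L ^+ p * Q ^+ q.-2) * Q =
    (4 * q)%:R * L ^+ p * (q.-1%:R * (Q ^+ q.-2 * Q)) by rewrite !natrM; ring.
rewrite hL hQ !natrM; case: (q) => [|q']; first by rewrite !mul0r; ring.
by rewrite /= -natr1; ring.
Qed.

End Zonal.

End Polynomials.

Section Harmonics.
Variables (R : realType) (n : nat) (sigma : probability (borel R n) R).
Hypotheses (hn : (2 <= n)%N) (hsigma : is_uniform sigma).
Implicit Types (x y a : 'rV[R]_n) (p : mpoly n R) (i j k : 'I_n) (l d : nat).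

Local Notation S := (sphere R n).
Local Notation I := (sint sigma).
Local Notation bI := (intg_bdm hsigma).

Definition E1 p i j x : R := x 0 i * ev (mderiv j p) x - x 0 j * ev (mderiv i p) x.

Definition E2 p i j x : R :=
  (dcoord i j i x * ev (mderiv j p) x + x 0 i * E1 (mderiv j p) i j x) -
  (dcoord i j j x * ev (mderiv i p) x + x 0 j * E1 (mderiv i p) i j x).

Lemma rd_ev p i j : rd i j (ev p) (E1 p i j).
Proof.
move=> x Sx; rewrite /E1 -(sum_dcoord i j x (fun k => ev (mderiv k p) x)).
have := @hd_ev R n p (fun a : R => x *m rotmx i j a) 0 (fun k => dcoord i j k x).
by rewrite rotmx0 mulmx1; apply=> k; exact: rd_coord.
Qed.

Lemma rd_E1 p i j : rd i j (E1 p i j) (E2 p i j).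
Proof. exact: rdB (rdM (rd_coord i j i) (rd_ev _ i j)) (rdM (rd_coord i j j) (rd_ev _ i j)). Qed.

Lemma bdm_E1 p i j : bdm (E1 p i j).
Proof. by apply: bdmB; apply: bdmM; try exact: bdm_coord; exact: bdm_ev. Qed.

Lemma bdm_E2 p i j : bdm (E2 p i j).
Proof.
have bd u v k : bdm (dcoord u v k : 'rV[R]_n -> R).
  by rewrite /dcoord; apply: bdmB; case: (k == _) => /=;
    rewrite ?mulr1n ?mulr0n; try exact: bdm_coord; exact: bdm_cst.
by apply: bdmB; apply: bdmD; apply: bdmM => //; try exact: bdm_coord; try exact: bdm_ev; exact: bdm_E1.
Qed.

Lemma euler_ev l p x : p \is ishomog1 l mdeg ->
  \sum_k x 0 k * ev (mderiv k p) x = l%:R * ev p x.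
Proof.
move=> hp; have := congr1 (meval (fun i => x 0 i)) (euler_mpoly hp).
rewrite mevalM rmorph_nat raddf_sum => <-; apply: eq_bigr => k _.
by rewrite /= mevalM mevalXU.
Qed.

Lemma euler2_ev l p x : p \is ishomog1 l mdeg ->
  \sum_i \sum_j x 0 i * x 0 j * ev (mderiv i (mderiv j p)) x = (l%:R * (l%:R - 1)) * ev p x.
Proof.
move=> hp; have eu := euler_ev x hp.
have h i : ev (mderiv i p) x + \sum_j x 0 j * ev (mderiv i (mderiv j p)) x = l%:R * ev (mderiv i p) x.
  have := congr1 (fun q => ev (mderiv i q) x) (euler_mpoly hp).
  have -> : ev (mderiv i (l%:R * p)) x = l%:R * ev (mderiv i p) x.
    by rewrite mderivM -mpolyC_nat mderivC mul0r add0r mpolyC_nat /ev mevalM rmorph_nat.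
  move=> <-; rewrite (_ : mderiv i (\sum_(k < n) _) =
    \sum_(k < n) mderiv i (mpolyX R (mnm1 k) * mderiv k p)); last exact: raddf_sum.
  rewrite /ev [RHS]raddf_sum /=.
  under [RHS]eq_bigr do rewrite mderivM mevalD !mevalM mderiv_X rmorph_nat mevalXU.
  rewrite big_split/=; congr (_ + _).
  by rewrite (bigD1 i)//= eqxx mul1r big1 ?addr0// => k /negPf; rewrite eq_sym => ->; rewrite mul0r.
have : \sum_i x 0 i * (ev (mderiv i p) x + \sum_j x 0 j * ev (mderiv i (mderiv j p)) x) =
    l%:R * (l%:R * ev p x).
  rewrite -eu mulr_sumr; apply: eq_bigr => i _; rewrite h; ring.
under eq_bigr do rewrite mulrDr.
rewrite big_split/= eu => hh.
transitivity (\sum_i x 0 i * \sum_j x 0 j * ev (mderiv i (mderiv j p)) x).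
  by apply: eq_bigr => i _; rewrite mulr_sumr; apply: eq_bigr => j _; rewrite mulrA.
by apply/eqP; rewrite eq_sym -(inj_eq (addrI (l%:R * ev p x))) hh; apply/eqP; ring.
Qed.

Lemma sum_E2 l p x : p \is ishomog1 l mdeg -> lapm p = 0 -> S x ->
  \sum_i \sum_j E2 p i j x = - (2 * (l * (l + n - 2))%:R) * ev p x.
Proof.
move=> hp lp Sx; have /sphereP xx := Sx.
have E i j : E2 p i j x =
    (x 0 i * ev (mderiv j p) x) *+ (i == j) + (x 0 j * ev (mderiv i p) x) *+ (i == j)
    - x 0 j * ev (mderiv j p) x - x 0 i * ev (mderiv i p) x
    + x 0 i * x 0 i * ev (mderiv j (mderiv j p)) x + x 0 j * x 0 j * ev (mderiv i (mderiv i p)) x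
    - x 0 i * x 0 j * ev (mderiv i (mderiv j p)) x - x 0 j * x 0 i * ev (mderiv j (mderiv i p)) x.
  rewrite /E2 /E1 /dcoord !eqxx (eq_sym j i); have [->|_] := eqVneq i j.
    rewrite !mulr1n; move: (ev (mderiv j p) x) (ev (mderiv j (mderiv j p)) x) (x 0 j) => u v w; ring.
  rewrite !mulr1n !mulr0n; move: (ev (mderiv j (mderiv j p)) x) (ev (mderiv i (mderiv i p)) x)
    (ev (mderiv i (mderiv j p)) x) (ev (mderiv j (mderiv i p)) x) => c d e g.
  move: (ev (mderiv j p) x) (ev (mderiv i p) x) (x 0 i) (x 0 j) => u v w z; ring.
under eq_bigr do under eq_bigr do rewrite E.
rewrite (lap_algebra hn (euler_ev x hp) (euler2_ev x hp) xx).
have -> : \sum_i ev (mderiv i (mderiv i p)) x = 0.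
  have h : ev (lapm p) x = 0 by rewrite lp /ev meval0.
  by rewrite -[RHS]h /lapm /ev [RHS]raddf_sum.
have -> : (l * (l + n - 2))%:R = l%:R * (l%:R + n%:R - 2) :> R.
  by rewrite natrM natrB ?natrD// (leq_trans hn)// leq_addl.
have -> : n.-1%:R = n%:R - 1 :> R by rewrite -[in RHS](prednK (ltnW hn)) -natr1 addrK.
ring.
Qed.

Lemma spherical_harmonicP l (Y : 'rV[R]_n -> R) : spherical_harmonic l Y <->
  exists p, [/\ p \is ishomog1 l mdeg, lapm p = 0 & Y = ev p].
Proof.
split=> -[p [h1 h2 h3]]; exists p; split=> //; first exact/funext.
by rewrite h3.
Qed.

Lemma bdm_harmonic l Y : spherical_harmonic l Y -> bdm (Y : 'rV[R]_n -> R).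
Proof. by move=> /spherical_harmonicP[p [_ _ ->]]; exact: bdm_ev. Qed.

Lemma hd_powd d (u : R) : is_derive u (1 : R) (fun v : R => v ^+ d) (d%:R * u ^+ d.-1).
Proof. by apply: is_derive_eq (hdX d (hd_id u)) _; rewrite mulr1. Qed.

Lemma lapz_powd d (u : R) : lapz n (d%:R * u ^+ d.-1) (d%:R * (d.-1%:R * u ^+ d.-2)) u =
  (d * d.-1)%:R * u ^+ d.-2 - (d * (d + n - 2))%:R * u ^+ d.
Proof.
have -> : (d * (d + n - 2))%:R = d%:R * (d%:R + n.-1%:R - 1) :> R.
  case: d => [|d]; first by rewrite !mul0r.
  have -> : (d.+1 + n - 2 = d + n.-1)%N.
    by case: (n) hn => [//|m _]; rewrite addSn addnS !subSS subn0.
  by rewrite natrM natrD -(natr1 d); ring.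
rewrite /lapz natrM; case: d => [|[|d]]; rewrite /= ?expr0 ?expr1; try by ring.
by rewrite !exprS -!natr1; ring.
Qed.

(** Induction on d. Green's formula equates - l (l + n - 2) times the integral with - d (d + n - 2)
    times it, up to the moment of order d - 2, which vanishes by induction; these factors differ
    when d < l. *)
Lemma sint_zonal_harmonic l Y d y : spherical_harmonic l Y -> S y -> (d < l)%N ->
  I (fun x => dot x y ^+ d * Y x) = 0.
Proof.
move=> /spherical_harmonicP[p [hp lp ->]] Sy.
elim/ltn_ind: d => d ih dl.
have cc : continuous (fun v : R => d%:R * (d.-1%:R * v ^+ d.-2)).
  have -> : (fun v : R => d%:R * (d.-1%:R * v ^+ d.-2)) =
      fun v => (d%:R * d.-1%:R) * v ^+ d.-2 by apply/funext => v; rewrite mulrA.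
  by move=> u; exact: hd_continuous (hdZ (d%:R * d.-1%:R) (hd_powd d.-2 u)).
have := sint_zonal_parts hn hsigma Sy (hd_powd d)
  (fun u : R => hdZ d%:R (hd_powd d.-1 u)) cc (rd_ev p) (rd_E1 p) (bdm_ev p) (bdm_E1 p) (bdm_E2 p).
have b m : bdm (fun x => dot x y ^+ m * ev p x).
  by apply: bdmM; [apply: bdmX; exact: bdm_dot|exact: bdm_ev].
have bE i j : bdm (fun x => dot x y ^+ d * E2 p i j x).
  by apply: bdmM; [apply: bdmX; exact: bdm_dot|exact: bdm_E2].
have -> : 2^-1 * \sum_i \sum_j I (fun x => dot x y ^+ d * E2 p i j x) =
    - (l * (l + n - 2))%:R * I (fun x => dot x y ^+ d * ev p x).
  rewrite -sintZ; last exact: bI.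
  under eq_bigr => i _.
    rewrite -(sint_sum hsigma) => [|j _]; last exact: bI.
    over.
  rewrite -(sint_sum hsigma) => [|i _]; last by apply: bI; exact: bdm_sum.
  rewrite -sintZ; last by apply: bI; apply: bdm_sum => i _; exact: bdm_sum.
  apply: eq_sint => x Sx.
  have -> : \sum_i \sum_j dot x y ^+ d * E2 p i j x = dot x y ^+ d * \sum_i \sum_j E2 p i j x.
    by rewrite mulr_sumr; apply: eq_bigr => i _; rewrite mulr_sumr.
  rewrite (sum_E2 hp lp Sx); move: (ev p x) (dot x y ^+ d) => e u; by field.
set A := I _; have -> : A = (d * d.-1)%:R * I (fun x => dot x y ^+ d.-2 * ev p x) -
    (d * (d + n - 2))%:R * I (fun x => dot x y ^+ d * ev p x).
  rewrite /A -(sintZ _ (bI (b d.-2))) -(sintZ _ (bI (b d))) -sintB; try (apply: bI; exact: bdmZ).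
  by apply: eq_sint => x _; rewrite lapz_powd; ring.
have -> : (d * d.-1)%:R * I (fun x => dot x y ^+ d.-2 * ev p x) = 0.
  case: d ih dl {A cc bE} => [|[|d]] ih dl; rewrite ?mul0r//.
  by rewrite ih ?mulr0//=; apply: ltn_trans dl; rewrite ?ltnS//; apply: ltn_trans (ltnSn _).
move=> /eqP; rewrite sub0r -subr_eq0 -mulNr -mulrBl mulf_eq0 opprK => /orP[|/eqP//].
rewrite addrC subr_eq0 eqr_nat => /eqP E; exfalso.
have : (d * (d + n - 2) < l * (l + n - 2))%N.
  have l0 : (0 < l)%N by apply: leq_ltn_trans dl.
  apply: (@leq_ltn_trans (d * (l + n - 2))).
    by rewrite leq_mul2l leq_sub2r ?orbT// leq_add2r ltnW.
  by rewrite ltn_pmul2r// subn_gt0 (leq_trans _ (leq_add l0 hn)).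
by rewrite E ltnn.
Qed.

End Harmonics.

Section ZonalHarmonics.
Variables (R : realType) (n : nat).
Hypothesis hn : (2 <= n)%N.
Implicit Types (x y a : 'rV[R]_n) (d b : nat).

Local Notation S := (sphere R n).

(** The factor with which the Laplacian of the term b + 1 of the zonal polynomial falls on the
    monomial left by the term b. *)
Definition zonal_den d b : R :=
  (2 * b.+1)%:R * ((2 * b.+1)%:R + (2 * (d - 2 * b.+1))%:R + n%:R - 2).

(** Coefficients of the Gegenbauer polynomial, normalised to leading coefficient 1 and homogenised
    by powers of |x|^2. *)
Fixpoint zonal_coef d b : R :=
  if b is b'.+1 then
    - zonal_coef d b' * ((d - 2 * b') * (d - 2 * b').-1)%:R / zonal_den d b'
  else 1.

Definition zonal_term d a b : mpoly n R :=
  mpolyC n (zonal_coef d b) * (linp a ^+ (d - 2 * b) * sqrp R n ^+ b).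

Definition zonal_poly d a : mpoly n R := \sum_(b < d./2.+1) zonal_term d a b.

Lemma zonal_den_gt0 d b : 0 < zonal_den d b.
Proof.
by rewrite /zonal_den mulr_gt0 ?ltr0n// -addrA ltr_wpDr ?subr_ge0 ?(ler_nat _ 2)// ltr_wpDr// ltr0n.
Qed.

Lemma lapmCM (c : R) (p : mpoly n R) : lapm (mpolyC n c * p) = mpolyC n c * lapm p.
Proof.
rewrite /lapm mulr_sumr; apply: eq_bigr => i _.
by rewrite !(mderivM, mderivC, mul0r, add0r).
Qed.

Lemma lapm_sum (K : nat) (F : 'I_K -> mpoly n R) : lapm (\sum_b F b) = \sum_b lapm (F b).
Proof.
rewrite /lapm exchange_big/=; apply: eq_bigr => i _.
by rewrite [X in mderiv i X]raddf_sum [LHS]raddf_sum.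
Qed.

(** Consecutive Laplacians cancel, so that only the part left by the last term survives. Its
    coefficient vanishes when d - 2 K is 0 or 1, that is, for K = d / 2 rounded down. *)
Lemma lapm_zonal_partial d a (K : nat) : dot a a = 1 -> (K <= d./2)%N ->
  \sum_(b < K.+1) lapm (zonal_term d a b) =
  mpolyC n (zonal_coef d K * ((d - 2 * K) * (d - 2 * K).-1)%:R) *
    (linp a ^+ (d - 2 * K).-2 * sqrp R n ^+ K).
Proof.
move=> aa; elim: K => [_|K ih Kd].
  rewrite big_ord1 /zonal_term lapmCM (lapm_zonal aa) muln0 !mul0r addr0 mpolyCM mpolyC_nat.
  by rewrite -mulrA.
rewrite big_ord_recr ih ?(ltnW Kd)//= /zonal_term lapmCM (lapm_zonal aa) mulrDr addrCA.
rewrite -[RHS]addr0; congr (_ + _); first by rewrite -/(zonal_coef d K.+1) mulrA -mpolyC_nat -mpolyCM.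
have -> : (d - 2 * K).-2 = (d - 2 * K.+1)%N by rewrite mulnS addnC subnDA subn2.
have h : zonal_coef d K.+1 * zonal_den d K = - (zonal_coef d K * ((d - 2 * K) * (d - 2 * K).-1)%:R).
  by rewrite /= mulfVK ?gt_eqF ?zonal_den_gt0// mulNr.
have := congr1 (@mpolyC n R) h.
rewrite mpolyCN mpolyCM => /eqP; rewrite -addr_eq0 => /eqP h'.
have hd : mpolyC n (zonal_den d K) =
    (2 * K.+1)%:R * ((2 * K.+1)%:R + (2 * (d - 2 * K.+1))%:R + n%:R - 2).
  by rewrite /zonal_den !(mpolyCM, mpolyCD, mpolyCN, mpolyC_nat).
rewrite hd in h'.
by rewrite -[RHS](mul0r (linp a ^+ (d - 2 * K.+1) * sqrp R n ^+ K)) -h' mulrDl addrC -!mulrA.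
Qed.

Lemma lapm_zonal_poly d a : dot a a = 1 -> lapm (zonal_poly d a) = 0.
Proof.
move=> aa; rewrite /zonal_poly lapm_sum lapm_zonal_partial//.
have -> : ((d - 2 * d./2) * (d - 2 * d./2).-1 = 0)%N.
  rewrite mul2n -{1 3}(odd_double_half d) addnK; by case: (odd d).
by rewrite mulr0 mpolyC0 mul0r.
Qed.

Lemma zonal_poly_homog d a : zonal_poly d a \is ishomog1 d mdeg.
Proof.
rewrite /zonal_poly; apply: rpred_sum => -[b /= bd] _; rewrite /zonal_term mul_mpolyC; apply: rpredZ.
have hb : (2 * b <= d)%N.
  rewrite -[leqRHS](odd_double_half d) mul2n; apply: leq_trans (leq_addl _ _).
  by rewrite leq_double -ltnS.
have hl : linp a \is ishomog1 1 mdeg.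
  apply: rpred_sum => i _; rewrite mul_mpolyC; apply: rpredZ.
  by rewrite dhomogX; apply/eqP; exact: mdeg1.
have hs : sqrp R n \is ishomog1 2 mdeg.
  apply: rpred_sum => i _; rewrite expr2 (_ : 2 = 1 + 1)%N//.
  by apply: dhomogM; rewrite dhomogX; apply/eqP; exact: mdeg1.
have := dhomogM (dhomogMn (d - 2 * b) hl) (dhomogMn b hs).
by rewrite mul1n subnK.
Qed.

Lemma zonal_harmonic d a x : S x -> ev (zonal_poly d a) x =
  dot x a ^+ d + \sum_(b < d./2) zonal_coef d b.+1 * dot x a ^+ (d - 2 * b.+1).
Proof.
move=> /sphereP xx; rewrite /ev /zonal_poly raddf_sum/= big_ord_recl; congr (_ + _).
  rewrite /zonal_term /= muln0 subn0 mulr1 mpolyC1 mul1r rmorphXn/=.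
  by rewrite -/(ev _ _) ev_linp.
apply: eq_bigr => b _; rewrite /zonal_term !mevalM mevalC !rmorphXn/= -/(ev _ _) ev_linp.
by rewrite -/(ev _ _) ev_sqrp xx expr1n mulr1.
Qed.

Lemma spherical_harmonic_zonal d a : S a -> spherical_harmonic d (ev (zonal_poly d a)).
Proof.
move=> /sphereP aa; apply/spherical_harmonicP; exists (zonal_poly d a); split=> //.
  exact: zonal_poly_homog.
exact: lapm_zonal_poly.
Qed.

End ZonalHarmonics.

(** * Measures with a density, and pairings controlled by Sobolev norms *)

Section Densities.
Variables (R : realType) (n : nat) (sigma : probability (borel R n) R).
Hypothesis hsigma : is_uniform sigma.
Variables (mu0 : {measure set (borel R n) -> \bar R}) (g : 'rV[R]_n -> R).
Hypothesis hg : has_density sigma mu0 g.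

Local Notation S := (sphere R n).
Local Notation I := (sint sigma).
Local Notation bI := (intg_bdm hsigma).
Local Notation mS := (measurable_sphere R n).

Let mg : measurable_fun (S : set (borel R n)) (fun x => (g x)%:E).
Proof. by apply/measurable_EFinP; case: hg. Qed.

Let g0 x : S x -> (0 <= (g x)%:E)%E.
Proof. by move=> Sx; rewrite lee_fin; case: hg => _ h _; exact: h. Qed.

Let density_indic (E : set (borel R n)) : measurable E ->
  (\int[mu0]_x (\1_E x)%:E = \int[sigma]_(x in S) ((g x)%:E * (\1_E x)%:E))%E.
Proof.
move=> mE; rewrite integral_indic// setIT; case: hg => _ _ ->//.
rewrite setIC integral_mkcondr; apply: eq_integral => x _.
by rewrite patchE indicE; case: ifPn => h; rewrite ?mule1 ?mule0.
Qed.

Import HBNNSimple.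

Let density_nnsfun (f : {nnsfun (borel R n) >-> R}) :
  (\int[mu0]_x (f x)%:E = \int[sigma]_(x in S) ((g x)%:E * (f x)%:E))%E.
Proof.
under [LHS]eq_integral do rewrite fimfunE -fsumEFin//.
rewrite [LHS]ge0_integral_fsum//; last 2 first.
  - by move=> r; exact/measurable_EFinP/measurableT_comp.
  - by move=> m x _; rewrite EFinM nnfun_muleindic_ge0.
under [RHS]eq_integral.
  move=> x xD; rewrite fimfunE -fsumEFin// ge0_mule_fsumr; last first.
    by move=> r; rewrite EFinM nnfun_muleindic_ge0.
  over.
have mi r : measurable_fun (S : set (borel R n)) (fun x => (r * \1_(f @^-1` [set r]) x)%:E).
  by apply/measurable_funTS/measurable_EFinP; do 2 apply/measurableT_comp => //.
rewrite [RHS]ge0_integral_fsum//; last 3 first.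
  - exact: mS.
  - by move=> r; apply: emeasurable_funM => //; exact: mi.
  - move=> m x Sx; rewrite mule_ge0// ?EFinM ?nnfun_muleindic_ge0//; exact: g0.
apply: eq_fsbigr => r _.
rewrite integralZl_indic_nnsfun//= density_indic//.
have [r0|r0] := leP 0 r; last first.
  rewrite preimage_nnfun0// indic0/=.
  under eq_integral do rewrite mule0.
  rewrite integral0 mule0; apply/esym.
  under eq_integral do rewrite mulr0 mule0.
  by rewrite integral0.
rewrite -ge0_integralZl//; [|exact: mS| |].
- by apply: eq_integral => x _; rewrite EFinM muleCA.
- apply: emeasurable_funM => //; apply/measurable_funTS/measurable_EFinP.
  exact: measurable_indic.
- by move=> x Sx; rewrite mule_ge0// ?lee_fin//; exact: g0.
Qed.

(** From indicators to simple functions, then by monotone convergence on both sides. *)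
Lemma ge0_density (f : borel R n -> \bar R) : measurable_fun setT f -> (forall x, 0 <= f x)%E ->
  (\int[mu0]_x f x = \int[sigma]_(x in S) ((g x)%:E * f x))%E.
Proof.
move=> mf f0.
pose f_ := nnsfun_approx measurableT mf.
have cf x : (f_ m x)%:E @[m --> \oo] --> f x by exact: cvg_nnsfun_approx.
transitivity (lim (\int[mu0]_x (f_ m x)%:E @[m --> \oo])%E).
  rewrite -monotone_convergence//=.
  - by apply: eq_integral => x _; apply/esym/cvg_lim => //=.
  - by move=> m; exact/measurable_EFinP/measurable_funTS.
  - by move=> m x _; rewrite lee_fin.
  - by move=> x _ m m' mm; rewrite lee_fin; exact/lefP/nd_nnsfun_approx.
rewrite (_ : (fun m => _) = (fun m => (\int[sigma]_(x in S) ((g x)%:E * (f_ m x)%:E))%E)); last first.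
  by apply/funext => m; exact: density_nnsfun.
rewrite -monotone_convergence//=.
- apply: eq_integral => x _; apply/cvg_lim => //=.
  by apply: cvgeZl => //.
- exact: mS.
- move=> m; apply: emeasurable_funM => //.
  exact/measurable_EFinP/measurable_funTS.
- by move=> m x Sx; rewrite mule_ge0// ?lee_fin//; exact: g0.
- move=> x Sx m m' mm; apply: lee_wpmul2l; first exact: g0.
  by rewrite lee_fin; exact/lefP/nd_nnsfun_approx.
Qed.

Variable rho : R.
Hypothesis mrho : mu0 S = rho%:E.

Lemma intg_density : intg sigma g /\ I g = rho.
Proof.
have h : (\int[sigma]_(x in S) (g x)%:E = rho%:E)%E.
  by rewrite -mrho; case: hg => _ _ ->; rewrite ?setIid//; exact: mS.
split; last by rewrite /sint /Rintegral h.
apply/integrableP; split=> //.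
have -> : (\int[sigma]_(x in S) `|(EFin \o g) x| = \int[sigma]_(x in S) (g x)%:E)%E.
  by apply: eq_integral => x /set_mem Sx; rewrite gee0_abs//; exact: g0.
by rewrite h ltry.
Qed.

Lemma dist_density Y : bdm Y -> dist_of_meas mu0 Y = I (fun x => g x * Y x).
Proof.
move=> bY; have [mY [M hM]] := bY; have [ig Ig] := intg_density.
have M0 : 0 <= `|M| by [].
have key (f : 'rV[R]_n -> R) : bdm f -> (forall x, S x -> 0 <= f x) ->
    (\int[mu0]_(x in S) (f x)%:E = (I (fun x => g x * f x))%:E)%E.
  move=> bf f0; rewrite integral_mkcond ge0_density.
  - rewrite /sint /Rintegral fineK; last first.
      by apply: integrable_fin_num; [exact: mS|exact: intgM].
    by apply: eq_integral => x xS; rewrite patchE xS.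
  - by apply/(measurable_restrictT _ mS)/measurable_EFinP; case: bf.
  - by move=> x; rewrite patchE; case: ifPn => // /set_mem /f0; rewrite lee_fin.
have bM : bdm (fun _ : 'rV[R]_n => `|M|) by exact: bdm_cst.
(* The change of measure is available for nonnegative functions; Y is shifted by a bound and the
   constant subtracted afterwards. *)
have bYM : bdm (fun x => Y x + `|M|) by exact: bdmD.
have Y0 x : S x -> 0 <= Y x + `|M|.
  move=> Sx; have := hM _ Sx; have := ler_norm M; have := ler_norm (- Y x).
  by rewrite normrN; lra.
have hYM := key _ bYM Y0; have hMM := key _ bM (fun _ _ => M0).
have finS : (mu0 S < +oo)%E by rewrite mrho ltry.
have muint (f : 'rV[R]_n -> R) : bdm f -> mu0.-integrable (S : set (borel R n)) (EFin \o f).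
  move=> [mf [B hB]]; apply: measurable_bounded_integrable => //; first exact: mS.
  exists B; split; first exact: num_real.
  by move=> N BN x Sx; rewrite /= (le_trans (hB _ Sx))// ltW.
have : (\int[mu0]_(x in S) (Y x)%:E = (I (fun x => g x * Y x))%:E)%E.
  have -> : (\int[mu0]_(x in S) (Y x)%:E =
     \int[mu0]_(x in S) (Y x + `|M|)%:E - \int[mu0]_(x in S) (`|M|)%:E)%E.
    rewrite -integralB_EFin; [|exact: mS|exact: muint|exact: muint].
    by apply: eq_integral => x _; rewrite -EFinB addrK.
  rewrite hYM hMM -EFinB -sintB; [|exact: intgM|exact: intgM].
  by congr (_%:E); apply: eq_sint => x _; ring.
by rewrite /dist_of_meas /Rintegral => ->.
Qed.

End Densities.

Section EnergyOfNorm.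
Variables (R : realType) (n : nat) (sigma : probability (borel R n) R).
Hypotheses (hn : (2 <= n)%N) (hsigma : is_uniform sigma).
Implicit Types (T : Defs.distribution R n) (l : nat) (s : R).

Local Notation S := (sphere R n).
Local Notation I := (sint sigma).
Local Notation bI := (intg_bdm hsigma).

Definition weight l s : R := (1 + (l * (l + n - 2))%:R) `^ s.

Lemma weight_gt0 l s : 0 < weight l s.
Proof. by rewrite powR_gt0// ltr_pwDl. Qed.

Lemma harmonic_energy_ge0 l T : (0 <= harmonic_energy sigma l T)%E.
Proof.
apply: (@le_trans _ _ (T (fun=> 0) ^+ 2)%:E); first by rewrite lee_fin sqr_ge0.
apply: ereal_sup_ubound; exists (fun=> 0) => //; split.
  apply/spherical_harmonicP; exists 0; split; first exact: rpred0.
    by rewrite /lapm big1// => i _; rewrite !raddf0.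
  by apply/funext => x; rewrite /ev meval0.
by rewrite -/(I _) (sint_cst hsigma) expr0n.
Qed.

Definition weighted_energy s T : \bar R :=
  (\sum_(0 <= l <oo) (weight l s)%:E * harmonic_energy sigma l T)%E.

Let term_ge0 s T l : (0 <= (weight l s)%:E * harmonic_energy sigma l T)%E.
Proof. by rewrite mule_ge0 ?harmonic_energy_ge0// lee_fin ltW ?weight_gt0. Qed.

Lemma weighted_energy_ge0 s T : (0 <= weighted_energy s T)%E.
Proof. by apply: nneseries_ge0 => l _ _; exact: term_ge0. Qed.

Lemma HnormE s T : Hnorm sigma s T = (weighted_energy s T `^ 2^-1)%E.
Proof. by []. Qed.

Lemma term_le_energy s T l : ((weight l s)%:E * harmonic_energy sigma l T <= weighted_energy s T)%E.
Proof.
apply: le_trans (nneseries_lim_ge l.+1 (fun l _ _ => term_ge0 s T l)).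
rewrite big_nat_recr//= leeDr// sume_ge0// => i _; exact: term_ge0.
Qed.

Lemma Hnorm_lt (s c : R) T : 0 < c -> (Hnorm sigma s T < c%:E)%E ->
  (weighted_energy s T < (c ^+ 2)%:E)%E.
Proof.
move=> c0; rewrite HnormE; move: (weighted_energy_ge0 s T).
case: (weighted_energy s T) => [e| |];[|by rewrite poweRyr ?invr_neq0// ltNge leey|by []].
rewrite !lee_fin => e0; rewrite lte_fin powR12_sqrt// => h.
by rewrite lte_fin -(sqr_sqrtr e0) ltrXn2r ?sqrtr_ge0// ltW.
Qed.

Lemma Hnorm_le (s c : R) T : 0 <= c ->
  (weighted_energy s T <= (c ^+ 2)%:E)%E -> (Hnorm sigma s T <= c%:E)%E.
Proof.
move=> c0; rewrite HnormE; move: (weighted_energy_ge0 s T).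
case: (weighted_energy s T) => [e| |]//=.
rewrite !lee_fin => e0 ec; rewrite powR12_sqrt//.
by rewrite -(sqrtr_sqr c) ger0_norm in ec * || rewrite -[leRHS]ger0_norm// -sqrtr_sqr ler_wsqrtr.
Qed.

Lemma harmonic_le (s c : R) T l Y : 0 < c ->
  spherical_harmonic l Y -> I (fun x => Y x ^+ 2) <= 1 ->
  (Hnorm sigma s T < c%:E)%E -> weight l s * T Y ^+ 2 < c ^+ 2.
Proof.
move=> c0 hY Y1 /(Hnorm_lt c0) h; rewrite -lte_fin EFinM; apply: le_lt_trans h.
apply: le_trans (term_le_energy s T l); apply: lee_wpmul2l; first by rewrite lee_fin ltW ?weight_gt0.
by apply: ereal_sup_ubound; exists Y.
Qed.

(** A single term of the series bounds the pairing with one harmonic; its weight is positive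
    whatever the sign of s. *)
Lemma Hnorm_cvg_harmonic (U : Type) (F : set_system U) {FF : Filter F} (s : R)
    (T : U -> Defs.distribution R n) l Y :
  spherical_harmonic l Y -> I (fun x => Y x ^+ 2) <= 1 ->
  Hnorm sigma s (T u) @[u --> F] --> 0%E -> T u Y @[u --> F] --> (0 : R).
Proof.
move=> hY Y1 hT; apply/cvgrPdist_lt => e e0.
have w0 := weight_gt0 l s.
have c0 : 0 < e * Num.sqrt (weight l s) by rewrite mulr_gt0// sqrtr_gt0.
have : nbhs 0%E [set y | (y < (e * Num.sqrt (weight l s))%:E)%E].
  by apply: open_nbhs_nbhs; split; [exact: open_ereal_lt_ereal|rewrite /= lte_fin].
move=> hN; have : \forall u \near F, (Hnorm sigma s (T u) < (e * Num.sqrt (weight l s))%:E)%E.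
  exact: (hT _ hN).
apply: filterS => u /(harmonic_le c0 hY Y1).
rewrite exprMn sqr_sqrtr ?(ltW w0)// mulrC ltr_pM2r// sub0r normrN.
by rewrite -[T u Y ^+ 2]real_normK ?num_real// ltr_pXn2r ?nnegrE ?(ltW e0).
Qed.

Lemma spherical_harmonicZ l (c : R) Y : spherical_harmonic l Y ->
  spherical_harmonic l (fun x : 'rV[R]_n => c * Y x).
Proof.
move=> /spherical_harmonicP[p [hp lp ->]]; apply/spherical_harmonicP.
exists (mpolyC n c * p); split; first by rewrite mul_mpolyC; exact: rpredZ.
  by rewrite lapmCM lp mulr0.
by apply/funext => x; rewrite /ev mevalM mevalC.
Qed.

Variables (f : R -> 'rV[R]_n -> R) (mu0 : {measure set (borel R n) -> \bar R})
  (f0 : 'rV[R]_n -> R) (rho s : R).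
Hypotheses (bf : forall t, 0 < t -> bdm (f t)) (hd : has_density sigma mu0 f0)
  (mrho : mu0 S = rho%:E)
  (h0 : Hnorm sigma s (dist_sub (dist_of_fun sigma (f u)) (dist_of_meas mu0))
    @[u --> 0^'+] --> 0%E).

Lemma harmonic_cvg l Y : spherical_harmonic l Y ->
  I (fun x => f t x * Y x) @[t --> 0^'+] --> I (fun x => f0 x * Y x).
Proof.
move=> hY; have bY := bdm_harmonic hY.
pose A := I (fun x => Y x ^+ 2); have A0 : 0 <= A by apply: sint_ge0 => x _; exact: sqr_ge0.
(* The rescaled harmonic has squared norm A / (1 + A)^2 <= 1, as the definition of the harmonic
   energy requires. *)
pose c := (1 + A)^-1; have c0 : 0 < c by rewrite invr_gt0 ltr_pwDl.
have cA : I (fun x => (c * Y x) ^+ 2) <= 1.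
  have -> : I (fun x => (c * Y x) ^+ 2) = c ^+ 2 * A.
    by rewrite -sintZ; [apply: eq_sint => x _; rewrite exprMn|exact/bI/bdmX].
  rewrite /c exprVn mulrC ler_pdivrMr ?exprn_gt0 ?ltr_pwDl// mul1r expr2; nra.
have [if0 _] := intg_density hd mrho.
have h : dist_sub (dist_of_fun sigma (f u)) (dist_of_meas mu0) (fun x => c * Y x)
    @[u --> 0^'+] --> (0 : R).
  exact: (@Hnorm_cvg_harmonic _ (0^'+) _ s (fun u => dist_sub (dist_of_fun sigma (f u)) (dist_of_meas mu0))
    l _ (spherical_harmonicZ c hY) cA h0).
have h2 : c^-1 * dist_sub (dist_of_fun sigma (f u)) (dist_of_meas mu0) (fun x => c * Y x)
    + I (fun x => f0 x * Y x) @[u --> 0^'+] --> c^-1 * 0 + I (fun x => f0 x * Y x).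
  by apply: cvgD; [apply: cvgM => //; exact: cvg_cst|exact: cvg_cst].
rewrite mulr0 add0r in h2; apply: cvg_trans h2; apply: near_eq_cvg; near=> t.
have t0 : 0 < t by near: t; exact: nbhs_right_gt.
rewrite /dist_sub (dist_density hd mrho (bdmZ c bY)) /dist_of_fun -/(I _).
have -> : I (fun x => f t x * (c * Y x)) = c * I (fun x => f t x * Y x).
  by rewrite -sintZ; [apply: eq_sint => x _; ring|apply: bI; apply: bdmM => //; exact: bf].
have -> : I (fun x => f0 x * (c * Y x)) = c * I (fun x => f0 x * Y x).
  by rewrite -sintZ; [apply: eq_sint => x _; ring|exact: intgM].
by rewrite -mulrBr mulKf ?gt_eqF// subrK.
Unshelve. all: by end_near. Qed.

(** Induction on d: on the sphere, the zonal harmonic of degree d is (x . y)^d plus lower powers, so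
    the moment of order d is a pairing with a harmonic minus lower moments. *)
Lemma moment_cvg x d : S x ->
  I (fun y => dot x y ^+ d * f t y) @[t --> 0^'+] --> I (fun y => dot x y ^+ d * f0 y).
Proof.
move=> Sx; have [if0 _] := intg_density hd mrho.
elim/ltn_ind: d => d ih.
have bd m : bdm (fun y => dot x y ^+ m).
  by apply: bdmX; apply: eq_bdm (bdm_dot x) => y _; exact: dotC.
pose c b := zonal_coef R n d b.+1; pose e b := (d - 2 * b.+1)%N.
have E w : intg sigma w -> I (fun y => dot x y ^+ d * w y) =
    I (fun y => w y * ev (zonal_poly d x) y) -
    \sum_(b < d./2) c b * I (fun y => dot x y ^+ e b * w y).
  move=> iw; have id m : intg sigma (fun y => dot x y ^+ m * w y).
    by apply: eq_intg (intgM iw (bd m)) => y _; exact: mulrC.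
  under eq_bigr do rewrite -(sintZ _ (id _)).
  rewrite -(sint_sum hsigma) => [|b _]; last exact/intgZ/id.
  rewrite -sintB; [|by apply: intgM => //; exact: bdm_ev|by apply: (intg_sum hsigma) => b _; exact/intgZ/id].
  apply: eq_sint => y Sy; rewrite zonal_harmonic// dotC.
  have -> : \sum_(b < d./2) c b * (dot y x ^+ e b * w y) = w y * \sum_(b < d./2) c b * dot y x ^+ e b.
    by rewrite mulr_sumr; apply: eq_bigr => b _; ring.
  by rewrite mulrDr addrK mulrC.
have -> : I (fun y => dot x y ^+ d * f0 y) = I (fun y => f0 y * ev (zonal_poly d x) y) -
    \sum_(b < d./2) c b * I (fun y => dot x y ^+ e b * f0 y) by exact: E.
have : I (fun y => f t y * ev (zonal_poly d x) y) -
    \sum_(b < d./2) c b * I (fun y => dot x y ^+ e b * f t y) @[t --> 0^'+] -->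
    I (fun y => f0 y * ev (zonal_poly d x) y) -
    \sum_(b < d./2) c b * I (fun y => dot x y ^+ e b * f0 y).
  apply: cvgB; first exact: harmonic_cvg (spherical_harmonic_zonal hn d Sx).
  apply: cvg_sumr => b _; apply: cvgM; first exact: cvg_cst.
  apply: ih; rewrite /e ltn_subrL muln_gt0/=.
  apply: leq_trans (leq_ltn_trans (leq0n b) (ltn_ord b)) _.
  by rewrite -[leqRHS](odd_double_half d) -addnn addnA leq_addl.
apply: cvg_trans; apply: near_eq_cvg; near=> t; rewrite E//.
by apply: bI; apply: bf; near: t; exact: nbhs_right_gt.
Unshelve. all: by end_near. Qed.

End EnergyOfNorm.

(** * Solutions and their initial data *)

Section RealFunctions.
Variable R : realType.
Implicit Types (a b s : R).

Lemma sq_tangent a b : a ^+ 2 + 2 * a * (b - a) <= b ^+ 2.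
Proof. rewrite -subr_ge0 (_ : _ - _ = (b - a) ^+ 2) ?sqr_ge0//; ring. Qed.

Lemma ln_quot a b : 0 < a -> 0 < b -> ln b - ln a <= (b - a) / a.
Proof.
move=> a0 b0; rewrite -ln_div ?posrE//; apply: le_trans (ln_le_subr1 (divr_gt0 b0 a0)) _.
by rewrite mulrBl mulfV ?gt_eqF.
Qed.

Lemma entropy_tangent a b : 0 < a -> 0 <= b -> a * ln a + (ln a + 1) * (b - a) <= b * ln b.
Proof.
move=> a0; rewrite le_eqVlt => /orP[/eqP <-|b0]; first by rewrite mul0r; nra.
have := ln_quot b0 a0; rewrite ler_pdivlMr// => h; nra.
Qed.

Lemma entropy_taylor a b : 0 < a -> 0 < b ->
  b * ln b <= a * ln a + (ln a + 1) * (b - a) + a^-1 * (b - a) ^+ 2.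
Proof.
move=> a0 b0; have := ln_quot a0 b0 => h.
have h2 : b * (ln b - ln a) <= b * ((b - a) / a) by rewrite ler_pM2l.
have -> : a * ln a + (ln a + 1) * (b - a) + a^-1 * (b - a) ^+ 2 = b * ln a + b * ((b - a) / a).
  by field; rewrite gt_eqF.
lra.
Qed.

Lemma entropy_ge s : 0 <= s -> s <= s * ln s + 1.
Proof. by move=> s0; have := entropy_tangent ltr01 s0; rewrite ln1; lra. Qed.

End RealFunctions.

Section Flux.
Variables (R : realType) (n : nat) (sigma : probability (borel R n) R).
Hypotheses (hn : (2 <= n)%N) (hsigma : is_uniform sigma).
Implicit Types (f g : 'rV[R]_n -> R) (v x : 'rV[R]_n).

Local Notation S := (sphere R n).
Local Notation I := (sint sigma).
Local Notation bI := (intg_bdm hsigma).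

Lemma fluxE f i : flux sigma f 0 i = I (fun x => x 0 i * f x).
Proof. by rewrite mxE. Qed.

Lemma intg_coordM f i : intg sigma f -> intg sigma (fun x => x 0 i * f x).
Proof. by move=> bf; have := intgM bf (@bdm_coord R n i); apply: eq_intg => x _; exact: mulrC. Qed.

Lemma dot_flux f v : intg sigma f -> dot (flux sigma f) v = I (fun x => dot x v * f x).
Proof.
move=> bf; rewrite /dot.
have -> : I (fun x => (\sum_i x 0 i * v 0 i) * f x) = I (fun x => \sum_i v 0 i * (x 0 i * f x)).
  by apply: eq_sint => x _; rewrite mulr_suml; apply: eq_bigr => i _; ring.
rewrite (sint_sum hsigma) => [|i _]; last exact/intgZ/intg_coordM.
by apply: eq_bigr => i _; rewrite (sintZ _ (intg_coordM i bf)) fluxE mulrC.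
Qed.

Lemma enorm_flux_le f : intg sigma f -> enorm (flux sigma f) <= I (fun x => `|f x|).
Proof.
move=> bf; set J := flux sigma f; have [J0|J0] := eqVneq J 0.
  rewrite J0 /enorm /dot big1 ?sqrtr0 => [|i _]; last by rewrite mxE mul0r.
  exact: sint_ge0.
have e0 := enorm_gt0 J0.
rewrite -(ler_pM2l e0) -expr2 sqr_enorm dot_flux// -sintZ; last exact: intg_norm.
have bd : bdm (fun x => dot x J) by exact: bdm_dot.
apply: le_sint; [by apply: eq_intg (intgM bf bd) => x _; exact: mulrC|exact/intgZ/intg_norm|].
move=> x Sx; rewrite (le_trans (ler_norm _))// normrM ler_wpM2r//.
rewrite (le_trans (CauchySchwarz_dot _ _))//.
by rewrite (_ : enorm x = 1) ?mul1r.
Qed.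

Lemma pole_sphere (i : 'I_n) : S (delta_mx 0 i).
Proof.
apply/sphereP; rewrite /dot (bigD1 i)//= big1 ?addr0 => [|k ki].
  by rewrite !mxE !eqxx mulr1.
by rewrite mxE eqxx (negPf ki) mul0r.
Qed.

Lemma dot_pole (i : 'I_n) x : dot (delta_mx 0 i) x = x 0 i.
Proof.
rewrite /dot (bigD1 i)//= big1 ?addr0 => [|k ki]; rewrite mxE eqxx ?eqxx ?mul1r//.
by rewrite (negPf ki) mul0r.
Qed.

Lemma continuous_enorm : continuous (@enorm R n).
Proof.
move=> x; apply: (@continuous_comp _ _ _ (fun x : 'rV[R]_n => dot x x) Num.sqrt).
  exact: continuous_dot.
exact: sqrt_continuous.
Qed.

End Flux.

Section Coefficients.
Variables (R : realType) (nu tau : R -> R).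
Hypothesis hcoef : coefficients nu tau.

Lemma lipschitz_nonneg (g : R -> R) : [lipschitz (g r) | r in `[0, +oo[%classic] ->
  exists2 L : R, 0 < L & forall a b, 0 <= a -> 0 <= b -> `|g a - g b| <= L * `|a - b|.
Proof.
move=> [L [_ hL]]; exists (`|L| + 1); first by rewrite ltr_wpDl.
have LL : L < `|L| + 1 by apply: le_lt_trans (ler_norm L) _; rewrite ltrDl.
move=> a b a0 b0; apply: (hL _ LL (a, b)).
by split; rewrite /= in_itv/= ?a0 ?b0.
Qed.

(** Composition with the absolute value turns a function controlled on [0, +oo[ into a continuous
    function on the line, to which theorems on segments apply. *)
Lemma lipschitz_continuous_abs (g : R -> R) : [lipschitz (g r) | r in `[0, +oo[%classic] ->
  continuous (fun r : R => g `|r|).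
Proof.
move=> /lipschitz_nonneg[L L0 hL] a; apply/cvgrPdist_le => e e0; near=> b.
apply: le_trans (hL _ _ _ _) _ => //.
rewrite -ler_pdivlMl//; apply: le_trans (ler_dist_dist _ _) _.
near: b; apply: cvgr_dist_le; first exact: cvg_id.
by rewrite mulr_gt0 ?invr_gt0.
Unshelve. all: by end_near. Qed.

Lemma coefficient_bounds rho : 0 <= rho -> exists nuM taum : R,
  [/\ 0 < taum, forall r, 0 <= r <= rho -> `|nu r| <= nuM
    & forall r, 0 <= r <= rho -> taum <= tau r].
Proof.
move=> rho0; case: hcoef => pos [nu0 _ [M hM]] _ _ _.
have [c cin hc] : exists2 c, c \in `[0, rho]%R & forall t, t \in `[0, rho]%R -> tau `|c| <= tau `|t|.
  apply: EVT_min => //; apply: continuous_subspaceT; apply: lipschitz_continuous_abs.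
  by case: hcoef => _ _ [].
exists (`|M| * rho), (tau `|c|); split.
- by case: (pos _ (normr_ge0 c)).
- move=> r /andP[r0 rr]; have [nr _] := pos _ r0; rewrite ger0_norm//.
  move: r0; rewrite le_eqVlt => /orP[/eqP <-|r0]; first by rewrite nu0 mulr_ge0.
  have := hM _ r0; rewrite ler_pdivrMr// => /le_trans; apply.
  apply: (@le_trans _ _ (`|M| * r)); first by rewrite ler_pM2r// ler_norm.
  by rewrite ler_wpM2l.
- by move=> r /[dup] h /andP[r0 _]; rewrite -[r in leRHS]ger0_norm//; apply: hc; rewrite in_itv.
Qed.

End Coefficients.

Section Solutions.
Variables (R : realType) (n : nat) (sigma : probability (borel R n) R).
Hypotheses (hn : (2 <= n)%N) (hsigma : is_uniform sigma).
Variables (nu tau : R -> R).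
Hypothesis hcoef : coefficients nu tau.
Variables (s rho : R) (mu0 : {measure set (borel R n) -> \bar R})
  (f : R -> 'rV[R]_n -> R) (f0 : 'rV[R]_n -> R).
Hypotheses (rho0 : 0 < rho) (hd : has_density sigma mu0 f0)
  (mrho : mu0 (sphere R n) = rho%:E) (sol : is_solution sigma nu tau s mu0 f).

Local Notation S := (sphere R n).
Local Notation I := (sint sigma).
Local Notation bI := (intg_bdm hsigma).
Local Notation J g := (enorm (flux sigma g)).
Local Notation Q := (Qop sigma nu tau).

Lemma sol_smooth t : 0 < t -> smooth_sphere (f t).
Proof. by move=> t0; have [h _] := sol; case: (h t t0). Qed.

Lemma sol_pos t : 0 < t -> forall x, S x -> 0 < f t x.
Proof. by move=> t0; have [h _] := sol; case: (h t t0). Qed.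

Lemma sol_bdm t : 0 < t -> bdm (f t).
Proof. by move=> /sol_smooth/bdm_smooth. Qed.

Lemma sol_uder t : 0 < t -> uder f t (Q (f t)).
Proof. by move=> t0; have [h _] := sol; case: (h t t0) => _ _ /cvg_smooth_uder. Qed.

Lemma sol_bdmQ t : 0 < t -> bdm (Q (f t)).
Proof. by move=> t0; exact: (bdm_Qop sigma hn nu tau (sol_smooth t0)). Qed.

Lemma sol_moment x d : S x ->
  I (fun y => dot x y ^+ d * f t y) @[t --> 0^'+] --> I (fun y => dot x y ^+ d * f0 y).
Proof. exact: (moment_cvg hn hsigma sol_bdm hd mrho (proj2 sol)). Qed.

Lemma init_intg : intg sigma f0. Proof. by case: (intg_density hd mrho). Qed.
Lemma init_mass : I f0 = rho. Proof. by case: (intg_density hd mrho). Qed.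
Lemma init_ge0 x : S x -> 0 <= f0 x. Proof. by case: hd => _ h _; exact: h. Qed.

Lemma sol_derive (w : 'rV[R]_n -> R) (t : R) : bdm w -> 0 < t ->
  is_derive t (1 : R) (fun u => I (fun x => w x * f u x)) (I (fun x => w x * Q (f t) x)).
Proof.
move=> bw t0; apply: (uder_sint hsigma).
- apply: filterS (near_pos t0) => u u0; apply: bdmM => //; exact: sol_bdm.
- by apply: bdmM => //; exact: sol_bdmQ.
- by apply: uder_mul => //; exact: sol_uder.
Qed.

Lemma sol_derive_mass t : 0 < t -> I (Q (f t)) = 0.
Proof.
move=> t0; have b0 : bdm (fun _ : 'rV[R]_n => 0 : R) := bdm_cst 0.
have := sint_Qop_parts hn hsigma nu tau (sol_smooth t0) (w := fun=> 1) (w1 := fun _ _ => fun=> 0)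
  (fun i j => rd_cst i j 1) (bdm_cst 1) (fun _ _ => b0).
have z (g : 'rV[R]_n -> R) : (forall x, S x -> g x = 0) -> I g = 0.
  by move=> h; rewrite -[RHS](sint_cst hsigma); exact: eq_sint.
rewrite (_ : I _ = I (Q (f t))); last by apply: eq_sint => x _; rewrite mul1r.
move=> ->; rewrite z => [|x _]; last first.
  by rewrite /Tgrad big1 ?mulr0// => i _; rewrite big1// => k _; rewrite mulr0.
rewrite big1 ?mulr0 ?subrr// => i _; rewrite big1// => k _; apply: z => x _; exact: mul0r.
Qed.

Lemma sol_mass t : 0 < t -> I (f t) = rho.
Proof.
move=> t0; have cst u : 0 < u -> I (f u) = I (f t).
  have dd (v : R) : 0 < v -> is_derive v (1 : R) (fun u => I (f u)) 0.
    move=> v0; apply: is_derive_eq (hd_eq _ (sol_derive (bdm_cst 1) v0)) _.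
      by move=> w; apply: eq_sint => x _; rewrite mul1r.
    by rewrite -(sol_derive_mass v0); apply: eq_sint => x _; rewrite mul1r.
  move=> u0; have le a b : 0 < a -> a <= b -> I (f a) = I (f b).
    move=> a0 ab; apply/eqP; rewrite eq_le; apply/andP; split; last first.
      by apply: (nonincreasing_pos dd) => //.
    rewrite -lerN2; apply: (nonincreasing_pos (y := fun v => - I (f v)) (dy := fun=> 0)) => // v v0.
    exact: is_derive_eq (hdN (dd v v0)) (oppr0 _).
  by have [ut|/ltW tu] := leP u t; [exact: le|apply/esym; exact: le].
(* The mass is constant for t > 0. Its value is read at time 0 on the moment of order 0, taken at an
   arbitrary pole. *)
have [i] : exists i : 'I_n, True by exists (Ordinal (ltnW hn)).
move=> _; have := sol_moment (d := 0) (pole_sphere _ i).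
have -> : I (fun y => dot (delta_mx 0 i) y ^+ 0 * f0 y) = rho.
  by rewrite -init_mass; apply: eq_sint => y _; rewrite expr0 mul1r.
move=> h; have h2 : I (fun y => dot (delta_mx 0 i) y ^+ 0 * f u y) @[u --> 0^'+] --> I (f t).
  apply: cvg_near_cst; near=> u; rewrite -(cst u); last by near: u; exact: nbhs_right_gt.
  by apply: eq_sint => y _; rewrite expr0 mul1r.
exact: (cvg_unique _ h2 h).
Unshelve. all: by end_near. Qed.

Lemma sol_flux_le t : 0 < t -> J (f t) <= rho.
Proof.
move=> t0; apply: (le_trans (enorm_flux_le hsigma (bI (sol_bdm t0)))).
rewrite -(sol_mass t0) le_eqVlt; apply/orP; left; apply/eqP.
by apply: eq_sint => x Sx; rewrite gtr0_norm//; exact: sol_pos.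
Qed.

Lemma sol_flux_cvg0 : flux sigma (f t) @[t --> 0^'+] --> flux sigma f0.
Proof.
apply: cvg_rV => i; rewrite fluxE (_ : (fun t => _) = fun t => I (fun x => x 0 i * f t x)); last first.
  by apply/funext => t; exact: fluxE.
have E (w : 'rV[R]_n -> R) : I (fun x => x 0 i * w x) = I (fun y => dot (delta_mx 0 i) y ^+ 1 * w y).
  by apply: eq_sint => x _; rewrite expr1 dot_pole.
rewrite E (_ : (fun t => _) = fun t => I (fun y => dot (delta_mx 0 i) y ^+ 1 * f t y)).
  exact: sol_moment (pole_sphere _ i).
by apply/funext => t; exact: E.
Qed.

Lemma sol_coef : exists nuM taum : R, [/\ 0 < taum,
  forall t, 0 < t -> `|nu (J (f t))| <= nuM & forall t, 0 < t -> taum <= tau (J (f t))].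
Proof.
have [nuM [taum [h1 h2 h3]]] := coefficient_bounds hcoef (ltW rho0).
by exists nuM, taum; split=> // t t0; [apply: h2|apply: h3]; rewrite enorm_ge0 sol_flux_le.
Qed.

Lemma sol_sq_le : exists C : R, forall t, 0 < t -> intg sigma (fun x => f0 x ^+ 2) ->
  I (fun x => f t x ^+ 2) <= expR (C * t) * I (fun x => f0 x ^+ 2).
Proof.
have [nuM [taum [h1 h2 h3]]] := sol_coef.
exists (2 * rateC n nuM taum) => t t0 int2.
have d1 (u : R) : 0 < u -> is_derive u (1 : R) (fun u => u ^+ 2) (2 * u).
  by move=> _; apply: is_derive_eq (hd_powd 2 u) _; rewrite expr1.
have d2 (u : R) : 0 < u -> is_derive u (1 : R) (fun u => 2 * u) 2.
  by move=> _; apply: is_derive_eq (hdZ 2 (hd_id u)) _; rewrite mulr1.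
have := @functional_le R n sigma hn hsigma nu tau f f0 rho nuM taum rho0 h1
  sol_smooth sol_pos sol_uder h2 h3 sol_mass init_intg init_ge0 init_mass sol_moment
  (fun u => u ^+ 2) (fun u => 2 * u) (fun=> 2) 2 0 d1 d2.
have cc : forall u : R, 0 < u -> {for u, continuous (fun _ : R => 2 : R)}.
  by move=> u _; exact: cvg_cst.
move=> /(_ cc (fun _ _ => ler0n _ 2)) h.
have := h _ _ _ _ t t0 int2; rewrite !addr0 mulrCA ler_pM2l//; apply=> //.
- by move=> u _; rewrite mulrC addr0.
- by move=> a b _ _; exact: sq_tangent.
- by move=> a b _ _; have := sqr_ge0 (b - a); rewrite !expr2; nra.
Qed.

(** The entropy may be negative; Gronwall's lemma is applied after the shift by 1, which comes from
    s <= s ln s + 1. *)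
Lemma sol_ent_le : exists C : R, forall t, 0 < t -> intg sigma (fun x => f0 x * ln (f0 x)) ->
  I (fun x => f t x * ln (f t x)) + 1 <= expR (C * t) * (I (fun x => f0 x * ln (f0 x)) + 1).
Proof.
have [nuM [taum [h1 h2 h3]]] := sol_coef.
exists (1 * rateC n nuM taum) => t t0 int2.
have d1 (u : R) : 0 < u -> is_derive u (1 : R) (fun u => u * ln u) (ln u + 1).
  move=> u0; apply: is_derive_eq (hdM (hd_id u) (hd_ln u0 (hd_id u))) _.
  by rewrite mul1r mulr1 mulfV ?gt_eqF.
have d2 (u : R) : 0 < u -> is_derive u (1 : R) (fun u => ln u + 1) u^-1.
  move=> u0; apply: is_derive_eq (hdD (hd_ln u0 (hd_id u)) (hd_cst 1 u)) _.
  by rewrite addr0 mulr1.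
have := @functional_le R n sigma hn hsigma nu tau f f0 rho nuM taum rho0 h1
  sol_smooth sol_pos sol_uder h2 h3 sol_mass init_intg init_ge0 init_mass sol_moment
  (fun u => u * ln u) (fun u => ln u + 1) (fun u => u^-1) 1 1 d1 d2.
have cc : forall u : R, 0 < u -> {for u, continuous (fun u : R => u^-1)}.
  by move=> u u0; apply: inv_continuous; rewrite gt_eqF.
move=> /(_ cc) h.
have := h _ _ _ _ _ t t0 int2; rewrite !mul1r; apply=> //.
- by move=> u u0; rewrite invr_ge0 ltW.
- by move=> u u0; rewrite expr2 -mulrA mulfV ?gt_eqF// mulr1 mul1r; apply: entropy_ge; exact: ltW.
- by move=> a b a0; exact: entropy_tangent.
- by move=> a b a0; exact: entropy_taylor.
Qed.

End Solutions.

(** * Zonal exponentials and the order parameter *)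

Section ExponentialTaylor.
Variable R : realType.
Implicit Types (z y : R) (N : nat).

Definition expT N z : R := \sum_(d < N) z ^+ d / d`!%:R.

Lemma hd_expT N z : is_derive z (1 : R) (expT N.+1) (expT N z).
Proof.
rewrite /expT.
have h := @hd_sum R _ (index_enum 'I_N.+1) xpredT (fun (d : 'I_N.+1) (z : R) => z ^+ d / d`!%:R) z
  (fun d => d`!%:R^-1 * (d%:R * z ^+ d.-1)).
apply: is_derive_eq (h _) _.
  by move=> d _; apply: hd_eq (hdZ d`!%:R^-1 (hd_powd d z)) => u; exact: mulrC.
rewrite big_ord_recl mul0r mulr0 add0r; apply: eq_bigr => d _.
rewrite lift0 /= factS natrM invfM mulrA mulrC mulrA -mulrA; congr (_ * _).
by rewrite mulrAC mulVf ?mul1r// pnatr_eq0.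
Qed.

Lemma expT0 N : expT N.+1 0 = 1.
Proof.
rewrite /expT big_ord_recl expr0 fact0 divr1 big1 ?addr0// => d _.
by rewrite lift0 expr0n mul0r.
Qed.

Lemma hd_expR z : is_derive z (1 : R) (@expR R) (expR z).
Proof. by apply: is_derive_eq (hd_exp (hd_id z)) _; rewrite mulr1. Qed.

Lemma nondecreasing_from0 (g dg : R -> R) y :
  (forall z, is_derive z (1 : R) g (dg z)) -> (forall z, 0 <= z <= y -> 0 <= dg z) ->
  g 0 = 0 -> 0 <= y -> 0 <= g y.
Proof.
move=> gd dg0 g0 y0; rewrite -g0 -lerN2.
apply: (hd_nincr (f := fun z => - g z) (df := fun z => - dg z)) => //.
- by move=> z /andP[h1 h2]; rewrite oppr_le0 dg0// !ltW.
- by apply: continuous_subspaceT => z; exact: hd_continuous (hdN (gd z)).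
Qed.

Lemma expT_le N y : 0 <= y -> expT N y <= expR y.
Proof.
elim: N y => [|N ih] y y0; first by rewrite /expT big_ord0 expR_ge0.
rewrite -subr_ge0; apply: (nondecreasing_from0 (g := fun z => expR z - expT N.+1 z)
  (dg := fun z => expR z - expT N z)) => //.
- by move=> z; exact: hdB (hd_expR z) (hd_expT N z).
- by move=> z /andP[z0 _]; rewrite subr_ge0 ih.
- by rewrite expT0 expR0 subrr.
Qed.

(* Both signs are treated at once: the remainder of e^(s y) with s = 1 or -1. *)
Lemma expT_remainder_aux (sg : R) N Y y : sg ^+ 2 = 1 -> 0 <= y <= Y ->
  `|expR (sg * y) - expT N (sg * y)| <= expR Y * (y ^+ N / N`!%:R).
Proof.
move=> sg2; have sgn : `|sg| = 1.
  by apply/eqP; rewrite -(@eqrXn2 _ 2)// -normrX sg2 normr1 expr1n.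
elim: N y => [|N ih] y /andP[y0 yY].
  rewrite /expT big_ord0 subr0 expr0 fact0 divr1 mulr1 ger0_norm ?expR_ge0// ler_expR.
  by rewrite (le_trans (ler_norm _))// normrM sgn mul1r ger0_norm.
have dE z : is_derive z (1 : R) (fun y => expR (sg * y) - expT N.+1 (sg * y))
    (sg * (expR (sg * z) - expT N (sg * z))).
  have hz : is_derive z (1 : R) (fun y : R => sg * y) sg.
    by apply: is_derive_eq (hdZ sg (hd_id z)) _; rewrite mulr1.
  apply: is_derive_eq (hdB (hd_comp (hd_expR _) hz) (hd_comp (hd_expT N _) hz)) _.
  by rewrite -mulrBl mulrC.
have dB z : is_derive z (1 : R) (fun y => expR Y * (y ^+ N.+1 / N.+1`!%:R))
    (expR Y * (z ^+ N / N`!%:R)).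
  have := hdZ (expR Y) (hdZ (N.+1`!%:R^-1) (hd_powd N.+1 z)).
  move=> h; apply: is_derive_eq (hd_eq _ h) _; first by move=> u; congr (_ * _); exact: mulrC.
  congr (_ * _); rewrite /= factS natrM invfM mulrACA mulVf ?pnatr_eq0// mul1r mulrC //.
rewrite ler_norml; apply/andP; split; rewrite -subr_ge0.
- apply: (nondecreasing_from0 (y := y)
    (g := fun y => expR (sg * y) - expT N.+1 (sg * y) - - (expR Y * (y ^+ N.+1 / N.+1`!%:R)))) => //.
  + move=> z /andP[z0 zy]; have := ih z; rewrite z0 (le_trans zy yY) => /(_ isT).
    move=> /(le_trans _); rewrite opprK -lerBlDr sub0r => h.
    rewrite lerNl; apply: le_trans (ler_norm _) _.
    by rewrite normrN normrM sgn mul1r; apply: h.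
  + by rewrite mulr0 expT0 expR0 expr0n/= mul0r mulr0 opprK addr0 subrr.
- apply: (nondecreasing_from0 (y := y)
    (g := fun y => expR Y * (y ^+ N.+1 / N.+1`!%:R) - (expR (sg * y) - expT N.+1 (sg * y)))) => //.
  + move=> z /andP[z0 zy]; have := ih z; rewrite z0 (le_trans zy yY) => /(_ isT) h.
    by rewrite subr_ge0 (le_trans (ler_norm _))// normrM sgn mul1r.
  + by rewrite mulr0 expT0 expR0 expr0n/= mul0r mulr0 ?oppr0 !subrr.
Qed.

Lemma expT_remainder N Y z : `|z| <= Y ->
  `|expR z - expT N z| <= expR Y * (`|z| ^+ N / N`!%:R).
Proof.
move=> zY; have [z0|z0] := leP 0 z.
  have := @expT_remainder_aux 1 N Y z; rewrite mul1r expr1n (ger0_norm z0).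
  by apply=> //; rewrite z0 -{1}(ger0_norm z0).
have := @expT_remainder_aux (-1) N Y (- z); rewrite mulN1r opprK sqrrN expr1n (ltr0_norm z0).
by apply=> //; rewrite oppr_ge0 (ltW z0) -{1}(ltr0_norm z0).
Qed.

Lemma expT_cvg (C : R) : C ^+ N / N`!%:R @[N --> \oo] --> (0 : R).
Proof. exact: (cvg_series_cvg_0 (is_cvg_series_exp_coeff C)). Qed.

End ExponentialTaylor.

Section ZonalExponentials.
Variables (R : realType) (n : nat) (sigma : probability (borel R n) R).
Hypotheses (hn : (2 <= n)%N) (hsigma : is_uniform sigma).
Implicit Types (Om x : 'rV[R]_n) (k : R) (a d : nat).

Local Notation S := (sphere R n).
Local Notation I := (sint sigma).
Local Notation bI := (intg_bdm hsigma).

Definition zexp a k Om x : R := dot x Om ^+ a * expR (k * dot x Om).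
(** [zon 0] is the partition function of the von Mises law, and [zon a] its a-th derivative in k. *)
Definition zon a k Om : R := I (zexp a k Om).

Lemma norm_kdot k Om x : S Om -> S x -> `|k * dot x Om| <= `|k|.
Proof. by move=> SO Sx; rewrite normrM ler_piMr// dot_sphere. Qed.

Lemma bdm_expdot k Om : bdm (fun x => expR (k * dot x Om)).
Proof.
apply: (bdm_zonal (phi := fun u => expR (k * u))) => u.
exact: hd_continuous (hd_exp (hdZ k (hd_id u))).
Qed.

Lemma bdm_zexp a k Om : bdm (zexp a k Om).
Proof. by apply: bdmM; [apply: bdmX; exact: bdm_dot|exact: bdm_expdot]. Qed.

Lemma expdot_ge k Om x : S Om -> S x -> expR (- `|k|) <= expR (k * dot x Om).
Proof.
move=> SO Sx; rewrite ler_expR; have := norm_kdot k SO Sx.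
by rewrite ler_norml => /andP[].
Qed.

Lemma expdot_le k Om x : S Om -> S x -> expR (k * dot x Om) <= expR `|k|.
Proof.
by move=> SO Sx; rewrite ler_expR (le_trans (ler_norm _))// norm_kdot.
Qed.

Lemma zon0_gt0 k Om : S Om -> 0 < zon 0 k Om.
Proof.
move=> SO; apply: (lt_le_trans (expR_gt0 (- `|k|))).
rewrite -[leLHS](sint_cst hsigma); apply: le_sint; [exact/bI/bdm_cst|exact/bI/bdm_zexp|].
by move=> x Sx; rewrite /zexp expr0 mul1r expdot_ge.
Qed.

Lemma uder_zexp a k Om : S Om -> uder (fun k => zexp a k Om) k (zexp a.+1 k Om).
Proof.
move=> SO e e0; pose C := expR `|k| * expR 1.
have C0 : 0 < C by rewrite mulr_gt0 ?expR_gt0.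
near=> h => x Sx.
have u1 : `|dot x Om| <= 1 by exact: dot_sphere.
have -> : zexp a (k + h) Om x - zexp a k Om x - h * zexp a.+1 k Om x =
    dot x Om ^+ a * (expR (k * dot x Om) * (expR (h * dot x Om) - expT 2 (h * dot x Om))).
  rewrite /zexp mulrDl expRD /expT big_ord_recl big_ord1 /= expr0 expr1 fact0 !divr1 exprS.
  move: (expR (k * dot x Om)) (expR (h * dot x Om)) => A B; move: (dot x Om) => u; ring.
have h1 : `|h| <= 1 by apply: ltW; near: h; apply: (@nbhs0_lt _ R).
have h2 : `|h| <= e / C by apply: ltW; near: h; apply: (@nbhs0_lt _ R); rewrite divr_gt0.
rewrite normrM normrX; apply: (@le_trans _ _ (1 * (expR `|k| * (expR 1 * (`|h| ^+ 2 / 2`!%:R))))).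
  apply: ler_pM => //; first exact: exprn_ile1.
  rewrite normrM; apply: ler_pM => //; first by rewrite ger0_norm ?expR_ge0// expdot_le.
  apply: (le_trans (expT_remainder 2 (le_trans (norm_kdot h SO Sx) h1))).
  rewrite ler_pM2l ?expR_gt0// ler_pM2r ?invr_gt0 ?ltr0n//.
  by rewrite lerXn2r ?nnegrE// norm_kdot.
rewrite mul1r mulrA -/C; apply: (@le_trans _ _ (C * `|h| ^+ 2)).
  by rewrite ler_pM2l// ler_piMr ?sqr_ge0// invf_le1// ler1n.
by rewrite expr2 mulrA ler_wpM2r// -ler_pdivlMl// mulrC.
Unshelve. all: by end_near. Qed.

Lemma hd_zon a k Om : S Om -> is_derive k (1 : R) (fun k : R => zon a k Om) (zon a.+1 k Om).
Proof.
move=> SO; apply: (uder_sint hsigma); last exact: uder_zexp.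
- by near=> u; exact: bdm_zexp.
- exact: bdm_zexp.
Unshelve. all: by end_near. Qed.

Lemma moment_rec d Om : S Om ->
  (d * (d + n - 2))%:R * I (fun x => dot x Om ^+ d) = (d * d.-1)%:R * I (fun x => dot x Om ^+ d.-2).
Proof.
move=> SO; have cc : continuous (fun v : R => d%:R * (d.-1%:R * v ^+ d.-2)).
  move=> u; exact: hd_continuous (hdZ d%:R (hdZ d.-1%:R (hd_powd d.-2 u))).
have := sint_lapz hn hsigma SO (hd_powd d) (fun u : R => hdZ d%:R (hd_powd d.-1 u)) cc.
have b m : bdm (fun x : 'rV[R]_n => dot x Om ^+ m) by apply: bdmX; exact: bdm_dot.
move=> h; apply/eqP; rewrite eq_sym -subr_eq0; apply/eqP; rewrite -[RHS]h.
rewrite -!sintZ; try exact: bI.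
rewrite -sintB; try (apply: bI; exact: bdmZ).
by apply: eq_sint => x _; rewrite lapz_powd.
Qed.

Lemma moment1 Om : S Om -> I (fun x => dot x Om) = 0.
Proof.
move=> SO; have := moment_rec 1 SO; rewrite mul0r mul1n => /eqP.
rewrite mulf_eq0 pnatr_eq0 => /orP[|/eqP <-]; last by apply: eq_sint => x _; rewrite expr1.
by rewrite subn_eq0 add1n ltnS leqNgt hn.
Qed.

Lemma moment2 Om : S Om -> I (fun x => dot x Om ^+ 2) = n%:R^-1.
Proof.
move=> SO; have := moment_rec 2 SO; rewrite /= addKn muln1.
rewrite (_ : I (fun x => dot x Om ^+ 0) = 1) => [|]; last first.
  by rewrite -[RHS](sint_cst hsigma); apply: eq_sint => x _; rewrite expr0.
rewrite mulr1 natrM.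
rewrite -mulrA -[RHS]mulr1 => /mulfI; rewrite pnatr_eq0 => /(_ isT) h.
by apply/eqP; rewrite eq_sym -(inj_eq (@mulfI R n%:R _)) ?h ?mulfV// pnatr_eq0 -lt0n ltnW.
Qed.

(** The expansion in k expresses these integrals through the moments of x . Om, so that they can be
    compared with angular integrals term by term. *)
Lemma zon_series a k Om : S Om ->
  \sum_(d < N) k ^+ d / d`!%:R * I (fun x => dot x Om ^+ (a + d)) @[N --> \oo] --> zon a k Om.
Proof.
move=> SO; have b m : bdm (fun x : 'rV[R]_n => dot x Om ^+ m) by apply: bdmX; exact: bdm_dot.
have bT N : bdm (fun x : 'rV[R]_n => dot x Om ^+ a * expT N (k * dot x Om)).
  apply: bdmM => //; apply: bdm_sum => d _.
  have := bdmZ (k ^+ d / d`!%:R) (b d); apply: eq_bdm => x _; rewrite exprMn; ring.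
have E N : \sum_(d < N) k ^+ d / d`!%:R * I (fun x => dot x Om ^+ (a + d)) =
    I (fun x => dot x Om ^+ a * expT N (k * dot x Om)).
  under eq_bigr do rewrite -(sintZ _ (bI (b _))).
  rewrite -(sint_sum hsigma) => [|d _]; last exact/bI/bdmZ.
  apply: eq_sint => x _; rewrite /expT mulr_sumr; apply: eq_bigr => d _.
  by rewrite exprD exprMn; ring.
under eq_fun do rewrite E.
apply/cvgrPdist_le => e e0; near=> N.
rewrite /zon -sintB; [|exact/bI/bdm_zexp|exact/bI].
apply: (norm_sint_le hsigma); first by apply: bI; apply: bdmB => //; exact: bdm_zexp.
move=> x Sx; rewrite /zexp -mulrBr normrM normrX.
apply: (@le_trans _ _ (1 * (expR `|k| * (`|k| ^+ N / N`!%:R)))).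
  apply: ler_pM => //; first by apply: exprn_ile1 => //; exact: dot_sphere.
  apply: (le_trans (expT_remainder N (norm_kdot k SO Sx))).
  rewrite ler_pM2l ?expR_gt0// ler_pM2r ?invr_gt0 ?ltr0n ?fact_gt0//.
  by rewrite lerXn2r ?nnegrE// norm_kdot.
rewrite mul1r -ler_pdivlMl ?expR_gt0//.
rewrite -[leLHS]ger0_norm; last by rewrite divr_ge0// exprn_ge0.
rewrite -[leLHS]normrN -[X in `|X|]sub0r; near: N.
apply: cvgr_dist_le; first exact: expT_cvg.
by rewrite mulr_gt0 ?invr_gt0 ?expR_gt0.
Unshelve. all: by end_near. Qed.

(** The vanishing mean of the Laplacian of e^(k u), u = x . Om, says that (n - 1) k [zon 1] equals
    k^2 times the integral of (1 - u^2) e^(k u), positive because the mean of u^2 is 1 / n < 1. *)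
Lemma zon1_gt0 k Om : 0 < k -> S Om -> 0 < zon 1 k Om.
Proof.
move=> k0 SO; have p1 : 0 < n.-1%:R :> R by exact: predn_gt0.
have dk (c u : R) : is_derive u (1 : R) (fun v : R => c * expR (k * v)) (c * k * expR (k * u)).
  apply: is_derive_eq (hdZ c (hd_exp (hdZ k (hd_id u)))) _; ring.
have d1 (u : R) : is_derive u (1 : R) (fun v : R => expR (k * v)) (k * expR (k * u)).
  by apply: is_derive_eq (hd_exp (hdZ k (hd_id u))) _; ring.
have cc : continuous (fun u : R => k * k * expR (k * u)) by move=> u; exact: hd_continuous (dk _ u).
have := sint_lapz hn hsigma SO d1 (dk k) cc.
have b2 : bdm (fun x => (1 - dot x Om ^+ 2) * expR (k * dot x Om)).
  apply: bdmM; last exact: bdm_expdot.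
  by apply: bdmB; [exact: bdm_cst|apply: bdmX; exact: bdm_dot].
have -> : I (fun x => lapz n (k * expR (k * dot x Om)) (k * k * expR (k * dot x Om)) (dot x Om)) =
    k * k * I (fun x => (1 - dot x Om ^+ 2) * expR (k * dot x Om)) - n.-1%:R * k * zon 1 k Om.
  rewrite /zon -(sintZ _ (bI b2)) -(sintZ _ (bI (bdm_zexp 1 k Om))).
  rewrite -sintB; [|exact/bI/bdmZ|exact/bI/bdmZ/bdm_zexp].
  by apply: eq_sint => x _; rewrite /lapz /zexp; ring.
move=> /eqP; rewrite subr_eq0 => /eqP h.
have h2 : 0 < I (fun x => (1 - dot x Om ^+ 2) * expR (k * dot x Om)).
  have n2 : 1 < n%:R :> R by rewrite ltr1n.
  apply: (@lt_le_trans _ _ (expR (- `|k|) * (1 - n%:R^-1))).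
    by rewrite mulr_gt0 ?expR_gt0// subr_gt0 invf_lt1// (lt_trans ltr01).
  have bb : bdm (fun x : 'rV[R]_n => dot x Om ^+ 2) by apply: bdmX; exact: bdm_dot.
  have b1 : bdm (fun _ : 'rV[R]_n => 1 : R) := bdm_cst 1.
  have -> : 1 - n%:R^-1 = I (fun x => 1 - dot x Om ^+ 2).
    by rewrite sintB ?(sint_cst hsigma) ?moment2//; exact: bI.
  rewrite -sintZ; last by apply: bI; exact: bdmB.
  apply: le_sint; [by apply: bI; apply: bdmZ; exact: bdmB|exact: bI|].
  move=> x Sx; rewrite mulrC ler_wpM2l ?expdot_ge// subr_ge0.
  by rewrite -real_normK ?num_real// exprn_ile1// dot_sphere.
have : 0 < n.-1%:R * k * zon 1 k Om by rewrite -h mulr_gt0// mulr_gt0.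
by rewrite pmulr_rgt0// mulr_gt0.
Qed.

(** Up to the factor [zon 0] this is the integral of (u - c)^2 e^(k u), with c the mean of u; it is
    at least e^(-|k|) (1 / n + c^2). *)
Lemma zon_var k Om : S Om -> 0 < zon 2 k Om * zon 0 k Om - zon 1 k Om ^+ 2.
Proof.
move=> SO; have z0 := zon0_gt0 k SO; pose c := zon 1 k Om / zon 0 k Om.
have bz a : intg sigma (zexp a k Om) by exact/bI/bdm_zexp.
have b1 : bdm (fun x : 'rV[R]_n => (dot x Om - c) ^+ 2).
  by apply: bdmX; apply: bdmB; [exact: bdm_dot|exact: bdm_cst].
have E : I (fun x => (dot x Om - c) ^+ 2 * expR (k * dot x Om)) =
    zon 2 k Om - 2 * c * zon 1 k Om + c ^+ 2 * zon 0 k Om.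
  rewrite /zon -!sintZ; try exact: bz.
  rewrite -sintB; [|exact: bz|exact/intgZ/bz].
  rewrite -sintD; [|by apply: intgB; [exact: bz|exact/intgZ/bz]|exact/intgZ/bz].
  by apply: eq_sint => x _; rewrite /zexp; ring.
have -> : zon 2 k Om * zon 0 k Om - zon 1 k Om ^+ 2 =
    zon 0 k Om * I (fun x => (dot x Om - c) ^+ 2 * expR (k * dot x Om)).
  by rewrite E /c; field; rewrite gt_eqF.
rewrite mulr_gt0//; apply: (@lt_le_trans _ _ (expR (- `|k|) * I (fun x => (dot x Om - c) ^+ 2))).
  rewrite mulr_gt0 ?expR_gt0//.
  have -> : I (fun x => (dot x Om - c) ^+ 2) = n%:R^-1 + c ^+ 2.
    have bd : bdm (fun x : 'rV[R]_n => dot x Om) by exact: bdm_dot.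
    have bb : bdm (fun x : 'rV[R]_n => dot x Om ^+ 2) by exact: bdmX.
    rewrite -(moment2 SO) -[RHS]addr0 -(mulr0 (-(2 * c))) -(moment1 SO) -(sint_cst hsigma (c ^+ 2)).
    rewrite -(sintZ _ (bI bd)) -sintD; [|exact: bI|exact/bI/bdm_cst].
    rewrite -sintD; [|by apply: bI; apply: bdmD => //; exact: bdm_cst|exact/bI/bdmZ].
    by apply: eq_sint => x _; ring.
  by rewrite ltr_pwDl ?sqr_ge0// invr_gt0 ltr0n ltnW.
rewrite -sintZ; last exact: bI.
apply: le_sint; [by apply: bI; exact: bdmZ|by apply: bI; apply: bdmM => //; exact: bdm_expdot|].
by move=> x Sx; rewrite mulrC ler_wpM2l ?sqr_ge0// expdot_ge.
Qed.

(** The derivative of e^(k x . Om) along the field (p, q) has mean zero, so the vector v of these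
    integrals satisfies v_p Om_q = v_q Om_p. It is parallel to Om, and contraction with Om gives the
    factor. *)
Lemma coord_zon k Om i : 0 < k -> S Om ->
  I (fun x => x 0 i * expR (k * dot x Om)) = zon 1 k Om * Om 0 i.
Proof.
move=> k0 SO; have /sphereP OO := SO.
have be j : bdm (fun x : 'rV[R]_n => x 0 j * expR (k * dot x Om)).
  by apply: bdmM; [exact: bdm_coord|exact: bdm_expdot].
have sym p q : I (fun x => x 0 p * expR (k * dot x Om)) * Om 0 q =
    I (fun x => x 0 q * expR (k * dot x Om)) * Om 0 p.
  have d1 (u : R) : is_derive u (1 : R) (fun v : R => expR (k * v)) (k * expR (k * u)).
    by apply: is_derive_eq (hd_exp (hdZ k (hd_id u))) _; ring.
  have := rd_zonal p q Om d1.
  have bg : bdm (fun x : 'rV[R]_n => k * expR (k * dot x Om) * ddot p q Om x).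
    by apply: bdmM; [exact/bdmZ/bdm_expdot|exact: bdm_ddot].
  move=> h; have := sint_rd hsigma h (bdm_expdot k Om) bg.
  have -> : I (fun x => k * expR (k * dot x Om) * ddot p q Om x) =
     k * (I (fun x => x 0 p * expR (k * dot x Om)) * Om 0 q -
          I (fun x => x 0 q * expR (k * dot x Om)) * Om 0 p).
    rewrite -!(sintZr _ (bI (be _))) -sintB; try by apply: intgM; [exact: bI|exact: bdm_cst].
    rewrite -sintZ; first by apply: eq_sint => x _; rewrite /ddot; ring.
    by apply: intgB; apply: intgM; try exact: bI; exact: bdm_cst.
  by move=> /eqP; rewrite mulf_eq0 gt_eqF//= subr_eq0 => /eqP.
rewrite -[LHS]mulr1 -OO /dot mulr_sumr.
under eq_bigr do rewrite mulrA sym mulrAC.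
rewrite -mulr_suml; congr (_ * _).
under eq_bigr do rewrite -(sintZr _ (bI (be _))).
rewrite -(sint_sum hsigma) => [|j _]; last by apply: intgM; [exact: bI|exact: bdm_cst].
apply: eq_sint => x _; rewrite /zexp expr1 mulr_suml; apply: eq_bigr => j _; ring.
Qed.

End ZonalExponentials.

Section OrderParameter.
Variables (R : realType) (n : nat).
Hypothesis hn : (2 <= n)%N.
Implicit Types (k : R) (a d : nat).

Local Notation mu := (@lebesgue_measure R).
Local Notation A0 := (`[0, pi]%classic : set R).

Definition tint (g : R -> R) : R := \int[mu]_(t in `[0, pi]) g t.

Lemma tint_integrable (g : R -> R) : continuous g -> mu.-integrable A0 (EFin \o g).
Proof.
move=> cg; apply: continuous_compact_integrable; first exact: segment_compact.
exact: continuous_subspaceT.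
Qed.

Lemma tint_FTC (F g : R -> R) : continuous g -> (forall t : R, is_derive t (1 : R) F (g t)) ->
  tint g = F pi - F 0.
Proof.
move=> cg dF; rewrite /tint /Rintegral (continuous_FTC2 (F := F))//.
- exact: pi_gt0.
- exact: continuous_subspaceT.
- split.
  + by move=> t _; case: (dF t).
  + by apply: cvg_at_right_filter; exact: hd_continuous (dF 0).
  + by apply: cvg_at_left_filter; exact: hd_continuous (dF pi).
- by move=> t _; rewrite derive1E; exact: derive_val.
Qed.

Lemma tintZ c (g : R -> R) : continuous g -> tint (fun t => c * g t) = c * tint g.
Proof. by move=> cg; rewrite /tint RintegralZl//; exact: tint_integrable. Qed.

Lemma tintB (g h : R -> R) : continuous g -> continuous h ->
  tint (fun t => g t - h t) = tint g - tint h.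
Proof. by move=> cg ch; rewrite /tint RintegralB//; exact: tint_integrable. Qed.

Lemma tintD (g h : R -> R) : continuous g -> continuous h ->
  tint (fun t => g t + h t) = tint g + tint h.
Proof. by move=> cg ch; rewrite /tint RintegralD//; exact: tint_integrable. Qed.

Lemma continuous_cos_sin d m : continuous (fun t : R => cos t ^+ d * sin t ^+ m).
Proof.
move=> t; exact: hd_continuous (hdM (hdX d (is_derive_cos t)) (hdX m (is_derive_sin t))).
Qed.

Definition tmom d : R := tint (fun t => cos t ^+ d * sin t ^+ (n - 2)).

(** The derivative of cos^d sin^(n-1) integrates to 0 over [0, pi]. The recurrence obtained is that
    of [moment_rec]. *)
Lemma tmom_rec d : (d.+1 + n - 2)%:R * tmom d.+1 = d%:R * tmom d.-1.
Proof.
pose m := (n - 2)%N; have nm : n = m.+2 by rewrite /m subn2; case: (n) hn => [|[]].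
have -> : (d.+1 + n - 2 = d + m.+1)%N by rewrite {1}nm addSn !addnS !subSS subn0.
pose F (t : R) := cos t ^+ d * sin t ^+ m.+1.
have dF (t : R) : is_derive t (1 : R) F
   ((d + m.+1)%:R * (cos t ^+ d.+1 * sin t ^+ m) - d%:R * (cos t ^+ d.-1 * sin t ^+ m)).
  apply: is_derive_eq (hdM (hdX d (is_derive_cos t)) (hdX m.+1 (is_derive_sin t))) _.
  have s2 : sin t ^+ 2 = 1 - cos t ^+ 2 by rewrite -(cos2Dsin2 t); ring.
  rewrite /= natrD; case: (d) => [|e] /=.
    by rewrite expr0 !mul0r add0r expr1; ring.
  have -> : sin t ^+ m.+1 = sin t * sin t ^+ m by rewrite exprS.
  rewrite !exprS; transitivity (m.+1%:R * (cos t * (cos t * (cos t ^+ e * sin t ^+ m)))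
    - e.+1%:R * (sin t ^+ 2 * (cos t ^+ e * sin t ^+ m))); first by ring.
  by rewrite s2; ring.
have c1 : continuous (fun t : R => (d + m.+1)%:R * (cos t ^+ d.+1 * sin t ^+ m)).
  move=> t; apply: (@cvgM _ _ (nbhs t)); [exact: cvg_cst|exact: continuous_cos_sin].
have c2 : continuous (fun t : R => d%:R * (cos t ^+ d.-1 * sin t ^+ m)).
  move=> t; apply: (@cvgM _ _ (nbhs t)); [exact: cvg_cst|exact: continuous_cos_sin].
have cg : continuous (fun t : R => (d + m.+1)%:R * (cos t ^+ d.+1 * sin t ^+ m) -
    d%:R * (cos t ^+ d.-1 * sin t ^+ m)).
  by move=> t; apply: (@cvgB _ _ _ (nbhs t)); [exact: c1|exact: c2].
have := tint_FTC cg dF; rewrite tintB// !tintZ; try exact: continuous_cos_sin.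
rewrite /F sinpi sin0 !expr0n /= !mulr0 subrr -/m => /eqP.
by rewrite subr_eq0 => /eqP.
Qed.

Lemma tmom1 : tmom 1 = 0.
Proof.
have := tmom_rec 0; rewrite mul0r => /eqP; rewrite mulf_eq0 => /orP[|/eqP//].
by rewrite pnatr_eq0 subn_eq0 add1n ltnS leqNgt hn.
Qed.

(** On [0, pi / 2] the integrand sin^m is at least cos sin^m, whose integral is 1 / (m + 1). *)
Lemma tmom0_gt0 : 0 < tmom 0.
Proof.
pose m := (n - 2)%N.
have pi2 : 0 < (pi : R) / 2 by rewrite divr_gt0 ?pi_gt0.
have pi2' : (pi : R) / 2 <= pi by have := pi_gt0 R; lra.
have c0 : continuous (fun t : R => cos t ^+ 0 * sin t ^+ m) by exact: continuous_cos_sin.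
have c1 : continuous (fun t : R => cos t ^+ 1 * sin t ^+ m) by exact: continuous_cos_sin.
have dF (t : R) : is_derive t (1 : R) (fun t : R => m.+1%:R^-1 * sin t ^+ m.+1) (cos t ^+ 1 * sin t ^+ m).
  apply: is_derive_eq (hdZ m.+1%:R^-1 (hdX m.+1 (is_derive_sin t))) _.
  by rewrite /= !mulrA mulVf ?pnatr_eq0// mul1r mulrC expr1.
have h : (\int[mu]_(t in `[0%R, ((pi : R) / 2)%R]) (cos t ^+ 1 * sin t ^+ m)%:E = (m.+1%:R^-1)%:E)%E.
  rewrite (continuous_FTC2 (F := fun t : R => m.+1%:R^-1 * sin t ^+ m.+1))//.
  - by rewrite sin_pihalf sin0 expr1n expr0n/= mulr1 mulr0 sube0.
  - exact: continuous_subspaceT.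
  - split.
    + by move=> t _; case: (dF t).
    + by apply: cvg_at_right_filter; exact: hd_continuous (dF 0).
    + by apply: cvg_at_left_filter; exact: hd_continuous (dF (pi / 2)).
  - by move=> t _; rewrite derive1E; exact: derive_val.
have mf (B : set R) (g : R -> R) : measurable B -> continuous g -> measurable_fun B (fun t => (g t)%:E).
  move=> mB cg; apply/measurable_EFinP; apply: measurable_funTS.
  exact: continuous_measurable_fun.
have h2 : ((m.+1%:R^-1)%:E <= \int[mu]_(t in `[0%R, (pi : R)]) (cos t ^+ 0 * sin t ^+ m)%:E)%E.
  rewrite -h; apply: (@le_trans _ _ (\int[mu]_(t in `[0%R, ((pi : R) / 2)%R]) (cos t ^+ 0 * sin t ^+ m)%:E)%E).
    apply: ge0_le_integral => //.
    + move=> t; rewrite /= in_itv/= => /andP[t0 t2]; rewrite lee_fin mulr_ge0//.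
        by rewrite expr1 cos_ge0_pihalf// t2 andbT (le_trans _ t0)// oppr_le0 ltW.
      by rewrite exprn_ge0// sin_ge0_pi// t0 (le_trans t2).
    + exact: mf.
    + exact: mf.
    + move=> t; rewrite /= in_itv/= => /andP[t0 t2]; rewrite lee_fin ler_wpM2r//.
        by rewrite exprn_ge0// sin_ge0_pi// t0 (le_trans t2).
      by rewrite expr1 expr0 cos_le1.
  apply: ge0_subset_integral => //.
  - exact: mf.
  - move=> t; rewrite /= in_itv/= => /andP[t0 t2]; rewrite lee_fin expr0 mul1r.
    by rewrite exprn_ge0// sin_ge0_pi// t0.
  - by move=> t; rewrite /= !in_itv/= => /andP[-> t2]; rewrite (le_trans t2).
have fin : (\int[mu]_(t in `[0%R, (pi : R)]) (cos t ^+ 0 * sin t ^+ m)%:E)%E \is a fin_num.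
  by apply: integrable_fin_num => //; exact: tint_integrable.
rewrite /tmom /tint /Rintegral -/m; apply: (@lt_le_trans _ _ m.+1%:R^-1); first by rewrite invr_gt0.
by rewrite -lee_fin fineK.
Qed.

Definition tang a k : R := tint (fun t => cos t ^+ a * expR (k * cos t) * sin t ^+ (n - 2)).

Lemma order_parameterE k : order_parameter n k = tang 1 k / tang 0 k.
Proof.
rewrite /order_parameter /tang /tint; congr (_ / _).
by apply: eq_Rintegral => t _; rewrite expr0 mul1r.
Qed.

Lemma tang_series a k :
  \sum_(d < N) k ^+ d / d`!%:R * tmom (a + d) @[N --> \oo] --> tang a k.
Proof.
pose m := (n - 2)%N.
have cT N : continuous (fun t : R => cos t ^+ a * expT N (k * cos t) * sin t ^+ m).
  move=> t; pose g (N : nat) (t : R) := \sum_(d < N) k ^+ d / d`!%:R * (cos t ^+ (a + d) * sin t ^+ m).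
  have -> : (fun t : R => cos t ^+ a * expT N (k * cos t) * sin t ^+ m) = g N.
    apply/funext => u; rewrite /g /expT mulr_sumr mulr_suml; apply: eq_bigr => d _.
    by rewrite exprD exprMn; ring.
  apply: (@cvg_sumr _ _ (nbhs t)) => d _; apply: (@cvgM _ _ (nbhs t)); [exact: cvg_cst|exact: continuous_cos_sin].
have cE : continuous (fun t : R => cos t ^+ a * expR (k * cos t) * sin t ^+ m).
  move=> t; exact: hd_continuous (hdM (hdM (hdX a (is_derive_cos t))
    (hd_exp (hdZ k (is_derive_cos t)))) (hdX m (is_derive_sin t))).
have E N : \sum_(d < N) k ^+ d / d`!%:R * tmom (a + d) =
    tint (fun t => cos t ^+ a * expT N (k * cos t) * sin t ^+ m).
  have : tint (fun t => \sum_(d < N) k ^+ d / d`!%:R * (cos t ^+ (a + d) * sin t ^+ m)) =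
      \sum_(d < N) k ^+ d / d`!%:R * tmom (a + d).
    elim: N => [|N ih].
      rewrite big_ord0 /tint; under eq_Rintegral do rewrite big_ord0.
      by rewrite Rintegral_cst// mul0r.
    rewrite big_ord_recr/= -ih /tmom -tintZ; last exact: continuous_cos_sin.
    have cc : continuous (fun t : R => k ^+ N / N`!%:R * (cos t ^+ (a + N) * sin t ^+ m)).
      by move=> t; apply: (@cvgM _ _ (nbhs t)); [exact: cvg_cst|exact: continuous_cos_sin].
    have cs : continuous (fun t : R => \sum_(d < N) k ^+ d / d`!%:R * (cos t ^+ (a + d) * sin t ^+ m)).
      move=> t; apply: (@cvg_sumr _ _ (nbhs t)) => d _.
      by apply: (@cvgM _ _ (nbhs t)); [exact: cvg_cst|exact: continuous_cos_sin].
    by rewrite -tintD//; congr tint; apply/funext => t; rewrite big_ord_recr.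
  move=> <-; congr tint; apply/funext => u; rewrite /expT mulr_sumr mulr_suml; apply: eq_bigr => d _.
  by rewrite exprD exprMn; ring.
under eq_fun do rewrite E.
apply/cvgrPdist_le => e e0; near=> N.
rewrite /tang -tintB//; apply: (@le_trans _ _ (tint (fun=> expR `|k| * (`|k| ^+ N / N`!%:R)))).
  apply: le_trans (le_normr_Rintegral _ _) _ => //.
    by apply: tint_integrable => t; apply: (@cvgB _ _ _ (nbhs t)); [exact: cE|exact: cT].
  apply: le_Rintegral => //.
  - apply: (@tint_integrable (fun t => `|_ - _|)) => t; apply: (@cvg_norm _ _ _ (nbhs t)).
    by apply: (@cvgB _ _ _ (nbhs t)); [exact: cE|exact: cT].
  - by apply: tint_integrable => t; exact: cvg_cst.
  move=> t _; have cos1 : `|cos t| <= 1 :> R by rewrite ler_norml cos_geN1 cos_le1.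
  have sin1 : `|sin t| <= 1 :> R by rewrite ler_norml sin_geN1 sin_le1.
  have kc : `|k * cos t| <= `|k| by rewrite normrM ler_piMr.
  rewrite -mulrBl -mulrBr !normrM !normrX.
  rewrite -[leRHS]mulr1; apply: ler_pM => //; [|exact: exprn_ile1].
  rewrite -[leRHS]mul1r; apply: ler_pM => //; first exact: exprn_ile1.
  apply: (le_trans (expT_remainder N kc)).
  rewrite ler_pM2l ?expR_gt0// ler_pM2r ?invr_gt0 ?ltr0n ?fact_gt0//.
  by rewrite lerXn2r ?nnegrE.
rewrite /tint Rintegral_cst//.
set c := fine _; have c0 : 0 <= c by exact: fine_ge0.
apply: (@le_trans _ _ (expR `|k| * (`|k| ^+ N / N`!%:R) * (c + 1))).
  by rewrite ler_wpM2l ?lerDl// mulr_ge0 ?expR_ge0// divr_ge0// exprn_ge0.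
have c1 : 0 < c + 1 by rewrite ltr_wpDl.
rewrite -ler_pdivlMr// -ler_pdivlMl ?expR_gt0//.
rewrite -[leLHS]ger0_norm; last by rewrite divr_ge0// exprn_ge0.
rewrite -[leLHS]normrN -[X in `|X|]sub0r; near: N.
apply: cvgr_dist_le; first exact: expT_cvg.
by rewrite mulr_gt0 ?invr_gt0 ?expR_gt0// divr_gt0// ltr_wpDl// fine_ge0.
Unshelve. all: by end_near. Qed.

Section Sphere.
Variable sigma : probability (borel R n) R.
Hypothesis hsigma : is_uniform sigma.

(** Both sequences have a zero term of order 1 and follow the same recurrence of step 2, hence are
    proportional. This replaces the slicing of the sphere along Om. *)
Lemma tmom_moment d Om : sphere R n Om ->
  tmom d = tmom 0 * sint sigma (fun x => dot x Om ^+ d).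
Proof.
move=> SO; elim/ltn_ind: d => -[|[|d]] ih.
- have -> : sint sigma (fun x => dot x Om ^+ 0) = 1; last by rewrite mulr1.
  by rewrite -[RHS](sint_cst hsigma); apply: eq_sint => x _; rewrite expr0.
- rewrite tmom1 (_ : sint _ _ = 0) ?mulr0//.
  by rewrite -(moment1 hn hsigma SO); apply: eq_sint => x _; rewrite expr1.
- have nz : (d.+2 + n - 2)%:R != 0 :> R by rewrite pnatr_eq0 !addSn !subSS subn0 -lt0n (leq_trans (ltnW hn))// leq_addl.
  have := tmom_rec d.+1; rewrite /= (ih d)// => h1.
  have := moment_rec hn hsigma d.+2 SO; rewrite /= => h2.
  apply: (mulfI nz); rewrite h1; move: h2; rewrite !natrM -!mulrA => h2.
  have /mulfI h3 : d.+2%:R != 0 :> R by rewrite pnatr_eq0.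
  by rewrite mulrCA (mulrCA _ (tmom 0)) (h3 _ _ h2).
Qed.

Lemma tang_zon a k Om : sphere R n Om -> tang a k = tmom 0 * zon sigma a k Om.
Proof.
move=> SO; have h1 := @tang_series a k.
have h2 : \sum_(d < N) k ^+ d / d`!%:R * tmom (a + d) @[N --> \oo] --> tmom 0 * zon sigma a k Om.
  have E N : \sum_(d < N) k ^+ d / d`!%:R * tmom (a + d) = tmom 0 *
      \sum_(d < N) k ^+ d / d`!%:R * sint sigma (fun x => dot x Om ^+ (a + d)).
    rewrite mulr_sumr; apply: eq_bigr => d _; rewrite (tmom_moment _ SO); ring.
  under eq_fun do rewrite E.
  by apply: cvgM; [exact: cvg_cst|exact: zon_series].
exact: (cvg_unique _ h1 h2).
Qed.

Lemma order_parameter_zon k Om : sphere R n Om ->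
  order_parameter n k = zon sigma 1 k Om / zon sigma 0 k Om.
Proof.
move=> SO; rewrite order_parameterE !(tang_zon _ _ SO) invfM mulrACA mulfV ?mul1r//.
by rewrite gt_eqF ?tmom0_gt0.
Qed.

Lemma zon_indep a k Om Om' : sphere R n Om -> sphere R n Om' -> zon sigma a k Om = zon sigma a k Om'.
Proof.
move=> SO SO'; have := tang_zon a k SO; rewrite (tang_zon a k SO').
have /mulfI h : tmom 0 != 0 by rewrite gt_eqF ?tmom0_gt0.
by move=> /h ->.
Qed.

End Sphere.

End OrderParameter.

(** * The rate, its potential and the equilibria *)

Section Rate.
Variables (R : realType) (nu tau : R -> R).
Hypothesis hcoef : coefficients nu tau.

Local Notation k := (rate nu tau).
Local Notation mu := (@lebesgue_measure R).
Local Notation Phi := (potential nu tau).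

Lemma rate_lt a b : 0 <= a -> a < b -> k a < k b.
Proof. by case: hcoef => _ _ _ h _; exact: h. Qed.

Lemma rate_le a b : 0 <= a -> a <= b -> k a <= k b.
Proof.
by move=> a0; rewrite le_eqVlt => /orP[/eqP->//|ab]; exact/ltW/rate_lt.
Qed.

Lemma rate0 : k 0 = 0.
Proof. by case: hcoef => _ [n0 _ _] _ _ _; rewrite /rate n0 mul0r. Qed.

Lemma rate_ge0 a : 0 <= a -> 0 <= k a.
Proof. by move=> a0; rewrite -rate0 rate_le. Qed.

(** Differentiability relative to [0, +oo[, in a form that also covers the endpoint 0, where the
    increment is one-sided. *)
Lemma rate_local (r : R) : 0 <= r -> exists D : R, forall e, 0 < e ->
  exists2 d : R, 0 < d & forall u, 0 <= u -> `|u - r| < d ->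
    `|k u - k r - (u - r) * D| <= e * `|u - r|.
Proof.
move=> r0; case: hcoef => _ _ _ _ [dk [_ /(_ r r0) h]]; exists (dk r) => e e0.
have : \forall u \near within `[0, +oo[%classic (r^'), `|dk r - (k u - k r) / (u - r)| <= e.
  by move/(@cvgrPdist_le _ _ _ _ (within_filter _ _)): h; apply.
rewrite near_withinE near_withinE => /nbhs_ballP[d /= d0 hd].
exists d => // u u0 ud; have [->|ur] := eqVneq u r.
  by rewrite !subrr normr0 mul0r subr0 normr0 mulr0.
have := hd u; rewrite /ball/= distrC => /(_ ud ur); rewrite in_itv/= u0 => /(_ isT) h2.
have nz : u - r != 0 by rewrite subr_eq0.
have -> : k u - k r - (u - r) * dk r = - (dk r - (k u - k r) / (u - r)) * (u - r) by field.
by rewrite normrM normrN ler_wpM2r.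
Qed.

Lemma rate_derive (r : R) : 0 < r -> exists D : R, is_derive r (1 : R) k D.
Proof.
move=> r0; have [D hD] := rate_local (ltW r0); exists D; apply/hd_epsP => e e0.
have [d d0 hd] := hD e e0; near=> h.
have hr : `|h| < r by near: h; exact: (@nbhs0_lt _ R).
have := hd (r + h); rewrite addrAC subrr add0r; apply.
  by move: hr; rewrite ltr_norml => /andP[h1 _]; lra.
by near: h; exact: (@nbhs0_lt _ R).
Unshelve. all: by end_near. Qed.

Lemma rate_continuous_abs : continuous (fun r : R => k `|r|).
Proof.
move=> a; have [D hD] := rate_local (normr_ge0 a).
have [d d0 hd] := hD 1 ltr01.
apply/cvgrPdist_le => e e0; near=> u.
have ua : `| `|u| - `|a| | <= `|u - a| by exact: ler_dist_dist.
have ud : `|u - a| < d.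
  by rewrite distrC; near: u; apply: cvgr_dist_lt => //; exact: cvg_id.
have h1 := hd _ (normr_ge0 u) (le_lt_trans ua ud).
have h2 : `|k `|u| - k `|a| | <= (1 + `|D|) * `| `|u| - `|a| |.
  rewrite -(subrK ((`|u| - `|a|) * D) (k `|u| - k `|a|)) (le_trans (ler_normD _ _))//.
  by rewrite [leRHS]mulrDl lerD// normrM mulrC.
rewrite distrC (le_trans h2)//; apply: (@le_trans _ _ ((1 + `|D|) * `|u - a|)).
  by rewrite ler_wpM2l// addr_ge0.
rewrite -ler_pdivlMl ?ltr_pwDl// distrC; near: u; apply: cvgr_dist_le; first exact: cvg_id.
by rewrite mulr_gt0// invr_gt0 ltr_pwDl.
Unshelve. all: by end_near. Qed.

Lemma rate_continuous (r : R) : 0 < r -> {for r, continuous k}.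
Proof. by move=> /rate_derive[D hD]; exact: hd_continuous hD. Qed.

Let Ka (r : R) := k `|r|.

Let Kint (b : R) : mu.-integrable `[0, b] (EFin \o Ka).
Proof.
apply: continuous_compact_integrable; first exact: segment_compact.
exact: continuous_subspaceT rate_continuous_abs.
Qed.

Let PhiE r : Phi r = \int[mu]_(u in `[0, r]) Ka u.
Proof.
by apply: eq_Rintegral => u; rewrite inE/= in_itv/= => /andP[u0 _]; rewrite /Ka ger0_norm.
Qed.

Lemma potential_bounds a b : 0 <= a -> a <= b ->
  k a * (b - a) <= Phi b - Phi a <= k b * (b - a).
Proof.
move=> a0 ab; rewrite !PhiE (Rintegral_itvB (Kint b)) ?bnd_simp//.
have int : mu.-integrable `]a, b] (EFin \o Ka).
  apply: integrableS (Kint b) => //.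
  by move=> x /=; rewrite !in_itv/= => /andP[ax ->]; rewrite (le_trans a0 (ltW ax)).
have cst (c : R) : \int[mu]_(x in `]a, b]) c = c * (b - a).
  rewrite Rintegral_cst//= lebesgue_measure_itv/= lte_fin; case: ltP => // ba.
  by rewrite (le_anti (introT andP (conj ab ba))) subrr.
have icst (c : R) : mu.-integrable `]a, b] (EFin \o (fun=> c)).
  apply: integrableS (_ : mu.-integrable `[a, b] _) => //.
    by move=> x /=; rewrite !in_itv/= => /andP[/ltW-> ->].
  apply: continuous_compact_integrable; first exact: segment_compact.
  by apply: continuous_subspaceT => x; exact: cvg_cst.
rewrite -!cst; apply/andP; split; apply: le_Rintegral => // x; rewrite /= in_itv/= => /andP[ax xb].
  by rewrite /Ka ger0_norm ?rate_le// ?(le_trans a0)// ltW.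
by rewrite /Ka ger0_norm ?rate_le// (le_trans a0)// ltW.
Qed.

(** Convexity of the potential, from the monotonicity of the rate; a and b come in either order. *)
Lemma potential_tangent a b : 0 <= a -> 0 <= b -> k a * (b - a) <= Phi b - Phi a.
Proof.
move=> a0 b0; have [ab|/ltW ba] := leP a b.
  by case/andP: (potential_bounds a0 ab).
by case/andP: (potential_bounds b0 ba) => _; lra.
Qed.

Lemma hd_potential (r : R) : 0 < r -> is_derive r (1 : R) Phi (k r).
Proof.
move=> r0; apply/hd_epsP => e e0; have kc := rate_continuous r0.
have hk : \forall h \near (0 : R), `|k (r + h) - k r| <= e.
  have h : \forall u \near r, `|k u - k r| <= e.
    by move/cvgrPdist_le: kc => /(_ e e0); apply: filterS => u; rewrite distrC.
  exact: (nearD0 h).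
near=> h.
have hr : `|h| < r by near: h; exact: (@nbhs0_lt _ R).
have rh : 0 <= r + h by move: hr; rewrite ltr_norml => /andP[h1 _]; lra.
have t1 := potential_tangent (ltW r0) rh; have t2 := potential_tangent rh (ltW r0).
have e1 : r + h - r = h by ring.
have e2 : r - (r + h) = - h by ring.
rewrite e1 in t1; rewrite e2 in t2.
rewrite ger0_norm; last by lra.
have h3 : `|k (r + h) - k r| <= e by near: h.
apply: (@le_trans _ _ (`|(k (r + h) - k r) * h|)); last by rewrite normrM ler_wpM2r.
by apply: le_trans (ler_norm _); lra.
Unshelve. all: by end_near. Qed.

(** Differentiability of the rate at the single point r0 suffices: the derivative k z - k r0 - (D +
    e) (z - r0) of [G] has near r0 the sign opposite to z - r0, so [G] has a local maximum there. *)
Lemma potential_second (r0 D e : R) : 0 < r0 -> is_derive r0 (1 : R) k D -> 0 < e ->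
  exists2 d : R, 0 < d & forall r, `|r - r0| <= d ->
    Phi r - Phi r0 - k r0 * (r - r0) <= (D + e) / 2 * (r - r0) ^+ 2.
Proof.
move=> r00 /hd_epsP kD e0.
have /nbhs_ballP[d1 /= d10 hd1] := kD e e0.
have hd z : `|z - r0| < d1 -> `|k z - k r0 - (z - r0) * D| <= e * `|z - r0|.
  move=> zd; have := hd1 (z - r0); rewrite /ball/= sub0r normrN => /(_ zd).
  by rewrite (addrC r0) subrK.
pose d := Num.min (d1 / 2) (r0 / 2).
have d0 : 0 < d by rewrite lt_min !divr_gt0.
have dd1 : d < d1 by rewrite gt_min ltr_pdivrMr// mulr2n mulrDr mulr1 ltrDl d10.
have dr0 : d < r0 by rewrite gt_min [X in _ || X]ltr_pdivrMr// mulr2n mulrDr mulr1 ltrDl r00 orbT.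
exists d => // r rd.
pose G z := Phi z - k r0 * z - (D + e) / 2 * (z - r0) ^+ 2.
have dG (z : R) : 0 < z -> is_derive z (1 : R) G (k z - k r0 - (D + e) * (z - r0)).
  move=> z0; apply: is_derive_eq (hdB (hdB (hd_potential z0) (hdZ (k r0) (hd_id z)))
    (hdZ ((D + e) / 2) (hdX 2 (hdB (hd_id z) (hd_cst r0 z))))) _.
  by rewrite /= expr1; field.
have cG a b : 0 < a -> {within `[a, b], continuous G}.
  move=> a0; apply: derivable_within_continuous => z; rewrite in_itv/= => /andP[az _].
  by case: (dG z (lt_le_trans a0 az)).
have GG : G r <= G r0.
  have [rr|/ltW rr] := leP r0 r.
  - apply: (hd_nincr (df := fun z => k z - k r0 - (D + e) * (z - r0))) => //.
    + by move=> z /andP[z0 _]; apply: dG; exact: lt_trans z0.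
    + move=> z /andP[z0 zr]; have zr0 : 0 < z - r0 by rewrite subr_gt0.
      have := hd z; rewrite gtr0_norm// => /(_ _); rewrite (ger0_norm (_ : 0 <= r - r0)) ?subr_ge0// in rd.
      move=> /(_ ltac:(lra)); rewrite ler_norml => /andP[_]; lra.
    + exact: cG.
  - rewrite -lerN2; apply: (hd_nincr (f := fun z => - G z)
      (df := fun z => - (k z - k r0 - (D + e) * (z - r0)))) => //.
    + move=> z /andP[z0 _]; apply: hdN; apply: dG.
      move: rd; rewrite ler_norml => /andP[h _]; lra.
    + move=> z /andP[rz zr0]; have zr : z - r0 < 0 by rewrite subr_lt0.
      rewrite (ler0_norm (_ : r - r0 <= 0)) ?subr_le0// in rd.
      have := hd z; rewrite ltr0_norm// => /(_ ltac:(lra)).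
      rewrite ler_norml => /andP[h _]; lra.
    + move=> z; apply: (@cvgN _ _ _ (nbhs _)); apply: cG.
      move: rd; rewrite ler_norml => /andP[h _]; lra.
move: GG; rewrite /G subrr expr0n/= mulr0; lra.
Qed.

End Rate.

Section InverseRate.
Variables (R : realType) (nu tau j : R -> R).
Hypotheses (hcoef : coefficients nu tau) (hj : is_inverse_rate nu tau j).
Variable (kappa : R).
Hypotheses (k0 : 0 < kappa) (k1 : (kappa%:E < kappa_max nu tau)%E).

Local Notation k := (rate nu tau).

Lemma near_kappa_max : \forall x \near kappa, 0 < x /\ (x%:E < kappa_max nu tau)%E.
Proof.
have h1 : \forall x \near kappa, (x%:E < kappa_max nu tau)%E.
  have h : x%:E @[x --> kappa] --> kappa%:E by apply: cvg_EFin; [exact: nearW|exact: cvg_id].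
  have hN : nbhs kappa%:E [set y | (y < kappa_max nu tau)%E].
    by apply: open_nbhs_nbhs; split; [exact: open_ereal_lt_ereal|exact: k1].
  exact: (h _ hN).
by near=> x; split; near: x => //; exact: lt_nbhsr.
Unshelve. all: by end_near. Qed.

Lemma inverse_rate_gt0 x : 0 < x -> (x%:E < kappa_max nu tau)%E -> 0 < j x /\ k (j x) = x.
Proof.
move=> x0 x1; have [j0 kj] := hj (ltW x0) x1; split=> //.
rewrite lt_neqAle j0 andbT; apply/eqP => jx; move: kj; rewrite -jx rate0// => xE.
by rewrite -xE ltxx in x0.
Qed.

Lemma near_inverse_rate : \forall x \near kappa, 0 < j x /\ k (j x) = x.
Proof. by apply: filterS near_kappa_max => x [x0 x1]; exact: inverse_rate_gt0. Qed.

Lemma inverse_rate_derive D dj : is_derive (j kappa) (1 : R) k D ->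
  is_derive kappa (1 : R) j dj -> D * dj = 1.
Proof.
move=> hD hdj; have h1 := hd_comp hD hdj.
have h2 : is_derive kappa (1 : R) (fun x => k (j x)) 1.
  apply: hd_near (hd_id kappa).
  by apply: filterS near_inverse_rate => x [_ ->].
exact: hd_unique h1 h2.
Qed.

End InverseRate.

Section Equilibria.
Variables (R : realType) (n : nat) (sigma : probability (borel R n) R).
Hypotheses (hn : (2 <= n)%N) (hsigma : is_uniform sigma).
Implicit Types (Om x : 'rV[R]_n) (k rho : R).

Local Notation S := (sphere R n).
Local Notation I := (sint sigma).
Local Notation bI := (intg_bdm hsigma).
Local Notation zon := (zon sigma).
Local Notation eq := (equilibrium sigma).
Local Notation c := (order_parameter n).

Lemma equilibriumE rho k Om x : eq rho k Om x = rho / zon 0 k Om * expR (k * dot x Om).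
Proof.
rewrite /equilibrium /von_mises mulrA mulrAC; congr (_ / _ * _).
by apply: eq_sint => y _; rewrite /zexp expr0 mul1r.
Qed.

Lemma bdm_equilibrium rho k Om : bdm (eq rho k Om).
Proof.
have := bdmZ (rho / zon 0 k Om) (bdm_expdot k Om).
by apply: eq_bdm => x _; rewrite equilibriumE.
Qed.

Lemma mass_equilibrium rho k Om : S Om -> I (eq rho k Om) = rho.
Proof.
move=> SO; rewrite (_ : I _ = rho / zon 0 k Om * zon 0 k Om); last first.
  rewrite -sintZ; last exact/bI/bdm_zexp.
  by apply: eq_sint => x _; rewrite equilibriumE /zexp expr0 mul1r.
by rewrite divfK// gt_eqF ?zon0_gt0.
Qed.

Lemma equilibrium_gt0 rho k Om x : 0 < rho -> S Om -> 0 < eq rho k Om x.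
Proof. by move=> r0 SO; rewrite equilibriumE mulr_gt0 ?expR_gt0// divr_gt0// zon0_gt0. Qed.

Lemma ln_equilibrium rho k Om x : 0 < rho -> S Om ->
  ln (eq rho k Om x) = ln (rho / zon 0 k Om) + k * dot x Om.
Proof.
move=> r0 SO; rewrite equilibriumE lnM ?posrE ?expR_gt0 ?expRK//.
by rewrite divr_gt0 ?zon0_gt0.
Qed.

Lemma order_parameter_gt0 k : 0 < k -> 0 < c k.
Proof.
move=> k0; have i : 'I_n by exact: Ordinal (ltnW hn).
have SO := pole_sphere R i.
by rewrite (order_parameter_zon hn hsigma _ SO) divr_gt0 ?zon0_gt0// zon1_gt0.
Qed.

Lemma zon1E k Om : S Om -> zon 1 k Om = c k * zon 0 k Om.
Proof. by move=> SO; rewrite (order_parameter_zon hn hsigma _ SO) divfK// gt_eqF ?zon0_gt0. Qed.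

Lemma flux_equilibrium rho k Om : 0 < k -> S Om -> flux sigma (eq rho k Om) = (rho * c k) *: Om.
Proof.
move=> k0 SO; apply/rowP => i; rewrite fluxE mxE.
have -> : I (fun x => x 0 i * eq rho k Om x) =
    rho / zon 0 k Om * I (fun x => x 0 i * expR (k * dot x Om)).
  rewrite -sintZ; last by apply: bI; apply: bdmM; [exact: bdm_coord|exact: bdm_expdot].
  by apply: eq_sint => x _; rewrite equilibriumE mulrCA.
rewrite coord_zon// zon1E//; field; by rewrite gt_eqF ?zon0_gt0.
Qed.

Lemma enorm_scale (a : R) Om : 0 <= a -> S Om -> enorm (a *: Om) = a.
Proof. by move=> a0 SO; rewrite enormZ// (_ : enorm Om = 1) ?mulr1. Qed.

(** The derivative of the order parameter, which is the variance of x . Om under the von Mises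
    law. *)
Definition dop k Om : R := zon 2 k Om / zon 0 k Om - c k ^+ 2.

Lemma hd_order_parameter k Om : S Om -> is_derive k (1 : R) c (dop k Om).
Proof.
move=> SO; have z0 u := zon0_gt0 hsigma u SO.
have nz : zon 0 k Om != 0 by rewrite gt_eqF.
apply: (@hd_eq _ (fun u => zon 1 u Om * (zon 0 u Om)^-1)).
  by move=> u; rewrite (order_parameter_zon hn hsigma _ SO).
apply: is_derive_eq (hdM (hd_zon hsigma 1 k SO) (hdV nz (hd_zon hsigma 0 k SO))) _.
rewrite /dop (order_parameter_zon hn hsigma _ SO); field.
exact: nz.
Qed.

Lemma dop_gt0 k Om : S Om -> 0 < dop k Om.
Proof.
move=> SO; have z0 := zon0_gt0 hsigma k SO; have := zon_var hn hsigma k SO.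
rewrite /dop (order_parameter_zon hn hsigma _ SO) => h.
have -> : zon 2 k Om / zon 0 k Om - (zon 1 k Om / zon 0 k Om) ^+ 2 =
   (zon 2 k Om * zon 0 k Om - zon 1 k Om ^+ 2) / zon 0 k Om ^+ 2 by field; rewrite gt_eqF.
by rewrite divr_gt0// exprn_gt0.
Qed.

End Equilibria.

(** * Free energy and relative entropy *)

Section FreeEnergy.
Variables (R : realType) (n : nat) (sigma : probability (borel R n) R).
Hypotheses (hn : (2 <= n)%N) (hsigma : is_uniform sigma).
Variables (nu tau : R -> R).
Hypothesis hcoef : coefficients nu tau.
Implicit Types (g : 'rV[R]_n -> R) (x Om : 'rV[R]_n).

Local Notation S := (sphere R n).
Local Notation I := (sint sigma).
Local Notation bI := (intg_bdm hsigma).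
Local Notation intg := (intg sigma).
Local Notation J g := (enorm (flux sigma g)).
Local Notation Phi := (potential nu tau).
Local Notation k := (rate nu tau).
Local Notation zon := (zon sigma).
Local Notation c := (order_parameter n).

Definition ent g x : R := g x * ln (g x).
Definition fe g : R := I (ent g) - Phi (J g).

Lemma free_energyE g : intg (ent g) -> free_energy sigma nu tau g = (fe g)%:E.
Proof.
move=> ig; rewrite /free_energy /fe EFinB; congr (_ - _)%E.
rewrite /sint /Rintegral fineK//; apply: integrable_fin_num ig; exact: measurable_sphere.
Qed.

Lemma intg_ent_sq g : intg g -> (forall x, S x -> 0 <= g x) -> intg (fun x => g x ^+ 2) ->
  intg (ent g).
Proof.
move=> ig g0 ig2; apply: (@intg_le _ _ sigma _ (fun x => g x ^+ 2 + 1)).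
- apply: measurable_funM; first exact: intg_measurable ig.
  exact: (measurableT_comp (@measurable_ln R) (intg_measurable ig)).
- move=> x Sx; have := entropy_ge (g0 _ Sx); have := g0 _ Sx => gx.
  have h : g x * ln (g x) <= g x ^+ 2.
    rewrite expr2 ler_wpM2l//; move: gx; rewrite le_eqVlt => /orP[/eqP <-|gx]; first by rewrite ln0.
    by have := ln_le_subr1 gx; lra.
  rewrite /ent ler_norml => h2; apply/andP; split; last by lra.
  by have := sqr_ge0 (g x); lra.
- by apply: intgD => //; exact/bI/bdm_cst.
Qed.

Lemma intg_ent_bdm g m : bdm g -> 0 < m -> (forall x, S x -> m <= g x) -> bdm (ent g).
Proof.
move=> bg m0 gm; apply: bdmM => //; apply: (continuous_pos_comp m0) => // s s0.
exact: hd_continuous (hd_ln s0 (hd_id s)).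
Qed.

Lemma direction_sphere g : flux sigma g != 0 -> S (direction sigma g).
Proof. exact: sphere_proj. Qed.

Lemma dot_direction g : flux sigma g != 0 -> dot (flux sigma g) (direction sigma g) = J g.
Proof.
move=> g0; have e0 := enorm_gt0 g0.
by rewrite /direction /Defs.proj dotZr -sqr_enorm expr2 mulKf// gt_eqF.
Qed.

Variables (rho kappa : R).
Hypotheses (rho0 : 0 < rho) (kappa0 : 0 < kappa).

Local Notation eq := (equilibrium sigma rho kappa).
Local Notation r0 := (rho * c kappa).

(** The logarithm of an equilibrium is affine in x . Om, so its entropy reduces to mass and flux. Om
    enters only through [zon 0], which does not depend on it. *)
Definition Fk Om : R := rho * ln (rho / zon 0 kappa Om) + kappa * r0 - Phi r0.

Lemma r0_ge0 : 0 <= r0.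
Proof. by rewrite mulr_ge0// ltW// (order_parameter_gt0 hn hsigma). Qed.

Lemma sint_ln_equilibrium g Om : intg g -> I g = rho -> S Om ->
  I (fun x => g x * ln (eq Om x)) =
    rho * ln (rho / zon 0 kappa Om) + kappa * dot (flux sigma g) Om.
Proof.
move=> ig Ig SO; rewrite (dot_flux hsigma _ ig).
have igd : intg (fun x => dot x Om * g x).
  by have := intgM ig (bdm_dot Om); apply: eq_intg => x _; exact: mulrC.
have -> : rho * ln (rho / zon 0 kappa Om) = I (fun x => g x * ln (rho / zon 0 kappa Om)).
  by rewrite sintZr// Ig.
rewrite -(sintZ _ igd) -sintD; [|by apply: intgM => //; exact: bdm_cst|exact: intgZ].
by apply: eq_sint => x Sx; rewrite ln_equilibrium//; ring.
Qed.

Lemma fe_equilibrium Om : S Om -> fe (eq Om) = Fk Om.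
Proof.
move=> SO; have bE := bdm_equilibrium sigma rho kappa Om.
rewrite /fe /ent (sint_ln_equilibrium (bI bE) (mass_equilibrium hsigma _ _ SO) SO).
rewrite flux_equilibrium// dotZl enorm_scale ?r0_ge0//.
by have /sphereP -> := SO; rewrite mulr1.
Qed.

Lemma bdm_ent_equilibrium Om : S Om -> bdm (ent (eq Om)).
Proof.
move=> SO; have bE := bdm_equilibrium sigma rho kappa Om.
apply: (intg_ent_bdm bE (m := rho / zon 0 kappa Om * expR (- `|kappa|))).
  by rewrite mulr_gt0 ?expR_gt0// divr_gt0// zon0_gt0.
move=> x Sx; rewrite equilibriumE ler_pM2l ?expdot_ge//.
by rewrite divr_gt0// zon0_gt0.
Qed.

Lemma Fk_indep Om Om' : S Om -> S Om' -> Fk Om = Fk Om'.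
Proof. by move=> SO SO'; rewrite /Fk (zon_indep hn hsigma _ _ SO SO'). Qed.

Section RelativeEntropy.
Variables (g : 'rV[R]_n -> R) (Om : 'rV[R]_n).
Hypotheses (ig : intg g) (g0 : forall x, S x -> 0 <= g x) (Ig : I g = rho)
  (ie : intg (ent g)) (SO : S Om).

Definition relent : R := I (ent g) - I (fun x => g x * ln (eq Om x)).

Let bE : bdm (eq Om) := bdm_equilibrium sigma rho kappa Om.
Let bE' : intg (eq Om) := bI bE.
Let E0 x : 0 < eq Om x. Proof. exact: equilibrium_gt0. Qed.
Let IE : I (eq Om) = rho := mass_equilibrium hsigma rho kappa SO.

Let blnE : bdm (fun x => ln (eq Om x)).
Proof.
have := bdmD (bdm_cst (ln (rho / zon 0 kappa Om))) (bdmZ kappa (bdm_dot Om)).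
by apply: eq_bdm => x Sx; rewrite ln_equilibrium.
Qed.

Lemma fe_relent : fe g - Fk Om = relent -
  (Phi (J g) - Phi r0 - kappa * (dot (flux sigma g) Om - r0)).
Proof. by rewrite /relent sint_ln_equilibrium// /fe /Fk; ring. Qed.

Let bdm_exp phi : bdm phi -> bdm (fun x => expR (phi x)).
Proof.
move=> bp; apply: (bdm_comp (phi := @expR R)) => //; first by move=> x _; exact: continuous_expR.
have [_ [M hM]] := bp; exists (expR M) => x Sx.
by rewrite ger0_norm ?expR_ge0// ler_expR (le_trans (ler_norm _))// hM.
Qed.

(* Convexity of a ln a, that is, a b <= a ln a - a + e^b. *)
Lemma young phi : bdm phi ->
  I (fun x => g x * phi x) - I (fun x => eq Om x * (expR (phi x) - 1)) <= relent.
Proof.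
move=> bp; have bep := bdm_exp bp.
have b1 : bdm (fun x => eq Om x * (expR (phi x) - 1)).
  by apply: bdmM => //; apply: bdmB => //; exact: bdm_cst.
have i1 : intg (fun x => g x * phi x) by exact: intgM.
have i2 : intg (fun x => g x * ln (eq Om x)) by exact: intgM.
have i3 : intg (fun x => g x - eq Om x) by apply: intgB => //; exact: bI.
have z : I (fun x => g x - eq Om x) = 0 by rewrite sintB ?Ig ?IE ?subrr//; exact: bI.
rewrite -[leLHS]addr0 -z /relent -!sintB//; try exact: bI.
rewrite -sintD//; last by apply: intgB => //; exact: bI.
apply: le_sint; [by apply: intgD => //; apply: intgB => //; exact: bI|exact: intgB|].
move=> x Sx; have a0 : 0 < eq Om x * expR (phi x) by rewrite mulr_gt0 ?expR_gt0.
have := entropy_tangent a0 (g0 Sx).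
rewrite lnM ?posrE ?expR_gt0// expRK /ent; move: (expR _) (ln (eq Om x)) => A L; lra.
Qed.

(** The dual bound with e^z - 1 replaced by a majorant [A] z, typically a Taylor polynomial plus an
    error; the linear part is regrouped with g - eq, which is centred. *)
Let young_upper (A : R -> R) phi : bdm phi -> bdm (fun x => A (phi x)) ->
  (forall x, S x -> expR (phi x) - 1 <= A (phi x)) ->
  I (fun x => (g x - eq Om x) * phi x) - I (fun x => eq Om x * (A (phi x) - phi x)) <= relent.
Proof.
move=> bp bA hA; apply: le_trans (young bp).
have bep := bdm_exp bp.
have b1 : bdm (fun x => eq Om x * (expR (phi x) - 1)).
  by apply: bdmM => //; apply: bdmB => //; exact: bdm_cst.
have b2 : bdm (fun x => eq Om x * phi x) by exact: bdmM.
have b3 : bdm (fun x => eq Om x * (A (phi x) - phi x)) by apply: bdmM => //; exact: bdmB.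
have i1 : intg (fun x => g x * phi x) by exact: intgM.
have -> : I (fun x => (g x - eq Om x) * phi x) = I (fun x => g x * phi x) - I (fun x => eq Om x * phi x).
  by rewrite -sintB//; [apply: eq_sint => x _; rewrite mulrBl|exact: bI].
rewrite -addrA lerD2l -opprD lerN2 -sintD; [|exact: bI|exact: bI].
apply: le_sint; [exact: bI|by apply: bI; exact: bdmD|].
by move=> x Sx; rewrite -mulrDr ler_pM2l//; have := hA x Sx; lra.
Qed.

(** Pinsker's inequality with a free parameter. The test function is lam times a continuous
    approximation of the sign of g - eq, and e^z - 1 <= z + e z^2 for |z| <= 1. *)
Lemma young_L1 (lam : R) : 0 < lam <= 1 ->
  I (fun x => `|g x - eq Om x|) <= relent / lam + lam * (expR 1 * rho).
Proof.
move=> /andP[l0 l1]; apply/ler_addgt0Pr => e e0.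
pose w x := g x - eq Om x; pose psi (s : R) := s / (`|s| + e).
have iw : intg w by exact: intgB.
have psi1 s : `|psi s| <= 1.
  rewrite /psi normrM normfV [X in _ / X]ger0_norm ?addr_ge0 ?(ltW e0)//.
  by rewrite ler_pdivrMr ?ltr_wpDl// mul1r lerDl ltW.
have cpsi : continuous psi.
  move=> s; apply: (@cvgM _ _ (nbhs s)); first exact: cvg_id.
  apply: (@cvgV _ _ (nbhs s)); first by rewrite gt_eqF// ltr_wpDl.
  by apply: (@cvgD _ _ _ (nbhs s)); [apply: (@cvg_norm _ _ _ (nbhs s)); exact: cvg_id|exact: cvg_cst].
have bpsi : bdm (fun x => psi (w x)).
  split; last by exists 1.
  exact: (measurableT_comp (continuous_measurable_fun cpsi) (intg_measurable iw)).
pose A (z : R) := z + expR 1 * z ^+ 2.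
have blp : bdm (fun x => lam * psi (w x)) by exact: bdmZ.
have lpsi x : `|lam * psi (w x)| <= lam by rewrite normrM (gtr0_norm l0) ler_piMr// ltW.
have bA : bdm (fun x => A (lam * psi (w x))) by apply: bdmD => //; apply: bdmZ; exact: bdmX.
have := young_upper (A := A) blp bA.
have hA x : S x -> expR (lam * psi (w x)) - 1 <= A (lam * psi (w x)).
  move=> Sx; have z1 := le_trans (lpsi x) l1; move: (lam * psi (w x)) z1 => z z1.
  have := expT_remainder 2 z1; rewrite /expT big_ord_recl big_ord1 /= expr0 expr1 fact0 !divr1 => h.
  have := le_trans (ler_norm _) h; rewrite real_normK ?num_real// /A.
  have : expR 1 * (z ^+ 2 / 2`!%:R) <= expR 1 * z ^+ 2.
    by rewrite ler_pM2l ?expR_gt0// ler_pdivrMr ?ltr0n// ler_peMr ?sqr_ge0// ler1n.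
  lra.
move=> /(_ hA) h.
have h1 : I (fun x => eq Om x * (A (lam * psi (w x)) - lam * psi (w x))) <= lam ^+ 2 * (expR 1 * rho).
  rewrite -[X in _ <= _ * (_ * X)]IE mulrA -sintZ//; apply: le_sint; [|exact: intgZ|].
    by apply: bI; apply: bdmM => //; exact: bdmB.
  move=> x Sx; rewrite /A addrC addKr mulrC ler_pM2r//.
  rewrite mulrC ler_pM2r ?expR_gt0// -real_normK ?num_real//.
  by rewrite lerXn2r ?nnegrE// ltW.
(* The regularised sign loses at most e: v^2 / (v + e) >= v - e. *)
have h2 : I (fun x => `|w x|) - e <= I (fun x => w x * psi (w x)).
  rewrite -(sint_cst hsigma e) -sintB; [|exact: intg_norm|exact/bI/bdm_cst].
  apply: le_sint; [by apply: intgB; [exact: intg_norm|exact/bI/bdm_cst]|exact: intgM|].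
  move=> x Sx; rewrite /psi mulrA -expr2 -real_normK ?num_real//.
  move: (normr_ge0 (w x)); move: (`|w x|) => v v0.
  by rewrite ler_pdivlMr ?ltr_wpDl// -subr_ge0 (_ : _ - _ = e ^+ 2) ?sqr_ge0//; ring.
have h3 : I (fun x => (g x - eq Om x) * (lam * psi (w x))) = lam * I (fun x => w x * psi (w x)).
  by rewrite -sintZ; [apply: eq_sint => x _; rewrite mulrCA|exact: intgM].
rewrite -lerBlDr (le_trans h2)// -(ler_pM2l l0) -h3 mulrDr mulrCA mulfV ?gt_eqF// mulr1.
have : lam * (lam * (expR 1 * rho)) = lam ^+ 2 * (expR 1 * rho) by ring.
lra.
Qed.

(** Test function lam (x . Om - c), centred for the equilibrium: the second order term is the
    variance [dop]. As |x . Om - c| <= 2, the cubic Taylor remainder gives 8 = 2^3 and e^2. *)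
Lemma young_quadratic (lam : R) : `|lam| <= 1 ->
  lam * (dot (flux sigma g) Om - r0) - lam ^+ 2 / 2 * (rho * dop sigma kappa Om)
    - `|lam| ^+ 3 * (8 * expR 2 * rho) <= relent.
Proof.
move=> l1; pose phi x := lam * (dot x Om - c kappa).
(* rho c is the length of the flux of a density of mass rho. *)
have c1 : `|c kappa| <= 1.
  have r00 := r0_ge0.
  have -> : c kappa = r0 / rho by rewrite mulrAC mulfV ?mul1r// gt_eqF.
  rewrite normrM normfV (ger0_norm r00) (gtr0_norm rho0) ler_pdivrMr// mul1r.
  rewrite -[r0](enorm_scale r00 SO) -(flux_equilibrium hn hsigma rho kappa0 SO).
  rewrite (le_trans (enorm_flux_le hsigma bE'))// -[leRHS]IE le_eqVlt; apply/orP; left; apply/eqP.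
  by apply: eq_sint => x _; rewrite gtr0_norm.
have phi_le x : S x -> `|phi x| <= `|lam| * 2.
  move=> Sx; rewrite normrM ler_wpM2l// (le_trans (ler_normB _ _))//.
  by have := dot_sphere Sx SO; lra.
have phi2 x : S x -> `|phi x| <= 2 by move=> /phi_le; lra.
have bphi : bdm phi by apply: bdmZ; apply: bdmB; [exact: bdm_dot|exact: bdm_cst].
pose C := `|lam| ^+ 3 * (8 * expR 2).
pose A (z : R) := z + z ^+ 2 / 2 + C.
have bA : bdm (fun x => A (phi x)).
  apply: bdmD; last exact: bdm_cst.
  by apply: bdmD => //; apply: bdmM; [exact: bdmX|exact: bdm_cst].
have hA x : S x -> expR (phi x) - 1 <= A (phi x).
  move=> Sx; have := phi_le x Sx; have := phi2 x Sx; move: (phi x) => z z2 zl.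
  have := expT_remainder 3 z2.
  rewrite /expT !big_ord_recl big_ord0 /= expr0 expr1 fact0 !divr1 addr0 -[bump 0 (bump 0 0)]/2%N => h.
  have := le_trans (ler_norm _) h.
  have : expR 2 * (`|z| ^+ 3 / 3`!%:R) <= C.
    rewrite /C [leRHS]mulrA [leRHS]mulrC ler_pM2l ?expR_gt0//.
    apply: (@le_trans _ _ (`|z| ^+ 3)).
      by rewrite ler_pdivrMr ?ltr0n// ler_peMr ?exprn_ge0// ler1n.
    have -> : `|lam| ^+ 3 * 8 = (`|lam| * 2) ^+ 3 by rewrite exprMn; congr (_ * _); ring.
    by rewrite lerXn2r// nnegrE mulr_ge0.
  by rewrite /A (_ : 2`!%:R = 2)//; lra.
have := young_upper (A := A) bphi bA hA.
have ik a : intg (zexp a kappa Om) by exact/bI/bdm_zexp.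
have iwd : intg (fun x => (g x - eq Om x) * phi x) by apply: intgM => //; exact: intgB.
have -> : I (fun x => (g x - eq Om x) * phi x) = lam * (dot (flux sigma g) Om - r0).
  have igd h : intg h -> intg (fun x => dot x Om * h x).
    by move=> ih; have := intgM ih (bdm_dot Om); apply: eq_intg => x _; exact: mulrC.
  have r0E : r0 = dot (flux sigma (eq Om)) Om.
    by rewrite flux_equilibrium// dotZl (_ : dot Om Om = 1) ?mulr1//; apply/sphereP.
  rewrite r0E !(dot_flux hsigma)// -sintB//; try exact: igd.
  have z : c kappa * I (fun x => g x - eq Om x) = 0 by rewrite sintB// Ig IE subrr mulr0.
  rewrite -[X in lam * X]subr0 -z -sintZ; last exact: intgB.
  rewrite -sintB; [|by apply: intgB; exact: igd|by apply: intgZ; exact: intgB].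
  rewrite -sintZ; last by apply: intgB; [by apply: intgB; exact: igd|by apply: intgZ; exact: intgB].
  by apply: eq_sint => x _; rewrite /phi; ring.
have -> : I (fun x => eq Om x * (A (phi x) - phi x)) =
    lam ^+ 2 / 2 * (rho * dop sigma kappa Om) + `|lam| ^+ 3 * (8 * expR 2 * rho).
  have z0 := zon0_gt0 hsigma kappa SO.
  have -> : rho * dop sigma kappa Om = I (fun x => eq Om x * (dot x Om - c kappa) ^+ 2).
    transitivity (rho / zon 0 kappa Om * (zon 2 kappa Om - 2 * c kappa * zon 1 kappa Om + c kappa ^+ 2 * zon 0 kappa Om)).
      rewrite /dop (zon1E hn hsigma _ SO); field; by rewrite gt_eqF.
    rewrite -!(sintZ _ (ik _)) -sintB//; try exact: intgZ.
    rewrite -sintD//; [|by apply: intgB => //; exact: intgZ|exact: intgZ].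
    rewrite -sintZ; last by apply: intgD; [apply: intgB => //; exact: intgZ|exact: intgZ].
    apply: eq_sint => x _; rewrite equilibriumE /zexp; ring.
  have b2 : bdm (fun x => eq Om x * (dot x Om - c kappa) ^+ 2).
    by apply: bdmM => //; apply: bdmX; apply: bdmB; [exact: bdm_dot|exact: bdm_cst].
  have -> : `|lam| ^+ 3 * (8 * expR 2 * rho) = C * rho by rewrite /C; ring.
  rewrite -[in C * rho]IE -!sintZ//; try exact: bI.
  rewrite -sintD//; [|by apply: bI; exact: bdmZ|exact: intgZ].
  by apply: eq_sint => x _; rewrite /A /phi; ring.
lra.
Qed.

(** ln (g / eq) <= (g - eq) / eq, and g (g - eq) / eq = (g - eq)^2 / eq + (g - eq), whose last term
    has integral 0 because the masses agree. *)
Lemma relent_le_sq m : 0 < m -> (forall x, S x -> m <= eq Om x) ->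
  intg (fun x => g x ^+ 2) -> relent <= m^-1 * I (fun x => (g x - eq Om x) ^+ 2).
Proof.
move=> m0 hm ig2.
have iw2 : intg (fun x => (g x - eq Om x) ^+ 2).
  have i1 : intg (fun x => g x * eq Om x) by exact: intgM.
  have i3 : intg (fun x => eq Om x ^+ 2) by exact/bI/bdmX.
  have := intgD (intgB ig2 (intgZ 2 i1)) i3; apply: eq_intg => x _; ring.
have iw : intg (fun x => g x - eq Om x) by exact: intgB.
have z : I (fun x => g x - eq Om x) = 0 by rewrite sintB// Ig IE subrr.
have ile : intg (fun x => g x * ln (eq Om x)) by exact: intgM.
rewrite /relent -sintB// -[leRHS]addr0 -z -sintZ// -sintD//; last exact: intgZ.
apply: le_sint; [exact: intgB|by apply: intgD => //; exact: intgZ|].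
move=> x Sx; have e0 := E0 x; have gx := g0 Sx.
apply: (@le_trans _ _ (g x * ((g x - eq Om x) / eq Om x))).
  rewrite /ent -mulrBr; move: gx; rewrite le_eqVlt => /orP[/eqP <-|gx]; first by rewrite !mul0r.
  by rewrite ler_pM2l// ln_quot.
have -> : g x * ((g x - eq Om x) / eq Om x) = (eq Om x)^-1 * (g x - eq Om x) ^+ 2 + (g x - eq Om x).
  by field; rewrite gt_eqF.
by rewrite lerD2r ler_wpM2r ?sqr_ge0// lef_pV2 ?posrE// hm.
Qed.

End RelativeEntropy.

End FreeEnergy.

(** * Decay of the free energy along solutions *)

Section Dissipation.
Variables (R : realType) (n : nat) (sigma : probability (borel R n) R).
Hypotheses (hn : (2 <= n)%N) (hsigma : is_uniform sigma).
Variables (nu tau : R -> R).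
Hypothesis hcoef : coefficients nu tau.
Variables (s rho : R) (mu0 : {measure set (borel R n) -> \bar R})
  (f : R -> 'rV[R]_n -> R) (f0 : 'rV[R]_n -> R).
Hypotheses (rho0 : 0 < rho) (hd : has_density sigma mu0 f0)
  (mrho : mu0 (sphere R n) = rho%:E) (sol : is_solution sigma nu tau s mu0 f).

Local Notation S := (sphere R n).
Local Notation I := (sint sigma).
Local Notation bI := (intg_bdm hsigma).
Local Notation J g := (enorm (flux sigma g)).
Local Notation Om g := (direction sigma g).
Local Notation Q := (Qop sigma nu tau).
Local Notation Phi := (potential nu tau).
Local Notation k := (rate nu tau).
Local Notation fe := (fe sigma nu tau).

Let fpos := sol_pos sol.
Let fbdm := sol_bdm sol.
Let fQ t t0 := @sol_bdmQ _ _ _ hn _ _ _ _ _ sol t t0.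
Let fmass t t0 := @sol_mass _ _ _ hn hsigma _ _ _ _ _ _ _ hd mrho sol t t0.

Lemma Tgrad_ddot v (w1 : 'I_n -> 'I_n -> 'rV[R]_n -> R) x :
  (forall i j, w1 j i x = - w1 i j x) ->
  Tgrad v w1 x = 2^-1 * \sum_i \sum_j ddot i j v x * w1 i j x.
Proof.
move=> asym; have -> : \sum_i \sum_j ddot i j v x * w1 i j x = Tgrad v w1 x + Tgrad v w1 x.
  rewrite {2}/Tgrad -[X in _ = X + _]/(\sum_i \sum_j _) [X in _ = X + _]exchange_big/= -big_split/=.
  apply: eq_bigr => i _; rewrite -big_split/=; apply: eq_bigr => j _.
  by rewrite /ddot (asym i j); ring.
by field.
Qed.

Lemma ln_smooth_bdm t : 0 < t -> bdm (fun x => ln (f t x)) /\ bdm (fun x => (f t x)^-1).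
Proof.
move=> t0; have [m m0 hm] := smooth_pos_bound (sol_smooth sol) fpos t0.
split; [apply: (continuous_pos_comp (phi := @ln R) m0 _ (fbdm t0) hm)|
        apply: (continuous_pos_comp (phi := fun u => u^-1) m0 _ (fbdm t0) hm)] => u u0.
  exact: hd_continuous (hd_ln u0 (hd_id u)).
by apply: inv_continuous; rewrite gt_eqF.
Qed.

Lemma hd_entropy (t : R) : 0 < t -> is_derive t (1 : R) (fun u => I (ent (f u)))
  (I (fun x => (ln (f t x) + 1) * Q (f t) x)).
Proof.
move=> t0; have [bl bi] := ln_smooth_bdm t0.
have bl1 : bdm (fun x => ln (f t x) + 1) by apply: bdmD => //; exact: bdm_cst.
apply: (uder_sint hsigma).
- apply: filterS (near_pos t0) => u u0; have [blu _] := ln_smooth_bdm u0.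
  by apply: bdmM => //; exact: fbdm.
- by apply: bdmM => //; exact: fQ.
- apply: (uder_comp (th := fun u => u * ln u) (th1 := fun u => ln u + 1) (D := fun u => u^-1)) => //.
  + move=> a b a0 b0; have := entropy_tangent a0 (ltW b0); have := entropy_taylor a0 b0.
    by move=> h1 h2; rewrite ger0_norm; lra.
  + by apply: filterS (near_pos t0) => u u0; exact: fpos.
  + exact: fQ.
  + exact: (sol_uder sol).
Qed.

Lemma hd_flux (t : R) i : 0 < t -> is_derive t (1 : R) (fun u => flux sigma (f u) 0 i)
  (I (fun x => x 0 i * Q (f t) x)).
Proof.
move=> t0; apply: (hd_eq _ (sol_derive hn hsigma sol (bdm_coord R i) t0)) => u.
by rewrite fluxE.
Qed.

Lemma enorm_le_sum (v : 'rV[R]_n) : enorm v <= \sum_i `|v 0 i|.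
Proof.
have s0 : 0 <= \sum_i `|v 0 i| by exact: sumr_ge0.
rewrite -(@ler_pXn2r _ 2) ?nnegrE ?enorm_ge0// sqr_enorm /dot expr2 mulr_suml ler_sum// => i _.
rewrite -[leLHS]ger0_norm -?expr2 ?sqr_ge0// expr2 normrM ler_wpM2l//.
by rewrite (bigD1 i)//= lerDl sumr_ge0.
Qed.

Lemma hd_near_bound (g : R -> R) (t d : R) : is_derive t (1 : R) g d ->
  \forall h \near (0 : R), `|g (t + h) - g t| <= (`|d| + 1) * `|h|.
Proof.
move=> /hd_epsP/(_ 1 ltr01); apply: filterS => h hh.
rewrite -[X in `|X|](subrK (h * d)) (le_trans (ler_normD _ _))// mulrDl addrC.
by rewrite lerD// normrM mulrC.
Qed.

(** Where the flux vanishes its norm need not be differentiable, but Phi of the norm is: the norm at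
    time t + h is O(h), and Phi r <= k r r with k continuous and zero at 0. *)
Lemma hd_flux_potential (t : R) : 0 < t -> is_derive t (1 : R) (fun u => Phi (J (f u)))
  (k (J (f t)) * I (fun x => dot x (Om (f t)) * Q (f t) x)).
Proof.
move=> t0; have bQ := fQ t0; pose dJ i := I (fun x => x 0 i * Q (f t) x).
have Jd i : is_derive t (1 : R) (fun u => flux sigma (f u) 0 i) (dJ i) := hd_flux i t0.
have dotE v : I (fun x => dot x v * Q (f t) x) = \sum_i v 0 i * dJ i.
  rewrite -(dot_flux hsigma v (bI bQ)) /dot; apply: eq_bigr => i _.
  by rewrite fluxE mulrC.
have [J0|J0] := eqVneq (flux sigma (f t)) 0.
- have z : J (f t) = 0 by rewrite J0 /enorm /dot big1 ?sqrtr0// => i _; rewrite mxE mul0r.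
  rewrite z (rate0 hcoef) mul0r; apply/hd_epsP => e e0.
  pose M : R := \sum_i (`|dJ i| + 1); have M0 : 0 <= M by apply: sumr_ge0 => i _; exact: addr_ge0.
  have hM : \forall h \near (0 : R), forall i, `|flux sigma (f (t + h)) 0 i| <= (`|dJ i| + 1) * `|h|.
    have hM0 i : \forall h \near (0 : R), `|flux sigma (f (t + h)) 0 i| <= (`|dJ i| + 1) * `|h|.
      by have := hd_near_bound (Jd i); apply: filterS => h; rewrite J0 [X in _ - X]mxE subr0.
    exact: (@filter_forall _ _ _ (nbhs (0 : R)) _ hM0).
  have kc : \forall h \near (0 : R), k `|h| <= e / (M + 1).
    have e1 : 0 < e / (M + 1) by rewrite divr_gt0// ltr_wpDl.
    have /cvgrPdist_le/(_ _ e1) := rate_continuous_abs hcoef (x := 0).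
    apply: filterS => h; rewrite normr0 (rate0 hcoef) sub0r normrN; apply: le_trans.
    exact: ler_norm.
  have kc2 : \forall h \near (0 : R), k (M * `|h|) <= e / (M + 1).
    have hh : (fun h : R => M * `|h|) @ (0 : R) --> (0 : R).
      rewrite -[X in _ --> X](mulr0 M); apply: cvgM; first exact: cvg_cst.
      by rewrite -[X in _ --> X](@normr0 R R); apply: cvg_norm; exact: cvg_id.
    have hk : \forall h \near (0 : R), k `|M * `|h| | <= e / (M + 1) by exact: (hh _ kc).
    by apply: filterS hk => h; rewrite ger0_norm// mulr_ge0.
  near=> h; have Jh : J (f (t + h)) <= M * `|h|.
    rewrite (le_trans (enorm_le_sum _))// /M mulr_suml ler_sum// => i _.
    have : forall i, `|flux sigma (f (t + h)) 0 i| <= (`|dJ i| + 1) * `|h| by near: h.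
    by apply.
  have p1 := potential_tangent hcoef (lexx 0) (enorm_ge0 (flux sigma (f (t + h)))).
  have p2 := potential_tangent hcoef (enorm_ge0 (flux sigma (f (t + h)))) (lexx 0).
  rewrite (rate0 hcoef) mul0r in p1.
  rewrite mulr0 subr0 z (ger0_norm p1).
  have kk : k (J (f (t + h))) <= e / (M + 1).
    apply: (le_trans (rate_le hcoef (enorm_ge0 _) Jh)); by near: h.
  apply: (@le_trans _ _ (e / (M + 1) * (M * `|h|))).
    apply: (@le_trans _ _ (k (J (f (t + h))) * J (f (t + h)))); first by lra.
    by apply: ler_pM => //; [exact: (rate_ge0 hcoef (enorm_ge0 _))|exact: enorm_ge0].
  rewrite mulrA ler_wpM2r// -mulrA ler_piMr ?(ltW e0)// mulrC ler_pdivrMr ?ltr_wpDl// mul1r.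
  by rewrite lerDl.
- have e0 := enorm_gt0 J0.
  have dJJ : is_derive t (1 : R) (fun u => dot (flux sigma (f u)) (flux sigma (f u)))
      (\sum_i (dJ i * flux sigma (f t) 0 i + flux sigma (f t) 0 i * dJ i)).
    exact: (@hd_sum R _ _ xpredT (fun i u => flux sigma (f u) 0 i * flux sigma (f u) 0 i) t _
      (fun i _ => hdM (Jd i) (Jd i))).
  have dot0 : 0 < dot (flux sigma (f t)) (flux sigma (f t)) by rewrite -sqr_enorm exprn_gt0.
  have ds := hd_comp (is_derive1_sqrt dot0) dJJ.
  have h := @hd_comp R Phi (fun u : R => J (f u)) t _ _ (hd_potential hcoef e0) ds.
  apply: (is_derive_eq h).
  congr (_ * _); rewrite dotE mulr_sumr; apply: eq_bigr => i _.
  have -> : Om (f t) 0 i = (J (f t))^-1 * flux sigma (f t) 0 i by rewrite /direction /Defs.proj [LHS]mxE.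
  rewrite -/(enorm (flux sigma (f t))); move: (J (f t)) (flux sigma (f t) 0 i) (dJ i) => a b d.
  have [->|a0] := eqVneq a 0; first by rewrite mulr0 invr0 !mul0r.
  by field.
Unshelve. all: by end_near. Qed.

(** Test function w = ln f + 1 - k(J) x . Om. Since D_ij f = f (D_ij w + k(J) D_ij (x . Om)) and nu
    = k tau, the drift cancels, leaving - tau times the integral of f |grad w|^2. *)
Lemma dissipation t : 0 < t ->
  I (fun x => (ln (f t x) + 1) * Q (f t) x) -
  k (J (f t)) * I (fun x => dot x (Om (f t)) * Q (f t) x) <= 0.
Proof.
move=> t0; have bf := fbdm t0; have sf := sol_smooth sol t0; have [bl bi] := ln_smooth_bdm t0.
have bQ := fQ t0; set kk := k _; set v := Om _.
have tau0 : 0 < tau (J (f t)) by case: hcoef => h _ _ _ _; case: (h _ (enorm_ge0 (flux sigma (f t)))).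
have nuE : nu (J (f t)) = kk * tau (J (f t)) by rewrite /kk /rate divfK// gt_eqF.
pose F1 := D1 (ext (f t)).
have bF i j : bdm (F1 i j) by exact: bdm_D1 sf i j.
pose w x := ln (f t x) + 1 - kk * dot x v.
pose w1 i j x := (f t x)^-1 * F1 i j x - kk * ddot i j v x.
have rw i j : rd i j w (w1 i j).
  have h1 : rd i j (fun x => ln (f t x)) (fun x => (f t x)^-1 * F1 i j x).
    apply: (@rd_comp _ _ i j (@ln R) (fun u => u^-1)); last exact: rd_smooth sf i j.
    move=> x Sx; apply: is_derive_eq (hd_ln (fpos t0 Sx) (hd_id _)) _; by rewrite mulr1.
  have h2 := rdB (rdD h1 (rd_cst i j 1)) (rdZ kk (rd_dot i j v)).
  apply: (eq_rd _ _ h2) => // x _; by rewrite addr0.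
have bw : bdm w.
  apply: bdmB; last exact/bdmZ/bdm_dot.
  by apply: bdmD => //; exact: bdm_cst.
have bw1 i j : bdm (w1 i j) by apply: bdmB; [exact: bdmM|exact/bdmZ/bdm_ddot].
have -> : I (fun x => (ln (f t x) + 1) * Q (f t) x) - kk * I (fun x => dot x v * Q (f t) x) =
    I (fun x => w x * Q (f t) x).
  have b1 : bdm (fun x => dot x v * Q (f t) x) by apply: bdmM => //; exact: bdm_dot.
  rewrite -(sintZ _ (bI b1)) -sintB; [|apply: bI; apply: bdmM => //; apply: bdmD => //; exact: bdm_cst|exact/bI/bdmZ].
  by apply: eq_sint => x _; rewrite /w; ring.
rewrite (sint_Qop_parts hn hsigma nu tau sf rw bw bw1) -/v nuE.
have F1E i j x : S x -> F1 i j x = f t x * (w1 i j x + kk * ddot i j v x).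
  by move=> Sx; rewrite /w1 subrK mulrA mulfV ?mul1r// gt_eqF ?fpos.
have bfd i j : bdm (fun x => f t x * (ddot i j v x * w1 i j x)).
  by apply: bdmM => //; apply: bdmM => //; exact: bdm_ddot.
have bfw i j : bdm (fun x => f t x * w1 i j x ^+ 2) by apply: bdmM => //; exact: bdmX.
have -> : I (fun x => f t x * Tgrad v w1 x) =
    2^-1 * \sum_i \sum_j I (fun x => f t x * (ddot i j v x * w1 i j x)).
  have -> : \sum_i \sum_j I (fun x => f t x * (ddot i j v x * w1 i j x)) =
      I (fun x => \sum_i \sum_j f t x * (ddot i j v x * w1 i j x)).
    rewrite (sint_sum hsigma) => [|i _]; last by apply: bI; exact: bdm_sum.
    by apply: eq_bigr => i _; rewrite (sint_sum hsigma) => [//|j _]; exact: bI.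
  rewrite -sintZ; last by apply: bI; apply: bdm_sum => i _; exact: bdm_sum.
  apply: eq_sint => x _; rewrite Tgrad_ddot; last first.
    by move=> i j; rewrite /w1 /F1 /D1 /ddot; ring.
  rewrite mulrCA mulr_sumr; congr (_ * _); apply: eq_bigr => i _.
  by rewrite mulr_sumr.
have -> : \sum_i \sum_j I (fun x => w1 i j x * F1 i j x) =
    \sum_i \sum_j I (fun x => f t x * w1 i j x ^+ 2) +
    kk * \sum_i \sum_j I (fun x => f t x * (ddot i j v x * w1 i j x)).
  rewrite mulr_sumr -big_split; apply: eq_bigr => i _; rewrite mulr_sumr -big_split; apply: eq_bigr => j _ /=.
  rewrite -(sintZ _ (bI (bfd i j))) -sintD; [|exact: bI|exact/bI/bdmZ].
  by apply: eq_sint => x Sx; rewrite F1E//; ring.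
set A := \sum_i \sum_j I (fun x => f t x * (ddot i j v x * w1 i j x)).
set B := \sum_i _.
have B0 : 0 <= B.
  apply: sumr_ge0 => i _; apply: sumr_ge0 => j _; apply: sint_ge0 => x Sx.
  by rewrite mulr_ge0 ?sqr_ge0// ltW// fpos.
have -> : kk * tau (J (f t)) * (2^-1 * A) - tau (J (f t)) * (2^-1 * (B + kk * A)) =
  - (tau (J (f t)) * (2^-1 * B)) by ring.
by rewrite oppr_le0 mulr_ge0 ?(ltW tau0)// mulr_ge0.
Qed.

Lemma fe_nonincreasing a b : 0 < a -> a <= b -> fe (f b) <= fe (f a).
Proof.
apply: (nonincreasing_pos (y := fun t => fe (f t))) => [t t0|t t0].
  exact: hdB (hd_entropy t0) (hd_flux_potential t0).
exact: dissipation.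
Qed.

Lemma potential_lip a b : 0 <= a <= rho -> 0 <= b <= rho ->
  `|Phi a - Phi b| <= k rho * `|a - b|.
Proof.
move=> /andP[a0 ar] /andP[b0 br].
have ka := rate_le hcoef a0 ar; have kb := rate_le hcoef b0 br.
have ka0 := rate_ge0 hcoef a0; have kb0 := rate_ge0 hcoef b0.
have p1 := potential_tangent hcoef a0 b0; have p2 := potential_tangent hcoef b0 a0.
have [ab|ba] := leP a b.
  rewrite (ler0_norm (_ : a - b <= 0)) ?subr_le0// ler_norml; apply/andP; split; nra.
rewrite (gtr0_norm (_ : 0 < a - b)) ?subr_gt0// ler_norml; apply/andP; split; nra.
Qed.

(** The entropy at small times is only bounded above, by e^(C u) (entropy of f0 + 1) - 1, but this
    bound tends to the entropy of f0, while the flux truly converges. *)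
Lemma fe_le_init t : 0 < t -> intg sigma (ent f0) -> fe (f t) <= fe f0.
Proof.
move=> t0 ie; have [C hC] := sol_ent_le hn hsigma hcoef rho0 hd mrho sol.
have JJ : J (f u) @[u --> 0^'+] --> J f0.
  apply: (@cvg_comp _ _ _ (fun u => flux sigma (f u)) (@enorm R n) _ (nbhs (flux sigma f0))).
    exact: (sol_flux_cvg0 hn hsigma hd mrho sol).
  exact: continuous_enorm.
have Jr u : 0 < u -> J (f u) <= rho by exact: (sol_flux_le hn hsigma hd mrho sol).
have J0r : J f0 <= rho.
  apply: (cvgr_to_le JJ); near=> u; apply: Jr; near: u; exact: nbhs_right_gt.
have PJ : Phi (J (f u)) @[u --> 0^'+] --> Phi (J f0).
  apply/cvgrPdist_le => e e0; near=> u.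
  have u0 : 0 < u by near: u; exact: nbhs_right_gt.
  apply: (le_trans (potential_lip _ _)); rewrite ?enorm_ge0 ?Jr//.
  apply: (@le_trans _ _ ((k rho + 1) * `|J f0 - J (f u)|)); first by rewrite ler_wpM2r// lerDl.
  rewrite -ler_pdivlMl ?ltr_wpDl ?(rate_ge0 hcoef (ltW rho0))//.
  near: u; move/cvgrPdist_le: JJ; apply.
  by rewrite mulr_gt0// invr_gt0 ltr_wpDl// (rate_ge0 hcoef (ltW rho0)).
have eC : expR (C * u) @[u --> 0^'+] --> (1 : R).
  have : expR (C * u) @[u --> 0^'+] --> expR (C * 0).
    apply: cvg_at_right_filter; exact: hd_continuous (hd_exp (hdZ C (hd_id 0))).
  by rewrite mulr0 expR0.
have EE : expR (C * u) * (I (ent f0) + 1) - 1 - Phi (J (f u)) @[u --> 0^'+] --> fe f0.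
  rewrite /fe; apply: cvgB => //.
  rewrite -[X in _ --> X](addrK 1); apply: cvgB; last exact: cvg_cst.
  rewrite -[X in _ --> X]mul1r; by apply: cvgM => //; exact: cvg_cst.
apply: (cvgr_to_ge EE); near=> u.
have u0 : 0 < u by near: u; exact: nbhs_right_gt.
apply: (@le_trans _ _ (fe (f u))).
  by apply: fe_nonincreasing => //; apply: ltW; near: u; exact: nbhs_right_lt.
by rewrite /fe lerD2r lerBrDr hC.
Unshelve. all: by end_near. Qed.

End Dissipation.

(** * Instability *)

Section HarmonicBounds.
Variables (R : realType) (n : nat) (sigma : probability (borel R n) R).
Hypotheses (hn : (2 <= n)%N) (hsigma : is_uniform sigma).
Implicit Types (x Om : 'rV[R]_n) (Y : 'rV[R]_n -> R) (l : nat).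

Local Notation S := (sphere R n).
Local Notation I := (sint sigma).
Local Notation bI := (intg_bdm hsigma).
Local Notation zon := (zon sigma).
Local Notation c := (order_parameter n).

(** The exponent is l - 1 because the integrands may carry one factor x . Om besides the
    exponential. For l = 0 the truncated predecessor gives the bound 1. *)
Definition hbound (B : R) l : R := B ^+ l.-1 / l.-1`!%:R.

Lemma hbound_ge0 (B : R) l : 0 <= B -> 0 <= hbound B l.
Proof. by move=> B0; rewrite divr_ge0// exprn_ge0. Qed.

Lemma harmonic_L1 Y : bdm Y -> I (fun x => Y x ^+ 2) <= 1 -> I (fun x => `|Y x|) <= 1.
Proof.
move=> bY Y1; have bY2 : bdm (fun x => Y x ^+ 2) by exact: bdmX.
apply: (@le_trans _ _ (2^-1 * (1 + I (fun x => Y x ^+ 2)))); last by lra.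
rewrite -[X in X + _](sint_cst hsigma 1) -sintD; [|exact/bI/bdm_cst|exact: bI].
rewrite -sintZ; last by apply: bI; apply: bdmD => //; exact: bdm_cst.
apply: le_sint; [exact/bI/bdm_norm|by apply: bI; apply: bdmZ; apply: bdmD => //; exact: bdm_cst|].
move=> x _; rewrite -real_normK ?num_real//; have := sqr_ge0 (`|Y x| - 1).
by rewrite !expr2; nra.
Qed.

(** A harmonic of degree l is orthogonal to the powers of x . Om below l, so only the Taylor
    remainder of the exponential contributes. *)
Lemma zexp_harmonic (B k : R) (a : nat) l Y Om : (a <= 1)%N -> `|k| <= B -> S Om ->
  spherical_harmonic l Y -> I (fun x => Y x ^+ 2) <= 1 ->
  `|I (fun x => Y x * zexp a k Om x)| <= expR B * hbound B l.
Proof.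
move=> a1 kB SO hY Y1; have bY := bdm_harmonic hY.
have B0 : 0 <= B by apply: le_trans kB.
pose N := l.-1; pose rem x := dot x Om ^+ a * (expR (k * dot x Om) - expT N (k * dot x Om)).
have bda : bdm (fun x : 'rV[R]_n => dot x Om ^+ a) by apply: bdmX; exact: bdm_dot.
have bdd d : bdm (fun x => dot x Om ^+ d * Y x).
  by apply: bdmM => //; apply: bdmX; exact: bdm_dot.
have bT : bdm (fun x => expT N (k * dot x Om)).
  apply: bdm_sum => d _; apply: bdmM; last exact: bdm_cst.
  by apply: bdmX; apply: bdmZ; exact: bdm_dot.
have brem : bdm rem by apply: bdmM => //; apply: bdmB => //; exact: bdm_expdot.
have -> : I (fun x => Y x * zexp a k Om x) = I (fun x => Y x * rem x).
  apply/eqP; rewrite -subr_eq0 -sintB; [|apply: bI; apply: bdmM => //; exact: bdm_zexp|exact/bI/bdmM].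
  have -> : I (fun x => Y x * zexp a k Om x - Y x * rem x) =
      I (fun x => \sum_(d < N) k ^+ d / d`!%:R * (dot x Om ^+ (a + d) * Y x)).
    apply: eq_sint => x _; rewrite -mulrBr /zexp /rem -mulrBr subKr /expT; move: (dot x Om) => u.
    rewrite !mulr_sumr; apply: eq_bigr => d _; rewrite exprD exprMn; ring.
  rewrite (sint_sum hsigma) => [|d _]; last exact/bI/bdmZ.
  rewrite big1// => d _; rewrite sintZ; last exact: bI.
  rewrite (sint_zonal_harmonic hn hsigma hY SO) ?mulr0//.
  have : (nat_of_ord d < l.-1)%N by exact: ltn_ord.
  move: (nat_of_ord d) => e; case: (l) => [//|l' /= dl].
  by rewrite (leq_ltn_trans (leq_add a1 (leqnn e)))// add1n ltnS.
apply: (le_trans (norm_sint (bI (bdmM bY brem)))).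
apply: (@le_trans _ _ (expR B * hbound B l * I (fun x => `|Y x|))).
  rewrite -sintZ; last exact/bI/bdm_norm.
  apply: le_sint; [exact/bI/bdm_norm/bdmM|exact/bI/bdmZ/bdm_norm|].
  move=> x Sx; rewrite normrM mulrC ler_wpM2r// /rem normrM normrX.
  have u1 := dot_sphere Sx SO; have ku := norm_kdot k SO Sx.
  rewrite -[leRHS]mul1r; apply: ler_pM => //; first exact: exprn_ile1.
  apply: (le_trans (expT_remainder N (le_trans ku kB))).
  rewrite ler_pM2l ?expR_gt0// ler_pM2r ?invr_gt0 ?ltr0n ?fact_gt0//.
  by rewrite lerXn2r ?nnegrE// (le_trans ku).
by rewrite ler_piMr ?harmonic_L1// mulr_ge0 ?expR_ge0 ?hbound_ge0.
Qed.

Lemma hd_harmonic_zexp (k : R) a Y Om : bdm Y -> S Om ->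
  is_derive k (1 : R) (fun k : R => I (fun x => Y x * zexp a k Om x))
    (I (fun x => Y x * zexp a.+1 k Om x)).
Proof.
move=> bY SO; apply: (uder_sint hsigma).
- by near=> u; apply: bdmM => //; exact: bdm_zexp.
- by apply: bdmM => //; exact: bdm_zexp.
- by apply: uder_mul => //; exact: uder_zexp.
Unshelve. all: by end_near. Qed.

Lemma zon0_ge1 (k : R) Om : S Om -> 1 <= zon 0 k Om.
Proof.
move=> SO; have bd : bdm (fun x : 'rV[R]_n => dot x Om) by exact: bdm_dot.
have <- : I (fun x => 1 + k * dot x Om) = 1.
  rewrite sintD; [|exact/bI/bdm_cst|exact/bI/bdmZ].
  by rewrite sintZ ?(moment1 hn hsigma SO) ?mulr0 ?addr0 ?(sint_cst hsigma)//; exact: bI.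
apply: le_sint; [by apply: bI; apply: bdmD; [exact: bdm_cst|exact: bdmZ]|exact/bI/bdm_zexp|].
by move=> x _; rewrite /zexp expr0 mul1r expR_ge1Dx.
Qed.

Lemma norm_zon1 (k : R) Om : S Om -> `|zon 1 k Om| <= zon 0 k Om.
Proof.
move=> SO; apply: (le_trans (norm_sint (bI (bdm_zexp 1 k Om)))).
apply: le_sint; [exact/bI/bdm_norm/bdm_zexp|exact/bI/bdm_zexp|].
move=> x Sx; rewrite /zexp expr0 expr1 normrM (gtr0_norm (expR_gt0 _)) ler_wpM2r ?expR_ge0//.
exact: dot_sphere.
Qed.

Lemma equilibrium_harmonic (rho B k : R) l Y Om : 0 < rho -> `|k| <= B -> S Om ->
  spherical_harmonic l Y -> I (fun x => Y x ^+ 2) <= 1 ->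
  `|I (fun x => equilibrium sigma rho k Om x * Y x)| <= rho * expR B * hbound B l.
Proof.
move=> r0 kB SO hY Y1; have bY := bdm_harmonic hY.
have -> : I (fun x => equilibrium sigma rho k Om x * Y x) =
    rho / zon 0 k Om * I (fun x => Y x * zexp 0 k Om x).
  rewrite -sintZ; last by apply: bI; apply: bdmM => //; exact: bdm_zexp.
  by apply: eq_sint => x _; rewrite equilibriumE /zexp expr0; ring.
have z1 := zon0_ge1 k SO; have z0 := lt_le_trans ltr01 z1.
rewrite normrM -mulrA ler_pM//; last exact: (zexp_harmonic (a := 0) _ kB SO hY Y1).
by rewrite gtr0_norm ?divr_gt0// ler_pdivrMr// ler_peMr// ltW.
Qed.

(** Mean value theorem in k. The derivative of the quotient by [zon 0] has two terms of the same
    size, hence the factor 2. *)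
Lemma equilibrium_harmonic_dist (rho B k k' : R) l Y Om : 0 < rho -> 0 <= k -> k < k' -> k' <= B -> S Om ->
  spherical_harmonic l Y -> I (fun x => Y x ^+ 2) <= 1 ->
  `|I (fun x => equilibrium sigma rho k' Om x * Y x) - I (fun x => equilibrium sigma rho k Om x * Y x)|
    <= (k' - k) * (2 * rho * expR B) * hbound B l.
Proof.
move=> r0 k0 kk kB SO hY Y1; have bY := bdm_harmonic hY.
pose p (x : R) := rho * (I (fun y => Y y * zexp 0 x Om y) * (zon 0 x Om)^-1).
have z0 (x : R) : 0 < zon 0 x Om := zon0_gt0 hsigma x SO.
have pE (x : R) : I (fun y => equilibrium sigma rho x Om y * Y y) = p x.
  rewrite /p mulrCA mulrC; have -> : rho / zon 0 x Om = rho * (zon 0 x Om)^-1 by [].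
  rewrite -sintZ; last by apply: bI; apply: bdmM => //; exact: bdm_zexp.
  by apply: eq_sint => y _; rewrite equilibriumE /zexp expr0; ring.
pose dp (x : R) := rho * (I (fun y => Y y * zexp 1 x Om y) * (zon 0 x Om)^-1 +
  I (fun y => Y y * zexp 0 x Om y) * (- (zon 0 x Om) ^- 2 * zon 1 x Om)).
have pd (x : R) : is_derive x (1 : R) p (dp x).
  have nz : zon 0 x Om != 0 by rewrite gt_eqF.
  apply: is_derive_eq (hdZ rho (hdM (hd_harmonic_zexp x 0 bY SO) (hdV nz (hd_zon hsigma 0 x SO)))) _.
  by rewrite /dp; congr (_ * (_ + _ * _)); rewrite !mulNr mulrC.
have [x] := MVT kk (fun (z : R) _ => pd z) (continuous_subspaceT (fun z : R => hd_continuous (pd z))).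
rewrite in_itv/= => /andP[kx xk] E; rewrite !pE E normrM mulrC (gtr0_norm (_ : 0 < k' - k)) ?subr_gt0//.
rewrite -mulrA ler_wpM2l ?subr_ge0 ?(ltW kk)//.
have xB : `|x| <= B by rewrite gtr0_norm ?(le_lt_trans k0)// (le_trans (ltW xk)).
have h1 := zexp_harmonic (a := 1) (leqnn _) xB SO hY Y1.
have h0 := zexp_harmonic (a := 0) (leq0n _) xB SO hY Y1.
have z1 := zon0_ge1 x SO; have := norm_zon1 x SO.
have -> : 2 * rho * expR B * hbound B l = rho * (2 * (expR B * hbound B l)) by ring.
rewrite /dp normrM (gtr0_norm r0) ler_pM2l// => hw0; move: hw0.
move: h1 h0 z1 (z0 x); move: (I _) (I _) (zon 0 x Om) (zon 1 x Om) => u v z w h1 h0 z1 zp hw.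
have i1 : z^-1 <= 1 by rewrite invf_le1.
have b0 : 0 <= expR B * hbound B l by apply: le_trans h0.
rewrite (le_trans (ler_normD _ _))// mulr_natl mulr2n lerD//.
  rewrite normrM -[leRHS]mulr1; apply: ler_pM => //.
  by rewrite gtr0_norm ?invr_gt0.
rewrite normrM -[leRHS]mulr1; apply: ler_pM => //.
rewrite normrM normrN (gtr0_norm (_ : 0 < z ^- 2)) ?invr_gt0 ?exprn_gt0//.
by rewrite mulrC ler_pdivrMr ?exprn_gt0// mul1r (le_trans hw)// expr2 ler_peMl// ltW.
Qed.

(** For an integer M above s the weight is at most (l + n)^(2 M), which is at most (2 M)! e^(l +
    n). *)
Lemma weight_le (s : R) : exists2 W : R, 0 < W & forall l, weight n l s <= W * expR 1 ^+ l.
Proof.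
pose M := Num.bound `|s|; have sM : s <= M%:R by rewrite (le_trans (ler_norm _))// ltW// archi_boundP.
exists ((2 * M)`!%:R * expR n%:R); first by rewrite mulr_gt0 ?expR_gt0// ltr0n fact_gt0.
move=> l; have b1 : 1 <= 1 + (l * (l + n - 2))%:R :> R by rewrite lerDl.
apply: (@le_trans _ _ ((1 + (l * (l + n - 2))%:R) `^ M%:R)); first by rewrite ler_powR.
rewrite powR_mulrn; last by rewrite (le_trans ler01).
apply: (@le_trans _ _ ((l + n)%:R ^+ (2 * M))).
  rewrite exprM lerXn2r ?nnegrE ?exprn_ge0 ?(le_trans ler01 b1)//.
  rewrite -natr1 addrC natr1 -natrX ler_nat -natr1 || idtac.
  rewrite -(natrX _ (l + n) 2) (_ : 1 + _ = (l * (l + n - 2)).+1%:R) ?ler_nat; last by rewrite -natr1 addrC.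
  rewrite expnS expn1; apply: (@leq_ltn_trans (l * (l + n))).
    by rewrite leq_mul2l leq_subr orbT.
  by rewrite ltn_pmul2r ?addn_gt0 ?(ltnW hn) ?orbT// -[X in (X < _)%N]addn0 ltn_add2l ltnW.
have h := expT_le (2 * M).+1 (ler0n R (l + n)).
have h2 : (l + n)%:R ^+ (2 * M) / (2 * M)`!%:R <= expR (l + n)%:R :> R.
  apply: le_trans h; rewrite /expT big_ord_recr/= lerDr; apply: sumr_ge0 => i _.
  by rewrite divr_ge0// exprn_ge0.
rewrite ler_pdivrMr ?ltr0n ?fact_gt0// in h2; apply: (le_trans h2).
by rewrite natrD expRD -[X in expR X](mulr1 l%:R) mulrC mulrA expRM_natl mulrAC.
Qed.

(** Factorial decay of the pairings beats the exponential bound on the weights, whatever s. *)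
Lemma Hnorm_bound (s B : R) : 0 <= B -> exists2 W : R, 0 < W &
  forall (T : Defs.distribution R n) (C : R), 0 <= C ->
    (forall l Y, spherical_harmonic l Y -> I (fun x => Y x ^+ 2) <= 1 -> `|T Y| <= C * hbound B l) ->
    (Hnorm sigma s T <= (C * W)%:E)%E.
Proof.
move=> B0; have [W W0 hW] := weight_le s.
pose X := expR 1 * B ^+ 2; have X0 : 0 <= X by rewrite mulr_ge0 ?expR_ge0 ?sqr_ge0.
(* The summand 1 accounts for l = 0, where the predecessor of l is truncated; the terms l >= 1 sum
   to at most e^X. *)
pose V := W * expR 1 * (1 + expR X).
have V0 : 0 < V by rewrite !mulr_gt0 ?expR_gt0// addr_gt0 ?expR_gt0.
exists (Num.sqrt V) => [|T C C0 hT]; first by rewrite sqrtr_gt0.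
apply: (Hnorm_le hsigma); first by rewrite mulr_ge0 ?sqrtr_ge0.
rewrite exprMn sqr_sqrtr ?(ltW V0)//.
have term l : ((weight n l s)%:E * harmonic_energy sigma l T <=
    (C ^+ 2 * (W * expR 1 * (X ^+ l.-1 / l.-1`!%:R)))%:E)%E.
  have E : (harmonic_energy sigma l T <= ((C * hbound B l) ^+ 2)%:E)%E.
    apply: ub_ereal_sup => _ [Y [hY Y1] <-]; rewrite lee_fin -real_normK ?num_real//.
    rewrite lerXn2r ?nnegrE//; [by rewrite mulr_ge0 ?hbound_ge0|exact: (hT l Y hY Y1)].
  apply: (le_trans (lee_wpmul2l _ E)); first by rewrite lee_fin ltW ?weight_gt0.
  rewrite -EFinM lee_fin exprMn mulrCA ler_wpM2l ?sqr_ge0//.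
  apply: (@le_trans _ _ (W * expR 1 ^+ l * hbound B l ^+ 2)).
    by rewrite ler_wpM2r ?sqr_ge0.
  rewrite -!mulrA ler_wpM2l ?(ltW W0)//.
  have e1 : 1 <= expR 1 :> R by rewrite -{1}(@expR0 R) ler_expR.
  apply: (@le_trans _ _ (expR 1 * expR 1 ^+ l.-1 * hbound B l ^+ 2)).
    rewrite ler_wpM2r ?sqr_ge0//; case: (l) => [|m] /=; last by rewrite exprS.
    by rewrite !expr0 mulr1.
  set p := l.-1; have XE : X ^+ p = expR 1 ^+ p * (B ^+ p) ^+ 2 by rewrite exprMn -!exprM mulnC.
  rewrite -mulrA ler_wpM2l ?expR_ge0// XE /hbound -/p exprMn -!mulrA.
  rewrite ler_wpM2l ?exprn_ge0 ?expR_ge0// ler_wpM2l ?exprn_ge0//.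
  rewrite ler_wpM2l ?exprn_ge0// expr2 ler_piMr ?invr_ge0// invf_le1 ?ltr0n ?fact_gt0//.
  by rewrite ler1n fact_gt0.
rewrite /weighted_energy; apply: lime_le.
  apply: is_cvg_nneseries => l _ _.
  by rewrite mule_ge0 ?harmonic_energy_ge0// lee_fin ltW ?weight_gt0.
apply: nearW => N; rewrite big_mkord.
apply: (@le_trans _ _ (\sum_(l < N) (C ^+ 2 * (W * expR 1 * (X ^+ l.-1 / l.-1`!%:R)))%:E)%E).
  by apply: lee_sum => l _; exact: term.
rewrite sumEFin lee_fin -mulr_sumr ler_wpM2l ?sqr_ge0// -mulr_sumr ler_wpM2l//.
  by rewrite mulr_ge0 ?expR_ge0// ltW.
case: N => [|N]; first by rewrite big_ord0 addr_ge0 ?expR_ge0.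
rewrite big_ord_recl/= expr0 fact0 divr1 lerD2l.
exact: expT_le.
Qed.

End HarmonicBounds.

Section DensityMeasure.
Context d (T : measurableType d) (R : realType).
Variables (mu : {measure set T -> \bar R}) (D : set T) (g : T -> R).
Hypotheses (mD : measurable D) (mg : measurable_fun D g).

(** The absolute value provides nonnegativity without a hypothesis on [g]. The measurability proofs
    are arguments so that the measure structure can be attached to the definition. *)
Definition density_measure of measurable D & measurable_fun D g :=
  fun A : set T => (\int[mu]_(x in A `&` D) (`|g x|)%:E)%E.

Local Notation dm := (density_measure mD mg).

Let dm0 : dm set0 = 0%E.
Proof. by rewrite /density_measure set0I integral_set0. Qed.

Let dm_ge0 A : (0 <= dm A)%E.
Proof. by apply: integral_ge0 => x _; rewrite lee_fin. Qed.

Let dm_sigma_additive : semi_sigma_additive dm.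
Proof.
move=> F mF tF mUF; apply: cvg_toP.
  by apply: is_cvg_nneseries => i _ _; exact: dm_ge0.
rewrite /density_measure setI_bigcupl ge0_integral_bigcup//.
- by move=> i; apply: measurableI.
- apply/measurable_EFinP; apply: measurableT_comp => //.
  by apply: measurable_funS mg => // x [i _ []].
- apply/trivIsetP => a b _ _ ab; rewrite setIACA setIid.
  by move/trivIsetP : tF => /(_ a b Logic.I Logic.I ab) ->; rewrite set0I.
Qed.

HB.instance Definition _ := measure_function.isMeasure.Build _ _ _ dm dm0 dm_ge0 dm_sigma_additive.

End DensityMeasure.

(** The negative part is bounded, hence integrable on a set of finite measure; an integral below +oo
    then bounds the positive part. *)
Lemma integrable_lower_bound d (T : measurableType d) (R : realType)
    (mu : {measure set T -> \bar R}) (D : set T) (g : T -> R) (a : R) :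
  measurable D -> (mu D < +oo)%E -> measurable_fun D g ->
  (forall x, D x -> - a <= g x) -> (\int[mu]_(x in D) (g x)%:E < +oo)%E ->
  mu.-integrable D (EFin \o g).
Proof.
move=> mD fD mg ga gfin; pose E := EFin \o g.
have mE : measurable_fun D E by exact/measurable_EFinP.
have icst : mu.-integrable D (EFin \o (fun=> `|a|)).
  apply: measurable_bounded_integrable => //; exists `|a|; split; first exact: num_real.
  by move=> N aN x _; rewrite /= normr_id ltW.
have ineg : mu.-integrable D (E^\-)%E.
  apply: (le_integrable mD _ _ icst); first exact: measurable_funeneg.
  move=> x Dx; rewrite (gee0_abs (funeneg_ge0 _ _)) funenegE /E /= -EFin_max lee_fin normr_id.
  by rewrite ge_max normr_ge0 andbT (le_trans _ (ler_norm a))// lerNl ga.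
have fneg : (\int[mu]_(x in D) E^\- x < +oo)%E.
  have /integrableP[_] := ineg; apply: le_lt_trans; rewrite le_eqVlt; apply/orP; left; apply/eqP.
  by apply: eq_integral => x _; rewrite gee0_abs.
have fpos : (\int[mu]_(x in D) E^\+ x < +oo)%E.
  move: gfin; rewrite (_ : (\int[mu]_(x in D) (g x)%:E = \int[mu]_(x in D) E^\+ x - \int[mu]_(x in D) E^\- x)%E); last first.
    by rewrite -integralE.
  have nn : (0 <= \int[mu]_(x in D) E^\- x)%E by apply: integral_ge0 => x _; exact: funeneg_ge0.
  move: fneg nn; case: (\int[mu]_(x in D) E^\- x)%E => [b| |]// _ _.
  by case: (\int[mu]_(x in D) E^\+ x)%E => [b'| |]// _; rewrite ltry.
apply/integrableP; split=> //.
have -> : (\int[mu]_(x in D) `|E x| = \int[mu]_(x in D) E^\+ x + \int[mu]_(x in D) E^\- x)%E.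
  rewrite -ge0_integralD//; [|exact: measurable_funepos|exact: measurable_funeneg].
  by apply: eq_integral => x _; rewrite -[LHS]/((abse \o E) x) fune_abse.
by rewrite lte_add_pinfty.
Qed.

Section Instability.
Variables (R : realType) (n : nat) (sigma : probability (borel R n) R).
Hypotheses (hn : (2 <= n)%N) (hsigma : is_uniform sigma).
Variables (nu tau j : R -> R).
Hypotheses (hcoef : coefficients nu tau) (hj : is_inverse_rate nu tau j).
Variables (kappa rho : R).
Hypotheses (kappa0 : 0 < kappa) (kappa1 : (kappa%:E < kappa_max nu tau)%E)
  (rhoE : rho = j kappa / order_parameter n kappa).

Local Notation S := (sphere R n).
Local Notation I := (sint sigma).
Local Notation bI := (intg_bdm hsigma).
Local Notation k := (rate nu tau).
Local Notation c := (order_parameter n).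
Local Notation J g := (enorm (flux sigma g)).
Local Notation Phi := (potential nu tau).
Local Notation fe := (fe sigma nu tau).
Local Notation Fk := (Fk sigma nu tau).
Local Notation q := (fun x => j x / order_parameter n x).

Lemma op_gt0 (x : R) : 0 < x -> 0 < c x. Proof. exact: (order_parameter_gt0 hn hsigma). Qed.

Lemma jkappa : 0 < j kappa /\ k (j kappa) = kappa.
Proof. exact: inverse_rate_gt0. Qed.

Lemma rho_gt0 : 0 < rho.
Proof. by rewrite rhoE divr_gt0 ?op_gt0//; case: jkappa. Qed.

Lemma rho_c : rho * c kappa = j kappa.
Proof. by rewrite rhoE divfK// gt_eqF ?op_gt0. Qed.

Let rho0 := rho_gt0.

(** The slope of the free energy along the family rho M_(x Om): [dop] being positive, its sign is
    that of x - k (rho c x), which is zero at kappa. *)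
Lemma hd_Fk (x : R) Om : 0 < x -> S Om -> is_derive x (1 : R) (fun x => Fk rho x Om)
  (rho * dop sigma x Om * (x - k (rho * c x))).
Proof.
move=> x0 SO; have z0 := zon0_gt0 hsigma x SO.
have zz : 0 < rho * (zon sigma 0 x Om)^-1 by rewrite divr_gt0.
have hz := hdZ rho (hdV (lt0r_neq0 z0) (hd_zon hsigma 0 x SO)).
have hc := hd_order_parameter hn hsigma x SO.
have hP := @hd_comp R Phi (fun x : R => rho * c x) x _ _ (hd_potential hcoef (mulr_gt0 rho0 (op_gt0 x0))) (hdZ rho hc).
have h := hdB (hdD (hdZ rho (@hd_ln R (fun x : R => rho * (zon sigma 0 x Om)^-1) x _ zz hz)) (hdM (hd_id x) (hdZ rho hc))) hP.
apply: (is_derive_eq (hd_eq _ h)) => [y|]; first by [].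
rewrite (order_parameter_zon hn hsigma _ SO); field.
by rewrite !gt_eqF.
Qed.

(** The quotient j / c decreases through rho at kappa, so j x < rho c x just above kappa; the
    increasing rate is applied to both sides. *)
Lemma supercritical (dq : R) : is_derive kappa (1 : R) q dq -> dq < 0 ->
  exists2 d : R, 0 < d & forall x, kappa < x < kappa + d -> x < k (rho * c x).
Proof.
move=> hq dq0; have e0 : 0 < - dq / 2 by rewrite divr_gt0// oppr_gt0.
have /nbhs_ballP[d1 /= d10 h1] := proj1 (hd_epsP _ _ _) hq _ e0.
have /nbhs_ballP[d2 /= d20 h2] := near_inverse_rate hcoef hj kappa0 kappa1.
exists (Num.min d1 d2); first by rewrite lt_min d10.
move=> x /andP[kx]; rewrite -ltrBlDl lt_min => /andP[xd1 xd2].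
have xk : 0 < x - kappa by rewrite subr_gt0.
have x0 : 0 < x by exact: lt_trans kx.
have [jx kj] : 0 < j x /\ k (j x) = x.
  by apply: h2; rewrite /ball/= distrC gtr0_norm.
have := h1 (x - kappa); rewrite /ball/= sub0r normrN gtr0_norm// => /(_ xd1).
rewrite (addrC kappa) subrK => hh; have := le_trans (ler_norm _) hh => h3.
have qx : j x / c x < rho by rewrite rhoE; nra.
rewrite -{1}kj; apply: (rate_lt hcoef); first exact: ltW.
by rewrite -ltr_pdivrMr ?op_gt0.
Qed.

Lemma Fk_decreases (dq : R) Om : is_derive kappa (1 : R) q dq -> dq < 0 -> S Om ->
  exists2 d : R, 0 < d & forall x, kappa < x < kappa + d -> Fk rho x Om < Fk rho kappa Om.
Proof.
move=> hq dq0 SO; have [d d0 hd] := supercritical hq dq0; exists d => // x /andP[kx xd].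
have dF (z : R) : kappa <= z -> is_derive z (1 : R) (fun x => Fk rho x Om)
    (rho * dop sigma z Om * (z - k (rho * c z))).
  by move=> kz; apply: hd_Fk => //; exact: lt_le_trans kz.
have dF' (z : R) : z \in `]kappa, x[ -> is_derive z (1 : R) (fun x => Fk rho x Om)
    (rho * dop sigma z Om * (z - k (rho * c z))).
  by rewrite in_itv/= => /andP[kz _]; apply: dF; exact: ltW.
have cF : {within `[kappa, x], continuous (fun x => Fk rho x Om)}.
  apply: derivable_within_continuous => z; rewrite in_itv/= => /andP[kz _].
  by case: (dF z kz).
have [z] := MVT kx dF' cF; rewrite in_itv/= => /andP[kz zx] E.
rewrite -subr_lt0 E nmulr_rlt0 ?subr_gt0// pmulr_rlt0; last by rewrite mulr_gt0// dop_gt0.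
by rewrite subr_lt0 hd// kz (lt_trans zx).
Qed.

Lemma unstable_data (dq : R) Om (s eps : R) : is_derive kappa (1 : R) q dq -> dq < 0 ->
  S Om -> 0 < eps ->
  exists (mu0 : {measure set (borel R n) -> \bar R}) (f0 : 'rV[R]_n -> R),
    [/\ initial_condition sigma s mu0, has_density sigma mu0 f0, mu0 S = rho%:E,
        (Hnorm sigma s (dist_sub (dist_of_meas mu0)
           (dist_of_fun sigma (equilibrium sigma rho kappa Om))) < eps%:E)%E
      & (free_energy sigma nu tau f0 < (Fk rho kappa Om)%:E)%E].
Proof.
move=> hq dq0 SO eps0; have [d d0 hd] := Fk_decreases hq dq0 SO.
pose B := kappa + 1; have B0 : 0 <= B by rewrite addr_ge0// ltW.
have [W W0 hW] := Hnorm_bound hn hsigma s B0.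
pose A := 2 * rho * expR B * W; have A0 : 0 < A by rewrite !mulr_gt0 ?expR_gt0.
(* Three demands on h: stay where the free energy is lower, keep x below [B] = kappa + 1, and make
   the Sobolev distance, at most h A, smaller than eps. *)
pose h := Num.min (Num.min (d / 2) 1) (eps / (2 * A)).
have h0 : 0 < h by rewrite !lt_min ltr01 !divr_gt0// mulr_gt0.
have hd2 : h <= d / 2 by rewrite /h !ge_min lexx.
have h1 : h <= 1 by rewrite /h !ge_min lexx orbT.
have he : h <= eps / (2 * A) by rewrite /h !ge_min lexx orbT.
pose x := kappa + h; have kx : kappa < x by rewrite ltrDl.
have x0 : 0 < x by exact: lt_trans kx.
have xB : x <= B by rewrite lerD2l.
have xBn : `|x| <= B by rewrite gtr0_norm.
pose g := equilibrium sigma rho x Om; have bg : bdm g := bdm_equilibrium sigma rho x Om.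
have mS := measurable_sphere R n; have mg : measurable_fun (S : set (borel R n)) (g : borel R n -> R) by case: bg.
have gpos y : 0 < g y by exact: equilibrium_gt0.
pose mu0 : {measure set (borel R n) -> \bar R} := density_measure sigma mS mg.
have dens : has_density sigma mu0 g.
  split=> //; first by move=> y _; exact: ltW.
  by move=> C _; apply: eq_integral => y _; rewrite gtr0_norm.
have mass : mu0 S = rho%:E.
  have [_ _ ->//] := dens; rewrite setIid -(mass_equilibrium hsigma rho x SO) /sint /Rintegral fineK//.
  by apply: integrable_fin_num => //; exact: bI.
have distE Y : bdm Y -> dist_of_meas mu0 Y = I (fun y => g y * Y y).
  exact: (dist_density dens mass).
exists mu0, g; split=> //.
- split; [|by rewrite mass ltry|].
    have [_ _ ->] := dens; last exact: measurableC.
    by rewrite setICl integral_set0.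
  apply: (@le_lt_trans _ _ (rho * expR B * W)%:E); last by rewrite ltry.
  apply: hW; first by rewrite mulr_ge0 ?expR_ge0// ltW.
  move=> l Y hY Y1; rewrite distE; last exact: bdm_harmonic hY.
  exact: equilibrium_harmonic.
- apply: (@le_lt_trans _ _ (h * (2 * rho * expR B) * W)%:E).
    apply: hW; first by rewrite !mulr_ge0 ?expR_ge0// ltW.
    move=> l Y hY Y1; rewrite /dist_sub distE; last exact: bdm_harmonic hY.
    have := equilibrium_harmonic_dist hn hsigma rho0 (ltW kappa0) kx xB SO hY Y1.
    by rewrite (_ : x - kappa = h)// /x addrC addKr.
  rewrite lte_fin -mulrA -/A; apply: (@le_lt_trans _ _ (eps / (2 * A) * A)); first by rewrite ler_pM2r.
  have -> : eps / (2 * A) * A = eps / 2 by field; rewrite gt_eqF.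
  lra.
- have bent := bdm_ent_equilibrium hsigma x rho0 SO.
  rewrite (free_energyE nu tau (bI bent)) lte_fin (fe_equilibrium hn hsigma nu tau rho0 x0 SO).
  by apply: hd; rewrite kx/= ltrD2l (le_lt_trans hd2)// ltr_pdivrMr// mulr2n mulrDr mulr1 ltrDl.
Qed.

Lemma intg_lower_bound (g : 'rV[R]_n -> R) (a : R) : measurable_fun (S : set (borel R n)) (g : borel R n -> R) ->
  (forall x, S x -> - a <= g x) -> (\int[sigma]_(x in S) (g x)%:E < +oo)%E -> intg sigma g.
Proof.
move=> mg ga gfin; apply: (integrable_lower_bound (a := a)) => //; first exact: measurable_sphere.
by have := ltry (1 : R); rewrite -(proj1 hsigma).
Qed.

Lemma relent_ge0 (g : 'rV[R]_n -> R) Om : intg sigma g -> (forall x, S x -> 0 <= g x) ->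
  I g = rho -> intg sigma (ent g) -> S Om -> 0 <= relent sigma rho kappa g Om.
Proof.
move=> ig g0 Ig ie SO.
have := young hsigma kappa rho0 ig g0 Ig ie SO (bdm_cst 0).
rewrite (_ : I _ - I _ = 0)//; apply/eqP; rewrite subr_eq0; apply/eqP.
by apply: eq_sint => x _; rewrite expR0 subrr !mulr0.
Qed.

Lemma potential_lip_at r : 0 <= r -> Phi r - Phi (j kappa) <= k (r + j kappa) * `|r - j kappa|.
Proof.
move=> r0; have [j0 kj] := jkappa.
have p := potential_tangent hcoef r0 (ltW j0).
have kr : k r <= k (r + j kappa) by apply: rate_le => //; rewrite lerDl ltW.
have kr0 := rate_ge0 hcoef r0.
apply: (@le_trans _ _ (k r * `|r - j kappa|)); last by rewrite ler_wpM2r.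
by apply: (@le_trans _ _ (k r * (r - j kappa))); [lra|rewrite ler_wpM2l// ler_norm].
Qed.

Lemma unstable_dynamics (s : R) (mu0 : {measure set (borel R n) -> \bar R})
    (f0 : 'rV[R]_n -> R) (f : R -> 'rV[R]_n -> R) Om : S Om ->
  has_density sigma mu0 f0 -> mu0 S = rho%:E ->
  (free_energy sigma nu tau f0 < (Fk rho kappa Om)%:E)%E ->
  is_solution sigma nu tau s mu0 f ->
  ~ (enorm (flux sigma (f t)) @[t --> +oo] --> rho * order_parameter n kappa).
Proof.
move=> SO hd mrho hF sol; rewrite rho_c => hJ; have [j0 kj] := jkappa.
have [mf0 f00 _] := hd; have [if0 If0] := intg_density hd mrho.
have ment : measurable_fun (S : set (borel R n)) (ent f0 : borel R n -> R).
  apply: measurable_funM => //; exact: (measurableT_comp (@measurable_ln R) mf0).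
(* The free energy is an extended real: being below a real number it excludes an infinite entropy,
   as s ln s is bounded below by -1. *)
have ie : intg sigma (ent f0).
  apply: (intg_lower_bound (a := 1) ment).
    by move=> x Sx; have := entropy_ge (f00 x Sx); have := f00 x Sx; rewrite /ent; lra.
  move: hF; rewrite /free_energy; case: (\int[sigma]_(x in S) _)%E => [b| |]//=.
  by rewrite ltry.
move: hF; rewrite (free_energyE nu tau ie) lte_fin => hF.
pose e := Fk rho kappa Om - fe f0; have e0 : 0 < e by rewrite subr_gt0.
(* The excess is at least - K |J - j| for |J - j| < 1: kappa comes from the linear term, k (2 j + 1)
   from the potential, and 1 gives a margin. *)
pose K := kappa + k (j kappa + 1 + j kappa) + 1.
have K0 : 0 < K.
  rewrite ltr_wpDl// addr_ge0 ?(ltW kappa0)// (rate_ge0 hcoef)//.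
  by rewrite !addr_ge0// ltW.
have near1 : \forall t \near +oo, `|j kappa - J (f t)| < Num.min (Num.min 1 (j kappa)) (e / K).
  by move/cvgrPdist_lt: hJ; apply; rewrite !lt_min ltr01 j0 divr_gt0.
have [t [t0 ht]] : exists t : R, 0 < t /\ `|j kappa - J (f t)| < Num.min (Num.min 1 (j kappa)) (e / K).
  have h2 : \forall t \near +oo, 0 < t /\ `|j kappa - J (f t)| < Num.min (Num.min 1 (j kappa)) (e / K).
    by near=> t; split; near: t => //; exact: nbhs_pinfty_gt.
  by have [t ht] := @filter_ex _ _ _ _ h2; exists t.
move: ht; rewrite !lt_min -andbA => /and3P[h1 h2 h3]; set r := J (f t) in h1 h2 h3.
have r0 : 0 < r by move: h2; rewrite ltr_norml => /andP[_]; lra.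
have nz : flux sigma (f t) != 0.
  apply: contraTneq r0 => fz; rewrite /r fz /enorm /dot big1 ?sqrtr0 ?ltxx// => i _.
  by rewrite mxE mul0r.
have SOt := direction_sphere nz.
have bft := sol_bdm sol t0.
have [m m0 hm] := smooth_pos_bound (sol_smooth sol) (sol_pos sol) t0.
have iet := bI (intg_ent_bdm bft m0 hm).
have pt x : S x -> 0 <= f t x by move=> Sx; exact/ltW/(sol_pos sol).
have mt : I (f t) = rho by exact: (sol_mass hn hsigma hd mrho sol).
have H0 := relent_ge0 (bI bft) pt mt iet SOt.
have := fe_relent hsigma nu tau kappa rho0 (bI bft) mt SOt.
rewrite (Fk_indep hn hsigma nu tau rho kappa SOt SO) (dot_direction nz) rho_c -/r => E.
have := fe_le_init hn hsigma hcoef rho0 hd mrho sol t0 ie => L.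
have P := potential_lip_at (ltW r0).
have d0 := normr_ge0 (r - j kappa).
have rd : `|r - j kappa| < 1 by rewrite distrC.
have r1 : r + j kappa <= j kappa + 1 + j kappa.
  by rewrite lerD2r ltW// -ltrBlDl (le_lt_trans (ler_norm _)).
have kr := rate_le hcoef (addr_ge0 (ltW r0) (ltW j0)) r1.
have : `|r - j kappa| < e / K by rewrite distrC.
rewrite ltr_pdivlMr// => h4.
have h5 : - `|r - j kappa| <= r - j kappa by rewrite lerNl -normrN ler_norm.
have h6 : k (r + j kappa) * `|r - j kappa| <= k (j kappa + 1 + j kappa) * `|r - j kappa|.
  by rewrite ler_wpM2r.
have h7 : - (kappa * `|r - j kappa|) <= kappa * (r - j kappa) by rewrite -mulrN ler_pM2l.
move: h4; rewrite /K !mulrDr mulr1 (mulrC _ kappa) (mulrC _ (k _)) /e.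
move: P E L H0 hF h6 h7 d0; rewrite -/r.
move: (relent _ _ _ _ _) (fe (f t)) (fe f0) (Fk rho kappa Om) (Phi r) (Phi (j kappa)) => H a b F p1 p2.
move: (k (r + j kappa)) (k (j kappa + 1 + j kappa)) (`|r - j kappa|) (r - j kappa) => k1 k2 w v.
lra.
Unshelve. all: by end_near. Qed.

End Instability.

(** * Confinement near the family of equilibria *)

Section Coercivity.
Variables (R : realType) (n : nat) (sigma : probability (borel R n) R).
Hypotheses (hn : (2 <= n)%N) (hsigma : is_uniform sigma).
Variables (nu tau j : R -> R).
Hypotheses (hcoef : coefficients nu tau) (hj : is_inverse_rate nu tau j).
Variables (kappa rho : R).
Hypotheses (kappa0 : 0 < kappa) (kappa1 : (kappa%:E < kappa_max nu tau)%E)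
  (rhoE : rho = j kappa / order_parameter n kappa).

Local Notation S := (sphere R n).
Local Notation I := (sint sigma).
Local Notation bI := (intg_bdm hsigma).
Local Notation intg := (intg sigma).
Local Notation k := (rate nu tau).
Local Notation c := (order_parameter n).
Local Notation J g := (enorm (flux sigma g)).
Local Notation Om g := (direction sigma g).
Local Notation Phi := (potential nu tau).
Local Notation fe := (fe sigma nu tau).
Local Notation Fk := (Fk sigma nu tau rho kappa).
Local Notation eq := (equilibrium sigma rho kappa).
Local Notation relent := (relent sigma rho kappa).
Local Notation q := (fun x => j x / order_parameter n x).

Let rho0 : 0 < rho := rho_gt0 hn hsigma hcoef hj kappa0 kappa1 rhoE.
Let rhoc : rho * c kappa = j kappa := rho_c hn hsigma kappa0 rhoE.
Let jk : 0 < j kappa /\ k (j kappa) = kappa := jkappa hcoef hj kappa0 kappa1.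

Lemma rate_derive_ge0 (r D : R) : 0 <= r -> is_derive r (1 : R) k D -> 0 <= D.
Proof.
move=> r0 /hd_epsP hD; apply/ler_addgt0Pr => e e0.
have /nbhs_ballP[d /= d0 hd] := hD e e0.
have d2 : 0 < d / 2 by rewrite divr_gt0.
have := hd (d / 2); rewrite /ball/= sub0r normrN gtr0_norm// => /(_ _).
rewrite ltr_pdivrMr// mulr2n mulrDr mulr1 ltrDl => /(_ d0) h.
have km : k r <= k (r + d / 2) by apply: (rate_le hcoef) => //; rewrite lerDl ltW.
have h2 : k (r + d / 2) - k r - d / 2 * D <= e * (d / 2) by exact: le_trans (ler_norm _) h.
by rewrite -(@pmulr_rge0 _ (d / 2))// mulrDr; lra.
Qed.

Lemma dop_indep Om Om' : S Om -> S Om' -> dop sigma kappa Om = dop sigma kappa Om'.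
Proof. by move=> SO SO'; rewrite /dop !(zon_indep hn hsigma _ _ SO SO'). Qed.

Lemma subcritical (dq D : R) Om : S Om -> is_derive kappa (1 : R) q dq -> 0 < dq ->
  is_derive (j kappa) (1 : R) k D -> D * (rho * dop sigma kappa Om) < 1.
Proof.
move=> SO hq dq0 hD; have c0 := op_gt0 hn hsigma kappa0; have [j0 kj] := jk.
have hc := hd_order_parameter hn hsigma kappa SO.
have hjd : is_derive kappa (1 : R) j (dq * c kappa + rho * dop sigma kappa Om).
  have h := hdM hq hc; rewrite -rhoE in h; apply: hd_near h.
  apply: filterS (lt_nbhsr kappa0) => x x0.
  by rewrite divfK// gt_eqF// (op_gt0 hn hsigma).
have D1 := inverse_rate_derive hcoef hj kappa0 kappa1 hD hjd.
have D0 := rate_derive_ge0 (ltW j0) hD.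
have : 0 < D by rewrite lt_neqAle D0 andbT; apply/eqP => Dz; move: D1; rewrite -Dz mul0r => /eqP; rewrite eq_sym oner_eq0.
move=> Dp; have : 0 < D * (dq * c kappa) by rewrite mulr_gt0// mulr_gt0.
by move: D1; rewrite mulrDr; lra.
Qed.

Record admissible (g : 'rV[R]_n -> R) : Prop := Admissible {
  adm_intg : intg g;
  adm_ge0 : forall x, S x -> 0 <= g x;
  adm_mass : I g = rho;
  adm_ent : intg (ent g) }.

Lemma fe_gap g : admissible g -> flux sigma g != 0 ->
  fe g - Fk (Om g) = relent g (Om g) - (Phi (J g) - Phi (j kappa) - kappa * (J g - j kappa)).
Proof.
move=> [ig g0 Ig ie] nz.
by rewrite (fe_relent hsigma nu tau kappa rho0 ig Ig (direction_sphere nz)) (dot_direction nz) rhoc.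
Qed.

Lemma fe_upper g : admissible g -> flux sigma g != 0 -> fe g - Fk (Om g) <= relent g (Om g).
Proof.
move=> ag nz; rewrite fe_gap//; have [j0 kj] := jk.
have := potential_tangent hcoef (ltW j0) (enorm_ge0 (flux sigma g)).
rewrite kj; move: (relent _ _) (J g) (Phi _) (Phi _) => H r p1 p2; lra.
Qed.

Lemma coercivity (dq : R) : is_derive kappa (1 : R) q dq -> 0 < dq ->
  exists d a eta : R, [/\ 0 < d, 0 < a, 0 < eta &
    forall g, admissible g -> flux sigma g != 0 -> `|J g - j kappa| <= d ->
      a * (J g - j kappa) ^+ 2 <= relent g (Om g) /\ eta * relent g (Om g) <= fe g - Fk (Om g)].
Proof.
move=> hq dq0; have [j0 kj] := jk; have [D hD] := rate_derive hcoef j0.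
have i : 'I_n by exact: Ordinal (ltnW hn).
have SO := pole_sphere R i; set P := delta_mx 0 i in SO.
pose V := rho * dop sigma kappa P; have V0 : 0 < V by rewrite mulr_gt0// dop_gt0.
have DV := subcritical SO hq dq0 hD; rewrite -/V in DV.
have D0 := rate_derive_ge0 (ltW j0) hD.
(* A quarter of the gap between the curvature 1 / V of the entropy and the curvature D of the
   potential. One [g] pays for the cubic remainder, one for the expansion of the potential, one for
   [eta]. *)
pose g := (V^-1 - D) / 4.
have g0 : 0 < g by rewrite divr_gt0// subr_gt0 -(ltr_pM2r V0) mulVf ?gt_eqF.
have [d1 d10 hP] := potential_second hcoef j0 hD g0.
pose C3 := 8 * expR 2 * rho; have C30 : 0 < C3 by rewrite !mulr_gt0 ?expR_gt0.
pose d2 := g / 2 * V ^+ 3 / C3; have d20 : 0 < d2 by rewrite divr_gt0// mulr_gt0 ?exprn_gt0// divr_gt0.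
have Vi : 0 < V^-1 by rewrite invr_gt0.
pose L := V^-1 - g; have L0 : 0 < L by rewrite /L /g; lra.
pose eta := Num.min (g / L) 1.
exists (Num.min d1 (Num.min V d2)), (L / 2), eta; split.
- by rewrite !lt_min d10 V0.
- by rewrite divr_gt0.
- by rewrite lt_min ltr01 divr_gt0.
move=> h ah nz; rewrite !le_min => /and3P[hd1 hdV hd2].
have [ih h0 Ih ie] := ah; have SOh := direction_sphere nz.
set r := J h in hd1 hdV hd2 *; pose x := r - j kappa.
(* lam = x / V maximises lam x - lam^2 V / 2, with maximum x^2 / (2 V). *)
have lam1 : `|x / V| <= 1 by rewrite normrM normfV (gtr0_norm V0) ler_pdivrMr// mul1r.
have Y := young_quadratic hn hsigma rho0 kappa0 ih h0 Ih ie SOh lam1.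
rewrite (dot_direction nz) rhoc -/r -/x -/C3 (dop_indep SOh SO) -/V in Y.
have Y2 : L / 2 * x ^+ 2 <= relent h (Om h).
  apply: le_trans Y; rewrite -/x.
  have alg (y v C : R) : 0 < v -> y / v * y - (y / v) ^+ 2 / 2 * v - `|y / v| ^+ 3 * C =
      v^-1 / 2 * y ^+ 2 - y ^+ 2 * (`|y| * C / v ^+ 3).
    move=> v0; have y2 : `|y| ^+ 2 = y ^+ 2 by rewrite real_normK ?num_real.
    rewrite normrM normfV (gtr0_norm v0).
    transitivity (v^-1 / 2 * y ^+ 2 - `|y| ^+ 2 * (`|y| * C / v ^+ 3)); last by rewrite y2.
    by field; rewrite gt_eqF.
  rewrite alg//.
  have : `|x| * C3 / V ^+ 3 <= g / 2.
    rewrite ler_pdivrMr ?exprn_gt0// -ler_pdivlMr//.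
  rewrite /L; have := sqr_ge0 x; move: (x ^+ 2) (`|x| * C3 / V ^+ 3) => s t s0 st; nra.
split=> //.
have E := fe_gap ah nz; rewrite -/r in E.
have B := hP r hd1; rewrite kj -/x in B.
have e1 : eta * L <= g.
  apply: (@le_trans _ _ (g / L * L)); last by rewrite divfK ?gt_eqF.
  by rewrite ler_pM2r// /eta ge_min lexx.
have e2 : eta <= 1 by rewrite /eta ge_min lexx orbT.
rewrite E -/x; have DE : D = V^-1 - 4 * g by rewrite /g; field; rewrite gt_eqF.
have x2 := sqr_ge0 x; move: B Y2; rewrite DE /L in e1 *.
move: (relent h _) (Phi r - _ - _) (x ^+ 2) x2 => H b s s0 B Y2.
have h3 : eta * H <= H - (1 - eta) * ((V^-1 - g) / 2 * s).
  have : (1 - eta) * ((V^-1 - g) / 2 * s) <= (1 - eta) * H by rewrite ler_wpM2l// subr_ge0.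
  lra.
apply: (le_trans h3); rewrite lerD2l lerN2; apply: (le_trans B).
have : eta * (V^-1 - g) * s <= g * s by rewrite ler_wpM2r.
have : 0 <= g * s by rewrite mulr_ge0// ltW.
lra.
Qed.

End Coercivity.

Section Confinement.
Variables (R : realType) (n : nat) (sigma : probability (borel R n) R).
Hypotheses (hn : (2 <= n)%N) (hsigma : is_uniform sigma).
Variables (nu tau j : R -> R).
Hypotheses (hcoef : coefficients nu tau) (hj : is_inverse_rate nu tau j).
Variables (kappa rho : R).
Hypotheses (kappa0 : 0 < kappa) (kappa1 : (kappa%:E < kappa_max nu tau)%E)
  (rhoE : rho = j kappa / order_parameter n kappa).

Local Notation S := (sphere R n).
Local Notation I := (sint sigma).
Local Notation bI := (intg_bdm hsigma).
Local Notation intg := (intg sigma).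
Local Notation k := (rate nu tau).
Local Notation J g := (enorm (flux sigma g)).
Local Notation Om g := (direction sigma g).
Local Notation fe := (fe sigma nu tau).
Local Notation Fk := (Fk sigma nu tau rho kappa).
Local Notation eq := (equilibrium sigma rho kappa).
Local Notation relent := (relent sigma rho kappa).
Local Notation adm := (admissible sigma rho).

Let rho0 : 0 < rho := rho_gt0 hn hsigma hcoef hj kappa0 kappa1 rhoE.
Let jk : 0 < j kappa /\ k (j kappa) = kappa := jkappa hcoef hj kappa0 kappa1.

Variables (d a eta : R).
Hypotheses (d0 : 0 < d) (dj : d < j kappa) (a0 : 0 < a) (eta0 : 0 < eta)
  (coer : forall g, adm g -> flux sigma g != 0 -> `|J g - j kappa| <= d ->
      a * (J g - j kappa) ^+ 2 <= relent g (Om g) /\ eta * relent g (Om g) <= fe g - Fk (Om g)).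

Variables (s : R) (mu0 : {measure set (borel R n) -> \bar R})
  (f : R -> 'rV[R]_n -> R) (f0 : 'rV[R]_n -> R) (D E : R).
Hypotheses (hd : has_density sigma mu0 f0) (mrho : mu0 S = rho%:E)
  (sol : is_solution sigma nu tau s mu0 f) (ie0 : intg (ent f0)) (P : 'rV[R]_n) (SP : S P)
  (J0 : `|J f0 - j kappa| < D) (fe0 : fe f0 - Fk P <= E) (Dd : D <= d)
  (ED : E < eta * (a * D ^+ 2)).

Lemma flux_neq0 g : `|J g - j kappa| <= d -> flux sigma g != 0.
Proof.
move=> h; apply/eqP => gz; move: h; rewrite gz /enorm /dot big1 => [|i _]; last by rewrite mxE mul0r.
by case: jk => j0 _; rewrite sqrtr0 sub0r normrN (gtr0_norm j0) leNgt dj.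
Qed.

Lemma sol_admissible t : 0 < t -> adm (f t).
Proof.
move=> t0; have bft := sol_bdm sol t0.
have [m m0 hm] := smooth_pos_bound (sol_smooth sol) (sol_pos sol) t0.
split; [exact: bI|by move=> x Sx; exact/ltW/(sol_pos sol)|exact: (sol_mass hn hsigma hd mrho sol)|].
exact: bI (intg_ent_bdm bft m0 hm).
Qed.

Lemma sol_fe_le t : 0 < t -> flux sigma (f t) != 0 -> fe (f t) - Fk (Om (f t)) <= E.
Proof.
move=> t0 nz; rewrite (Fk_indep hn hsigma nu tau rho kappa (direction_sphere nz) SP).
apply: le_trans fe0; rewrite lerD2r; exact: (fe_le_init hn hsigma hcoef rho0 hd mrho sol t0 ie0).
Qed.

Lemma sol_flux_continuous (t : R) : 0 < t -> {for t, continuous (fun u : R => J (f u))}.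
Proof.
move=> t0; apply: (@continuous_comp _ _ _ (fun u : R => flux sigma (f u)) (@enorm R n) t).
  apply: (@cvg_rV _ _ _ (nbhs t)) => i.
  exact: hd_continuous (hd_flux hn hsigma sol i t0).
exact: continuous_enorm.
Qed.

(** At distance exactly [D], coercivity would make the excess at least eta a D^2 > E, while the
    decay of the free energy keeps it at most E. *)
Lemma not_at_distance t : 0 < t -> `|J (f t) - j kappa| != D.
Proof.
move=> t0; apply/eqP => h; have hd' : `|J (f t) - j kappa| <= d by rewrite h.
have nz := flux_neq0 hd'; have [h1 h2] := coer (sol_admissible t0) nz hd'.
have h3 := sol_fe_le t0 nz; have x2 : (J (f t) - j kappa) ^+ 2 = D ^+ 2.
  by rewrite -real_normK ?num_real// h.
rewrite x2 in h1; have : eta * (a * D ^+ 2) <= E.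
  by apply: le_trans h3; apply: le_trans h2; rewrite ler_pM2l.
by rewrite leNgt ED.
Qed.

(** J is continuous for t > 0 and starts, as a limit at 0, within [D] of j; to leave, it would have
    to be at distance exactly [D]. *)
Lemma confinement t : 0 < t -> `|J (f t) - j kappa| < D.
Proof.
move=> t0; rewrite ltNge; apply/negP => hD.
have JJ : `|J (f u) - j kappa| @[u --> 0^'+] --> `|J f0 - j kappa|.
  apply: cvg_norm; apply: cvgB; last exact: cvg_cst.
  apply: (@cvg_comp _ _ _ (fun u => flux sigma (f u)) (@enorm R n) _ (nbhs (flux sigma f0))).
    exact: (sol_flux_cvg0 hn hsigma hd mrho sol).
  exact: continuous_enorm.
have [b [b0 bt hb]] : exists b : R, [/\ 0 < b, b <= t & `|J (f b) - j kappa| < D].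
  have h : \forall b \near 0^'+, [/\ 0 < b, b <= t & `|J (f b) - j kappa| < D].
    near=> b; split; near: b; first exact: nbhs_right_gt.
      exact: nbhs_right_le.
    by apply: (cvgr_lt _ JJ).
  by have [b hb] := @filter_ex _ _ _ _ h; exists b.
have cJ : {within `[b, t], continuous (fun u : R => `|J (f u) - j kappa|)}.
  apply: continuous_in_subspaceT => u /set_mem; rewrite /= in_itv/= => /andP[bu _].
  apply: (@cvg_norm _ _ _ (nbhs u)); apply: (@cvgB _ _ _ (nbhs u)); last exact: cvg_cst.
  by apply: sol_flux_continuous; exact: lt_le_trans bu.
have [|u] := @IVT R (fun u : R => `|J (f u) - j kappa|) b t D bt cJ.
  by rewrite ge_min (ltW hb)/= le_max hD orbT.
rewrite in_itv/= => /andP[bu _] hu.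
by move/eqP: (not_at_distance (lt_le_trans b0 bu)); apply.
Unshelve. all: by end_near. Qed.

Lemma sol_near t : 0 < t -> [/\ flux sigma (f t) != 0, `|J (f t) - j kappa| < D,
  0 <= fe (f t) - Fk (Om (f t)) & relent (f t) (Om (f t)) <= E / eta].
Proof.
move=> t0; have hD := confinement t0; have hd' := le_trans (ltW hD) Dd.
have nz := flux_neq0 hd'; have [h1 h2] := coer (sol_admissible t0) nz hd'.
have H0 : 0 <= relent (f t) (Om (f t)) by apply: le_trans h1; rewrite mulr_ge0 ?sqr_ge0// ltW.
split=> //; first by apply: le_trans h2; rewrite mulr_ge0// ltW.
rewrite ler_pdivlMr// mulrC; apply: (le_trans h2); exact: sol_fe_le.
Qed.

End Confinement.

(** * Relaxation in L2 *)

Section FluxRate.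
Variables (R : realType) (n : nat) (sigma : probability (borel R n) R).
Hypotheses (hn : (2 <= n)%N) (hsigma : is_uniform sigma).
Variables (nu tau : R -> R).
Hypothesis hcoef : coefficients nu tau.
Variables (kappa rho : R).
Hypotheses (kappa0 : 0 < kappa) (rho0 : 0 < rho).

Local Notation S := (sphere R n).
Local Notation I := (sint sigma).
Local Notation bI := (intg_bdm hsigma).
Local Notation intg := (intg sigma).
Local Notation k := (rate nu tau).
Local Notation J g := (enorm (flux sigma g)).
Local Notation Om g := (direction sigma g).
Local Notation Q := (Qop sigma nu tau).
Local Notation eq := (equilibrium sigma rho kappa).
Local Notation n2 := ((n * n)%:R : R).

Definition norm1 (v : 'rV[R]_n) : R := \sum_i `|v 0 i|.

Lemma norm1_ge0 (v : 'rV[R]_n) : 0 <= norm1 v. Proof. exact: sumr_ge0. Qed.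

Lemma coord_norm1 (v : 'rV[R]_n) (i : 'I_n) : `|v 0 i| <= norm1 v.
Proof. by rewrite /norm1 (bigD1 i)//= lerDl sumr_ge0. Qed.

Lemma dot_norm1 (x v : 'rV[R]_n) : S x -> `|dot x v| <= norm1 v.
Proof.
move=> Sx; apply: (le_trans (ler_norm_sum _ _ _)); apply: ler_sum => i _.
by rewrite normrM ler_piMl// coord_sphere.
Qed.

Lemma ddot_norm1 (i j : 'I_n) (x v : 'rV[R]_n) : S x -> `|ddot i j v x| <= 2 * norm1 v.
Proof.
move=> Sx; rewrite /ddot (le_trans (ler_normB _ _))// mulr_natl mulr2n.
by apply: lerD; rewrite normrM; [apply: le_trans (coord_norm1 v j)|apply: le_trans (coord_norm1 v i)]; rewrite ler_piMl// coord_sphere.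
Qed.

Lemma ddot_sphere (i j : 'I_n) (x v : 'rV[R]_n) : S x -> S v -> `|ddot i j v x| <= 2.
Proof.
move=> Sx Sv; rewrite /ddot (le_trans (ler_normB _ _))// (_ : 2 = 1 + 1 :> R)//.
by rewrite lerD// normrM mulr_ile1// coord_sphere.
Qed.

Lemma sint_coord_parts (v : 'rV[R]_n) g (g1 : 'I_n -> 'I_n -> 'rV[R]_n -> R) :
  (forall i j, rd i j g (g1 i j)) -> bdm g -> (forall i j, bdm (g1 i j)) ->
  2^-1 * \sum_i \sum_j I (fun x => ddot i j v x * g1 i j x) = n.-1%:R * I (fun x => dot x v * g x).
Proof.
move=> rg bg bg1; have b1 i j : bdm (fun x => d2dot i j v x * g x) by apply: bdmM => //; exact: bdm_d2dot.
have bdg : bdm (fun x => dot x v * g x) by apply: bdmM => //; exact: bdm_dot.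
have E i j : I (fun x => ddot i j v x * g1 i j x) = - I (fun x => d2dot i j v x * g x).
  by rewrite (sint_rd_parts hsigma (rd_ddot i j v) (rg i j)) ?opprK//; [exact: bdm_ddot|exact: bdm_d2dot].
under eq_bigr do under eq_bigr do rewrite E.
under eq_bigr => i _.
  rewrite sumrN -(sint_sum hsigma) => [|j _]; last exact: bI.
  over.
rewrite sumrN -(sint_sum hsigma) => [|i _]; last by apply: bI; exact: bdm_sum.
rewrite -sintZ; last exact: bI.
rewrite mulrN -mulNr -sintZ; last by apply: bI; apply: bdm_sum => i _; exact: bdm_sum.
apply: eq_sint => x _.
have -> : \sum_i \sum_j d2dot i j v x * g x = (\sum_i \sum_j d2dot i j v x) * g x.
  by rewrite mulr_suml; apply: eq_bigr => i _; rewrite mulr_suml.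
rewrite (sum_d2dot hn); move: (dot x v) (g x) (n.-1%:R : R) => a b c; by field.
Qed.

Lemma sint_Tgrad_ddot h (v : 'rV[R]_n) (w1 : 'I_n -> 'I_n -> 'rV[R]_n -> R) :
  bdm h -> (forall i j, bdm (w1 i j)) -> (forall i j x, w1 j i x = - w1 i j x) ->
  I (fun x => h x * Tgrad v w1 x) = 2^-1 * \sum_i \sum_j I (fun x => h x * (ddot i j v x * w1 i j x)).
Proof.
move=> bh bw1 asym; have b i j : bdm (fun x => h x * (ddot i j v x * w1 i j x)).
  by apply: bdmM => //; apply: bdmM => //; exact: bdm_ddot.
have -> : \sum_i \sum_j I (fun x => h x * (ddot i j v x * w1 i j x)) =
    I (fun x => \sum_i \sum_j h x * (ddot i j v x * w1 i j x)).
  rewrite (sint_sum hsigma) => [|i _]; last by apply: bI; exact: bdm_sum.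
  by apply: eq_bigr => i _; rewrite (sint_sum hsigma) => [//|j _]; exact: bI.
rewrite -sintZ; last by apply: bI; apply: bdm_sum => i _; exact: bdm_sum.
apply: eq_sint => x _; rewrite Tgrad_ddot// mulrCA mulr_sumr; congr (_ * _); apply: eq_bigr => i _.
by rewrite mulr_sumr.
Qed.

Lemma ddotC (i j : 'I_n) (v x : 'rV[R]_n) : ddot j i v x = - ddot i j v x.
Proof. by rewrite /ddot opprB. Qed.

Lemma rd_equilibrium Om i j : rd i j (eq Om) (fun x => kappa * eq Om x * ddot i j Om x).
Proof.
pose c := rho / zon sigma 0 kappa Om.
have d1 (u : R) : is_derive u (1 : R) (fun v : R => c * expR (kappa * v)) (c * kappa * expR (kappa * u)).
  by apply: is_derive_eq (hdZ c (hd_exp (hdZ kappa (hd_id u)))) _; ring.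
apply: (eq_rd _ _ (rd_zonal i j Om d1)) => x _; rewrite equilibriumE -/c//.
by rewrite /ddot; ring.
Qed.

(** The stationary equation kappa div (P Om eq) = Laplacian of eq, tested against x . v; it rests on
    D_ij eq = kappa eq D_ij (x . Om). *)
Lemma equilibrium_balance (Om v : 'rV[R]_n) :
  kappa * I (fun x => eq Om x * Tgrad Om (fun i j => ddot i j v) x) =
  n.-1%:R * I (fun x => dot x v * eq Om x).
Proof.
have be := bdm_equilibrium sigma rho kappa Om.
have bk i j : bdm (fun x => kappa * eq Om x * ddot i j Om x).
  by apply: bdmM; [exact: bdmZ|exact: bdm_ddot].
rewrite -(sint_coord_parts v (rd_equilibrium Om) be bk).
rewrite (@sint_Tgrad_ddot _ Om (fun i j => ddot i j v) be); last first.
- by move=> i j x; exact: ddotC.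
- by move=> i j; exact: bdm_ddot.
rewrite mulrCA; congr (_ * _); rewrite mulr_sumr; apply: eq_bigr => i _.
rewrite mulr_sumr; apply: eq_bigr => j _; rewrite -sintZ; first by apply: eq_sint => x _; ring.
by apply: bI; apply: bdmM => //; apply: bdmM; exact: bdm_ddot.
Qed.

Lemma Tgrad_ddot_le (Om v x : 'rV[R]_n) : S x -> S Om -> S v ->
  `|Tgrad Om (fun i j => ddot i j v) x| <= 2 * n2.
Proof.
move=> Sx SO Sv; rewrite Tgrad_ddot; last by move=> i j; exact: ddotC.
rewrite normrM gtr0_norm ?invr_gt0//.
have : `|\sum_i \sum_j ddot i j Om x * ddot i j v x| <= \sum_(i < n) \sum_(j < n) (4 : R).
  apply: (le_trans (ler_norm_sum _ _ _)); apply: ler_sum => i _.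
  apply: (le_trans (ler_norm_sum _ _ _)); apply: ler_sum => j _.
  by rewrite normrM (_ : 4 = 2 * 2 :> R)//; [apply: ler_pM => //; exact: ddot_sphere|ring].
rewrite !sumr_const card_ord -mulrnA -mulr_natr => h.
rewrite ler_pdivrMl//; apply: (le_trans h); rewrite le_eqVlt; apply/orP; left; apply/eqP; ring.
Qed.

Lemma bdm_Tgrad_ddot (Om v : 'rV[R]_n) : bdm (Tgrad Om (fun i j => ddot i j v)).
Proof. by apply: bdm_Tgrad => i j; exact: bdm_ddot. Qed.

(** Subtracting the balance of the equilibrium with the same direction leaves only terms small with
    the L^1 distance to it or with k(J) - kappa. This is why the flux moves slowly near the
    family. *)
Lemma flux_rate g (v : 'rV[R]_n) : smooth_sphere g -> I (fun x => dot x v * Q g x) =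
  tau (J g) * (k (J g) * I (fun x => (g x - eq (Om g) x) * Tgrad (Om g) (fun i j => ddot i j v) x)
    + (k (J g) - kappa) * I (fun x => eq (Om g) x * Tgrad (Om g) (fun i j => ddot i j v) x)
    - n.-1%:R * I (fun x => dot x v * (g x - eq (Om g) x))).
Proof.
move=> sg; have bg := bdm_smooth sg; have be := bdm_equilibrium sigma rho kappa (Om g).
have bT := bdm_Tgrad_ddot (Om g) v.
have tau0 : 0 < tau (J g) by case: hcoef => h _ _ _ _; case: (h _ (enorm_ge0 (flux sigma g))).
have nuE : nu (J g) = tau (J g) * k (J g) by rewrite /rate mulrC divfK// gt_eqF.
have bd i j : bdm (ddot i j v : 'rV[R]_n -> R) by exact: bdm_ddot.
rewrite (sint_Qop_parts hn hsigma nu tau sg (fun i j => rd_dot i j v) (bdm_dot v) bd).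
rewrite (sint_coord_parts v (rd_smooth sg) bg (bdm_D1 sg)) nuE.
have bgT : bdm (fun x => g x * Tgrad (Om g) (fun i j => ddot i j v) x) by exact: bdmM.
have beT : bdm (fun x => eq (Om g) x * Tgrad (Om g) (fun i j => ddot i j v) x) by exact: bdmM.
have bvg : bdm (fun x => dot x v * g x) by apply: bdmM => //; exact: bdm_dot.
have bve : bdm (fun x => dot x v * eq (Om g) x) by apply: bdmM => //; exact: bdm_dot.
have -> : I (fun x => (g x - eq (Om g) x) * Tgrad (Om g) (fun i j => ddot i j v) x) =
    I (fun x => g x * Tgrad (Om g) (fun i j => ddot i j v) x) -
    I (fun x => eq (Om g) x * Tgrad (Om g) (fun i j => ddot i j v) x).
  by rewrite -sintB; [apply: eq_sint => x _; rewrite mulrBl|exact: bI|exact: bI].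
have -> : I (fun x => dot x v * (g x - eq (Om g) x)) =
    I (fun x => dot x v * g x) - I (fun x => dot x v * eq (Om g) x).
  by rewrite -sintB; [apply: eq_sint => x _; rewrite mulrBr|exact: bI|exact: bI].
have := equilibrium_balance (Om g) v.
move: (I _) (I _) (I _) (I _) => a b c d; move: (k _) (tau _) (n.-1%:R) => kk t m E.
have -> : kk * (b - d) + (kk - kappa) * d - m * (a - c) = kk * b - m * a - (kappa * d - m * c) by ring.
rewrite E; ring.
Qed.

Lemma flux_rate_le g (v : 'rV[R]_n) (A2 L kM tM d : R) : smooth_sphere g -> flux sigma g != 0 -> S v ->
  I (fun x => `|g x - eq (Om g) x|) <= A2 * d -> 0 <= k (J g) <= kM -> `|k (J g) - kappa| <= L * d ->
  0 <= tau (J g) <= tM ->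
  `|I (fun x => dot x v * Q g x)| <= tM * (kM * (2 * n2 * A2) + L * (2 * n2 * rho) + n%:R * A2) * d.
Proof.
move=> sg nz Sv hA /andP[k0 kk] hL /andP[t0 tt]; have SO := direction_sphere nz.
have bg := bdm_smooth sg; have be := bdm_equilibrium sigma rho kappa (Om g).
have bw : bdm (fun x => g x - eq (Om g) x) by exact: bdmB.
have bT := bdm_Tgrad_ddot (Om g) v; rewrite (flux_rate v sg).
have n20 : 0 <= 2 * n2 by rewrite mulr_ge0.
have Ad0 : 0 <= A2 * d by apply: le_trans hA; exact: sint_ge0.
have i1 : `|I (fun x => (g x - eq (Om g) x) * Tgrad (Om g) (fun i j => ddot i j v) x)| <= 2 * n2 * (A2 * d).
  apply: (le_trans (norm_sint (bI (bdmM bw bT)))); apply: (@le_trans _ _ (2 * n2 * I (fun x => `|g x - eq (Om g) x|))); last first.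
    by rewrite ler_wpM2l.
  rewrite -sintZ; last exact/bI/bdm_norm.
  apply: le_sint; [exact/bI/bdm_norm/bdmM|exact/bI/bdmZ/bdm_norm|].
  by move=> x Sx; rewrite normrM mulrC ler_wpM2r// Tgrad_ddot_le.
have i2 : `|I (fun x => eq (Om g) x * Tgrad (Om g) (fun i j => ddot i j v) x)| <= 2 * n2 * rho.
  apply: (le_trans (norm_sint (bI (bdmM be bT)))); rewrite -[X in _ * X](mass_equilibrium hsigma rho kappa SO) -sintZ; last exact: bI.
  apply: le_sint; [exact/bI/bdm_norm/bdmM|exact/bI/bdmZ|].
  move=> x Sx; rewrite normrM mulrC [X in _ * X]gtr0_norm ?equilibrium_gt0//.
  apply: ler_wpM2r; [exact/ltW/equilibrium_gt0|exact: Tgrad_ddot_le].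
have i3 : `|I (fun x => dot x v * (g x - eq (Om g) x))| <= A2 * d.
  have bvw : bdm (fun x => dot x v * (g x - eq (Om g) x)) by apply: bdmM => //; exact: bdm_dot.
  apply: (le_trans (norm_sint (bI bvw))); apply: le_trans hA.
  apply: le_sint; [exact/bI/bdm_norm|exact/bI/bdm_norm|].
  by move=> x Sx; rewrite normrM ler_piMl// dot_sphere.
have n1 : `|n.-1%:R| <= n%:R :> R by rewrite ger0_norm// ler_nat leq_pred.
rewrite normrM (ger0_norm t0) -mulrA; apply: ler_pM => //.
have -> : (kM * (2 * n2 * A2) + L * (2 * n2 * rho) + n%:R * A2) * d =
  kM * (2 * n2 * (A2 * d)) + L * d * (2 * n2 * rho) + n%:R * (A2 * d) by ring.
apply: (le_trans (ler_normB _ _)); apply: lerD; last by rewrite normrM; apply: ler_pM.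
apply: (le_trans (ler_normD _ _)); apply: lerD; last by rewrite normrM; apply: ler_pM.
by rewrite normrM (ger0_norm k0); apply: ler_pM.
Qed.

Lemma enorm_dist (u v : 'rV[R]_n) : `|enorm u - enorm v| <= norm1 (u - v).
Proof.
have tri a b : enorm (a + b : 'rV[R]_n) <= enorm a + enorm b.
  rewrite -(@ler_pXn2r _ 2) ?nnegrE ?addr_ge0 ?enorm_ge0// sqrrD !sqr_enorm dotDl !dotDr (dotC b a).
  have := le_trans (ler_norm _) (CauchySchwarz_dot a b).
  by rewrite -mulr_natl; lra.
have e1 : enorm u <= enorm (u - v) + enorm v by have := tri (u - v) v; rewrite subrK.
have e2 : enorm v <= enorm (v - u) + enorm u by have := tri (v - u) u; rewrite subrK.
have e3 : enorm (v - u) <= norm1 (u - v).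
  apply: (le_trans (enorm_le_sum _)); rewrite /norm1 le_eqVlt; apply/orP; left; apply/eqP.
  by apply: eq_bigr => i _; rewrite mxE [X in _ + X]mxE [in RHS]mxE [X in _ = `|_ + X|]mxE distrC.
have e4 := enorm_le_sum (u - v); rewrite -/(norm1 (u - v)) in e4.
rewrite ler_norml; apply/andP; split; lra.
Qed.

(** From u / |u| - v / |v| = (u - v - (|u| - |v|) v / |v|) / |u|, a quantitative lower bound being
    required on |u| only. *)
Lemma direction_lip g h (R0 A : R) : flux sigma g != 0 -> flux sigma h != 0 -> 1 <= R0 * J g ->
  (forall i, `|flux sigma g 0 i - flux sigma h 0 i| <= A) ->
  norm1 (Om g - Om h) <= (1 + n%:R) * (n%:R * A) * R0.
Proof.
move=> ng nh hR hA; have rg := enorm_gt0 ng; have rh := enorm_gt0 nh.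
have A0 : 0 <= A by apply: le_trans (hA (Ordinal (ltnW hn))).
have N1 : norm1 (flux sigma g - flux sigma h) <= n%:R * A.
  apply: (@le_trans _ _ (\sum_(i < n) A)).
    by apply: ler_sum => i _; rewrite mxE [X in _ + X]mxE; exact: hA.
  by rewrite sumr_const card_ord mulr_natl.
have enB : `|J g - J h| <= n%:R * A by apply: le_trans N1; exact: enorm_dist.
have B i : `|(Om g - Om h) 0 i| <= (`|flux sigma g 0 i - flux sigma h 0 i| + `|J g - J h|) * R0.
  have -> : (Om g - Om h) 0 i = (J g)^-1 * flux sigma g 0 i - (J h)^-1 * flux sigma h 0 i.
    by rewrite mxE [X in _ + X]mxE /direction /Defs.proj [X in X - _]mxE [X in _ - X]mxE.
  have vb : `|flux sigma h 0 i| <= J h.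
    have := CauchySchwarz_dot (delta_mx 0 i) (flux sigma h).
    by rewrite dot_pole (pole_sphere R i) mul1r.
  have -> : (J g)^-1 * flux sigma g 0 i - (J h)^-1 * flux sigma h 0 i =
      (flux sigma g 0 i - flux sigma h 0 i - (J g - J h) * ((J h)^-1 * flux sigma h 0 i)) * (J g)^-1.
    by move: rg rh (flux sigma g 0 i) (flux sigma h 0 i); move: (J g) (J h) => a b a0 b0 c e; field; rewrite !gt_eqF.
  rewrite normrM; apply: ler_pM => //.
    apply: (le_trans (ler_normB _ _)); rewrite lerD2l normrM ler_piMr// normrM gtr0_norm ?invr_gt0//.
    by rewrite mulrC ler_pdivrMr ?mul1r.
  by rewrite gtr0_norm ?invr_gt0// -[_^-1]mul1r ler_pdivrMr.
have R0p : 0 <= R0 by rewrite -(pmulr_rge0 _ rg) mulrC (le_trans _ hR).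
apply: (@le_trans _ _ (\sum_(i < n) (A + n%:R * A) * R0)).
  apply: ler_sum => i _; apply: (le_trans (B i)); rewrite ler_wpM2r// lerD//.
rewrite sumr_const card_ord -mulr_natl le_eqVlt; apply/orP; left; apply/eqP; ring.
Qed.

End FluxRate.

Section QuadraticRate.
Variables (R : realType) (n : nat) (sigma : probability (borel R n) R).
Hypotheses (hn : (2 <= n)%N) (hsigma : is_uniform sigma).
Variables (nu tau : R -> R).
Hypothesis hcoef : coefficients nu tau.
Variables (kappa rho : R).
Hypotheses (kappa0 : 0 < kappa) (rho0 : 0 < rho).

Local Notation S := (sphere R n).
Local Notation I := (sint sigma).
Local Notation bI := (intg_bdm hsigma).
Local Notation intg := (intg sigma).
Local Notation k := (rate nu tau).
Local Notation J g := (enorm (flux sigma g)).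
Local Notation Om g := (direction sigma g).
Local Notation Q := (Qop sigma nu tau).
Local Notation eq := (equilibrium sigma rho kappa).
Local Notation n2 := ((n * n)%:R : R).
Local Notation Me := (rho * expR kappa).

Lemma equilibrium_le (P x : 'rV[R]_n) : S P -> S x -> eq P x <= Me.
Proof.
move=> SP Sx; rewrite equilibriumE; apply: ler_pM.
- by rewrite divr_ge0 ?ltW// zon0_gt0.
- exact: expR_ge0.
- by rewrite ler_pdivrMr ?zon0_gt0// ler_peMr ?zon0_ge1// ltW.
- by have := expdot_le kappa SP Sx; rewrite (gtr0_norm kappa0).
Qed.

(** By symmetry let x . P' <= x . P. The normalising constants agree, so the quotient of the two
    equilibria is e^(- kappa (x . P - x . P')), between 1 - kappa (x . P - x . P') and 1. *)
Lemma equilibrium_lip (P P' x : 'rV[R]_n) : S P -> S P' -> S x ->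
  `|eq P x - eq P' x| <= kappa * Me * norm1 (P - P').
Proof.
wlog le_dot : P P' / dot x P' <= dot x P.
  move=> W SP SP' Sx; have [h|/ltW h] := leP (dot x P') (dot x P); first exact: W.
  rewrite distrC (_ : norm1 _ = norm1 (P' - P)); first exact: W.
  by apply: eq_bigr => i _; rewrite mxE [X in _ + X]mxE [in RHS]mxE [X in _ = `|_ + X|]mxE distrC.
move=> SP SP' Sx; have z0 := zon0_gt0 hsigma kappa SP.
have ep := equilibrium_le SP Sx; have e0 := equilibrium_gt0 hsigma kappa x rho0 SP.
have dB : dot x P - dot x P' = dot x (P - P').
  by rewrite -[in RHS]scaleN1r [RHS]dotDr dotZr mulN1r.
have E : eq P' x = eq P x * expR (kappa * (dot x P' - dot x P)).
  rewrite !equilibriumE (zon_indep hn hsigma 0 kappa SP' SP) -[RHS]mulrA -expRD; congr (_ * expR _); ring.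
have h1 := expR_ge1Dx (kappa * (dot x P' - dot x P)).
have h2 : expR (kappa * (dot x P' - dot x P)) <= 1.
  by rewrite -[leRHS]expR0 ler_expR pmulr_rle0// subr_le0.
have h3 : dot x P - dot x P' <= norm1 (P - P').
  by rewrite dB; apply: (le_trans (ler_norm _)); exact: dot_norm1.
rewrite E -[X in X - _]mulr1 -mulrBr normrM (gtr0_norm e0) ger0_norm ?subr_ge0//.
have d0 : 0 <= norm1 (P - P') by exact: norm1_ge0.
rewrite (_ : kappa * Me * _ = Me * (kappa * norm1 (P - P'))); last by ring.
apply: ler_pM => //; [exact: ltW|by rewrite subr_ge0|].
rewrite (le_trans (_ : _ <= kappa * (dot x P - dot x P')))//; last by rewrite ler_pM2l.
move: h1; move: (expR (kappa * _)) => ee; lra.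
Qed.

Lemma ddotB (i j : 'I_n) (P P' x : 'rV[R]_n) : ddot i j P x - ddot i j P' x = ddot i j (P - P') x.
Proof. by rewrite /ddot !mxE; ring. Qed.

Lemma young3 (h1 h2 h3 v a b c : R) : h1 ^+ 2 <= a -> h2 ^+ 2 <= b -> h3 ^+ 2 <= c ->
  (h1 + h2 + h3) * v - v ^+ 2 <= 3 / 2 * (a + b + c) - 2^-1 * v ^+ 2.
Proof.
have := sqr_ge0 (h1 + h2 + h3 - v); have := sqr_ge0 (h1 - h2).
have := sqr_ge0 (h1 - h3); have := sqr_ge0 (h2 - h3); rewrite !expr2; nra.
Qed.

Lemma sqr_le (a b : R) : `|a| <= b -> a ^+ 2 <= b ^+ 2.
Proof.
move=> h; rewrite -[a ^+ 2]real_normK ?num_real// ler_pXn2r// nnegrE; exact: le_trans h.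
Qed.

Lemma sqr_leM3 (a b c a' b' c' : R) : `|a| <= a' -> `|b| <= b' -> `|c| <= c' ->
  (a * b * c) ^+ 2 <= (a' * b' * c') ^+ 2.
Proof.
move=> ha hb hc; apply: sqr_le; rewrite !normrM; apply: ler_pM => //; exact: ler_pM.
Qed.

(** Weak form tested with w = g - eq P, for a fixed P. Replacing g by the equilibrium in the drift
    makes three errors: w itself, k(J) - kappa, and the angle between Om g and P. Young's inequality
    absorbs their gradients in half of the Dirichlet form. *)
Lemma sq_rate g (P : 'rV[R]_n) (kM l tm tM q : R) : smooth_sphere g -> flux sigma g != 0 -> S P ->
  0 <= k (J g) <= kM -> `|k (J g) - kappa| <= l -> tm <= tau (J g) <= tM ->
  norm1 (Om g - P) <= q ->
  2 * I (fun x => (g x - eq P x) * Q g x) <=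
  2 * tM * (3 * n2 * (kM ^+ 2 * I (fun x => (g x - eq P x) ^+ 2) +
     Me ^+ 2 * (l ^+ 2 + kappa ^+ 2 * q ^+ 2)))
  - tm * dirichlet sigma (fun i j x => D1 (ext g) i j x - kappa * eq P x * ddot i j P x).
Proof.
move=> sg nz SP /andP[k0 kk] hl /andP[t1 t2] hq; have SO := direction_sphere nz.
pose w x := g x - eq P x; pose w1 i j x := D1 (ext g) i j x - kappa * eq P x * ddot i j P x.
have bg := bdm_smooth sg; have be := bdm_equilibrium sigma rho kappa P.
have bw : bdm w by exact: bdmB.
have bD i j : bdm (D1 (ext g) i j) by exact: bdm_D1.
have bw1 i j : bdm (w1 i j).
  by apply: bdmB => //; apply: bdmM; [exact: bdmZ|exact: bdm_ddot].
have rw i j : rd i j w (w1 i j) by apply: rdB; [exact: rd_smooth|exact: rd_equilibrium].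
have asym i j x : w1 j i x = - w1 i j x.
  by rewrite /w1 ddotC /D1; ring.
have tau0 : 0 < tau (J g) by case: hcoef => h _ _ _ _; case: (h _ (enorm_ge0 (flux sigma g))).
have nuE : nu (J g) = tau (J g) * k (J g) by rewrite /rate mulrC divfK// gt_eqF.
rewrite -/w (sint_Qop_parts hn hsigma nu tau sg rw bw bw1) nuE sint_Tgrad_ddot//.
set y := I _; pose B := kM ^+ 2 * y + Me ^+ 2 * (l ^+ 2 + kappa ^+ 2 * q ^+ 2).
have bsq i j : bdm (fun x => w1 i j x ^+ 2) by apply: (eq_bdm _ (bdmM (bw1 i j) (bw1 i j))) => x _; rewrite expr2.
have bwsq : bdm (fun x => w x ^+ 2) by apply: (eq_bdm _ (bdmM bw bw)) => x _; rewrite expr2.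
have P1 i j : k (J g) * I (fun x => g x * (ddot i j (Om g) x * w1 i j x))
    - I (fun x => w1 i j x * D1 (ext g) i j x) <= 6 * B - 2^-1 * I (fun x => w1 i j x ^+ 2).
  have b1 : bdm (fun x => g x * (ddot i j (Om g) x * w1 i j x)).
    by apply: bdmM => //; apply: bdmM => //; exact: bdm_ddot.
  have b2 : bdm (fun x => w1 i j x * D1 (ext g) i j x) by exact: bdmM.
  have b3 : bdm (fun x => 6 * (kM ^+ 2 * w x ^+ 2 + Me ^+ 2 * (l ^+ 2 + kappa ^+ 2 * q ^+ 2))).
    by apply: bdmZ; apply: bdmD; [exact: bdmZ|exact: bdm_cst].
  have -> : 6 * B = I (fun x => 6 * (kM ^+ 2 * w x ^+ 2 + Me ^+ 2 * (l ^+ 2 + kappa ^+ 2 * q ^+ 2))).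
    rewrite sintZ; last by apply: bI; apply: bdmD; [exact: bdmZ|exact: bdm_cst].
    rewrite sintD; [|exact/bI/bdmZ|exact/bI/bdm_cst].
    by rewrite sintZ ?(sint_cst hsigma)//; exact: bI.
  rewrite -sintZ; last exact: bI.
  rewrite -sintB; [|exact/bI/bdmZ|exact: bI].
  rewrite -sintZ; last exact: bI.
  rewrite -sintB; [|exact: bI|exact/bI/bdmZ].
  apply: le_sint; [apply: bI; apply: bdmB => //; exact: bdmZ|apply: bI; apply: bdmB => //; exact: bdmZ|].
  move=> x Sx; have a2 := ddot_sphere i j Sx SO.
  have ab : `|ddot i j (Om g) x - ddot i j P x| <= 2 * q.
    by rewrite ddotB; apply: (le_trans (ddot_norm1 _ _ _ Sx)); rewrite ler_pM2l.
  have ee := equilibrium_le SP Sx; have e0 := equilibrium_gt0 hsigma kappa x rho0 SP.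
  have E : k (J g) * (g x * (ddot i j (Om g) x * w1 i j x)) - w1 i j x * D1 (ext g) i j x =
    (k (J g) * w x * ddot i j (Om g) x + (k (J g) - kappa) * eq P x * ddot i j (Om g) x
      + kappa * eq P x * (ddot i j (Om g) x - ddot i j P x)) * w1 i j x - w1 i j x ^+ 2.
    rewrite /w1 /w; ring.
  rewrite E; have l0 : 0 <= l by apply: le_trans hl.
  have h1 : (k (J g) * w x * ddot i j (Om g) x) ^+ 2 <= (kM * `|w x| * 2) ^+ 2.
    by apply: sqr_leM3 => //; rewrite ger0_norm.
  have h2 : ((k (J g) - kappa) * eq P x * ddot i j (Om g) x) ^+ 2 <= (l * Me * 2) ^+ 2.
    by apply: sqr_leM3 => //; rewrite gtr0_norm.
  have h3 : (kappa * eq P x * (ddot i j (Om g) x - ddot i j P x)) ^+ 2 <= (kappa * Me * (2 * q)) ^+ 2.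
    by apply: sqr_leM3 => //; rewrite gtr0_norm.
  apply: (le_trans (young3 (w1 i j x) h1 h2 h3)); rewrite lerD2r !exprMn real_normK ?num_real//.
  by rewrite le_eqVlt; apply/orP; left; apply/eqP; field.
have E2 : tau (J g) * k (J g) * (2^-1 * \sum_i \sum_j I (fun x => g x * (ddot i j (Om g) x * w1 i j x))) -
    tau (J g) * (2^-1 * \sum_i \sum_j I (fun x => w1 i j x * D1 (ext g) i j x)) =
    tau (J g) * (2^-1 * \sum_i \sum_j (k (J g) * I (fun x => g x * (ddot i j (Om g) x * w1 i j x))
      - I (fun x => w1 i j x * D1 (ext g) i j x))).
  have -> : \sum_i \sum_j (k (J g) * I (fun x => g x * (ddot i j (Om g) x * w1 i j x))
      - I (fun x => w1 i j x * D1 (ext g) i j x)) =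
      k (J g) * \sum_i \sum_j I (fun x => g x * (ddot i j (Om g) x * w1 i j x)) -
      \sum_i \sum_j I (fun x => w1 i j x * D1 (ext g) i j x).
    rewrite mulr_sumr -sumrB; apply: eq_bigr => i _; rewrite mulr_sumr -sumrB.
    by apply: eq_bigr => j _.
  by ring.
rewrite E2.
have E3 : \sum_i \sum_j (k (J g) * I (fun x => g x * (ddot i j (Om g) x * w1 i j x))
      - I (fun x => w1 i j x * D1 (ext g) i j x)) <= 6 * n2 * B - dirichlet sigma w1.
  apply: (@le_trans _ _ (\sum_(i < n) \sum_(j < n) (6 * B - 2^-1 * I (fun x => w1 i j x ^+ 2)))).
    by apply: ler_sum => i _; apply: ler_sum => j _; exact: P1.
  under eq_bigr => i _ do rewrite sumrB sumr_const card_ord -mulr_sumr.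
  rewrite sumrB sumr_const card_ord -mulrnA -mulr_sumr /dirichlet.
  by rewrite -mulr_natr le_eqVlt; apply/orP; left; apply/eqP; ring.
have y0 : 0 <= y by apply: sint_ge0 => x _; exact: sqr_ge0.
have B0 : 0 <= 3 * n2 * B.
  apply: mulr_ge0; first exact: mulr_ge0.
  apply: addr_ge0; apply: mulr_ge0; rewrite ?sqr_ge0//.
  by apply: addr_ge0; rewrite ?sqr_ge0// mulr_ge0 ?sqr_ge0.
have D0 : 0 <= dirichlet sigma w1.
  rewrite /dirichlet mulr_ge0//; apply: sumr_ge0 => i _; apply: sumr_ge0 => j _.
  by apply: sint_ge0 => x _; exact: sqr_ge0.
rewrite -/w1 -/B; move: E3 B0 D0; move: (dirichlet _ _) (\sum_i _) => D s E3 B0 D0.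
have -> : 2 * (tau (J g) * (2^-1 * s)) = tau (J g) * s by field.
have h : tau (J g) * s <= tau (J g) * (2 * (3 * n2 * B) - D).
  by rewrite ler_pM2l//; apply: (le_trans E3); rewrite lerD2r; rewrite le_eqVlt; apply/orP; left; apply/eqP; ring.
apply: (le_trans h); rewrite mulrBr; apply: lerB; last by rewrite ler_wpM2r.
have := ler_wpM2r B0 t2; move: (3 * n2 * B) (tau _) => b t; lra.
Qed.

(** N is so large that tm N exceeds the coefficient of the squared distance by 1. The Nash
    inequality, multiplied by tm N, then trades the Dirichlet form for a decay at rate 1 and a
    multiple of the squared L^1 distance. *)
Lemma sq_rate_nash g (P : 'rV[R]_n) (kM l tm tM q X : R) (N : nat) :
  smooth_sphere g -> flux sigma g != 0 -> S P ->
  0 <= k (J g) <= kM -> `|k (J g) - kappa| <= l -> tm <= tau (J g) <= tM -> 0 < tm ->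
  norm1 (Om g - P) <= q -> (0 < N)%N -> 2 * tM * (3 * n2 * kM ^+ 2) + 1 <= tm * N%:R ->
  I (fun x => `|g x - eq P x|) <= X ->
  2 * I (fun x => (g x - eq P x) * Q g x) <= - I (fun x => (g x - eq P x) ^+ 2) +
  (tm * N%:R * (2 ^+ N / mass R n N) * X ^+ 2 +
   2 * tM * (3 * n2) * (Me ^+ 2 * (l ^+ 2 + kappa ^+ 2 * q ^+ 2))).
Proof.
move=> sg nz SP hk hl ht tm0 hq N0 hN hX; have := sq_rate sg nz SP hk hl ht hq.
(* The extension replaces g, with which it agrees on the sphere, because the Nash inequality asks
   for continuity in the ambient space. *)
pose w x := ext g x - eq P x; pose w1 i j x := D1 (ext g) i j x - kappa * eq P x * ddot i j P x.
pose w2 i j x := D2 g i j x - (kappa * (kappa * eq P x * ddot i j P x) * ddot i j P x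
  + kappa * eq P x * d2dot i j P x).
have bg := bdm_smooth sg; have be := bdm_equilibrium sigma rho kappa P.
have bd i j : bdm (fun x => kappa * eq P x * ddot i j P x).
  by apply: bdmM; [exact: bdmZ|exact: bdm_ddot].
have Ew x : S x -> g x - eq P x = w x by move=> Sx; rewrite /w ext_sphere.
have bw : bdm w by apply: (eq_bdm Ew); exact: bdmB.
have bw1 i j : bdm (w1 i j) by apply: bdmB => //; exact: bdm_D1.
have bw2 i j : bdm (w2 i j).
  apply: bdmB; first exact: bdm_D2.
  by apply: bdmD; apply: bdmM; try exact: bdmZ; [exact: bdm_ddot|exact: bdm_d2dot].
have rw i j : rd i j w (w1 i j).
  by apply: (eq_rd Ew (fun _ _ => erefl)); apply: rdB; [exact: rd_smooth|exact: rd_equilibrium].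
have rw1 i j : rd i j (w1 i j) (w2 i j).
  apply: rdB; [exact: rd_D1|apply: rdM; [apply: rdZ; exact: rd_equilibrium|exact: rd_ddot]].
have cw x : S x -> {for x, continuous w}.
  move=> Sx; apply: (@cvgB _ _ _ (nbhs x)); first exact: smooth_continuous.
  rewrite (_ : eq P = fun x => rho / zon sigma 0 kappa P * expR (kappa * dot x P)); last first.
    by apply/funext => z; exact: equilibriumE.
  apply: (@cvgM _ _ (nbhs x)); first exact: cvg_cst.
  apply: (@continuous_comp _ _ _ (fun x : 'rV[R]_n => kappa * dot x P) expR); last exact: continuous_expR.
  apply: (@cvgM _ _ (nbhs x)); first exact: cvg_cst.
  by apply: (@cvg_sumr _ _ (nbhs x)) => i _; apply: (@cvgM _ _ (nbhs x)); [exact: continuous_coord|exact: cvg_cst].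
have := nash hn hsigma rw rw1 bw bw1 bw2 N0 cw.
have -> : I (fun x => w x ^+ 2) = I (fun x => (g x - eq P x) ^+ 2) by apply: eq_sint => x Sx; rewrite Ew.
have -> : I (fun x => `|w x|) = I (fun x => `|g x - eq P x|) by apply: eq_sint => x Sx; rewrite Ew.
have mass0 : 0 <= 2 ^+ N / mass R n N by rewrite divr_ge0 ?exprn_ge0// ltW// mass_gt0.
have X2 : I (fun x => `|g x - eq P x|) ^+ 2 <= X ^+ 2.
  by apply: sqr_le; rewrite ger0_norm//; exact: sint_ge0.
have y0 : 0 <= I (fun x => (g x - eq P x) ^+ 2) by apply: sint_ge0 => x _; exact: sqr_ge0.
rewrite -/w1; move: (I _ ^+ 2) X2 y0 => z X2; move: (I (fun x => (g x - _) ^+ 2)) => y y0.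
have Nr : 0 < N%:R :> R by rewrite ltr0n.
move=> h; have {}h : tm * N%:R * y <= tm * N%:R * (2 ^+ N / mass R n N) * X ^+ 2 + tm * dirichlet sigma w1.
  have h' : y <= 2 ^+ N / mass R n N * X ^+ 2 + dirichlet sigma w1 / N%:R.
    by apply: (le_trans h); rewrite lerD2r ler_wpM2l.
  apply: (le_trans (ler_wpM2l (ltW (mulr_gt0 tm0 Nr)) h')); rewrite le_eqVlt; apply/orP; left; apply/eqP.
  move: Nr (2 ^+ N / mass R n N) (dirichlet sigma w1); move: (N%:R : R) => NN Nr c D; field; by rewrite gt_eqF.
move: h; have := ler_wpM2r y0 hN.
move: (dirichlet _ _) (2 * I _) => D r; move: (tm * N%:R * (2 ^+ N / mass R n N) * X ^+ 2) => c.
move: (tm * N%:R) => m h1 h2 h3.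
apply: (le_trans h3); move: h1 h2; rewrite mulrDl mul1r.
move: (Me ^+ 2 * _) => b; rewrite !mulrDr !mulrA.
move: (2 * tM * 3 * n2 * kM * kM * y) (2 * tM * 3 * n2 * b) (m * y) => a1 b1 c1; lra.
Qed.

End QuadraticRate.

Lemma sqrD1_le (R : realType) (a : R) : (1 + a) ^+ 2 <= 2 * (1 + a ^+ 2).
Proof. by have := sqr_ge0 (1 - a); rewrite !expr2 => h; lra. Qed.

Lemma remainder_le (R : realType) (l q a d w : R) :
  (l * d) ^+ 2 + q ^+ 2 * (a * d * w) ^+ 2 <= (l ^+ 2 + q ^+ 2 * a ^+ 2) * (d ^+ 2 * (1 + w ^+ 2)).
Proof. by have := sqr_ge0 (l * d * w); have := sqr_ge0 (q * a * d); rewrite !expr2; lra. Qed.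

Section Relaxation.
Variables (R : realType) (n : nat) (sigma : probability (borel R n) R).
Hypotheses (hn : (2 <= n)%N) (hsigma : is_uniform sigma).
Variables (nu tau : R -> R).
Hypothesis hcoef : coefficients nu tau.
Variables (kappa rho : R).
Hypotheses (kappa0 : 0 < kappa) (rho0 : 0 < rho).
Variables (s : R) (mu0 : {measure set (borel R n) -> \bar R})
  (f0 : 'rV[R]_n -> R) (f : R -> 'rV[R]_n -> R).
Hypotheses (hd : has_density sigma mu0 f0) (mrho : mu0 (sphere R n) = rho%:E)
  (sol : is_solution sigma nu tau s mu0 f).

Local Notation S := (sphere R n).
Local Notation I := (sint sigma).
Local Notation bI := (intg_bdm hsigma).
Local Notation intg := (intg sigma).
Local Notation k := (rate nu tau).
Local Notation J g := (enorm (flux sigma g)).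
Local Notation Om g := (direction sigma g).
Local Notation Q := (Qop sigma nu tau).
Local Notation eq := (equilibrium sigma rho kappa).
Local Notation n2 := ((n * n)%:R : R).
Local Notation Me := (rho * expR kappa).

(** Convergence of the pairing with an equilibrium. The exponential is replaced by a Taylor
    polynomial, with an error uniform in time because the mass is rho, and the moments converge. *)
Lemma sol_exp_moment (P : 'rV[R]_n) : S P ->
  I (fun x => expR (kappa * dot x P) * f t x) @[t --> 0^'+] --> I (fun x => expR (kappa * dot x P) * f0 x).
Proof.
move=> SP.
have T N g : intg g -> I (fun x => expT N (kappa * dot x P) * g x) =
    \sum_(d < N) kappa ^+ d / d`!%:R * I (fun y => dot P y ^+ d * g y).
  move=> ig; have ig' (d : 'I_N) : intg (fun y => dot P y ^+ d * g y).
    apply: (eq_intg _ (intgM ig (bdmX d (bdm_dot P)))) => x _; by rewrite mulrC dotC.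
  rewrite (@eq_sint _ _ _ _ (fun x => \sum_(d < N) kappa ^+ d / d`!%:R * (dot P x ^+ d * g x))).
    rewrite (sint_sum hsigma) => [|d _]; last exact: intgZ.
    by apply: eq_bigr => d _; rewrite sintZ.
  by move=> x _; rewrite /expT mulr_suml; apply: eq_bigr => d _; rewrite exprMn dotC; ring.
have near_exp N g : intg g -> (forall x, S x -> 0 <= g x) -> I g = rho ->
    `|I (fun x => expR (kappa * dot x P) * g x) - I (fun x => expT N (kappa * dot x P) * g x)|
      <= expR kappa * (kappa ^+ N / N`!%:R) * rho.
  move=> ig g0 Ig.
  have be : bdm (fun x => expR (kappa * dot x P)) by exact: bdm_expdot.
  have bt : bdm (fun x => expT N (kappa * dot x P)).
    by apply: bdm_sum => d _; apply: bdmM; [apply/bdmX/bdmZ/bdm_dot|exact: bdm_cst].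
  have i1 : intg (fun x => expR (kappa * dot x P) * g x).
    by apply: (eq_intg _ (intgM ig be)) => x _; rewrite mulrC.
  have i2 : intg (fun x => expT N (kappa * dot x P) * g x).
    by apply: (eq_intg _ (intgM ig bt)) => x _; rewrite mulrC.
  rewrite -sintB// -[X in _ <= _ * X]Ig -sintZ//.
  have i3 := intgB i1 i2; apply: (le_trans (norm_sint i3)); apply: le_sint.
  - exact: intg_norm.
  - exact: intgZ.
  move=> x Sx; rewrite -mulrBl normrM (ger0_norm (g0 x Sx)) ler_wpM2r ?g0//.
  have zk : `|kappa * dot x P| <= kappa by have := norm_kdot kappa SP Sx; rewrite (gtr0_norm kappa0).
  apply: (le_trans (expT_remainder N zk)); rewrite ler_pM2l ?expR_gt0//.
  rewrite ler_wpM2r ?invr_ge0//; case: N {T bt i2 i3} => [|N]; first by rewrite !expr0.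
  by rewrite ler_pXn2r// nnegrE// ltW.
apply/cvgrPdist_le => e e0.
have [N hN] : exists N, expR kappa * (kappa ^+ N / N`!%:R) * rho <= e / 3.
  have h : expR kappa * (kappa ^+ N / N`!%:R) * rho @[N --> \oo] --> (0 : R).
    rewrite -[X in _ --> X](_ : expR kappa * 0 * rho = 0); last by rewrite mulr0 mul0r.
    by apply: cvgM; [apply: cvgM; [exact: cvg_cst|exact: expT_cvg]|exact: cvg_cst].
  have [M _ hM] := cvgr_le _ h (e / 3) (divr_gt0 e0 (ltr0n _ 3)).
  by exists M; apply: hM => /=.
have hT : \sum_(d < N) kappa ^+ d / d`!%:R * I (fun y => dot P y ^+ d * f t y) @[t --> 0^'+] -->
    \sum_(d < N) kappa ^+ d / d`!%:R * I (fun y => dot P y ^+ d * f0 y).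
  apply: (@cvg_sumr _ _ (0^'+)) => d _; apply: cvgM; first exact: cvg_cst.
  exact: (sol_moment hn hsigma hd mrho sol).
move/cvgrPdist_le : hT => /(_ (e / 3) (divr_gt0 e0 (ltr0n _ 3))) hT.
have if0 := init_intg hd mrho.
near=> t; have t0 : 0 < t by near: t; exact: nbhs_right_gt.
have ift := bI (sol_bdm sol t0).
have h1 := near_exp N _ if0 (init_ge0 hd) (init_mass hd mrho).
have h2 := near_exp N _ ift (fun x Sx => ltW (sol_pos sol t0 Sx)) (sol_mass hn hsigma hd mrho sol t0).
have h3 : `|\sum_(d < N) kappa ^+ d / d`!%:R * I (fun y => dot P y ^+ d * f0 y) -
    \sum_(d < N) kappa ^+ d / d`!%:R * I (fun y => dot P y ^+ d * f t y)| <= e / 3 by near: t.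
rewrite -!T// in h3; move: h1 h2 h3 hN.
move: (I _) (I _) (I _) (I _) (_ * rho) => a b c d q.
rewrite !ler_norml => /andP[? ?] /andP[? ?] /andP[? ?] ?; apply/andP; split; lra.
Unshelve. all: by end_near. Qed.

Lemma sq_derive (P : 'rV[R]_n) (t : R) : 0 < t ->
  is_derive t (1 : R) (fun u => I (fun x => (f u x - eq P x) ^+ 2))
    (2 * I (fun x => (f t x - eq P x) * Q (f t) x)).
Proof.
move=> t0; have be := bdm_equilibrium sigma rho kappa P; have bQ := sol_bdmQ hn sol t0.
have bf := sol_bdm sol t0.
have bwQ : bdm (fun x => (f t x - eq P x) * Q (f t) x) by apply: bdmM => //; exact: bdmB.
have := @uder_sint _ _ _ hsigma (fun u x => (f u x - eq P x) ^+ 2) t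
  (fun x => 2 * ((f t x - eq P x) * Q (f t) x)); rewrite sintZ; last exact: bI.
apply.
- near=> u; have u0 : 0 < u by near: u; exact: near_pos.
  by have bu := sol_bdm sol u0; exact: (bdmX 2 (bdmB bu be)).
- exact: bdmZ.
have [_ [M0 hM0]] : bdm (fun x => f t x - eq P x) by exact: bdmB.
have [M Mp hM] := uder_bound bQ (sol_uder sol t0).
move=> e e0; have m1 : 0 < 2 * (`|M0| + 1) by rewrite mulr_gt0// ltr_wpDl.
have e2 : 0 < e / 2 / (2 * (`|M0| + 1)) by rewrite !divr_gt0.
have uF := sol_uder sol t0 e2.
have hs : \forall h \near (0 : R), `|h| < e / 2 / M ^+ 2.
  by apply: nbhs0_lt; rewrite !divr_gt0// exprn_gt0.
near=> h => x Sx.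
have h1 : `|f (t + h) x - f t x| <= M * `|h| by apply: (near hM h).
have h2 : `|f (t + h) x - f t x - h * Q (f t) x| <= e / 2 / (2 * (`|M0| + 1)) * `|h| by apply: (near uF h).
have h3 : `|h| < e / 2 / M ^+ 2 by near: h.
have h4 : `|2 * (f t x - eq P x)| <= 2 * (`|M0| + 1).
  rewrite normrM (ger0_norm (ler0n _ 2)) ler_pM2l// (le_trans (hM0 x Sx))// (le_trans (ler_norm _))//.
  by rewrite lerDl.
have -> : (f (t + h) x - eq P x) ^+ 2 - (f t x - eq P x) ^+ 2 - h * (2 * ((f t x - eq P x) * Q (f t) x)) =
  2 * (f t x - eq P x) * (f (t + h) x - f t x - h * Q (f t) x) + (f (t + h) x - f t x) ^+ 2 by ring.
apply: (le_trans (ler_normD _ _)); rewrite (_ : e * `|h| = e / 2 * `|h| + e / 2 * `|h|); last by field.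
apply: lerD.
  rewrite normrM (le_trans (ler_pM _ _ h4 h2))// mulrA mulrCA divff ?mulr1//.
rewrite normrX (le_trans (_ : _ <= (M * `|h|) ^+ 2))//; first by rewrite ler_pXn2r// nnegrE mulr_ge0// ltW.
rewrite exprMn expr2 mulrA -mulrA mulrCA [leRHS]mulrC ler_wpM2l//.
by move: h3; rewrite ltr_pdivlMr ?exprn_gt0// => /ltW; rewrite mulrC expr2.
Unshelve. all: by end_near. Qed.

Variables (kM L tm tM R0 A2 d : R) (N : nat).
Hypotheses (L0 : 0 <= L) (A20 : 0 <= A2) (R00 : 0 <= R0) (d0 : 0 <= d) (tm0 : 0 < tm).
Hypotheses (N0 : (0 < N)%N) (hN : 2 * tM * (3 * n2 * kM ^+ 2) + 1 <= tm * N%:R).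
Hypothesis near_eq : forall t : R, 0 < t -> [/\ flux sigma (f t) != 0,
  I (fun x => `|f t x - eq (Om (f t)) x|) <= A2 * d,
  0 <= k (J (f t)) <= kM, `|k (J (f t)) - kappa| <= L * d & tm <= tau (J (f t)) <= tM /\ 1 <= R0 * J (f t)].
Hypotheses (nz0 : flux sigma f0 != 0) (sq0 : intg (fun x => f0 x ^+ 2))
  (hsq0 : I (fun x => (f0 x - eq (Om f0) x) ^+ 2) <= d ^+ 2).

(** This and the next constants do not involve [d]: every bound of [near_eq] is linear in [d], hence
    the speeds are proportional to [d] and the forcing to its square. *)
Definition flux_speed : R := tM * (kM * (2 * n2 * A2) + L * (2 * n2 * rho) + n%:R * A2).
Definition direction_speed : R := (1 + n%:R) * (n%:R * flux_speed) * R0.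
Definition l1_speed : R := A2 + kappa * Me * direction_speed.
Definition forcing : R := tm * N%:R * (2 ^+ N / mass R n N) * (2 * l1_speed ^+ 2)
  + 2 * tM * (3 * n2) * (Me ^+ 2 * (L ^+ 2 + kappa ^+ 2 * direction_speed ^+ 2)).

Lemma near_pos_coef (t : R) : 0 < t -> 0 <= k (J (f t)) <= kM /\ 0 <= tau (J (f t)) <= tM.
Proof.
move=> t0; have [_ _ h1 _ [/andP[h2 h3] _]] := near_eq t0; split=> //.
by rewrite h3 (le_trans (ltW tm0) h2).
Qed.

Lemma kM_ge0 : 0 <= kM. Proof. by have [/andP[h1 h2] _] := near_pos_coef ltr01; exact: le_trans h2. Qed.
Lemma tM_ge0 : 0 <= tM. Proof. by have [_ /andP[h1 h2]] := near_pos_coef ltr01; exact: le_trans h2. Qed.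
Lemma flux_speed_ge0 : 0 <= flux_speed. Proof. by rewrite /flux_speed mulr_ge0 ?tM_ge0// !addr_ge0 ?mulr_ge0 ?kM_ge0// ltW. Qed.
Lemma direction_speed_ge0 : 0 <= direction_speed. Proof. by rewrite /direction_speed mulr_ge0// mulr_ge0 ?addr_ge0// mulr_ge0// flux_speed_ge0. Qed.
Lemma Me_gt0 : 0 < Me. Proof. by rewrite mulr_gt0// expR_gt0. Qed.
Lemma forcing_ge0 : 0 <= forcing.
Proof.
have m0 : 0 <= 2 ^+ N / mass R n N by rewrite divr_ge0 ?exprn_ge0// ltW// mass_gt0.
apply: addr_ge0; rewrite mulr_ge0//.
- by rewrite mulr_ge0// mulr_ge0// ltW.
- by rewrite mulr_ge0// sqr_ge0.
- by rewrite mulr_ge0 ?tM_ge0// mulr_ge0 ?tM_ge0// .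
- by rewrite mulr_ge0 ?sqr_ge0// addr_ge0 ?sqr_ge0// mulr_ge0 ?sqr_ge0.
Qed.

Lemma sol_flux_rate (t : R) (i : 'I_n) : 0 < t -> `|I (fun x => x 0 i * Q (f t) x)| <= flux_speed * d.
Proof.
move=> t0; have [h1 h2 h3 h4 _] := near_eq t0; have [_ h5] := near_pos_coef t0.
have := @flux_rate_le _ _ _ hn hsigma _ _ hcoef kappa _ rho0 _ _ A2 L kM tM d (sol_smooth sol t0) h1 (pole_sphere R i) h2 h3 h4 h5.
by rewrite (_ : I _ = I (fun x => x 0 i * Q (f t) x))//; apply: eq_sint => x _; rewrite dotC dot_pole.
Qed.

Lemma sol_flux_lip (t T : R) (i : 'I_n) : 0 < t -> t <= T ->
  `|flux sigma (f T) 0 i - flux sigma (f t) 0 i| <= flux_speed * d * (T - t).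
Proof.
move=> t0 tT; have dJ (u : R) : 0 < u -> is_derive u (1 : R) (fun u => flux sigma (f u) 0 i)
   (I (fun x => x 0 i * Q (f u) x)) by exact: (hd_flux hn hsigma sol).
have h1 : flux sigma (f T) 0 i - flux_speed * d * T <= flux sigma (f t) 0 i - flux_speed * d * t.
  apply: (nonincreasing_pos (y := fun u => flux sigma (f u) 0 i - flux_speed * d * u)
   (fun u u0 => hdB (dJ u u0) (hdZ (flux_speed * d) (hd_id u)))) => // u u0.
  by rewrite mulr1 subr_le0 (le_trans (ler_norm _))// sol_flux_rate.
have h2 : - flux sigma (f T) 0 i - flux_speed * d * T <= - flux sigma (f t) 0 i - flux_speed * d * t.
  apply: (nonincreasing_pos (y := fun u => - flux sigma (f u) 0 i - flux_speed * d * u)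
   (fun u u0 => hdB (hdN (dJ u u0)) (hdZ (flux_speed * d) (hd_id u)))) => // u u0.
  by rewrite mulr1 subr_le0 (le_trans (ler_norm _))// normrN sol_flux_rate.
rewrite ler_norml mulrBr; apply/andP; split; lra.
Qed.

Lemma sol_direction_lip (t T : R) : 0 < t -> t <= T -> norm1 (Om (f t) - Om (f T)) <= direction_speed * d * (T - t).
Proof.
move=> t0 tT; have T0 := lt_le_trans t0 tT.
have [n1 _ _ _ [_ r1]] := near_eq t0; have [n2 _ _ _ _] := near_eq T0.
have := @direction_lip _ _ _ hn (f t) (f T) R0 (flux_speed * d * (T - t)) n1 n2 r1.
rewrite (_ : (1 + n%:R) * _ * R0 = direction_speed * d * (T - t)); last by rewrite /direction_speed; ring.
by apply=> i; rewrite distrC; exact: sol_flux_lip.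
Qed.

Lemma init_direction_lip (T : R) : 0 < T -> norm1 (Om (f T) - Om f0) <= direction_speed * d * T.
Proof.
move=> T0; have [n1 _ _ _ [_ r1]] := near_eq T0.
have := @direction_lip _ _ _ hn (f T) f0 R0 (flux_speed * d * T) n1 nz0 r1.
rewrite (_ : (1 + n%:R) * _ * R0 = direction_speed * d * T); last by rewrite /direction_speed; ring.
apply=> i.
have h : `|flux sigma (f T) 0 i - flux sigma (f t) 0 i| @[t --> 0^'+] --> `|flux sigma (f T) 0 i - flux sigma f0 0 i|.
  apply: (@cvg_norm _ _ _ (0^'+)); apply: cvgB; first exact: cvg_cst.
  have := sol_flux_cvg0 hn hsigma hd mrho sol; exact: continuous_cvg (@continuous_coord _ _ i _).
apply: (cvgr_to_le h); near=> t.
have t0 : 0 < t by near: t; exact: nbhs_right_gt.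
have tT : t <= T by apply: ltW; near: t; exact: nbhs_right_lt.
apply: (le_trans (sol_flux_lip i t0 tT)); apply: ler_wpM2l; first exact: mulr_ge0 flux_speed_ge0 d0.
by rewrite lerBlDr lerDl ltW.
Unshelve. all: by end_near. Qed.

Lemma sol_sq_rate (t T : R) : 0 < t -> t <= T ->
  2 * I (fun x => (f t x - eq (Om (f T)) x) * Q (f t) x) <=
  - I (fun x => (f t x - eq (Om (f T)) x) ^+ 2) + forcing * d ^+ 2 * (1 + (T - t) ^+ 2).
Proof.
move=> t0 tT; have T0 := lt_le_trans t0 tT; pose w := T - t; have w0 : 0 <= w by rewrite subr_ge0.
have [n1 ha hk hl [ht _]] := near_eq t0; have [nT _ _ _ _] := near_eq T0.
have SO := direction_sphere n1; have SP := direction_sphere nT.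
have hq := sol_direction_lip t0 tT; rewrite -/w in hq.
have bf := sol_bdm sol t0; have be P := bdm_equilibrium sigma rho kappa P.
have hX : I (fun x => `|f t x - eq (Om (f T)) x|) <= l1_speed * d * (1 + w).
  apply: (@le_trans _ _ (A2 * d + kappa * Me * (direction_speed * d * w))); last first.
    have : 0 <= A2 * d * w by rewrite !mulr_ge0.
    have : 0 <= kappa * Me * direction_speed * d by rewrite mulr_ge0// mulr_ge0 ?direction_speed_ge0// mulr_ge0 ?(ltW Me_gt0)// ltW.
    rewrite (_ : kappa * Me * (direction_speed * d * w) = kappa * Me * direction_speed * d * w); last by ring.
    rewrite /l1_speed; move: (kappa * Me * direction_speed) => z; lra.
  have b1 : bdm (fun x => `|f t x - eq (Om (f t)) x|) by exact/bdm_norm/bdmB.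
  rewrite -[kappa * Me * _](sint_cst hsigma).
  apply: (le_trans _ (lerD ha (lexx _))); rewrite -sintD; [|exact: bI|exact/bI/bdm_cst].
  apply: le_sint; [exact/bI/bdm_norm/bdmB|apply/bI/bdmD => //; exact: bdm_cst|].
  move=> x Sx; apply: (le_trans (ler_distD (eq (Om (f t)) x) _ _)); rewrite lerD2l.
  apply: (le_trans (equilibrium_lip hn hsigma kappa0 rho0 SO SP Sx)).
  by rewrite ler_pM2l// mulr_gt0 ?Me_gt0.
have := sq_rate_nash hn hsigma hcoef kappa0 rho0 (sol_smooth sol t0) n1 SP hk hl ht tm0 hq N0 hN hX.
move=> h; apply: (le_trans h); rewrite lerD2l /forcing.
have m0 : 0 <= tm * N%:R * (2 ^+ N / mass R n N).
  by rewrite mulr_ge0 ?divr_ge0 ?exprn_ge0 ?(ltW (mass_gt0 _ _ _))// mulr_ge0// ltW.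
have b0 : 0 <= 2 * tM * (3 * n2) * Me ^+ 2 by rewrite mulr_ge0 ?sqr_ge0// mulr_ge0 ?mulr_ge0 ?tM_ge0.
rewrite -!/w [leRHS](_ : _ = tm * N%:R * (2 ^+ N / mass R n N) * (2 * l1_speed ^+ 2 * d ^+ 2 * (1 + w ^+ 2)) +
  2 * tM * (3 * n2) * Me ^+ 2 * ((L ^+ 2 + kappa ^+ 2 * direction_speed ^+ 2) * (d ^+ 2 * (1 + w ^+ 2)))); last by ring.
rewrite [X in _ + X <= _]mulrA; apply: lerD; apply: ler_wpM2l => //.
  rewrite (_ : (l1_speed * d * (1 + w)) ^+ 2 = l1_speed ^+ 2 * d ^+ 2 * (1 + w) ^+ 2); last by ring.
  rewrite (_ : 2 * l1_speed ^+ 2 * d ^+ 2 * _ = l1_speed ^+ 2 * d ^+ 2 * (2 * (1 + w ^+ 2))); last by ring.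
  apply: ler_wpM2l; first exact: mulr_ge0 (sqr_ge0 _) (sqr_ge0 _).
  exact: sqrD1_le.
exact: remainder_le.
Qed.

Lemma expT2 (T : R) : 0 <= T -> expR (- T) * T ^+ 2 <= 2.
Proof.
move=> T0; have h := expT_le 3 T0; rewrite expRN mulrC ler_pdivrMr ?expR_gt0//.
move: h; rewrite /expT !big_ord_recr big_ord0 /= add0r expr0 expr1.
have -> : 2`! = 2%N by []. rewrite !fact0 !divr1; move: (expR T) => E; lra.
Qed.

(* The equilibrium is frozen at the final time T: its distance to the one at
   time t grows linearly in T - t, which the decay e^(t - T) absorbs. *)
Lemma sol_relaxation (T : R) : 0 < T ->
  I (fun x => (f T x - eq (Om (f T)) x) ^+ 2) <= (3 * forcing + 2 + 4 * (kappa * Me * direction_speed) ^+ 2) * d ^+ 2.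
Proof.
move=> T0; have [nT _ _ _ _] := near_eq T0; have SP := direction_sphere nT.
pose e := eq (Om (f T)); pose y t := I (fun x => (f t x - e x) ^+ 2).
(* A solution of B' + B = forcing d^2 (1 + (T - t)^2), so that e^t (y - B) is nonincreasing; its
   value at T is 3 forcing d^2. *)
pose B t := forcing * d ^+ 2 * ((T - t) ^+ 2 + 2 * (T - t) + 3).
have be : bdm e := bdm_equilibrium sigma rho kappa (Om (f T)).
have be2 : bdm (fun x => e x ^+ 2) by exact: bdmX.
have if0 := init_intg hd mrho.
have ief0 : intg (fun x => e x * f0 x) by apply: (eq_intg _ (intgM if0 be)) => x _; rewrite mulrC.
have Bd (t : R) : is_derive t (1 : R) B (forcing * d ^+ 2 * (- 2 * (T - t) - 2)).
  have h1 := hdB (hd_cst T t) (hd_id t).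
  apply: is_derive_eq (hdZ (forcing * d ^+ 2) (hdD (hdD (hdM h1 h1) (hdZ 2 h1)) (hd_cst 3 t))) _.
  by ring.
have yd (t : R) : 0 < t -> is_derive t (1 : R) (fun t => y t - B t)
    (2 * I (fun x => (f t x - e x) * Q (f t) x) - forcing * d ^+ 2 * (- 2 * (T - t) - 2)).
  by move=> t0; exact: hdB (sq_derive _ t0) (Bd t).
have mono (a : R) : 0 < a -> a <= T -> y T - B T <= expR (- (T - a)) * (y a - B a).
  move=> a0 aT; pose z t := (y t - B t) * expR t.
  suff : z T <= z a.
    rewrite /z opprB expRD -mulrA [X in _ -> _ <= X]mulrC -mulrA => h.
    rewrite mulrC in h; rewrite -(ler_pM2l (expR_gt0 T)); apply: (le_trans h).
    rewrite le_eqVlt; apply/orP; left; apply/eqP; rewrite mulrCA mulrA [in RHS]mulrC.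
    by rewrite !mulrA; have := expRxMexpNx_1 T; move: (expR _) (expR _) (expR _) => u v w uv; rewrite -[LHS]mul1r -uv; ring.
  apply: (hd_nincr (df := fun t => (2 * I (fun x => (f t x - e x) * Q (f t) x) -
    forcing * d ^+ 2 * (- 2 * (T - t) - 2)) * expR t + (y t - B t) * (expR t * 1))) => //.
  - by move=> t /andP[ax _]; apply: hdM (yd t (lt_trans a0 ax)) (hd_exp (hd_id t)).
  - move=> t /andP[ax tT]; rewrite mulr1 -mulrDl pmulr_lle0 ?expR_gt0//.
    have := sol_sq_rate (lt_trans a0 ax) (ltW tT); rewrite -/e -/(y t) /B.
    by move: (y t) (2 * I _) => u v; lra.
  - apply: derivable_within_continuous => t; rewrite in_itv/= => /andP[at_ _].
    by case: (hdM (yd t (lt_le_trans a0 at_)) (hd_exp (hd_id t))).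
have [C hC] := sol_sq_le hn hsigma hcoef rho0 hd mrho sol.
have B0 t : 0 <= t -> t <= T -> 0 <= B t.
  by move=> t0 tT; rewrite mulr_ge0 ?mulr_ge0 ?forcing_ge0 ?sqr_ge0// !addr_ge0 ?sqr_ge0 ?mulr_ge0 ?subr_ge0.
(* A majorant of y at small times with a known limit: the square of f is bounded through [sol_sq_le]
   and the cross term converges as an exponential moment, L^2 continuity at 0 not being
   available. *)
pose U a := expR (- (T - a)) * (expR (C * a) * I (fun x => f0 x ^+ 2) - 2 * I (fun x => e x * f a x) + I (fun x => e x ^+ 2)).
have yU (a : R) : 0 < a -> a <= T -> y T - B T <= U a.
  move=> a0 aT; apply: (le_trans (mono a a0 aT)); rewrite ler_pM2l ?expR_gt0//.
  apply: (@le_trans _ _ (y a)); first by rewrite gerBl B0// ltW.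
  have bf := sol_bdm sol a0.
  have -> : y a = I (fun x => f a x ^+ 2) - 2 * I (fun x => e x * f a x) + I (fun x => e x ^+ 2).
    rewrite -sintZ; last exact/bI/bdmM.
    rewrite -sintB; [|exact/bI/bdmX|exact/bI/bdmZ/bdmM].
    rewrite -sintD; [|apply: bI; apply: bdmB; [exact: bdmX|exact/bdmZ/bdmM]|exact: bI].
    by apply: eq_sint => x _; ring.
  by rewrite lerD2r lerD2r hC.
have Ul : U a @[a --> 0^'+] --> expR (- T) * (I (fun x => f0 x ^+ 2) - 2 * I (fun x => e x * f0 x) + I (fun x => e x ^+ 2)).
  apply: cvgM.
    apply: cvg_at_right_filter; rewrite -[X in expR (- X)]subr0.
    exact: hd_continuous (hd_exp (hdN (hdB (hd_cst T 0) (hd_id 0)))).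
  apply: cvgD; last exact: cvg_cst.
  apply: cvgB.
    rewrite -[X in _ --> X]mul1r; apply: cvgM; last exact: cvg_cst.
    apply: cvg_at_right_filter; rewrite -expR0 -[X in expR X](mulr0 C).
    exact: hd_continuous (hd_exp (hdZ C (hd_id 0))).
  apply: cvgM; first exact: cvg_cst.
  have E g : intg g -> I (fun x => e x * g x) = rho / zon sigma 0 kappa (Om (f T)) * I (fun x => expR (kappa * dot x (Om (f T))) * g x).
    move=> ig; rewrite -sintZ; first by apply: eq_sint => x _; rewrite /e equilibriumE mulrA.
    by apply: (eq_intg _ (intgM ig (bdm_expdot kappa (Om (f T))))) => x _; rewrite mulrC.
  rewrite E//; apply: (@cvg_trans _ ((fun a => rho / zon sigma 0 kappa (Om (f T)) * I (fun x => expR (kappa * dot x (Om (f T))) * f a x)) @ 0^'+)).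
    apply: near_eq_cvg; near=> a; rewrite E//; apply: bI; apply: (sol_bdm sol); near: a; exact: nbhs_right_gt.
  by apply: cvgM; [exact: cvg_cst|exact: sol_exp_moment].
have hy : y T - B T <= expR (- T) * (I (fun x => f0 x ^+ 2) - 2 * I (fun x => e x * f0 x) + I (fun x => e x ^+ 2)).
  apply: (cvgr_to_ge Ul); near=> a; apply: yU; first by near: a; exact: nbhs_right_gt.
  by apply: ltW; near: a; exact: nbhs_right_lt.
have bd0 : bdm (eq (Om f0)) by exact: bdm_equilibrium.
pose q := kappa * Me * (direction_speed * d * T).
have i1 : intg (fun x => (f0 x - eq (Om f0) x) ^+ 2).
  apply: (eq_intg _ (intgD (intgB sq0 (intgZ 2 (intgM if0 bd0))) (bI (bdmX 2 bd0)))) => x _; ring.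
have h0 : I (fun x => f0 x ^+ 2) - 2 * I (fun x => e x * f0 x) + I (fun x => e x ^+ 2) <=
    2 * d ^+ 2 + 2 * q ^+ 2.
  rewrite -sintZ// -sintB//; last exact: intgZ.
  rewrite -sintD; [|apply: intgB => //; exact: intgZ|exact: bI].
  apply: (@le_trans _ _ (2 * I (fun x => (f0 x - eq (Om f0) x) ^+ 2) + 2 * q ^+ 2)); last first.
    by rewrite lerD2r ler_pM2l.
  rewrite -sintZ// -[2 * q ^+ 2](sint_cst hsigma) -sintD; [|exact: intgZ|exact/bI/bdm_cst].
  apply: le_sint.
  - apply: intgD; last exact: bI.
    by apply: intgB => //; exact: intgZ.
  - by apply: intgD; [exact: intgZ|exact/bI/bdm_cst].
  move=> x Sx; have : `|eq (Om f0) x - e x| <= q.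
    rewrite distrC; apply: (le_trans (equilibrium_lip hn hsigma kappa0 rho0 SP (direction_sphere nz0) Sx)).
    by rewrite ler_pM2l ?init_direction_lip// mulr_gt0 ?Me_gt0.
  move/sqr_le; have := sqr_ge0 (f0 x - eq (Om f0) x - (eq (Om f0) x - e x)).
  by move: (f0 x) (eq (Om f0) x) (e x) (q) => a b c g; rewrite !expr2; nra.
have eT : expR (- T) <= 1 by rewrite -expR0 ler_expR oppr_le0 ltW.
have h1 := ler_wpM2l (expR_ge0 (- T)) h0.
have h2 : B T = 3 * forcing * d ^+ 2 by rewrite /B subrr; ring.
have h3 : expR (- T) * (2 * d ^+ 2 + 2 * q ^+ 2) <= 2 * d ^+ 2 + 4 * (kappa * Me * direction_speed) ^+ 2 * d ^+ 2.
  rewrite mulrDr; apply: lerD; first by rewrite ler_piMl// mulr_ge0// sqr_ge0.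
  rewrite (_ : _ * _ = (expR (- T) * T ^+ 2) * (2 * (kappa * Me * direction_speed) ^+ 2 * d ^+ 2)); last first.
    by rewrite /q; ring.
  rewrite (_ : 4 * _ * _ = 2 * (2 * (kappa * Me * direction_speed) ^+ 2 * d ^+ 2)); last by ring.
  apply: ler_wpM2r (expT2 (ltW T0)).
  by apply: mulr_ge0 (sqr_ge0 _); apply: mulr_ge0 (sqr_ge0 _).
rewrite -/e -/(y T); move: hy h1 h2 h3; move: (B T) (y T) (expR (- T) * (2 * _ + _)) (expR (- T) * _) => b yy u v hy h1 h2 h3.
move: hy h1 h2 h3; move: (kappa * Me * direction_speed) => z; rewrite !mulrDl; move: (3 * forcing * d ^+ 2) (2 * d ^+ 2) (4 * z ^+ 2 * d ^+ 2) => a1 a2 a3; lra.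
Unshelve. all: by end_near. Qed.

End Relaxation.

(** * L2 norms and the stability of the family of equilibria *)

Section L2Norm.
Variables (R : realType) (n : nat) (sigma : probability (borel R n) R).
Hypotheses (hn : (2 <= n)%N) (hsigma : is_uniform sigma).
Local Notation S := (sphere R n).
Local Notation I := (sint sigma).
Local Notation intg := (intg sigma).

Lemma L2normE (h : 'rV[R]_n -> R) :
  L2norm sigma h = ((\int[sigma]_(x in S) (h x ^+ 2)%:E) `^ 2^-1)%E.
Proof.
rewrite /L2norm unlock; congr (_ `^ _)%E; rewrite [RHS]integral_mkcond.
apply: eq_integral => x _; rewrite /= patchE /restrict; case: ifPn => _.
  by congr (_%:E); rewrite powR_mulrn// real_normK// num_real.
by change ((`|0 : R| `^ 2)%:E = 0%:E); rewrite normr0 powR0// pnatr_eq0.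
Qed.

Lemma L2norm_intg (h : 'rV[R]_n -> R) : intg (fun x => h x ^+ 2) ->
  L2norm sigma h = (Num.sqrt (I (fun x => h x ^+ 2)))%:E.
Proof.
move=> ih; rewrite L2normE -powR12_sqrt; last by apply: sint_ge0 => x _; exact: sqr_ge0.
rewrite -poweR_EFin; congr (_ `^ _)%E; rewrite /sint /Rintegral fineK//.
by apply: integrable_fin_num ih; exact: measurable_sphere.
Qed.

Lemma L2norm_le (h : 'rV[R]_n -> R) (e : R) :
  measurable_fun (S : set (borel R n)) (h : borel R n -> R) -> 0 <= e -> (L2norm sigma h <= e%:E)%E ->
  intg (fun x => h x ^+ 2) /\ I (fun x => h x ^+ 2) <= e ^+ 2.
Proof.
move=> mh e0 he; have ih : intg (fun x => h x ^+ 2).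
  apply/integrableP; split; first by apply/measurable_EFinP; exact: measurable_funX.
  rewrite (eq_integral (fun x : borel R n => (h x ^+ 2)%:E)); last first.
    by move=> x _; rewrite /= ger0_norm// sqr_ge0.
  have /= := le_lt_trans he (ltry e); rewrite L2normE.
  case E : (\int[sigma]_(x in S) _)%E => [r| |] //=; rewrite ?ltry ?invr_eq0 ?pnatr_eq0//.
split=> //; move: he; rewrite L2norm_intg// lee_fin -[e in X in X -> _]ger0_norm// -sqrtr_sqr.
by rewrite ler_sqrt// sqr_ge0.
Qed.

Lemma L2norm_scale (g h : 'rV[R]_n -> R) (C : R) :
  intg (fun x => g x ^+ 2) -> intg (fun x => h x ^+ 2) -> 0 <= C ->
  I (fun x => g x ^+ 2) <= C ^+ 2 * I (fun x => h x ^+ 2) -> (L2norm sigma g <= C%:E * L2norm sigma h)%E.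
Proof.
move=> ig ih C0 le_gh; rewrite (L2norm_intg ig) (L2norm_intg ih) -EFinM lee_fin.
rewrite -[C](ger0_norm C0) -sqrtr_sqr -sqrtrM ?sqr_ge0// ler_sqrt//.
by rewrite mulr_ge0 ?sqr_ge0// sint_ge0// => x _; exact: sqr_ge0.
Qed.

End L2Norm.

Lemma sq_split_le (R : realType) (b c : R) : 0 <= b ->
  2 * c ^+ 2 + 2 * (b * c) ^+ 2 <= (2 * (1 + b) * c) ^+ 2.
Proof.
move=> b0; have : 0 <= b * c ^+ 2 by rewrite mulr_ge0 ?sqr_ge0.
by have := sqr_ge0 c; have := sqr_ge0 (b * c); rewrite !expr2; lra.
Qed.

Lemma le_sqrD1 (R : realType) (a : R) : 0 <= a -> a <= (a + 1) ^+ 2.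
Proof. by move=> a0; have := sqr_ge0 a; rewrite !expr2; lra. Qed.

Lemma half_lower (R : realType) (a b : R) : `|b - a| <= a / 2 -> a <= 2 * b.
Proof. by rewrite ler_norml => /andP[h _]; lra. Qed.

(* The condition [0 < d] excludes [d = sqrt Y] when [Y = 0]. *)
Lemma sq_bound_closure (R : realType) (y K Y D : R) : 0 < D -> D <= 1 -> 0 <= Y -> Y <= D ^+ 2 ->
  (forall d, 0 < d -> d <= D -> Y <= d ^+ 2 -> y <= K * d ^+ 2) -> y <= (1 + `|K|) ^+ 2 * Y.
Proof.
move=> D0 D1 Y0 YD h; have K1 : 0 < 1 + `|K| by rewrite ltr_wpDr.
have KK : K <= 1 + `|K| by rewrite (le_trans (ler_norm K))// lerDr.
have [Yp|] := ltP 0 Y; last first.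
  move=> Yn; have YE : Y = 0 by apply/eqP; rewrite eq_le Yn.
  rewrite YE mulr0; apply/ler_addgt0Pr => e e0; rewrite add0r.
  pose d := Num.min D (e / (1 + `|K|)).
  have d0 : 0 < d by rewrite lt_min D0 divr_gt0.
  have dD : d <= D by rewrite /d ge_min lexx.
  have de : (1 + `|K|) * d <= e by rewrite mulrC -ler_pdivlMr// /d ge_min lexx orbT.
  apply: (le_trans (h d d0 dD _)); first by rewrite YE sqr_ge0.
  apply: le_trans de; apply: (@le_trans _ _ ((1 + `|K|) * d ^+ 2)); first by rewrite ler_wpM2r ?sqr_ge0.
  by rewrite ler_pM2l// expr2 ler_piMl ?(ltW d0)// (le_trans dD).
have sY : Num.sqrt Y ^+ 2 = Y by rewrite sqr_sqrtr.
apply: (@le_trans _ _ (K * Y)).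
  rewrite -[in leRHS]sY; apply: h; rewrite ?sqrtr_gt0 ?sY//.
  by rewrite -[leRHS](ger0_norm (ltW D0)) -sqrtr_sqr ler_sqrt// sqr_ge0.
rewrite ler_wpM2r// (le_trans KK)// expr2 ler_peMl ?(ltW K1)// lerDl.
by [].
Qed.

Section Stability.
Variables (R : realType) (n : nat) (sigma : probability (borel R n) R).
Hypotheses (hn : (2 <= n)%N) (hsigma : is_uniform sigma).
Variables (nu tau j : R -> R).
Hypotheses (hcoef : coefficients nu tau) (hj : is_inverse_rate nu tau j).
Variables (kappa rho : R).
Hypotheses (kappa0 : 0 < kappa) (kappa1 : (kappa%:E < kappa_max nu tau)%E)
  (rhoE : rho = j kappa / order_parameter n kappa).

Local Notation S := (sphere R n).
Local Notation I := (sint sigma).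
Local Notation bI := (intg_bdm hsigma).
Local Notation intg := (intg sigma).
Local Notation k := (rate nu tau).
Local Notation J g := (enorm (flux sigma g)).
Local Notation Om g := (direction sigma g).
Local Notation eq := (equilibrium sigma rho kappa).
Local Notation Me := (rho * expR kappa).
Local Notation Fk := (Fk sigma nu tau rho kappa).
Local Notation fe := (fe sigma nu tau).
Local Notation relent := (relent sigma rho kappa).
Let rho0 : 0 < rho := rho_gt0 hn hsigma hcoef hj kappa0 kappa1 rhoE.
Let jk := jkappa hcoef hj kappa0 kappa1.

Lemma equilibrium_lower : exists2 m : R, 0 < m & forall P x, S P -> S x -> m <= eq P x.
Proof.
pose P0 : 'rV[R]_n := delta_mx 0 (Ordinal (ltnW hn)); have S0 : S P0 := pole_sphere R _.
exists (rho / zon sigma 0 kappa P0 * expR (- kappa)).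
  by rewrite mulr_gt0 ?expR_gt0// divr_gt0// zon0_gt0.
move=> P x SP Sx; rewrite equilibriumE (zon_indep hn hsigma 0 kappa S0 SP).
rewrite ler_pM2l ?divr_gt0 ?zon0_gt0//.
by have := expdot_ge kappa SP Sx; rewrite (gtr0_norm kappa0).
Qed.

Lemma flux_equilibrium_j (P : 'rV[R]_n) : S P -> flux sigma (eq P) = j kappa *: P.
Proof. by move=> SP; rewrite flux_equilibrium// (rho_c hn hsigma kappa0 rhoE). Qed.

Lemma enorm_flux_equilibrium (P : 'rV[R]_n) : S P -> J (eq P) = j kappa.
Proof.
by move=> SP; rewrite flux_equilibrium_j// enorm_scale// ltW// (proj1 jk).
Qed.

Lemma direction_equilibrium (P : 'rV[R]_n) : S P -> Om (eq P) = P.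
Proof.
move=> SP; rewrite /direction /Defs.proj enorm_flux_equilibrium// flux_equilibrium_j//.
by rewrite scalerA mulVf ?scale1r// gt_eqF ?(proj1 jk).
Qed.

(** Closeness to one equilibrium eq P puts the flux near j P and the direction near P; hence g is
    also close, up to a constant factor, to the equilibrium in its own direction, the one from which
    distances are measured afterwards. *)
Lemma initial_near (g : 'rV[R]_n -> R) (P : 'rV[R]_n) (e : R) : S P -> 0 < e -> n%:R * e <= j kappa / 2 ->
  intg g -> intg (fun x => (g x - eq P x) ^+ 2) -> I (fun x => (g x - eq P x) ^+ 2) <= e ^+ 2 ->
  [/\ flux sigma g != 0, `|J g - j kappa| <= n%:R * e &
    I (fun x => (g x - eq (Om g) x) ^+ 2) <=
      (2 * (1 + kappa * Me * ((1 + n%:R) * n%:R * (2 / j kappa))) * e) ^+ 2].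
Proof.
move=> SP e0 he ig i2 h2; have [j0 _] := jk; have be := bdm_equilibrium sigma rho kappa P.
have ih : intg (fun x => g x - eq P x) by apply: intgB => //; exact: bI.
have h1 : I (fun x => `|g x - eq P x|) <= e.
  (* a <= a^2 / (2 e) + e / 2 bounds the L^1 norm by e. *)
  apply: (@le_trans _ _ (I (fun x => (2 * e)^-1 * (g x - eq P x) ^+ 2 + e / 2))).
    apply: le_sint; [exact: intg_norm|by apply: intgD; [exact: intgZ|exact/bI/bdm_cst]|].
    move=> x _; have := sqr_ge0 (`|g x - eq P x| - e); rewrite -[(g x - eq P x) ^+ 2]real_normK ?num_real//.
    move: (`|_|) => a ha; rewrite -subr_ge0 (_ : _ - _ = (2 * e)^-1 * (a - e) ^+ 2).
      by rewrite mulr_ge0// invr_ge0 mulr_ge0// ltW.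
    by move: e0 => e0; field; rewrite gt_eqF.
  rewrite sintD; [|exact: intgZ|exact/bI/bdm_cst]; rewrite (sint_cst hsigma) sintZ//.
  apply: (@le_trans _ _ ((2 * e)^-1 * e ^+ 2 + e / 2)); first by rewrite lerD2r ler_pM2l ?invr_gt0 ?mulr_gt0.
  by rewrite le_eqVlt; apply/orP; left; apply/eqP; field; rewrite gt_eqF.
have hi i : `|flux sigma g 0 i - flux sigma (eq P) 0 i| <= e.
  rewrite !fluxE -sintB; [|exact: intg_coordM|exact/intg_coordM/bI].
  apply: le_trans h1; rewrite (@eq_sint _ _ _ _ (fun x => x 0 i * (g x - eq P x))); last by move=> x _; ring.
  have ii := intg_coordM i ih; apply: (le_trans (norm_sint ii)); apply: le_sint.
  - exact: intg_norm.
  - exact: intg_norm.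
  by move=> x Sx; rewrite normrM ler_piMl// coord_sphere.
have hJ : `|J g - j kappa| <= n%:R * e.
  rewrite -(enorm_flux_equilibrium SP); apply: (le_trans (enorm_dist _ _)).
  apply: (@le_trans _ _ (\sum_(i < n) e)).
    by apply: ler_sum => i _; rewrite mxE [X in _ + X]mxE; exact: hi.
  by rewrite sumr_const card_ord mulr_natl.
have Jg : j kappa / 2 <= J g by move: hJ; rewrite ler_norml => /andP[h _]; move: h he; move: (n%:R * e) (J g) => a b; lra.
have nz : flux sigma g != 0.
  apply/eqP => z; move: Jg; rewrite z (_ : enorm 0 = 0) ?leNgt ?divr_gt0//.
  by rewrite /enorm /dot big1 ?sqrtr0// => i _; rewrite mxE mul0r.
split=> //.
have nzE : flux sigma (eq P) != 0.
  by apply/eqP => z; move: j0; rewrite -(enorm_flux_equilibrium SP) z /enorm /dot big1 ?sqrtr0 ?ltxx// => i _; rewrite mxE mul0r.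
have hR : 1 <= 2 / j kappa * J g by rewrite mulrAC ler_pdivlMr// mul1r; move: Jg; move: (J g) => b; lra.
have hO := direction_lip hn nz nzE hR hi; rewrite direction_equilibrium// in hO.
pose B := kappa * Me * ((1 + n%:R) * n%:R * (2 / j kappa)).
have B0 : 0 <= B.
  apply: mulr_ge0; first by rewrite mulr_ge0 ?mulr_ge0 ?expR_ge0 ?ltW.
  by apply: mulr_ge0; [rewrite mulr_ge0// addr_ge0|rewrite divr_ge0// ltW].
have hB x : S x -> `|eq P x - eq (Om g) x| <= B * e.
  move=> Sx; rewrite distrC; apply: (le_trans (equilibrium_lip hn hsigma kappa0 rho0 (direction_sphere nz) SP Sx)).
  rewrite (_ : B * e = kappa * Me * ((1 + n%:R) * (n%:R * e) * (2 / j kappa))); last by rewrite /B; ring.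
  by rewrite ler_pM2l// mulr_gt0// mulr_gt0// expR_gt0.
apply: (@le_trans _ _ (2 * e ^+ 2 + 2 * (B * e) ^+ 2)); last first.
  exact: sq_split_le.
have bd0 : bdm (eq (Om g)) by exact: bdm_equilibrium.
have bdd : bdm (fun x => eq P x - eq (Om g) x) by exact: bdmB.
have i1 : intg (fun x => (g x - eq (Om g) x) ^+ 2).
  apply: (eq_intg _ (intgD (intgD i2 (intgZ 2 (intgM ih bdd))) (bI (bdmX 2 bdd)))) => x _; ring.
apply: (@le_trans _ _ (I (fun x => 2 * (g x - eq P x) ^+ 2 + 2 * (B * e) ^+ 2))).
  apply: le_sint => //; first by apply: intgD; [exact: intgZ|exact/bI/bdm_cst].
  move=> x Sx; have /sqr_le := hB x Sx; have := sqr_ge0 (g x - eq P x - (eq P x - eq (Om g) x)).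
  by move: (g x) (eq (Om g) x) (eq P x) (B * e) => a b c d; rewrite !expr2; lra.
rewrite sintD; [|exact: intgZ|exact/bI/bdm_cst]; rewrite (sint_cst hsigma) sintZ//.
by rewrite lerD2r ler_pM2l.
Qed.

(** With Y the initial squared distance, all bounds are proved for each [dd] in ]0, D2] with Y <=
    dd^2, with constants independent of [dd]. Then [sq_bound_closure] returns to Y itself. *)
Lemma stability (dq : R) : is_derive kappa (1 : R) (fun x => j x / order_parameter n x) dq -> 0 < dq ->
  exists delta C : R, 0 < delta /\ forall (s : R) (mu0 : {measure set (borel R n) -> \bar R})
    (f : R -> 'rV[R]_n -> R), has_density sigma mu0 (f 0) -> mu0 S = rho%:E ->
    is_solution sigma nu tau s mu0 f -> forall P, S P -> intg (fun x => (f 0 x - eq P x) ^+ 2) ->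
    I (fun x => (f 0 x - eq P x) ^+ 2) <= delta ^+ 2 -> forall t, 0 <= t ->
    [/\ flux sigma (f t) != 0, intg (ent (f t)), 0 <= fe (f t) - Fk (Om (f t)),
      intg (fun x => (f t x - eq (Om (f t)) x) ^+ 2) &
      I (fun x => (f t x - eq (Om (f t)) x) ^+ 2) <=
        C ^+ 2 * I (fun x => (f 0 x - eq (Om (f 0)) x) ^+ 2) /\ 0 <= C].
Proof.
move=> hq dq0; have [j0 kj] := jk.
have [d' [a [eta [d'0 a0 eta0 coer']]]] := coercivity hn hsigma hcoef hj kappa0 kappa1 rhoE hq dq0.
(* Within j / 2 of j the flux cannot vanish, so the direction is meaningful. *)
pose d := Num.min d' (j kappa / 2); have d0 : 0 < d by rewrite lt_min d'0 divr_gt0.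
have dj : d <= j kappa / 2 by rewrite /d ge_min lexx orbT.
have dd' : d <= d' by rewrite /d ge_min lexx.
have coer g ag nz (h : `|J g - j kappa| <= d) := coer' g ag nz (le_trans h dd').
have [Dr /(_ 1 ltr01)[d1 d10 hDr]] := rate_local hcoef (ltW j0).
have [nuM [tm [tm0 hnu htm]]] := coefficient_bounds hcoef (ltW rho0).
have [tM htM] : exists M, forall r, 0 <= r -> tau r <= M by case: hcoef => _ _ [_ h] _ _.
have [m m0 hm] := equilibrium_lower.
have nR : 0 < n%:R :> R by rewrite ltr0n ltnW.
pose D := Num.min d d1; have D0 : 0 < D by rewrite lt_min d0.
have Dd : D <= d by rewrite /D ge_min lexx.
have Dd1 : D <= d1 by rewrite /D ge_min lexx orbT.
have Dj := le_trans Dd dj.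
(* The relative entropy stays below dd^2 / (m eta), so (J - j)^2 <= z dd^2. [A5] = z + 1 dominates
   the square root of z, [L] transfers the bound to k(J), and [A2] is Pinsker's bound with parameter
   dd. *)
pose z := (a * (m * eta))^-1; have z0 : 0 < z by rewrite invr_gt0 !mulr_gt0.
pose A5 := z + 1; pose L := (`|Dr| + 1) * A5; pose A2 := (m * eta)^-1 + expR 1 * rho.
pose kM := nuM / tm; pose R0 := 2 / j kappa.
have [N [N0 hN]] : exists N, (0 < N)%N /\ 2 * tM * (3 * (n * n)%:R * kM ^+ 2) + 1 <= tm * N%:R.
  have := archi_boundP (normr_ge0 ((2 * tM * (3 * (n * n)%:R * kM ^+ 2) + 1) / tm)).
  set N := Num.bound _ => h; exists N.+1; split=> //.
  rewrite -ler_pdivrMl// mulrC (le_trans (ler_norm _))// (le_trans (ltW h))// ler_nat//.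
(* For dd <= D2 <= 1 one has dd^2 <= D2 < m eta a D^2: the initial excess, at most dd^2 / m, is too
   small to bring J to distance [D]. *)
pose D2 := Num.min 1 (m * (eta * (a * D ^+ 2)) / 2).
have D20 : 0 < D2 by rewrite lt_min ltr01/= divr_gt0// !mulr_gt0// exprn_gt0.
have D21 : D2 <= 1 by rewrite /D2 ge_min lexx.
have D2E : D2 < m * (eta * (a * D ^+ 2)).
  apply: (@le_lt_trans _ _ (m * (eta * (a * D ^+ 2)) / 2)); first by rewrite /D2 ge_min lexx orbT.
  by rewrite ltr_pdivrMr// ltr_pMr ?ltr1n// !mulr_gt0// exprn_gt0.
pose B := 2 * (1 + kappa * Me * ((1 + n%:R) * n%:R * (2 / j kappa))).
have B0 : 0 < B.
  rewrite mulr_gt0// ltr_wpDr// mulr_ge0//; first by rewrite mulr_ge0 ?mulr_ge0 ?expR_ge0 ?ltW.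
  by apply: mulr_ge0; [rewrite mulr_ge0// addr_ge0|rewrite divr_ge0// ltW].
(* The first bound makes Y at most D2^2 through [initial_near], the second puts the initial flux
   within D / 2 of j. *)
pose delta := Num.min (D2 / B) (D / (2 * n%:R)).
have delta0 : 0 < delta by rewrite lt_min !divr_gt0// mulr_gt0.
have deltaB : B * delta <= D2.
  by rewrite mulrC -ler_pdivlMr// /delta ge_min lexx.
have deltaD : n%:R * delta <= D / 2.
  rewrite -ler_pdivlMl//; apply: (@le_trans _ _ (D / (2 * n%:R))); first by rewrite /delta ge_min lexx orbT.
  by rewrite le_eqVlt; apply/orP; left; apply/eqP; field; rewrite gt_eqF.
pose K := 3 * forcing n kappa rho kM L tm tM R0 A2 N + 2 + 4 * (kappa * Me * direction_speed n rho kM L tM R0 A2) ^+ 2.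
exists delta, (1 + `|K|); split=> // s mu0 f hd mrho sol P SP i2 h2.
have C0 : 0 <= 1 + `|K| by rewrite addr_ge0.
have C1 : 1 <= (1 + `|K|) ^+ 2 by rewrite exprn_ege1// lerDl.
have if0 := init_intg hd mrho.
have D2D : D / 2 < D by rewrite ltr_pdivrMr// ltr_pMr ?ltr1n.
have [nz hJ hd0] := initial_near SP delta0 (le_trans deltaD (le_trans (ltW D2D) Dj)) if0 i2 h2.
have {}hJ : `|J (f 0) - j kappa| < D by apply: (le_lt_trans hJ); exact: (le_lt_trans deltaD).
have beP := bdm_equilibrium sigma rho kappa P; have be0 := bdm_equilibrium sigma rho kappa (Om (f 0)).
have sq0 : intg (fun x => f 0 x ^+ 2).
  apply: (eq_intg _ (intgB (intgD i2 (intgZ 2 (intgM if0 beP))) (bI (bdmX 2 beP)))) => x _; ring.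
have i0 : intg (fun x => (f 0 x - eq (Om (f 0)) x) ^+ 2).
  apply: (eq_intg _ (intgD (intgB sq0 (intgZ 2 (intgM if0 be0))) (bI (bdmX 2 be0)))) => x _; ring.
have ge00 := init_ge0 hd; have If0 := init_mass hd mrho.
have ie0 := intg_ent_sq hsigma if0 ge00 sq0.
have adm0 := Admissible if0 ge00 If0 ie0; have SO0 := direction_sphere nz.
pose Y := I (fun x => (f 0 x - eq (Om (f 0)) x) ^+ 2).
have Y0 : 0 <= Y by apply: sint_ge0 => x _; exact: sqr_ge0.
have YD2 : Y <= D2 ^+ 2.
  apply: (le_trans hd0); change ((B * delta) ^+ 2 <= D2 ^+ 2).
  by rewrite ler_pXn2r// nnegrE ltW// mulr_gt0.
have gap0 : fe (f 0) - Fk (Om (f 0)) <= m^-1 * Y.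
  apply: (le_trans (fe_upper hn hsigma hcoef hj kappa0 kappa1 rhoE adm0 nz)).
  by apply: (relent_le_sq hsigma rho0 if0 ge00 If0 ie0 SO0 m0) => // x Sx; exact: hm.
have near_t (dd : R) (dd0 : 0 < dd) (ddD : dd <= D2) (Ydd : Y <= dd ^+ 2) (t : R) (t0 : 0 < t) :
    [/\ flux sigma (f t) != 0, I (fun x => `|f t x - eq (Om (f t)) x|) <= A2 * dd,
     0 <= k (J (f t)) <= kM, `|k (J (f t)) - kappa| <= L * dd &
     tm <= tau (J (f t)) <= tM /\ 1 <= R0 * J (f t)] /\ 0 <= fe (f t) - Fk (Om (f t)).
  have dd1 : dd <= 1 by exact: le_trans D21.
  have dd2 : dd ^+ 2 <= D2 by rewrite expr2 (le_trans _ ddD)// ler_piMl// ltW.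
  have ED : m^-1 * dd ^+ 2 < eta * (a * D ^+ 2).
    by rewrite ltr_pdivrMl//; exact: le_lt_trans D2E.
  have gap : fe (f 0) - Fk (Om (f 0)) <= m^-1 * dd ^+ 2.
    by apply: (le_trans gap0); rewrite ler_pM2l ?invr_gt0.
  have djj : d < j kappa by apply: (le_lt_trans dj); rewrite ltr_pdivrMr// ltr_pMr ?ltr1n.
  have [nzt hJt gapt relt] := sol_near hn hsigma hcoef hj kappa0 kappa1 rhoE djj a0 eta0 coer hd mrho sol ie0 SO0 hJ gap Dd ED t0.
  have admt := sol_admissible hn hsigma hd mrho sol t0.
  have [cJ _] := coer _ admt nzt (le_trans (ltW hJt) Dd).
  have SOt := direction_sphere nzt.
  have Jrho : 0 <= J (f t) <= rho by rewrite enorm_ge0 (sol_flux_le hn hsigma hd mrho sol).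
  have [nu0 tau0] : 0 <= nu (J (f t)) /\ 0 < tau (J (f t)) by case: hcoef => h _ _ _ _; apply: h; exact: enorm_ge0.
  have tmt := htm _ Jrho; have nut := hnu _ Jrho.
  have rE : m^-1 * dd ^+ 2 / eta = (m * eta)^-1 * dd ^+ 2 by rewrite invfM; ring.
  rewrite rE in relt; split=> //; split=> //.
  - case: admt => it ft0 It iet.
    have lam : 0 < dd <= 1 by rewrite dd0.
    have hy := @young_L1 _ _ _ hsigma rho kappa rho0 _ _ it ft0 It iet SOt _ lam.
    apply: (le_trans hy).
    apply: (@le_trans _ _ ((m * eta)^-1 * dd ^+ 2 / dd + dd * (expR 1 * rho))).
      by rewrite lerD2r ler_pM2r ?invr_gt0.
    rewrite /A2; move: (expR 1 * rho) ((m * eta)^-1) => u v.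
    by rewrite le_eqVlt; apply/orP; left; apply/eqP; field; rewrite gt_eqF.
  - rewrite divr_ge0 ?(ltW tau0)//= /kM; apply: ler_pM => //; first by rewrite invr_ge0 ltW.
      by rewrite (le_trans (ler_norm _)).
    by rewrite lef_pV2 ?posrE.
  - have JA : `|J (f t) - j kappa| <= A5 * dd.
      have h : (J (f t) - j kappa) ^+ 2 <= (A5 * dd) ^+ 2.
        apply: (@le_trans _ _ (z * dd ^+ 2)).
          rewrite /z invfM -mulrA ler_pdivlMl//; exact: le_trans relt.
        rewrite exprMn ler_wpM2r ?sqr_ge0// /A5.
        exact: le_sqrD1 (ltW z0).
      have A50 : 0 <= A5 * dd by rewrite mulr_ge0 ?addr_ge0 ?ltW.
      by rewrite -(@ler_pXn2r _ 2) ?nnegrE// real_normK ?num_real.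
    have h := hDr _ (enorm_ge0 (flux sigma (f t))) (lt_le_trans hJt Dd1); rewrite kj mul1r in h.
    rewrite /L -mulrA; apply: (@le_trans _ _ ((`|Dr| + 1) * `|J (f t) - j kappa|)); last first.
      by rewrite ler_wpM2l// addr_ge0.
    rewrite mulrDl mul1r -normrM mulrC.
    rewrite -[X in `|X|](subrK ((J (f t) - j kappa) * Dr)) addrC.
    by apply: (le_trans (ler_normD _ _)); rewrite lerD2l.
  - split; first by rewrite tmt htM// enorm_ge0.
    rewrite /R0 mulrAC ler_pdivlMr// mul1r.
    exact: half_lower (le_trans (ltW hJt) Dj).
have relax (dd : R) (dd0 : 0 < dd) (ddD : dd <= D2) (Ydd : Y <= dd ^+ 2) (t : R) (t0 : 0 < t) :
    I (fun x => (f t x - eq (Om (f t)) x) ^+ 2) <= K * dd ^+ 2.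
  have L0 : 0 <= L by apply: mulr_ge0; apply: addr_ge0 => //; exact: ltW.
  have A20 : 0 <= A2.
    by apply: addr_ge0; [rewrite invr_ge0 ltW// mulr_gt0|exact: mulr_ge0 (expR_ge0 _) (ltW rho0)].
  have R00 : 0 <= R0 by apply: divr_ge0 (ltW j0).
  exact: (sol_relaxation hn hsigma hcoef kappa0 rho0 hd mrho sol L0 A20 R00 (ltW dd0) tm0 N0 hN
    (fun t t0 => proj1 (near_t dd dd0 ddD Ydd t t0)) nz sq0 Ydd t0).
have relax2 (t : R) (t0 : 0 < t) : I (fun x => (f t x - eq (Om (f t)) x) ^+ 2) <= (1 + `|K|) ^+ 2 * Y.
  apply: (sq_bound_closure D20 D21 Y0 YD2) => dd dd0 ddD Ydd; exact: relax.
(* At t = 0 the function is the density of the datum, and the distance bound holds because the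
   constant is at least 1. *)
move=> t; rewrite le_eqVlt => /predU1P[<-|t0].
  split=> //; last by split=> //; rewrite ler_peMl.
  have [_ h] := coer _ adm0 nz (le_trans (ltW hJ) Dd); apply: le_trans h.
  by rewrite mulr_ge0 ?(ltW eta0)// (relent_ge0 hn hsigma hcoef hj kappa0 kappa1 rhoE if0 ge00 If0 ie0 SO0).
have [[nzt _ _ _ _] gapt] := near_t D2 D20 (lexx _) YD2 t t0.
have [_ _ _ iet] := sol_admissible hn hsigma hd mrho sol t0.
split; [exact: nzt|exact: iet|exact: gapt| |split; [exact: (relax2 t t0)|exact: C0]].
by apply: bI; apply: (bdmX 2); apply: bdmB (sol_bdm sol t0) (bdm_equilibrium _ _ _ _).
Qed.

End Stability.

Lemma hd_derive1 (R : realType) (g : R -> R) (t : R) :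
  derivable g t 1 -> is_derive t (1 : R) g (derive1 g t).
Proof. by move=> dg; rewrite derive1E; exact: DeriveDef. Qed.

Theorem proposition3p5 (R : realType) (n : nat) (hn : (2 <= n)%N)
    (sigma : probability (borel R n) R) (hsigma : is_uniform sigma)
    (nu tau j : R -> R)
    (hcoef : coefficients nu tau) (hj : is_inverse_rate nu tau j)
    (kappa : R) (hkappa0 : 0 < kappa)
    (hkappa1 : (kappa%:E < kappa_max nu tau)%E)
    (rho : R) (hrho : rho = j kappa / order_parameter n kappa) :
  exists Fkappa : R,
    (forall Om, sphere R n Om ->
       free_energy sigma nu tau (equilibrium sigma rho kappa Om)
         = Fkappa%:E) /\
    (* (i) *)
    (derivable (fun x => j x / order_parameter n x) kappa 1 ->
     derive1 (fun x => j x / order_parameter n x) kappa < 0 ->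
       (forall Om, sphere R n Om ->
        forall s eps : R, 0 < eps ->
        exists (mu0 : {measure set (borel R n) -> \bar R})
               (f0 : 'rV[R]_n -> R),
          [/\ initial_condition sigma s mu0,
              has_density sigma mu0 f0,
              mu0 (sphere R n) = rho%:E,
              (Hnorm sigma s (dist_sub (dist_of_meas mu0)
                 (dist_of_fun sigma (equilibrium sigma rho kappa Om)))
                 < eps%:E)%E
            & (free_energy sigma nu tau f0 < Fkappa%:E)%E]) /\
       (forall (s : R) (mu0 : {measure set (borel R n) -> \bar R})
               (f0 : 'rV[R]_n -> R) (f : R -> 'rV[R]_n -> R),
          initial_condition sigma s mu0 ->
          has_density sigma mu0 f0 ->
          mu0 (sphere R n) = rho%:E ->
          (free_energy sigma nu tau f0 < Fkappa%:E)%E ->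
          is_solution sigma nu tau s mu0 f ->
          ~ (enorm (flux sigma (f t)) @[t --> +oo]
               --> rho * order_parameter n kappa /\
             forall s' : R,
               Hnorm sigma s' (dist_sub (dist_of_fun sigma (f t))
                 (dist_of_fun sigma
                   (equilibrium sigma rho kappa (direction sigma (f t)))))
               @[t --> +oo] --> 0%E))) /\
    (* (ii) *)
    (derivable (fun x => j x / order_parameter n x) kappa 1 ->
     0 < derive1 (fun x => j x / order_parameter n x) kappa ->
       forall K s : R, 0 < K -> (n.-1)%:R / 2 < s ->
       exists delta C : R, 0 < delta /\
       forall (mu0 : {measure set (borel R n) -> \bar R})
              (f : R -> 'rV[R]_n -> R),
         initial_condition sigma s mu0 ->
         has_density sigma mu0 (f 0) ->
         mu0 (sphere R n) = rho%:E ->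
         (Hnorm sigma s (dist_of_meas mu0) <= K%:E)%E ->
         is_solution sigma nu tau s mu0 f ->
         (exists2 Om, sphere R n Om &
            (L2dist sigma (f 0%R) (equilibrium sigma rho kappa Om)
               <= delta%:E)%E) ->
         forall t, 0 <= t ->
           [/\ flux sigma (f t) != 0,
               (Fkappa%:E <= free_energy sigma nu tau (f t))%E
             & (L2dist sigma (f t)
                  (equilibrium sigma rho kappa (direction sigma (f t)))
                <= C%:E * L2dist sigma (f 0%R)
                  (equilibrium sigma rho kappa (direction sigma (f 0%R))))%E]).

Proof.
pose P0 : 'rV[R]_n := delta_mx 0 (Ordinal (ltnW hn)); have S0 : sphere R n P0 := pole_sphere R _.
have rho0 := rho_gt0 hn hsigma hcoef hj hkappa0 hkappa1 hrho.
have FkE Om : sphere R n Om -> Fk sigma nu tau rho kappa P0 = Fk sigma nu tau rho kappa Om.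
  by move=> SO; exact: Fk_indep.
have drv := @hd_derive1 R (fun x => j x / order_parameter n x) kappa.
exists (Fk sigma nu tau rho kappa P0); split; [|split].
- move=> Om SO; rewrite (free_energyE nu tau (intg_bdm hsigma (bdm_ent_equilibrium hsigma kappa rho0 SO))).
  by rewrite (fe_equilibrium hn hsigma nu tau rho0 hkappa0 SO) (FkE Om SO).
- move=> /drv dr neg; split.
    move=> Om SO s eps eps0; rewrite (FkE Om SO).
    exact: (unstable_data hn hsigma hcoef hj hkappa0 hkappa1 hrho s dr neg SO eps0).
  move=> s mu0 f0 f _ hd mrho hF sol [hJ _].
  exact: (unstable_dynamics hn hsigma hcoef hj hkappa0 hkappa1 hrho S0 hd mrho hF sol hJ).
move=> /drv dr pos K s _ _.
have [delta [C [delta0 stab]]] := stability hn hsigma hcoef hj hkappa0 hkappa1 hrho dr pos.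
exists delta, C; split; first exact: delta0.
move=> mu0 f _ hd mrho _ sol [P SP hP] t t0.
(* A finite L^2 distance to one equilibrium is what makes the real-valued integrals of the estimates
   meaningful for the initial density. *)
have mf : measurable_fun (sphere R n : set (borel R n)) (f 0 : borel R n -> R) by case: hd.
have me := proj1 (bdm_equilibrium sigma rho kappa P).
have [i2 h2] := L2norm_le (measurable_funB mf me) (ltW delta0) hP.
have stab_t := stab s mu0 f hd mrho sol P SP i2 h2.
have [nz ie gap it [ht C0]] := stab_t t t0; have [nz0 _ _ i0 _] := stab_t 0 (lexx 0).
split; first exact: nz.
  by rewrite (free_energyE nu tau ie) lee_fin (FkE _ (direction_sphere nz)) -subr_ge0.
exact: (L2norm_scale it i0 C0 ht).
Qed.
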